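(* Let $d\ge1$, $\nu>0$ and $s_d=d/2$. Consider on the torus $\mathbb T^d$ the equation $$\partial_t h=\nabla\cdot\bigl((|\nabla h|^2-1)\nabla h\bigr)-\nu\Delta^2h .$$ For any initial data $h_0\in H^{s_d}(\mathbb T^d)$ there exist $T_0=T_0(h_0)>0$ and a unique local solution $h\in C_t^0H_x^{s_d}$ on $[0,T_0]$ with $h(0)=h_0$, $t^{1/4}\nabla h\in C_t^0C_x^0$ and $t^{1/4}h\in C_t^0H_x^{s_d+1}$. Moreover $h(t)\in H_x^m$ for all $m\ge1$ and $0<t<T_*$, where $0<T_*\le\infty$ is the maximal lifespan of the local solution. In particular $h(t)\in C_x^\infty$ for all $0<t<T_*$. If $h_0$ has mean zero, then $h(t)$ also has mean zero for all $0<t<T_*$.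
   Context: $\mathbb T^d=\mathbb R^d/2\pi\mathbb Z^d$; all functions are real-valued. For $s\ge0$, $\|f\|_{H^s}=\bigl(\sum_{k\in\mathbb Z^d}(1+|k|^{2s})|\hat f(k)|^2\bigr)^{1/2}$ with $\hat f(k)=\int_{\mathbb T^d}f(x)e^{-ik\cdot x}\,dx$. $C_t^0B_x$ denotes continuous functions of time on the closed time interval with values in the Banach space $B$ of functions of $x$; the weighted functions $t^{1/4}\nabla h$, $t^{1/4}h$ are continuous up to $t=0$, with their value at $t=0$ understood as the limit $t\to0+$. ''Solution'' with initial data $h_0$ means mild solution: $$h(t)=e^{-\nu t\Delta^2}h_0+\int_0^t\nabla\cdot e^{-\nu(t-s)\Delta^2}\bigl((|\nabla h|^2-1)\nabla h\bigr)(s)\,ds,$$ where $e^{-\nu t\Delta^2}$ is the Fourier multiplier $e^{-\nu t|k|^4}$. Uniqueness is in the stated class, and the maximal lifespan $T_*$ is the supremum of the times up to which the solution can be continued in this class. *)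

(* Defs.v *)
From HB Require Import structures.
From mathcomp Require Import all_boot all_order all_algebra.
From mathcomp Require Import complex.
From mathcomp Require Import all_classical all_reals all_analysis.

Set Implicit Arguments.
Unset Strict Implicit.
Unset Printing Implicit Defensive.

Import Order.TTheory GRing.Theory Num.Theory.
Import numFieldNormedType.Exports.

Local Open Scope classical_set_scope.
Local Open Scope ring_scope.
Local Open Scope complex_scope.

(* A function on the torus R^d / 2 pi Z^d is a 2 pi Z^d-periodic function on
   'rV[R]_d; it is integrated over the fundamental domain [0, 2 pi]^d. *)

Section torus_measure.
Context (R : realType).

Definition I2pi : set (measurableTypeR R) := `[0, 2 * pi]%classic.

Lemma measurable_I2pi : measurable I2pi.
Proof. exact: measurable_itv. Qed.

Lemma lebesgue_I2pi_lty : (@lebesgue_measure R I2pi < +oo)%E.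
Proof.
rewrite lebesgue_measure_itv/=.
by case: ifP => _; rewrite -?EFinD ltry.
Qed.

Definition circle_measure : set (measurableTypeR R) -> \bar R :=
  mfrestr measurable_I2pi lebesgue_I2pi_lty.

HB.instance Definition _ := FiniteMeasure.on circle_measure.

Section step.
Variables (n : nat)
  (m : {finite_measure set (n.-tuple (measurableTypeR R)) -> \bar R}).

Definition cons_pair (p : measurableTypeR R * n.-tuple (measurableTypeR R)) :
  n.+1.-tuple (measurableTypeR R) := [the n.+1.-tuple _ of p.1 :: p.2].

Lemma measurable_cons_pair : measurable_fun setT cons_pair.
Proof. exact: measurable_cons. Qed.

Definition torus_measure_step :
    set (n.+1.-tuple (measurableTypeR R)) -> \bar R :=
  pushforward (circle_measure \x m)%E cons_pair.

Let step0 : torus_measure_step set0 = 0%E.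
Proof. by rewrite /torus_measure_step /pushforward preimage_set0 measure0. Qed.

Let step_ge0 A : (0 <= torus_measure_step A)%E.
Proof. by apply: measure_ge0; exact: measurable_cons_pair. Qed.

Let step_sigma_additive : semi_sigma_additive torus_measure_step.
Proof.
by apply: measure_semi_sigma_additive; exact: measurable_cons_pair.
Qed.

HB.instance Definition _ := isMeasure.Build _ _ _ torus_measure_step
  step0 step_ge0 step_sigma_additive.


Lemma torus_measure_step_fin : fin_num_fun torus_measure_step.
Proof.
apply: lty_fin_num_fun.
rewrite /= /torus_measure_step /pushforward preimage_setT.
by rewrite -setXTT product_measure1E// lte_mul_pinfty ?ge0_fin_numE//
  ?fin_num_measure// -ge0_fin_numE// fin_num_measure.
Qed.

HB.instance Definition _ :=
  @Measure_isFinite.Build _ _ _ torus_measure_step torus_measure_step_fin.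

End step.

(* Lebesgue measure on [0, 2 pi]^n *)
Fixpoint torus_measure (n : nat) :
    {finite_measure set (n.-tuple (measurableTypeR R)) -> \bar R} :=
  match n with
  | 0 => [the {finite_measure set _ -> \bar R} of dirac [tuple]]
  | n'.+1 => torus_measure_step (torus_measure n')
  end.

End torus_measure.

Section complex_integral.
Context {R : realType}.

Definition cexpi (x : R) : R[i] := cos x +i* sin x.

Definition Cintegral dsp (T : measurableType dsp)
    (mu : {measure set T -> \bar R}) (D : set T) (f : T -> R[i]) : R[i] :=
  (\int[mu]_(x in D) complex.Re (f x)) +i* (\int[mu]_(x in D) complex.Im (f x)).

End complex_integral.

Section torus_functions.
Context {R : realType} {d : nat}.
Notation pt := 'rV[R]_d.
Implicit Types (f g : pt -> R) (k : 'rV[int]_d).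

Definition pt_of_tuple (t : d.-tuple (measurableTypeR R)) : pt :=
  \row_j tnth t j.

Definition torus_periodic (V : Type) (F : pt -> V) :=
  forall (x : pt) k, F (x + (2 * pi) *: map_mx intr k) = F x.

Definition aeq f g :=
  ae_eq (torus_measure R d) setT (f \o pt_of_tuple) (g \o pt_of_tuple).

Definition torus_int f : R := \int[torus_measure R d]_t f (pt_of_tuple t).

Definition mean_zero f := torus_int f = 0.

Definition L2 f :=
  torus_periodic f /\ f \o pt_of_tuple \in Lfun (torus_measure R d) 2%:E.

(* Euclidean norms: the library norm on 'rV is the maximum norm *)
Definition sqnorm (v : pt) : R := \sum_j v 0 j ^+ 2.
Definition freq_norm k : R := Num.sqrt (sqnorm (map_mx intr k)).

Definition phase k (x : pt) : R := \sum_j (k 0 j)%:~R * x 0 j.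

Definition fourier f k : R[i] :=
  Cintegral (torus_measure R d) setT
    (fun t => (f (pt_of_tuple t))%:C * cexpi (- phase k (pt_of_tuple t))).

Definition sqmod (z : R[i]) : R := complex.Re z ^+ 2 + complex.Im z ^+ 2.

Definition Hnorm (s : R) f : \bar R :=
  ((\esum_(k in [set: 'rV[int]_d])
     ((1 + freq_norm k `^ (2 * s)) * sqmod (fourier f k))%:E) `^ 2^-1)%E.

Definition Hs (s : R) : set (pt -> R) :=
  [set f | L2 f /\ (Hnorm s f < +oo)%E].

Definition C0x (V : normedModType R) : set (pt -> V) :=
  [set F | torus_periodic F /\ continuous F].

Definition supnorm (V : normedModType R) (F : pt -> V) : \bar R :=
  ereal_sup [set `|F x|%:E | x in [set: pt]].

Definition partial (j : 'I_d) f : pt -> R := fun x => 'D_(delta_mx 0 j) f x.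

Definition grad f : pt -> 'rV[R]_d := fun x => \row_j partial j f x.

Fixpoint Ck (m : nat) f : Prop :=
  match m with
  | 0 => continuous f
  | m'.+1 => (forall x, differentiable f x) /\ (forall j, Ck m' (partial j f))
  end.

Definition smooth f := forall m, Ck m f.

End torus_functions.

Section time_dependent.
Context {R : realType}.

(* u is in C([0, T]; B), where N is the norm of B *)
Definition Ct (V : zmodType) (B : set V) (N : V -> \bar R) (T : R)
    (u : R -> V) :=
  forall t0, t0 \in `[0, T] ->
    B (u t0) /\ N (u t - u t0) @[t --> within `[0, T] (nbhs t0)] --> 0%E.

(* t^a u is in C([0, T]; B) after extension to t = 0 by its limit *)
Definition Ct_weighted (V : lmodType R) (B : set V) (N : V -> \bar R)
    (T a : R) (u : R -> V) :=
  exists v : R -> V, Ct B N T v /\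
    forall t, t \in `]0, T] -> v t = (t `^ a) *: u t.

End time_dependent.

Section equation.
Context {R : realType} {d : nat}.
Notation pt := 'rV[R]_d.
Implicit Types (nu T : R) (h : R -> pt -> R).

Definition s_crit : R := d%:R / 2.

(* symbol of e^{- nu t Delta^2} *)
Definition bih_symbol nu (t : R) (k : 'rV[int]_d) : R :=
  expR (- (nu * t * freq_norm k ^+ 4)).

Definition flux (f : pt -> R) (j : 'I_d) : pt -> R :=
  fun x => (sqnorm (grad f x) - 1) * grad f x 0 j.

(* Duhamel formula as an identity between elements of L^2, i.e. between
   Fourier coefficients: the operators e^{- nu t Delta^2} and div act on these
   as the multipliers bih_symbol nu t k and (i k_j)_j, and the time integral
   commutes with them. The value of the integrand at s = 0 is irrelevant. *)
Definition mild nu (h0 : pt -> R) T h :=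
  forall t, t \in `[0, T] -> forall k : 'rV[int]_d,
    fourier (h t) k =
      (bih_symbol nu t k)%:C * fourier h0 k +
      Cintegral (@lebesgue_measure R) `[0, t]
        (fun s => \sum_j (0 +i* (k 0 j)%:~R) *
                     ((bih_symbol nu (t - s) k)%:C *
                      fourier (flux (h s) j) k)).

(* For t > 0 the representative h t of the class of functions equal almost
   everywhere is the C^1 one, so that grad (h t) is a classical gradient. *)
Definition solution nu (h0 : pt -> R) T h :=
  [/\ Ct (Hs s_crit) (Hnorm s_crit) T h,
      aeq (h 0) h0,
      (forall t, t \in `]0, T] -> Ck 1 (h t)) /\
      Ct_weighted (@C0x R d 'rV[R]_d) (@supnorm R d 'rV[R]_d) T 4^-1
        (fun t => grad (h t)),
      Ct_weighted (Hs (s_crit + 1)) (Hnorm (s_crit + 1)) T 4^-1 h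
    & mild nu h0 T h].

Definition unique_solution nu (h0 : pt -> R) T h :=
  solution nu h0 T h /\
  forall h', solution nu h0 T h' ->
    forall t, t \in `[0, T] -> aeq (h' t) (h t).

(* T_*: supremum of the T such that the solution h on [0, T0] continues to
   [0, T] *)
Definition lifespan nu (h0 : pt -> R) (T0 : R) h : \bar R :=
  ereal_sup [set T%:E | T in [set T | T0 <= T /\
    exists h', solution nu h0 T h' /\
      forall t, t \in `[0, T0] -> aeq (h' t) (h t)]].

End equation.

Arguments s_crit : clear implicits.

(* Main.v *)
Require Import Defs.
From HB Require Import structures.
From mathcomp Require Import all_boot all_order all_algebra.
From mathcomp Require Import complex.
From mathcomp Require Import all_classical all_reals all_analysis.
From mathcomp Require Import measurable_realfun.
From mathcomp Require Import ring lra zify.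
Import Order.TTheory GRing.Theory Num.Theory.
Import numFieldNormedType.Exports.
Set Implicit Arguments.
Unset Strict Implicit.
Unset Printing Implicit Defensive.
Local Open Scope classical_set_scope.
Local Open Scope ring_scope.
Local Open Scope complex_scope.

(** The equation is critical in [H^(d/2)].  The gradient of the linear flow
   [e^(- nu t Delta^2) h0] is [o(t^(-1/4))], its cube is [O(t^(-3/4))], and the Duhamel integral,
   where the divergence and one more derivative cost [(t - s)^(-1/2)], returns [O(t^(-1/4))].
   Hence the problem closes in norms with the weight [t^(1/4)], but no power of the time span is
   gained: the contraction comes from the smallness of the linear part.  This smallness depends on
   the datum and not on its norm alone; it holds for short times because a datum in [H^(d/2)] is
   a finite trigonometric sum plus a small remainder ([lin_nw_small]).

   Everything is done on Fourier coefficients.  A function is recovered from summable coefficients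
   by [syn]; function spaces are bounds on finite partial sums ([L1le], [L2le]); products are
   finite convolutions up to an arbitrarily small error ([fourierM_le]).

   Existence ([local_existence]) is a Picard iteration in the norm
   [sup t^(1/4) sum_k |k| e^(nu t |k| / 2) |c_k|].  This is a Wiener algebra norm of the gradient,
   so that the cubic term needs Young's inequality only; half of the decay of the biharmonic
   semigroup pays for the growth of the exponential weight ([wt_bs]); and for [t > 0] the weight
   makes the coefficients decay exponentially, so that the solution is smooth.  The linear part
   lies in this space by Cauchy-Schwarz and the lattice sum [lattice_heat].  The bounds in
   [H^(d/2)] and [H^(d/2+1)] follow along the same iteration.

   Uniqueness ([flow_uniq]) compares the gradients of two solutions in [L2] with the weight
   [t^(1/4) e^(- lam t)]: near the initial time the Duhamel formula contracts because
   [t^(1/4) grad h] is small, later on because [lam] is large.  That [t^(1/4) grad h] tends to [0]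
   is not part of the definition of a solution, which requires only some limit in [C^0].  But the
   coefficients of this limit are limits of [t^(1/4) i k_j h^(t, k)], where [h^(t, k)] stays
   bounded, so they vanish, and a continuous function without Fourier coefficients is zero
   ([fourier_inj0], [sol_grad0], [solution_flow]).

   For smoothness at a time [t > 0], the construction is started from the solution itself at
   a slightly earlier time.  Its time span is the same for all data near [h(t)] in [H^(d/2)]
   ([local_near]), and the solution is continuous in this space, so the constructed solution
   reaches [t]; by uniqueness it is the given one ([solution_rapid]).  Solutions with the same datum
   agree, hence are restrictions of one function ([glued_solution]), which is the maximal solution.
   The zero mode is constant in time because the nonlinearity is a divergence. *)

(** * Integration on the torus *)

Section basics.
Context {R : realType}.

Lemma ball_normP (V W : normedModType R) (f : V -> W) :
  continuous f <-> forall x e, 0 < e -> exists2 r, 0 < r &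
    forall y, `|x - y| < r -> `|f x - f y| < e.
Proof.
split=> [cf x e e0|H x].
  have /cvgrPdist_lt/(_ _ e0) := cf x.
  by move=> /nbhs_normP[r r0 rP]; exists r => // y; exact: rP.
apply/cvgrPdist_lt => e e0; have [r r0 rP] := H x e e0.
by apply/nbhs_normP; exists r => // y; exact: rP.
Qed.

Lemma rV_norm_le (n : nat) (v : 'rV[R]_n) (r : R) : 0 <= r ->
  (forall j, `|v 0 j| <= r) -> `|v| <= r.
Proof.
move=> r0 H; rewrite [leLHS]mx_normrE.
apply: bigmax_le => // -[i j] _ /=; rewrite (ord1 i); exact: H.
Qed.

Lemma rV_coord_le (n : nat) (v : 'rV[R]_n) j : `|v 0 j| <= `|v|.
Proof.
rewrite [leRHS]mx_normrE.
exact: (le_bigmax _ (fun ij : 'I_1 * 'I_n => `|v ij.1 ij.2|) (0, j)).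
Qed.

End basics.

Section tuples.
Context {R : realType}.
Local Notation mR := (measurableTypeR R).
Local Notation mu n := (torus_measure R n).

Definition round_pt n (m : nat) (t : n.-tuple mR) : 'rV[int]_n :=
  \row_j Num.floor (m.+1%:R * tnth t j).

Lemma measurable_round_pt n m (z : 'rV[int]_n) :
  measurable [set t : n.-tuple mR | round_pt m t = z].
Proof.
have -> : [set t : n.-tuple mR | round_pt m t = z] =
    \bigcap_(j in [set: 'I_n]) ((fun t : n.-tuple mR => m.+1%:R * tnth t j)
       @^-1` `[ (z 0 j)%:~R, (z 0 j + 1)%:~R [ ).
  apply/seteqP; split => t /=.
    by move=> <- j _ /=; rewrite in_itv/= mxE; exact: floor_itv.
  move=> H; apply/rowP => j; rewrite mxE; have := H j I; rewrite /= in_itv/=.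
  move=> h; exact: floor_def.
apply: fin_bigcap_measurable => [|j _]; first exact: finite_finset.
rewrite -[X in measurable X]setTI.
apply: (_ : measurable_fun setT _) => //.
by apply: measurable_funM => //; exact: measurable_tnth.
Qed.

Lemma near_harmonic_le (r : R) : 0 < r ->
  \forall m \near \oo, m.+1%:R^-1 <= r / 2.
Proof.
move=> r0; have rh : 0 < r / 2 by rewrite divr_gt0.
have /cvgrPdist_lt/(_ _ rh) := @cvg_harmonic R.
apply: filterS => m; rewrite sub0r normrN /harmonic ger0_norm ?invr_ge0//.
exact: ltW.
Qed.

(** A continuous function is the pointwise limit of its compositions with the roundings to
   the grids of mesh [1 / (m + 1)], which take countably many values on measurable cells. *)
Lemma measurable_pt_of_tuple n (f : 'rV[R]_n -> R) : continuous f ->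
  measurable_fun setT (f \o @pt_of_tuple R n).
Proof.
move=> /ball_normP cf.
pose h m (t : n.-tuple mR) : R :=
  f (m.+1%:R^-1 *: map_mx intr (round_pt m t)).
apply: (@measurable_realfun.measurable_fun_cvg _ _ _ _ h).
  move=> m _ A mA; rewrite setTI.
  have -> : h m @^-1` A = \bigcup_(z : 'rV[int]_n)
      ([set t | round_pt m t = z] `&`
        (if `[< A (f (m.+1%:R^-1 *: map_mx intr z)) >] then setT else set0)).
    apply/seteqP; split => t /=.
      move=> At; exists (round_pt m t) => //; split => //.
      by rewrite (asboolT At).
    by move=> [z _ [<-]]; case: ifPn => // /asboolP.
  apply: countable_bigcupT_measurable; first exact: countableP.
  move=> z; apply: measurableI; first exact: measurable_round_pt.
  by case: ifP.
move=> t _; apply/cvgrPdist_lt => e e0; rewrite /h/=.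
have [r r0 rP] := cf (pt_of_tuple t) e e0.
near=> m; apply: rP.
have rh : 0 < r / 2 by rewrite divr_gt0.
apply: (@le_lt_trans _ _ (r / 2)); last by rewrite ltr_pdivrMr// ltr_pMr// ltr1n.
apply: rV_norm_le => [|j]; first exact: ltW.
rewrite !mxE.
have /andP[h1 h2] := floor_itv (m.+1%:R * tnth t j).
set q := (Num.floor _)%:~R in h1 h2 *.
rewrite intrD in h2.
have m0 : 0 < m.+1%:R :> R by rewrite ltr0n.
have -> : tnth t j - m.+1%:R^-1 * (Num.floor (m.+1%:R * tnth t j))%:~R =
   m.+1%:R^-1 * (m.+1%:R * tnth t j - (Num.floor (m.+1%:R * tnth t j))%:~R).
  by rewrite mulrBr mulrA mulVf ?gt_eqF// mul1r.
rewrite normrM ger0_norm ?invr_ge0//.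
apply: (@le_trans _ _ (m.+1%:R^-1 * 1)).
  rewrite ler_wpM2l// ?invr_ge0// ler_norml; apply/andP; split; lra.
rewrite mulr1.
near: m; exact: near_harmonic_le.
Unshelve. all: by end_near.
Qed.

(** Apart from the initial datum, every function integrated on the torus is of this kind,
   for which Fubini's theorem has no side conditions. *)
Definition bmf d (T : measurableType d) (F : T -> R) :=
  measurable_fun setT F /\ exists M, forall t, `|F t| <= M.

Lemma bmf_integrable d (T : measurableType d) (m : {finite_measure set T -> \bar R})
  (F : T -> R) : bmf F -> m.-integrable setT (EFin \o F).
Proof.
move=> [mF [M hM]]; apply: measurable_bounded_integrable => //.
  exact: fin_num_fun_lty.
exists M; split; first by rewrite num_real.
by move=> x Mx y _ /=; rewrite (le_trans (hM _))// ltW.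
Qed.

Lemma bmfD d (T : measurableType d) (F G : T -> R) :
  bmf F -> bmf G -> bmf (fun t => F t + G t).
Proof.
move=> [mF [M hM]] [mG [N hN]]; split; first exact: measurable_funD.
by exists (M + N) => t; rewrite (le_trans (ler_normD _ _))// lerD.
Qed.

Lemma bmfM d (T : measurableType d) (F G : T -> R) :
  bmf F -> bmf G -> bmf (fun t => F t * G t).
Proof.
move=> [mF [M hM]] [mG [N hN]]; split; first exact: measurable_funM.
by exists (M * N) => t; rewrite normrM ler_pM.
Qed.

Lemma bmf_cst d (T : measurableType d) (c : R) : bmf (fun _ : T => c).
Proof. by split=> //; exists `|c|. Qed.

Lemma bmf_comp d (T : measurableType d) d' (T' : measurableType d')
  (F : T' -> R) (g : T -> T') : measurable_fun setT g -> bmf F -> bmf (F \o g).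
Proof.
move=> mg [mF [M hM]]; split; first exact: measurableT_comp.
by exists M => t /=.
Qed.

Lemma bmf_integrable_prod d1 d2 (T1 : measurableType d1) (T2 : measurableType d2)
  (m1 : {finite_measure set T1 -> \bar R}) (m2 : {finite_measure set T2 -> \bar R})
  (F : T1 * T2 -> R) : bmf F -> (m1 \x m2)%E.-integrable setT (EFin \o F).
Proof.
move=> [mF [M hM]]; apply: measurable_bounded_integrable => //.
  have e : (m1 \x m2)%E setT = (m1 setT * m2 setT)%E.
    by rewrite -setXTT product_measure1E.
  by rewrite [ltLHS]e lte_mul_pinfty ?ge0_fin_numE// ?fin_num_measure//
    -ge0_fin_numE// fin_num_measure.
exists M; split; first by rewrite num_real.
by move=> x Mx y _ /=; rewrite (le_trans (hM _))// ltW.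
Qed.

Section bmf_fubini.
Context d1 d2 (T1 : measurableType d1) (T2 : measurableType d2)
  (m1 : {finite_measure set T1 -> \bar R}) (m2 : {finite_measure set T2 -> \bar R})
  (F : T1 * T2 -> R).
Hypothesis bF : bmf F.

Lemma bmf_pair1 x : bmf (fun y => F (x, y)).
Proof. exact: (@bmf_comp _ _ _ _ F (pair x)). Qed.

Lemma bmf_pair2 y : bmf (fun x => F (x, y)).
Proof. exact: (@bmf_comp _ _ _ _ F (fun x => (x, y))). Qed.

Lemma Rintegral_prod :
  fine (\int[(m1 \x m2)%E]_z (F z)%:E)%E = \int[m1]_x \int[m2]_y F (x, y).
Proof.
rewrite /Rintegral -integral12_prod_meas1//; last exact: bmf_integrable_prod.
congr fine; apply: eq_integral => x _; rewrite /fubini_F fineK//.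
apply: integrable_fin_num => //.
exact: (bmf_integrable m2 (bmf_pair1 x)).
Qed.

Lemma Rintegral_swap :
  \int[m1]_x \int[m2]_y F (x, y) = \int[m2]_y \int[m1]_x F (x, y).
Proof.
rewrite -Rintegral_prod /Rintegral -integral21_prod_meas1//; last exact: bmf_integrable_prod.
congr fine; apply: eq_integral => x _; rewrite /fubini_G fineK//.
apply: integrable_fin_num => //.
exact: (bmf_integrable m1 (bmf_pair2 x)).
Qed.

End bmf_fubini.

Lemma Rintegral_eq0 d (T : measurableType d) (m : {measure set T -> \bar R}) (D : set T) (f : T -> R) :
  (forall t, D t -> f t = 0) -> \int[m]_(t in D) f t = 0.
Proof.
move=> f0; rewrite /Rintegral integral0_eq// => t Dt; by rewrite f0.
Qed.

Lemma Rintegral_torus_measureS n (F : n.+1.-tuple mR -> R) : bmf F ->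
  \int[mu n.+1]_t F t =
  \int[@circle_measure R]_x \int[mu n]_t F (cons_pair (x, t)).
Proof.
move=> bF.
have bG : bmf (F \o @cons_pair R n).
  by apply: bmf_comp => //; exact: measurable_cons_pair.
rewrite -(@Rintegral_prod _ _ _ _ _ _ _ bG).
rewrite /Rintegral/= /torus_measure_step integral_pushforward//=.
- exact: measurable_cons_pair.
- by apply/measurable_EFinP; case: bF.
- rewrite preimage_setT; exact: (bmf_integrable_prod _ _ bG).
Qed.

Lemma Rintegral_torus_measureS_swap n (F : n.+1.-tuple mR -> R) : bmf F ->
  \int[mu n.+1]_t F t =
  \int[mu n]_t \int[@circle_measure R]_x F (cons_pair (x, t)).
Proof.
move=> bF; rewrite Rintegral_torus_measureS//.
rewrite (@Rintegral_swap _ _ _ _ _ _ (F \o @cons_pair R n))//.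
by apply: bmf_comp => //; exact: measurable_cons_pair.
Qed.

Lemma bmf_cons_pair n (F : n.+1.-tuple mR -> R) x :
  bmf F -> bmf (fun t => F (cons_pair (x, t))).
Proof.
move=> bF; apply: (@bmf_pair1 _ _ _ _ (F \o @cons_pair R n)).
by apply: bmf_comp => //; exact: measurable_cons_pair.
Qed.

Lemma pi2_gt0 : 0 < 2 * pi :> R.
Proof. by rewrite mulr_gt0// pi_gt0. Qed.

Lemma circle_RintegralE (f : R -> R) : bmf (f : mR -> R) ->
  \int[@circle_measure R]_x f x = \int[@lebesgue_measure R]_(x in `[0, 2 * pi]) f x.
Proof.
move=> bf; rewrite /Rintegral; congr fine.
have mI := @measurable_I2pi R.
rewrite (@negligible_integral _ mR _ _ setT (~` @I2pi R))//; last 3 first.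
- exact: measurableC.
- exact: (bmf_integrable (@circle_measure R) bf).
- change (lebesgue_measure ((~` @I2pi R) `&` @I2pi R) = 0%E).
  by rewrite setICl measure0.
rewrite setTD setCK; apply: eq_measure_integral => A mA AI.
change (lebesgue_measure (A `&` @I2pi R) = lebesgue_measure A).
by rewrite setIidl.
Qed.

Lemma circle_measure_itv (A : set mR) : A `<=` @I2pi R ->
  @circle_measure R A = lebesgue_measure A.
Proof. by move=> AI; rewrite /circle_measure /mfrestr/= /mrestr setIidl. Qed.

Lemma circle_measureT : @circle_measure R setT = (2 * pi)%:E.
Proof.
rewrite /circle_measure /mfrestr/= /mrestr setTI /I2pi lebesgue_measure_itv/= lte_fin.
by rewrite pi2_gt0 -EFinD subr0.
Qed.

Lemma circle_FTC (F f : R -> R) : continuous f ->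
  (forall x : R, is_derive x 1 F (f x)) -> F 0 = F (2 * pi) ->
  bmf (f : mR -> R) -> \int[@circle_measure R]_x f x = 0.
Proof.
move=> cf dF per bf; rewrite circle_RintegralE// /Rintegral.
rewrite (@continuous_FTC2 _ f F)//.
- by rewrite per subee.
- exact: pi2_gt0.
- exact: continuous_subspaceT.
- split.
  + by move=> x _; have [] := dF x.
  + apply: cvg_at_right_filter; apply: differentiable_continuous.
    by apply/derivable1_diffP; have [] := dF 0.
  + apply: cvg_at_left_filter; apply: differentiable_continuous.
    by apply/derivable1_diffP; have [] := dF (2 * pi).
- by move=> x _; rewrite derive1E; have [] := dF x.
Qed.

Definition upd n (t : n.-tuple mR) (j : 'I_n) (y : R) : n.-tuple mR :=
  [tuple if i == j then y else tnth t i | i < n].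

(** Fubini reduces the claim to the fundamental theorem of calculus on one circle. *)
Lemma torus_int_derive n (F G : n.-tuple mR -> R) (j : 'I_n) : bmf G ->
  (forall t, continuous (fun y => G (upd t j y))) ->
  (forall t (y : R), is_derive y 1 (fun y => F (upd t j y)) (G (upd t j y))) ->
  (forall t, F (upd t j 0) = F (upd t j (2 * pi))) ->
  \int[mu n]_t G t = 0.
Proof.
elim: n => [|n IH] in F G j *; first by case: j.
move=> bG cG dF per.
have updS t (x y : mR) : cons_pair (x, t) = upd (cons_pair (y, t)) ord0 x.
  apply: eq_from_tnth => i; rewrite tnth_mktuple.
  have [->|/negPf i0] := eqVneq i ord0; first by rewrite tnth0.
  case: (unliftP ord0 i) => [i' ei|ei]; last by rewrite ei eqxx in i0.
  by rewrite ei !tnthS.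
case: (unliftP ord0 j) => [j' ej|ej]; last first.
  rewrite {j}ej in cG dF per.
  rewrite Rintegral_torus_measureS_swap//.
  apply: Rintegral_eq0 => t _ /=.
  have e x : G (cons_pair (x, t)) = G (upd (cons_pair (0 : mR, t)) ord0 x) by rewrite -updS.
  transitivity (\int[@circle_measure R]_x G (upd (cons_pair (0 : mR, t)) ord0 x)).
    by apply: eq_Rintegral => x _; rewrite e.
  apply: (@circle_FTC (fun x => F (upd (cons_pair (0 : mR, t)) ord0 x))) => //.
  have := @bmf_pair2 _ _ _ _ (G \o @cons_pair R n) _ t.
  have -> : (fun x : mR => (G \o cons_pair (n:=n)) (x, t)) =
     (fun x => G (upd (cons_pair (0 : mR, t)) ord0 x)).
    by apply/funext => x /=.
  by apply; apply: bmf_comp => //; exact: measurable_cons_pair.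
have updL (x : mR) t y : upd (cons_pair (x, t)) j y = cons_pair (x, upd t j' y).
  apply: eq_from_tnth => i; rewrite tnth_mktuple ej.
  case: (unliftP ord0 i) => [i' ->|->]; last by rewrite !tnth0.
  by rewrite !tnthS tnth_mktuple (inj_eq lift_inj).
rewrite Rintegral_torus_measureS//.
apply: Rintegral_eq0 => x _ /=.
apply: (IH (fun t => F (cons_pair (x, t))) _ j').
- exact: bmf_cons_pair.
- by move=> t; under eq_fun do rewrite -updL; exact: cG.
- by move=> t y; under eq_fun do rewrite -updL; rewrite -updL; exact: dF.
- by move=> t; rewrite -!updL; exact: per.
Qed.

Lemma torus_measure_setT n : mu n setT = ((2 * pi) ^+ n)%:E.
Proof.
elim: n => [|n IH]; first by rewrite /= diracT expr0.
rewrite /= /torus_measure_step /pushforward preimage_setT -setXTT.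
rewrite product_measure1E//= [X in (_ * X)%E]IH exprS EFinM; congr (_ * _)%E.
exact: circle_measureT.
Qed.

Definition box n (a : 'rV[R]_n) (e : R) : set (n.-tuple mR) :=
  [set t | forall j, a 0 j < tnth t j < a 0 j + e].

Lemma measurable_box n (a : 'rV[R]_n) e : measurable (box a e).
Proof.
have -> : box a e = \bigcap_(j in [set: 'I_n]) ((fun t : n.-tuple mR => tnth t j)
       @^-1` `] a 0 j, a 0 j + e [ ).
  apply/seteqP; split => t /= H j; first by move=> _; rewrite /= in_itv/= H.
  by have := H j I; rewrite /= in_itv/=.
apply: fin_bigcap_measurable => [|j _]; first exact: finite_finset.
rewrite -[X in measurable X]setTI.
by apply: (_ : measurable_fun setT _) => //; exact: measurable_tnth.
Qed.

Lemma torus_measure_box n (a : 'rV[R]_n) (e : R) : 0 < e ->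
  (forall j, 0 <= a 0 j /\ a 0 j + e <= 2 * pi) ->
  mu n (box a e) = (e ^+ n)%:E.
Proof.
move=> e0; elim: n => [|n IH] in a *.
  move=> _; rewrite /= diracE expr0 mem_set// => -[].
  by case.
move=> H; rewrite /= /torus_measure_step /pushforward.
have -> : cons_pair (n:=n) @^-1` box a e =
   `] a 0 ord0, a 0 ord0 + e [%classic `*` box (\row_j a 0 (lift ord0 j)) e.
  apply/seteqP; split => -[x t] /=.
    move=> h; split; first by rewrite /= in_itv/=; have := h ord0; rewrite tnth0.
    by move=> j; have := h (lift ord0 j); rewrite tnthS mxE.
  move=> [] /=; rewrite in_itv/= => h1 h2 j.
  case: (unliftP ord0 j) => [j' ->|->]; last by rewrite tnth0.
  by have := h2 j'; rewrite tnthS mxE.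
rewrite product_measure1E//=; last exact: measurable_box.
rewrite IH; last by move=> j; rewrite mxE.
rewrite circle_measure_itv; last first.
  move=> x /=; rewrite /I2pi /= !in_itv/= => /andP[h1 h2].
  by have [h3 h4] := H ord0; apply/andP; split; lra.
rewrite lebesgue_measure_itv/= lte_fin ltrDl e0 exprS EFinM -EFinD.
by congr (_%:E * _)%E; ring.
Qed.

(** ** Real Fourier integrals *)

Lemma phase_cons n (k : 'rV[int]_n.+1) (x : mR) (t : n.-tuple mR) :
  phase k (pt_of_tuple (cons_pair (x, t))) =
  (k 0 ord0)%:~R * x + phase (\row_j k 0 (lift ord0 j)) (pt_of_tuple t).
Proof.
rewrite /phase big_ord_recl !mxE tnth0; congr (_ + _).
by apply: eq_bigr => i _; rewrite !mxE tnthS.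
Qed.

Lemma continuous_phase n (k : 'rV[int]_n) : continuous (@phase R n k).
Proof.
move=> x; rewrite /phase.
have -> : (fun x : 'rV[R]_n => \sum_j (k 0 j)%:~R * x 0 j) =
  \sum_j (fun x : 'rV[R]_n => (k 0 j)%:~R * x 0 j) by apply/funext => y; rewrite fct_sumE.
apply: (big_ind (fun f : 'rV[R]_n -> R => {for x, continuous f})).
- exact: cst_continuous.
- by move=> f g cf cg; exact: continuousD.
- by move=> j _; apply: continuousM; [exact: cst_continuous|exact: coord_continuous].
Qed.

Lemma bmf_cos_phase n (k : 'rV[int]_n) (th : R) :
  bmf (fun t : n.-tuple mR => cos (th + phase k (pt_of_tuple t))).
Proof.
split; last by exists 1 => t; rewrite ler_norml cos_geN1 cos_le1.
apply: (@measurable_pt_of_tuple _ (fun x => cos (th + phase k x))) => x.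
apply: continuous_comp; last exact: continuous_cos.
by apply: continuousD; [exact: cst_continuous|exact: continuous_phase].
Qed.

Lemma cos_int_period (x : R) (m : int) : cos (x + m%:~R * (2 * pi)) = cos x.
Proof.
have P n (y : R) : cos (y + n%:R * (2 * pi)) = cos y.
  rewrite -[RHS](periodicn (@cosD2pi R) n); congr (cos (_ + _)).
  by rewrite !mulr_natl -mulrnA mulnC mulrnA.
case: m => n; first by rewrite pmulrn P.
by rewrite NegzE mulrNz mulNr -[LHS](P n.+1) pmulrn subrK.
Qed.

Lemma sin_int_period (x : R) (m : int) : sin (x + m%:~R * (2 * pi)) = sin x.
Proof.
have e y : sin y = cos (y - pi / 2) by rewrite cosB cos_pihalf sin_pihalf mulr0 add0r mulr1.
by rewrite !e addrAC cos_int_period.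
Qed.

Lemma circle_int_cos (m : int) (th : R) : m != 0 ->
  \int[@circle_measure R]_x cos (th + m%:~R * x) = 0.
Proof.
move=> m0; have mR0 : m%:~R != 0 :> R by rewrite intr_eq0.
apply: (@circle_FTC (fun x => m%:~R^-1 * sin (th + m%:~R * x))).
- move=> x; apply: continuous_comp; last exact: continuous_cos.
  apply: continuousD; first exact: cst_continuous.
  exact: mulrl_continuous.
- move=> x; apply: is_derive_eq.
  rewrite add0r mul1r.
  rewrite /GRing.scale/= mulr1; field; exact: mR0.
- by rewrite mulr0 addr0 sin_int_period.
- split; last by exists 1 => t; rewrite ler_norml cos_geN1 cos_le1.
  apply: continuous_measurable_fun => x.
  apply: continuous_comp; last exact: continuous_cos.
  by apply: continuousD; [exact: cst_continuous|exact: mulrl_continuous].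
Qed.

Lemma torus_int_cos n (k : 'rV[int]_n) (th : R) : k != 0 ->
  \int[mu n]_t cos (th + phase k (pt_of_tuple t)) = 0.
Proof.
elim: n => [|n IH] in k th *.
  by move=> /eqP[]; apply/rowP; case.
move=> k0; rewrite Rintegral_torus_measureS; last exact: bmf_cos_phase.
have [k'0|k'0] := eqVneq (\row_j k 0 (lift ord0 j)) 0; last first.
  apply: Rintegral_eq0 => x _.
  rewrite -[RHS](IH _ (th + (k 0 ord0)%:~R * x) k'0).
  by apply: eq_Rintegral => t _; rewrite phase_cons addrA.
have k00 : k 0 ord0 != 0.
  apply: contra k0 => /eqP k00; apply/eqP/rowP => j; rewrite mxE.
  by case: (unliftP ord0 j) => [j' ->|-> //]; have /rowP/(_ j') := k'0; rewrite !mxE.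
rewrite -[RHS](mul0r (fine (mu n setT))) -(circle_int_cos th k00).
rewrite -RintegralZr//; last first.
  apply: bmf_integrable; split; last by exists 1 => t; rewrite ler_norml cos_geN1 cos_le1.
  have cc : continuous (fun x : R => cos (th + (k 0 ord0)%:~R * x)).
    move=> x; apply: continuous_comp; last exact: continuous_cos.
    apply: continuousD; first exact: cst_continuous.
    exact: mulrl_continuous.
  exact: continuous_measurable_fun.
apply: eq_Rintegral => x _; rewrite -Rintegral_cst//; apply: eq_Rintegral => t _.
rewrite phase_cons k'0.
by rewrite /phase big1 ?addr0// => i _; rewrite mxE mul0r.
Qed.

End tuples.

(** * Fourier coefficients of periodic functions *)

Notation cabs := (@Normc.normc _).

Section complex_modulus.
Context {R : realType}.
Implicit Types z w : R[i].

Lemma cabsE z : cabs z = Num.sqrt (sqmod z).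
Proof. by case: z. Qed.

Lemma cabs_ge0 z : 0 <= cabs z.
Proof. by rewrite cabsE sqrtr_ge0. Qed.

Lemma sqmod_ge0 z : 0 <= sqmod z.
Proof. by rewrite addr_ge0 ?sqr_ge0. Qed.

Lemma cabs_sqr z : cabs z ^+ 2 = sqmod z.
Proof. by rewrite cabsE sqr_sqrtr// sqmod_ge0. Qed.

Lemma cabsD z w : cabs (z + w) <= cabs z + cabs w.
Proof. exact: le_normcD. Qed.

Lemma cabsN z : cabs (- z) = cabs z.
Proof. exact: normcN. Qed.

Lemma cabsB z w : cabs (z - w) <= cabs z + cabs w.
Proof. by rewrite -(cabsN w) cabsD. Qed.

Lemma cabs_distC z w : cabs (z - w) = cabs (w - z).
Proof. by rewrite -cabsN opprB. Qed.

Lemma cabsM z w : cabs (z * w) = cabs z * cabs w.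
Proof. exact: Normc.normcM. Qed.

Lemma cabs0 : cabs (0 : R[i]) = 0.
Proof. exact: Normc.normc0. Qed.

Lemma cabs_eq0 z : cabs z = 0 -> z = 0.
Proof. exact: Normc.eq0_normc. Qed.

Lemma cabs_real (x : R) : cabs x%:C = `|x|.
Proof. by rewrite /Normc.normc/= expr0n/= addr0 sqrtr_sqr. Qed.

Lemma cabs_imag (x : R) : cabs (0 +i* x) = `|x|.
Proof. by rewrite /Normc.normc/= expr0n/= add0r sqrtr_sqr. Qed.

Lemma cabs_sum (I : Type) (r : seq I) (P : pred I) (F : I -> R[i]) :
  cabs (\sum_(i <- r | P i) F i) <= \sum_(i <- r | P i) cabs (F i).
Proof.
apply: (big_rec2 (fun z x => cabs z <= x)); first by rewrite cabs0.
by move=> i x z _ h; rewrite (le_trans (cabsD _ _))// lerD2l.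
Qed.

Lemma Re_le_cabs z : `|complex.Re z| <= cabs z.
Proof.
by rewrite -sqrtr_sqr cabsE ler_sqrt ?sqmod_ge0// lerDl sqr_ge0.
Qed.

Lemma Im_le_cabs z : `|complex.Im z| <= cabs z.
Proof.
by rewrite -sqrtr_sqr cabsE ler_sqrt ?sqmod_ge0// lerDr sqr_ge0.
Qed.

Lemma cabs_le_ReIm z : cabs z <= `|complex.Re z| + `|complex.Im z|.
Proof.
case: z => a b /=.
rewrite -(ger0_norm (addr_ge0 (normr_ge0 a) (normr_ge0 b))) -sqrtr_sqr ler_sqrt ?sqr_ge0//.
by rewrite sqrrD !real_normK ?num_real// lerD2r lerDl mulrn_wge0// mulr_ge0.
Qed.

Lemma ReDc z w : complex.Re (z + w) = complex.Re z + complex.Re w.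
Proof. by case: z; case: w. Qed.
Lemma ImDc z w : complex.Im (z + w) = complex.Im z + complex.Im w.
Proof. by case: z; case: w. Qed.
Lemma ReBc z w : complex.Re (z - w) = complex.Re z - complex.Re w.
Proof. by case: z; case: w. Qed.
Lemma ImBc z w : complex.Im (z - w) = complex.Im z - complex.Im w.
Proof. by case: z; case: w. Qed.
Lemma ReMc z w : complex.Re (z * w) =
  complex.Re z * complex.Re w - complex.Im z * complex.Im w.
Proof. by case: z; case: w. Qed.
Lemma ImMc z w : complex.Im (z * w) =
  complex.Re z * complex.Im w + complex.Im z * complex.Re w.
Proof. by case: z => a b; case: w. Qed.
Lemma complex_ext z w : complex.Re z = complex.Re w ->
  complex.Im z = complex.Im w -> z = w.
Proof. by case: z => a b; case: w => c e /= -> ->. Qed.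

End complex_modulus.

Section torus_functions.
Context {R : realType} {d : nat}.
Local Notation pt := 'rV[R]_d.
Local Notation Z := 'rV[int]_d.
Local Notation mu := (torus_measure R d).
Local Notation mR := (measurableTypeR R).
Implicit Types (f g : pt -> R) (k : Z).

Definition tint f : R := torus_int f.

Definition pcont f := torus_periodic f /\ continuous f.

Definition bpt f := bmf (f \o @pt_of_tuple R d).

Lemma pcont_bounded f : pcont f -> exists M, forall x, `|f x| <= M.
Proof.
move=> [pf cf].
pose K := [set v : pt | forall i, `[0, 2 * pi : R]%classic (v 0 i)].
have cK : compact K.
  by apply: (@rV_compact R^o d (fun _ => `[0, 2 * pi]%classic)) => i; exact: segment_compact.
have cfK : compact (f @` K).
  by apply: continuous_compact => //; exact: continuous_subspaceT.
have [M [_ HM]] := compact_bounded cfK.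
exists (M + 1) => x.
pose k : Z := \row_j - Num.floor (x 0 j / (2 * pi)).
rewrite -(pf x k); apply: (HM (M + 1)); first by rewrite ltrDl.
exists (x + (2 * pi) *: map_mx intr k) => // i.
rewrite !mxE /= in_itv/=.
have /andP[h1 h2] := floor_itv (x 0 i / (2 * pi)).
have p0 := @pi2_gt0 R.
rewrite ler_pdivlMr// in h1; rewrite ltr_pdivrMr// intrD in h2.
rewrite intrN; apply/andP; split; lra.
Qed.

Lemma pcont_bpt f : pcont f -> bpt f.
Proof.
move=> pf; split; first by apply: measurable_pt_of_tuple; case: pf.
by have [M hM] := pcont_bounded pf; exists M => t; exact: hM.
Qed.

Lemma bptD f g : bpt f -> bpt g -> bpt (fun x => f x + g x).
Proof. exact: bmfD. Qed.
Lemma bptM f g : bpt f -> bpt g -> bpt (fun x => f x * g x).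
Proof. exact: bmfM. Qed.
Lemma bpt_cst (c : R) : bpt (fun=> c).
Proof. exact: bmf_cst. Qed.
Lemma bptZ (c : R) f : bpt f -> bpt (fun x => c * f x).
Proof. by apply: bptM; exact: bpt_cst. Qed.
Lemma bptB f g : bpt f -> bpt g -> bpt (fun x => f x - g x).
Proof.
move=> bf bg; have -> : (fun x => f x - g x) = (fun x => f x + (-1) * g x).
  by apply/funext => x; rewrite mulN1r.
by apply: bptD => //; exact: bptZ.
Qed.
Lemma bpt_sum (I : Type) (r : seq I) (F : I -> pt -> R) :
  (forall i, bpt (F i)) -> bpt (fun x => \sum_(i <- r) F i x).
Proof.
move=> H; elim: r => [|i r IH].
  by under eq_fun do rewrite big_nil; exact: bpt_cst.
by under eq_fun do rewrite big_cons; exact: bptD.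
Qed.
Lemma bpt_cos k (th : R) : bpt (fun x => cos (th + phase k x)).
Proof. exact: bmf_cos_phase. Qed.

Definition tI f := mu.-integrable setT (EFin \o (f \o @pt_of_tuple R d)).

Lemma bpt_tI f : bpt f -> tI f.
Proof. exact: bmf_integrable. Qed.

Lemma tID f g : tI f -> tI g -> tI (fun x => f x + g x).
Proof.
move=> If Ig; rewrite /tI.
have -> : EFin \o ((fun x => f x + g x) \o @pt_of_tuple R d) =
  (EFin \o (f \o @pt_of_tuple R d)) \+ (EFin \o (g \o @pt_of_tuple R d)) by [].
exact: integrableD.
Qed.

Lemma tIM f g : tI f -> bpt g -> tI (fun x => f x * g x).
Proof.
move=> If [mg [M hM]]; rewrite /tI.
have := @integrableMl _ _ _ mu setT measurableT _ (g \o @pt_of_tuple R d) If mg.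
apply; exists M; split; first by rewrite num_real.
by move=> x Mx y _ /=; rewrite (le_trans (hM _))// ltW.
Qed.

Lemma tintD f g : tI f -> tI g -> tint (fun x => f x + g x) = tint f + tint g.
Proof. by move=> If Ig; rewrite /tint/torus_int RintegralD. Qed.

Lemma tintZ (c : R) f : tI f -> tint (fun x => c * f x) = c * tint f.
Proof. by move=> If; rewrite /tint/torus_int RintegralZl. Qed.

Lemma tint_le f g : tI f -> tI g -> (forall x, f x <= g x) -> tint f <= tint g.
Proof. by move=> If Ig fg; apply: le_Rintegral. Qed.

Lemma tint_ge0 f : (forall x, 0 <= f x) -> 0 <= tint f.
Proof. by move=> f0; apply: Rintegral_ge0. Qed.

Lemma tint_norm f : tI f -> `|tint f| <= tint (fun x => `|f x|).
Proof. by move=> If; apply: le_normr_Rintegral. Qed.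

Lemma tint_cst (c : R) : tint (fun=> c) = c * (2 * pi) ^+ d.
Proof. rewrite /tint/torus_int Rintegral_cst//; congr (_ * _).
by rewrite [X in fine X](@torus_measure_setT R d). Qed.

Lemma tIB f g : tI f -> tI g -> tI (fun x => f x - g x).
Proof.
move=> If Ig.
have -> : (fun x => f x - g x) = (fun x => f x + g x * (-1)).
  by apply/funext => x; rewrite mulrN1.
by apply: tID => //; apply: tIM => //; exact: bpt_cst.
Qed.

Lemma tintB f g : tI f -> tI g -> tint (fun x => f x - g x) = tint f - tint g.
Proof. by move=> If Ig; rewrite /tint/torus_int RintegralB. Qed.

Lemma tint_sum (I : Type) (r : seq I) (F : I -> pt -> R) :
  (forall i, bpt (F i)) -> tint (fun x => \sum_(i <- r) F i x) = \sum_(i <- r) tint (F i).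
Proof.
move=> H; elim: r => [|i r IH].
  by rewrite big_nil; under eq_fun do rewrite big_nil; rewrite tint_cst mul0r.
rewrite big_cons -IH -tintD; last 2 first.
- exact: bpt_tI.
- by apply: bpt_tI; exact: bpt_sum.
by congr tint; apply/funext => x; rewrite big_cons.
Qed.

(** The real part of [exp (- i th)] times the [k]-th coefficient: real and imaginary parts
   of a coefficient are the cases [th = 0] and [th = pi / 2], so one real integral serves both. *)
Definition fcos (th : R) k f : R := tint (fun x => f x * cos (th + phase k x)).

Lemma fourierE f k : fourier f k = fcos 0 k f +i* fcos (pi / 2) k f.
Proof.
rewrite /fourier /Cintegral; congr (_ +i* _).
  apply: eq_Rintegral => t _.
  by rewrite ReMc/= mul0r subr0 add0r cosN.
apply: eq_Rintegral => t _.
by rewrite ImMc/= mul0r addr0 cosD cos_pihalf sin_pihalf mul0r sub0r mul1r sinN.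
Qed.

Lemma fcosE f k th : tI f ->
  fcos th k f = complex.Re (cexpi (- th) * fourier f k).
Proof.
move=> If; rewrite fourierE ReMc/= cosN sinN mulNr opprK /fcos.
rewrite -!tintZ; try by apply: tIM => //; exact: bpt_cos.
rewrite -tintD; last 2 first.
- have -> : (fun x => cos th * (f x * cos (0 + phase k x))) =
    (fun x => f x * (cos th * cos (0 + phase k x))) by apply/funext => x; ring.
  by apply: tIM => //; apply: bptZ; exact: bpt_cos.
- have -> : (fun x => sin th * (f x * cos (pi / 2 + phase k x))) =
    (fun x => f x * (sin th * cos (pi / 2 + phase k x))) by apply/funext => x; ring.
  by apply: tIM => //; apply: bptZ; exact: bpt_cos.
congr tint; apply/funext => x.
rewrite !cosD cos_pihalf sin_pihalf cos0 sin0; ring.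
Qed.

Lemma fourierD f g k : tI f -> tI g ->
  fourier (fun x => f x + g x) k = fourier f k + fourier g k.
Proof.
move=> If Ig; rewrite !fourierE /fcos.
have E th : tint (fun x => (f x + g x) * cos (th + phase k x)) = fcos th k f + fcos th k g.
  rewrite /fcos -tintD; try by apply: tIM => //; exact: bpt_cos.
  by congr tint; apply/funext => x; rewrite mulrDl.
by rewrite !E.
Qed.

Lemma fourierZ (c : R) f k : tI f -> fourier (fun x => c * f x) k = c%:C * fourier f k.
Proof.
move=> If; rewrite !fourierE /fcos.
have E th : tint (fun x => c * f x * cos (th + phase k x)) = c * fcos th k f.
  rewrite /fcos -tintZ; last by apply: tIM => //; exact: bpt_cos.
  by congr tint; apply/funext => x; rewrite mulrA.
by rewrite !E; apply: complex_ext; rewrite ?ReMc ?ImMc/= mul0r ?subr0 ?addr0.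
Qed.

Lemma fourierB f g k : tI f -> tI g ->
  fourier (fun x => f x - g x) k = fourier f k - fourier g k.
Proof.
move=> If Ig; rewrite !fourierE /fcos.
have E th : tint (fun x => (f x - g x) * cos (th + phase k x)) = fcos th k f - fcos th k g.
  rewrite /fcos -tintB; try by apply: tIM => //; exact: bpt_cos.
  by congr tint; apply/funext => x; rewrite mulrBl.
by rewrite !E.
Qed.

Lemma fourier_le f k M : bpt f -> (forall x, `|f x| <= M) ->
  cabs (fourier f k) <= 2 * M * (2 * pi) ^+ d.
Proof.
move=> bf hM; have E th : `|fcos th k f| <= M * (2 * pi) ^+ d.
  have I1 : bpt (fun x => f x * cos (th + phase k x)) by apply: bptM => //; exact: bpt_cos.
  rewrite /fcos (le_trans (tint_norm _))//; first exact: bpt_tI.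
  rewrite -tint_cst; apply: tint_le => //; last 1 first.
  - move=> x; rewrite normrM (le_trans _ (hM x))// ler_piMr//.
    by rewrite ler_norml cos_geN1 cos_le1.
  - apply: bpt_tI; have [m [B hB]] := I1; split; first exact: measurableT_comp.
    by exists B => t /=; rewrite normr_id; exact: hB.
  - by apply: bpt_tI; exact: bpt_cst.
rewrite fourierE (le_trans (cabs_le_ReIm _))//=.
by apply: (le_trans (lerD (E 0) (E (pi / 2)))); move: (_ ^+ d) => X; lra.
Qed.

Lemma fourierN f k : tI f -> fourier f (- k) = (fourier f k)^*%C.
Proof.
move=> If; rewrite !fourierE/=.
have ph x : phase (- k) x = - phase k x :> R.
  by rewrite /phase -sumrN; apply: eq_bigr => j _; rewrite mxE intrN mulNr.
congr (_ +i* _).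
  by congr tint; apply/funext => x; rewrite ph !add0r cosN.
rewrite -mulN1r -tintZ; last by apply: tIM => //; exact: bpt_cos.
congr tint; apply/funext => x; rewrite ph !cosD cos_pihalf sin_pihalf sinN; ring.
Qed.

Lemma phase_period k (x : pt) (m : Z) :
  exists n : int, phase k (x + (2 * pi) *: map_mx intr m) = phase k x + n%:~R * (2 * pi).
Proof.
exists (\sum_j k 0 j * m 0 j).
rewrite /phase rmorph_sum/= mulr_suml -big_split/=; apply: eq_bigr => j _.
by rewrite !mxE rmorphM/=; ring.
Qed.

Lemma cos_phase_period (th : R) k : torus_periodic (fun x : pt => cos (th + phase k x)).
Proof.
by move=> x m; have [n ->] := phase_period k x m; rewrite addrA cos_int_period.
Qed.

Lemma pcont_cos (th : R) k : pcont (fun x => cos (th + phase k x)).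
Proof.
split; first exact: cos_phase_period.
move=> x; apply: continuous_comp; last exact: continuous_cos.
by apply: continuousD; [exact: cst_continuous|exact: continuous_phase].
Qed.

Lemma pcontD f g : pcont f -> pcont g -> pcont (fun x => f x + g x).
Proof.
move=> [pf cf] [pg cg]; split; first by move=> x k; rewrite pf pg.
by move=> x; apply: continuousD; [exact: cf|exact: cg].
Qed.

Lemma pcontM f g : pcont f -> pcont g -> pcont (fun x => f x * g x).
Proof.
move=> [pf cf] [pg cg]; split; first by move=> x k; rewrite pf pg.
by move=> x; apply: continuousM; [exact: cf|exact: cg].
Qed.

Lemma pcont_cst (c : R) : pcont (fun=> c).
Proof. by split=> // x; exact: cst_continuous. Qed.

Lemma pcontB f g : pcont f -> pcont g -> pcont (fun x => f x - g x).
Proof.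
move=> [pf cf] [pg cg]; split; first by move=> x k; rewrite pf pg.
by move=> x; apply: continuousB; [exact: cf|exact: cg].
Qed.

Lemma pcont_sum (I : Type) (r : seq I) (F : I -> pt -> R) :
  (forall i, pcont (F i)) -> pcont (fun x => \sum_(i <- r) F i x).
Proof.
move=> H; elim: r => [|i r IH].
  by under eq_fun do rewrite big_nil; exact: pcont_cst.
by under eq_fun do rewrite big_cons; exact: pcontD.
Qed.

Lemma pt_upd (t : d.-tuple mR) (j : 'I_d) (y : mR) :
  pt_of_tuple (upd t j y) = pt_of_tuple t + (y - tnth t j) *: delta_mx 0 j.
Proof.
apply/rowP => i; rewrite !mxE tnth_mktuple /=.
by case: eqVneq => [->|_]; rewrite ?mulr1 ?mulr0 ?addr0// addrC subrK.
Qed.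

Lemma phase_line k (x : pt) (c : R) (j : 'I_d) :
  phase k (x + c *: delta_mx 0 j) = phase k x + c * (k 0 j)%:~R.
Proof.
rewrite /phase (bigD1 j)//= [in RHS](bigD1 j)//= !mxE !eqxx/= mulr1.
rewrite mulrDr -!addrA; congr (_ + _); rewrite addrC mulrC; congr (_ + _).
by apply: eq_bigr => i ij; rewrite !mxE (negPf ij)/= mulr0 addr0.
Qed.

Lemma id_cont : continuous (fun x : R => x).
Proof. by move=> x; exact: cvg_id. Qed.

Lemma continuous_line (x v : pt) (b : R) :
  continuous (fun y : R => x + (y - b) *: v).
Proof.
apply/ball_normP => y e e0; have v0 : 0 < `|v| + 1 by rewrite ltr_wpDl.
exists (e / (`|v| + 1)); first by rewrite divr_gt0.
move=> z; rewrite ltr_pdivlMr// => h.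
rewrite opprD addrACA subrr add0r -scalerBl opprD addrACA subrr addr0 normrZ.
by apply: le_lt_trans h; rewrite ler_wpM2l// lerDl.
Qed.

Lemma is_derive_line (f : pt -> R) (v a : pt) (b y : R) :
  derivable f (a + (y - b) *: v) v ->
  is_derive y 1 (fun y => f (a + (y - b) *: v)) ('D_v f (a + (y - b) *: v)).
Proof.
move=> df.
have E : (fun h : R => h^-1 *: (((fun y => f (a + (y - b) *: v)) \o shift y) (h *: 1) -
     f (a + (y - b) *: v))) =
  (fun h : R => h^-1 *: ((f \o shift (a + (y - b) *: v)) (h *: v) - f (a + (y - b) *: v))).
  apply/funext => h /=; congr (_ *: (f _ - _)).
  have -> : h *: (1 : R^o) = h by rewrite /GRing.scale/= mulr1.
  by rewrite addrCA -scalerDl addrA.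
split; first by rewrite /derivable E.
by rewrite /derive E.
Qed.

(** Integration by parts on the torus; both parts of the coefficient are handled at once by
   a shift of the angle by [pi / 2]. *)
Lemma fourier_partial f (j : 'I_d) k : torus_periodic f ->
  (forall x, differentiable f x) -> continuous (partial j f) ->
  fourier (partial j f) k = (0 +i* (k 0 j)%:~R) * fourier f k.
Proof.
move=> pf df cpf.
have cf : continuous f by move=> x; exact: differentiable_continuous.
have ppf : torus_periodic (partial j f).
  move=> x m; rewrite /partial /derive.
  have -> // : (fun h : R => h^-1 *: ((f \o shift (x + (2 * pi) *: map_mx intr m)) (h *: delta_mx 0 j) -
      f (x + (2 * pi) *: map_mx intr m))) =
    (fun h : R => h^-1 *: ((f \o shift x) (h *: delta_mx 0 j) - f x)).
  by apply/funext => h /=; rewrite addrA !pf.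
have bf : bpt f by exact: pcont_bpt.
have bpf : bpt (partial j f) by exact: pcont_bpt.
suff E th : fcos th k (partial j f) = - ((k 0 j)%:~R * fcos (th + pi / 2) k f).
  rewrite !fourierE; apply: complex_ext; rewrite ?ReMc ?ImMc/= E.
    by rewrite mul0r sub0r add0r.
  rewrite mul0r add0r -mulrN; congr (_ * _).
  rewrite /fcos -mulN1r -tintZ; last by apply: tIM; [exact: bpt_tI|exact: bpt_cos].
  congr tint; apply/funext => x; rewrite -splitr cosD cospi sinpi cosD cos0 sin0; ring.
apply/eqP; rewrite -subr_eq0 opprK; apply/eqP.
rewrite /fcos -tintZ; last by apply: tIM; [exact: bpt_tI|exact: bpt_cos].
rewrite -tintD; last 2 first.
- by apply: tIM; [exact: bpt_tI|exact: bpt_cos].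
- by apply: bpt_tI; apply: bptZ; apply: bptM => //; exact: bpt_cos.
rewrite /tint /torus_int.
apply: (@torus_int_derive _ _ (fun t => f (pt_of_tuple t) * cos (th + phase k (pt_of_tuple t)))
  (fun t => partial j f (pt_of_tuple t) * cos (th + phase k (pt_of_tuple t)) +
   (k 0 j)%:~R * (f (pt_of_tuple t) * cos (th + pi / 2 + phase k (pt_of_tuple t)))) j).
- apply: (@bptD (fun x => partial j f x * cos (th + phase k x))
    (fun x => (k 0 j)%:~R * (f x * cos (th + pi / 2 + phase k x)))).
    by apply: bptM => //; exact: bpt_cos.
  by apply: bptZ; apply: bptM => //; exact: bpt_cos.
- move=> t; under eq_fun do rewrite pt_upd.
  have cl : continuous (fun y : R => pt_of_tuple t + (y - tnth t j) *: delta_mx 0 j).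
    exact: continuous_line.
  pose h := fun x : pt => partial j f x * cos (th + phase k x) +
     (k 0 j)%:~R * (f x * cos (th + pi / 2 + phase k x)).
  have [_ ch] : pcont h.
    apply: pcontD; first by apply: pcontM; [split|exact: pcont_cos].
    apply: pcontM; first exact: pcont_cst.
    by apply: pcontM; [split|exact: pcont_cos].
  exact: (fun y => @continuous_comp _ _ _ (fun y : R => pt_of_tuple t + (y - tnth t j) *: delta_mx 0 j) h y (cl y) (ch _)).
- move=> t y; rewrite pt_upd; under eq_fun do rewrite pt_upd phase_line.
  have dv : derivable f (pt_of_tuple t + (y - tnth t j) *: delta_mx 0 j) (delta_mx 0 j).
    by apply: diff_derivable; exact: df.
  have h1 := is_derive_line dv.
  apply: is_derive_eq.
  rewrite phase_line -/(partial j f _).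
  have -> : th + pi / 2 + (phase k (pt_of_tuple t) + (y - tnth t j) * (k 0 j)%:~R) =
    (th + (phase k (pt_of_tuple t) + (y - tnth t j) * (k 0 j)%:~R)) + pi / 2 by ring.
  set A := th + (_ + _).
  rewrite cosD cos_pihalf sin_pihalf /GRing.scale/=; ring.
- move=> t; have -> : pt_of_tuple (upd t j (2 * pi)) = pt_of_tuple (upd t j 0) +
      (2 * pi) *: map_mx intr (delta_mx 0 j).
    rewrite !pt_upd -addrA; congr (_ + _); apply/rowP => i; rewrite !mxE.
    by case: (_ && _); rewrite ?mulr1 ?mulr0 ?addr0//; ring.
  by rewrite pf cos_phase_period.
Qed.

Lemma partial_periodic f (j : 'I_d) : torus_periodic f -> torus_periodic (partial j f).
Proof.
move=> pf x m; rewrite /partial /derive.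
have -> // : (fun h : R => h^-1 *: ((f \o shift (x + (2 * pi) *: map_mx intr m)) (h *: delta_mx 0 j) -
    f (x + (2 * pi) *: map_mx intr m))) =
  (fun h : R => h^-1 *: ((f \o shift x) (h *: delta_mx 0 j) - f x)).
by apply/funext => h /=; rewrite addrA !pf.
Qed.

(** ** Uniqueness of Fourier coefficients for continuous functions *)

(** The trigonometric polynomial [peak a], at most 1 with equality only at [a]
   modulo periods: integrating against its powers localizes at [a]. *)
Definition peak (a x : pt) : R := \sum_j (1 + cos (x 0 j - a 0 j)) / (2 * d%:R).

Lemma phase_delta (j : 'I_d) (x : pt) : phase (delta_mx 0 j) x = x 0 j.
Proof.
rewrite /phase (bigD1 j)//= mxE !eqxx mul1r big1 ?addr0// => i ij.
by rewrite mxE eqxx/= (negPf ij) mul0r.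
Qed.

Lemma phaseD k l (x : pt) : phase (k + l) x = phase k x + phase l x.
Proof.
by rewrite /phase -big_split; apply: eq_bigr => j _; rewrite mxE intrD mulrDl.
Qed.

Lemma pcont_peak a : pcont (peak a).
Proof.
apply: pcont_sum => j.
have -> : (fun x : pt => (1 + cos (x 0 j - a 0 j)) / (2 * d%:R)) =
  (fun x => (1 + cos (- a 0 j + phase (delta_mx 0 j) x)) * (2 * d%:R)^-1).
  by apply/funext => x; rewrite phase_delta [x 0 j - _]addrC.
apply: pcontM; last exact: pcont_cst.
by apply: pcontD; [exact: pcont_cst|exact: pcont_cos].
Qed.

Lemma pcontX f n : pcont f -> pcont (fun x => f x ^+ n).
Proof.
move=> pf; elim: n => [|n IH].
  by under eq_fun do rewrite expr0; exact: pcont_cst.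
by under eq_fun do rewrite exprS; exact: pcontM.
Qed.

(** A power of [peak a] times a cosine is a trigonometric polynomial. *)
Lemma tint_peak0 g a : pcont g -> (forall k, fourier g k = 0) ->
  forall n th k, tint (fun x => g x * peak a x ^+ n * cos (th + phase k x)) = 0.
Proof.
move=> pg g0; elim=> [|n IH] th k.
  under eq_fun do rewrite expr0 mulr1.
  have := @fcosE g k th (bpt_tI (pcont_bpt pg)).
  by rewrite g0 mulr0 /fcos.
have E x : g x * peak a x ^+ n.+1 * cos (th + phase k x) =
  \sum_j (2 * d%:R)^-1 * (g x * peak a x ^+ n * cos (th + phase k x) +
   2^-1 * (g x * peak a x ^+ n * cos (th - a 0 j + phase (k + delta_mx 0 j) x) +
           g x * peak a x ^+ n * cos (th + a 0 j + phase (k - delta_mx 0 j) x))).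
  rewrite exprSr mulrA -mulrA [peak a x * _]mulrC mulrA [X in _ * X]/peak mulr_sumr.
  apply: eq_bigr => j _.
  have phN : phase (- delta_mx 0 j : Z) x = - x 0 j :> R.
    rewrite -[in RHS](phase_delta j x) /phase -sumrN.
    by apply: eq_bigr => i _; rewrite mxE intrN mulNr.
  rewrite !phaseD phN phase_delta.
  have -> : th - a 0 j + (phase k x + x 0 j) = (th + phase k x) + (x 0 j - a 0 j) by ring.
  have -> : th + a 0 j + (phase k x - x 0 j) = (th + phase k x) - (x 0 j - a 0 j) by ring.
  move: (th + phase k x) (x 0 j - a 0 j) => A B; rewrite cosD cosB; field.
  have [dn|] := boolP (d%:R == 0 :> R); last by [].
  by move: dn; rewrite pnatr_eq0 => /eqP d0; have := ltn_ord j; rewrite {2}d0.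
have bp m l t : bpt (fun x => g x * peak a x ^+ m * cos (t + phase l x)).
  apply: pcont_bpt; apply: pcontM; last exact: pcont_cos.
  by apply: pcontM => //; apply: pcontX; exact: pcont_peak.
under eq_fun do rewrite E.
rewrite tint_sum; last first.
  move=> j; apply: bptZ; apply: bptD; first exact: bp.
  by apply: bptZ; apply: bptD; exact: bp.
apply: big1 => j _; rewrite tintZ; last first.
  apply: bpt_tI; apply: bptD; first exact: bp.
  by apply: bptZ; apply: bptD; exact: bp.
rewrite tintD; [|exact/bpt_tI/bp|by apply: bpt_tI; apply: bptZ; apply: bptD; exact: bp].
rewrite tintZ; last by apply: bpt_tI; apply: bptD; exact: bp.
rewrite tintD; [|exact/bpt_tI/bp|exact/bpt_tI/bp].
by rewrite !IH addr0 mulr0 addr0 mulr0.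
Qed.

Lemma cos_near_int (z e : R) : 0 < e -> e <= pi -> cos e < cos z ->
  exists m : int, `|z + m%:~R * (2 * pi)| < e.
Proof.
move=> e0 epi cz; pose m := - Num.floor ((z + pi) / (2 * pi)).
exists m; set w := z + _.
have cw : cos w = cos z by rewrite cos_int_period.
have p0 := @pi2_gt0 R.
have [w1 w2] : - pi <= w /\ w < pi.
  have /andP[h1 h2] := floor_itv ((z + pi) / (2 * pi)).
  rewrite ler_pdivlMr// in h1; rewrite ltr_pdivrMr// intrD in h2.
  by rewrite /w /m intrN; split; lra.
rewrite ltNge; apply/negP => we; move: cz; apply/negP; rewrite -leNgt -cw.
have cn : cos w = cos `|w| by have [h|h] := leP 0 w; rewrite ?(ger0_norm h) ?(ltr0_norm h) ?cosN.
have wpi : `|w| <= pi by rewrite ler_norml w1 ltW.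
rewrite cn; case: (ltgtP e `|w|) we => // [ew _|-> //].
by apply/ltW; rewrite ltr_cos// in_itv/= ?(ltW e0) ?epi// normr_ge0 wpi.
Qed.

Lemma tint_box_lower (F : pt -> R) (a : pt) (b A C : R) : bpt F -> 0 < b ->
  (forall j, 0 <= a 0 j /\ a 0 j + b <= 2 * pi) ->
  (forall t, A * \1_(box a b) t - C <= F (pt_of_tuple t)) ->
  A * b ^+ d - C * (2 * pi) ^+ d <= tint F.
Proof.
move=> bF b0 hb low.
have mB : measurable (box a b) by exact: measurable_box.
have I1 : bmf (\1_(box a b) : d.-tuple mR -> R).
  split; first exact: measurable_indic.
  by exists 1 => t; rewrite indicE; case: (_ \in _); rewrite ?normr1 ?normr0.
have I2 : bmf (fun t : d.-tuple mR => A * \1_(box a b) t).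
  by apply: bmfM => //; exact: bmf_cst.
have := @le_Rintegral _ _ _ mu setT _ _ measurableT
  (bmf_integrable mu (bmfD I2 (bmf_cst _ (- C)))) (bmf_integrable mu bF) (fun t _ => low t).
rewrite RintegralD//; [|exact: bmf_integrable|by apply: bmf_integrable; exact: bmf_cst].
rewrite Rintegral_cst// [X in fine X](@torus_measure_setT R d)/=.
rewrite RintegralZl//; last exact: bmf_integrable.
by rewrite {1}/Rintegral integral_indic// setIT [X in fine X]torus_measure_box//= mulNr.
Qed.

Lemma expr_ratio_contra (rho rho' c M : R) : 0 <= rho -> rho < rho' -> 0 < c ->
  (forall n, c * rho' ^+ n <= M * rho ^+ n) -> False.
Proof.
move=> rho0 lt c0 key; have rho'0 : 0 < rho' by exact: le_lt_trans lt.
pose q := rho / rho'.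
have q1 : `|q| < 1 by rewrite ger0_norm ?divr_ge0 ?(ltW rho'0)// ltr_pdivrMr// mul1r.
have M1 : 0 < `|M| + 1 by rewrite ltr_wpDl.
have /cvgrPdist_lt/(_ _ (divr_gt0 c0 M1)) [N _ /(_ N (leqnn N))] := cvg_expr q1.
rewrite sub0r normrN ger0_norm; last by rewrite exprn_ge0// divr_ge0 ?(ltW rho'0).
rewrite ltr_pdivlMr// expr_div_n mulrAC ltr_pdivrMr ?exprn_gt0// => h.
have := key N; apply/negP; rewrite -ltNge.
apply: le_lt_trans h.
by rewrite mulrC ler_wpM2l ?exprn_ge0// (le_trans (ler_norm _))// lerDl.
Qed.

(** If [g x > 0], the integrals of [g] against the powers of the peak at [x] are all zero, although
   these powers concentrate where [g] is positive: on a box near [x] the peak is at least [rho'],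
   which is larger than its bound [rho] where [g] may fail to be positive, and [rho' ^+ n] wins
   over [rho ^+ n]. *)
Lemma fourier_inj0 g : (0 < d)%N -> pcont g -> (forall k, fourier g k = 0) ->
  forall x, g x = 0.
Proof.
move=> d0 pg g0 x.
wlog gx : g pg g0 / 0 < g x.
  move=> W; have [h|h|//] := ltgtP (g x) 0; last exact: (W _ pg g0 h).
  have : - g x = 0; last by move/eqP; rewrite oppr_eq0 => /eqP.
  have e : (fun y => - g y) = (fun y => (-1) * g y) by apply/funext => y; rewrite mulN1r.
  apply: (W (fun y => - g y)); last by rewrite oppr_gt0.
    by rewrite e; apply: pcontM => //; exact: pcont_cst.
  by move=> k; rewrite e fourierZ ?g0 ?mulr0//; exact/bpt_tI/pcont_bpt.
exfalso.
(* [a] is the translate of [x] in the fundamental domain; boxes are placed to the right of it,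
   since it may lie on the lower boundary *)
pose m0 : Z := \row_j - Num.floor (x 0 j / (2 * pi)).
pose a := x + (2 * pi) *: map_mx intr m0.
have p0 := @pi2_gt0 R.
have a_itv j : 0 <= a 0 j < 2 * pi.
  have /andP[h1 h2] := floor_itv (x 0 j / (2 * pi)).
  rewrite ler_pdivlMr// in h1; rewrite ltr_pdivrMr// intrD in h2.
  by rewrite /a !mxE intrN; apply/andP; split; lra.
have ga : 0 < g a by case: (pg) => pg1 _; rewrite /a pg1.
pose eta := g a / 2.
have eta0 : 0 < eta by rewrite divr_gt0.
have [pg1 /ball_normP cg] := pg.
have [r r0 rP] := cg a eta eta0.
pose e := Num.min (r / 2) (pi / 2).
have pi0 := @pi_gt0 R.
have e0 : 0 < e by rewrite lt_min !divr_gt0.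
have epi : e <= pi by rewrite ge_min; apply/orP; right; lra.
have dR : 0 < d%:R :> R by rewrite ltr0n.
pose rho : R := 1 - (1 - cos e) / (2 * d%:R).
have cose : cos e < 1.
  rewrite -cos0 ltr_cos// in_itv/= ?lexx ?(ltW pi0)//.
  by rewrite (ltW e0) epi.
(* each of the [d] summands of the peak is at most [1 / d], so if the peak exceeds [rho] then
   every coordinate of [y] is near that of [a] modulo periods *)
have far y : rho < peak a y -> eta < g y.
  move=> hy.
  have hj j : cos e < cos (y 0 j - a 0 j).
    rewrite ltNge; apply/negP => h; move: hy; apply/negP; rewrite -leNgt.
    rewrite /peak (bigD1 j)//=.
    have h2 : \sum_(i < d | i != j) (1 + cos (y 0 i - a 0 i)) / (2 * d%:R) <=
       \sum_(i < d | i != j) d%:R^-1.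
      apply: ler_sum => i _; rewrite ler_pdivrMr ?mulr_gt0// mulrCA mulVf ?gt_eqF// mulr1.
      by have := cos_le1 (y 0 i - a 0 i); lra.
    rewrite sumr_const cardC1 card_ord in h2.
    have h3 : (d%:R^-1 *+ d.-1 : R) = 1 - d%:R^-1.
      rewrite -[X in _ *+ X]subn1 mulrnBr// mulr1n; congr (_ - _).
      by rewrite -[LHS]mulr_natl mulfV ?gt_eqF.
    rewrite h3 in h2.
    have h4 : (1 + cos (y 0 j - a 0 j)) / (2 * d%:R) <= (1 + cos e) / (2 * d%:R).
      by rewrite ler_pM2r ?invr_gt0 ?mulr_gt0// lerD2l.
    apply: (le_trans (lerD h4 h2)); rewrite /rho le_eqVlt; apply/orP; left; apply/eqP.
    by field; rewrite gt_eqF.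
  have [M HM] : exists M : 'I_d -> int, forall j, `|y 0 j - a 0 j + (M j)%:~R * (2 * pi)| < e.
    have H j := cos_near_int e0 epi (hj j).
    by exists (fun j => sval (cid (H j))) => j; case: (cid _).
  rewrite -(pg1 y (\row_j M j)).
  have : `|g a - g (y + (2 * pi) *: map_mx intr (\row_j M j))| < eta.
    apply: rP; apply: (@le_lt_trans _ _ e); last first.
      by rewrite gt_min; apply/orP; left; lra.
    apply: rV_norm_le; first exact: ltW.
    move=> j; apply: le_trans (ltW (HM j)); rewrite /a !mxE.
    by rewrite -normrN le_eqVlt; apply/orP; left; apply/eqP; congr (`|_|); ring.
  rewrite ltr_norml /eta => /andP[_ h]; lra.
(* within [e'] of [a] in each coordinate, the peak is at least a constant larger than [rho] *)
have [e' [e'0 e'pi e'near]] : exists e', [/\ 0 < e', e' <= pi &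
     (1 + cos e') / 2 > rho].
  have h : 0 < (1 - cos e) / (2 * d%:R) by rewrite divr_gt0 ?mulr_gt0// subr_gt0.
  have /ball_normP cc := @continuous_cos R.
  have [s s0 sP] := cc 0 _ h.
  exists (Num.min (s / 2) pi); split.
  - by rewrite lt_min pi0 divr_gt0.
  - by rewrite ge_min lexx orbT.
  - have := sP (Num.min (s / 2) pi).
    rewrite sub0r normrN gtr0_norm; last by rewrite lt_min pi0 divr_gt0.
    have hs : Num.min (s / 2) pi < s by rewrite gt_min; apply/orP; left; lra.
    move=> /(_ hs).
    rewrite cos0 ltr_norml /rho; lra.
have [b [b0 be' bpi]] : exists b, [/\ 0 < b, b <= e' & forall j, a 0 j + b <= 2 * pi].
  exists (\big[Num.min/e']_j (2 * pi - a 0 j)); split.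
  - apply: lt_bigmin => // j _; have /andP[_ h] := a_itv j; lra.
  - exact: bigmin_le_id.
  - by move=> j; rewrite -lerBrDl; apply: bigmin_le_cond.
pose B := box a b.
pose rho' := (1 + cos e') / 2.
have peak_box t : B t -> rho' <= peak a (pt_of_tuple t).
  move=> Bt; rewrite /peak.
  apply: (@le_trans _ _ (\sum_(j < d) (1 + cos e') / (2 * d%:R))).
    rewrite sumr_const card_ord -mulr_natl /rho' le_eqVlt; apply/orP; left; apply/eqP.
    by field; rewrite gt_eqF.
  apply: ler_sum => j _; rewrite ler_pM2r ?invr_gt0 ?mulr_gt0// lerD2l mxE.
  have /andP[t1 t2] := Bt j.
  apply/ltW; rewrite ltr_cos ?in_itv/=; [lra| |]; apply/andP; split; lra.
have rho0 : 0 <= rho.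
  rewrite /rho subr_ge0 ler_pdivrMr ?mulr_gt0// mul1r.
  have := cos_geN1 e; have : 1 <= d%:R :> R by rewrite ler1n.
  lra.
have peak_ge0 y : 0 <= peak a y.
  apply: sumr_ge0 => j _; rewrite divr_ge0 ?mulr_ge0 ?(ltW dR)//.
have [M hM] := pcont_bounded pg.
have key n : eta * rho' ^+ n * b ^+ d <= M * rho ^+ n * (2 * pi) ^+ d.
  have low t : eta * rho' ^+ n * \1_B t - M * rho ^+ n <=
     g (pt_of_tuple t) * peak a (pt_of_tuple t) ^+ n.
    have M0' : 0 <= M by apply: le_trans (hM a).
    have [h|h] := ltP rho (peak a (pt_of_tuple t)).
      have gy := far _ h.
      apply: (@le_trans _ _ (eta * peak a (pt_of_tuple t) ^+ n)); last first.
        by rewrite ler_wpM2r ?exprn_ge0// ltW.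
      rewrite lerBlDr (@le_trans _ _ (eta * peak a (pt_of_tuple t) ^+ n))//; last first.
        by rewrite lerDl mulr_ge0// exprn_ge0.
      rewrite -mulrA ler_wpM2l ?(ltW eta0)// indicE; have [tB|_] := boolP (t \in B).
        rewrite mulr1 lerXn2r// ?nnegrE//; last by apply: peak_box; exact: set_mem.
        by rewrite divr_ge0// -lerBlDl sub0r cos_geN1.
      by rewrite mulr0 exprn_ge0.
    rewrite indicE memNset ?mulr0 ?sub0r; last first.
      by move=> /peak_box h'; move: e'near; apply/negP; rewrite -leNgt (le_trans h').
    apply: (@le_trans _ _ (- `|g (pt_of_tuple t) * peak a (pt_of_tuple t) ^+ n|)); last first.
      by rewrite lerNl ler_normr lexx orbT.
    rewrite lerN2 normrM ler_pM// ger0_norm ?exprn_ge0//.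
    by rewrite lerXn2r// ?nnegrE.
  have := tint_peak0 a pg g0 n 0 0.
  have -> : (fun x : pt => g x * peak a x ^+ n * cos (0 + phase 0 x)) =
      (fun x => g x * peak a x ^+ n).
    apply/funext => x1; rewrite /phase big1 ?addr0 ?cos0 ?mulr1// => i _.
    by rewrite mxE mul0r.
  move=> E0; rewrite -subr_le0 -[leRHS]E0.
  apply: tint_box_lower low => //.
  - exact/pcont_bpt/(pcontM pg (pcontX n (pcont_peak a))).
  - by move=> j; have /andP[h _] := a_itv j; have := bpi j.
apply: (@expr_ratio_contra rho rho' (eta * b ^+ d) (M * (2 * pi) ^+ d)) => //.
  by rewrite mulr_gt0// exprn_gt0.
by move=> n; have := key n; rewrite mulrAC [X in _ <= X -> _]mulrAC.
Qed.

End torus_functions.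

Arguments fourier : simpl never.
Arguments Normc.normc : simpl never.

(** * Norms of sequences through their finite partial sums *)

Section finite_sums.
Context {R : realType} {I : choiceType}.
Implicit Types (a b u : I -> R) (s : seq I).

(** The [l1] and [l2] norms are used through bounds on finite partial sums only, which avoids
   summability side conditions. *)
Definition L1le a (M : R) := forall s, uniq s -> \sum_(k <- s) a k <= M.
Definition L2le a (M : R) := 0 <= M /\ L1le (fun k => a k ^+ 2) (M ^+ 2).

Lemma L1le_ge0 a M : L1le a M -> 0 <= M.
Proof. by move=> /(_ [::] isT); rewrite big_nil. Qed.

Lemma L1le_le a b M N : (forall k, a k <= b k) -> M <= N -> L1le b M -> L1le a N.
Proof.
by move=> ab MN h s us; rewrite (le_trans _ MN)// (le_trans _ (h s us))// ler_sum.
Qed.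

Lemma L1leD a b M N : L1le a M -> L1le b N -> L1le (fun k => a k + b k) (M + N).
Proof. by move=> ha hb s us; rewrite big_split/= lerD ?ha ?hb. Qed.

Lemma L1leZ a M (c : R) : 0 <= c -> L1le a M -> L1le (fun k => c * a k) (c * M).
Proof. by move=> c0 h s us; rewrite -mulr_sumr ler_wpM2l ?h. Qed.

Lemma L1le_point a M k : L1le a M -> a k <= M.
Proof. by move=> /(_ [:: k] isT); rewrite big_seq1. Qed.

Lemma L1le_sum (J : Type) (r : seq J) (F : J -> I -> R) (M : J -> R) :
  (forall j, L1le (F j) (M j)) ->
  L1le (fun k => \sum_(j <- r) F j k) (\sum_(j <- r) M j).
Proof.
by move=> h s us; rewrite exchange_big/= ler_sum// => j _; exact: h.
Qed.

Lemma L1le_inj a M (f : I -> I) s : L1le a M -> injective f -> uniq s ->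
  \sum_(k <- s) a (f k) <= M.
Proof.
by move=> h fi us; have := h (map f s); rewrite big_map => -> //; rewrite map_inj_uniq.
Qed.

(** If every finite set left a tail larger than [e], disjoint tails would add up to more than [M]. *)
Lemma L1le_tail a M : (forall k, 0 <= a k) -> L1le a M -> forall e, 0 < e ->
  exists2 s0, uniq s0 & forall s, uniq s -> (forall k, k \in s -> k \notin s0) ->
    \sum_(k <- s) a k <= e.
Proof.
move=> a0 h e e0; apply: contrapT => H.
have step s0 : uniq s0 -> exists2 s, uniq s & \sum_(k <- s0) a k + e <= \sum_(k <- s) a k.
  move=> us0; apply: contrapT => H'; apply: H; exists s0 => // s us dis.
  rewrite leNgt; apply/negP => lt; apply: H'; exists (s0 ++ s).
    by rewrite cat_uniq us0 us/= andbT; apply/hasPn => k /dis.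
  by rewrite big_cat/= lerD2l ltW.
have build n : exists2 s, uniq s & n%:R * e <= \sum_(k <- s) a k.
  elim: n => [|n [s us hs]]; first by exists [::] => //; rewrite mul0r big_nil.
  have [s' us' hs'] := step s us; exists s' => //.
  by rewrite (le_trans _ hs')// -natr1 mulrDl mul1r lerD2r.
have M0 := L1le_ge0 h.
have [s us hs] := build (Num.truncn (M / e)).+1.
have := le_trans hs (h s us); apply/negP; rewrite -ltNge -ltr_pdivrMr//.
exact: truncnS_gt.
Qed.

Lemma amgm_sum (x y A B : R) : 0 < A -> 0 < B -> x * y <= (B / A * x ^+ 2 + A / B * y ^+ 2) / 2.
Proof.
move=> A0 B0; rewrite ler_pdivlMr// -subr_ge0.
have -> : B / A * x ^+ 2 + A / B * y ^+ 2 - x * y * 2 = (B * x - A * y) ^+ 2 / (A * B).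
  by field; rewrite !gt_eqF.
by rewrite divr_ge0 ?sqr_ge0// mulr_ge0 ?ltW.
Qed.

Lemma sum_sqr_eq0 (J : eqType) (s : seq J) (x : J -> R) : \sum_(k <- s) x k ^+ 2 <= 0 ->
  forall k, k \in s -> x k = 0.
Proof.
move=> h k ks; apply/eqP; rewrite -sqrf_eq0 eq_le sqr_ge0 andbT.
apply: le_trans h; rewrite (big_rem k)//= lerDl.
by apply: sumr_ge0 => i _; exact: sqr_ge0.
Qed.

Lemma cauchy_schwarz_sum (J : eqType) (s : seq J) (x y : J -> R) (A B : R) :
  0 <= A -> 0 <= B -> \sum_(k <- s) x k ^+ 2 <= A ^+ 2 ->
  \sum_(k <- s) y k ^+ 2 <= B ^+ 2 -> \sum_(k <- s) x k * y k <= A * B.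
Proof.
rewrite le_eqVlt => /predU1P[<-|A0].
  move=> B0; rewrite expr0n/= => h _; rewrite mul0r big1_seq// => k /= ks.
  by rewrite (sum_sqr_eq0 h ks) mul0r.
rewrite le_eqVlt => /predU1P[<-|B0].
  move=> _; rewrite expr0n/= => h; rewrite mulr0 big1_seq// => k /= ks.
  by rewrite (sum_sqr_eq0 h ks) mulr0.
move=> hx hy.
apply: (@le_trans _ _ (\sum_(k <- s) (B / A * x k ^+ 2 + A / B * y k ^+ 2) / 2)).
  by apply: ler_sum => k _; exact: amgm_sum.
rewrite -mulr_suml big_split/= -!mulr_sumr ler_pdivrMr//.
have h1 : B / A * \sum_(k <- s) x k ^+ 2 <= B / A * A ^+ 2.
  by rewrite ler_wpM2l// divr_ge0 ?ltW.
have h2 : A / B * \sum_(k <- s) y k ^+ 2 <= A / B * B ^+ 2.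
  by rewrite ler_wpM2l// divr_ge0 ?ltW.
apply: (le_trans (lerD h1 h2)); rewrite le_eqVlt; apply/orP; left; apply/eqP.
by field; rewrite !gt_eqF.
Qed.

(** An [l2] bound is an [l1] bound against every finite family of weights;
   taking the family itself as weights gives the converse. *)
Lemma L2le_dual a M : 0 <= M -> (forall k, 0 <= a k) ->
  (forall (y : I -> R) (Y : R) s, uniq s -> 0 <= Y -> (forall k, 0 <= y k) ->
     \sum_(k <- s) y k ^+ 2 <= Y ^+ 2 -> \sum_(k <- s) y k * a k <= Y * M) ->
  L2le a M.
Proof.
move=> M0 a0 H; split => // s us.
pose Y := Num.sqrt (\sum_(k <- s) a k ^+ 2).
have Y2 : Y ^+ 2 = \sum_(k <- s) a k ^+ 2.
  by rewrite sqr_sqrtr// sumr_ge0// => k _; exact: sqr_ge0.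
have Y0 : 0 <= Y by exact: sqrtr_ge0.
have := H a Y s us Y0 a0; rewrite Y2 => /(_ (lexx _)).
have -> : \sum_(k <- s) a k * a k = Y ^+ 2 by rewrite Y2; apply: eq_bigr => k _; rewrite expr2.
move=> h; rewrite lerXn2r// ?nnegrE//; move: h.
move: Y0; rewrite le_eqVlt => /predU1P[<- //|Y0].
by rewrite expr2 ler_pM2l.
Qed.

Lemma L2le_le a b M N : (forall k, 0 <= a k <= b k) -> M <= N -> L2le b M -> L2le a N.
Proof.
move=> ab MN [M0 h]; split; first exact: le_trans MN.
apply: L1le_le h; last by rewrite lerXn2r// nnegrE// (le_trans M0).
by move=> k; have /andP[h1 h2] := ab k; rewrite lerXn2r// nnegrE// (le_trans h1).
Qed.

Lemma L2le_pair a M (y : I -> R) Y s : L2le a M -> uniq s -> 0 <= Y ->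
  \sum_(k <- s) y k ^+ 2 <= Y ^+ 2 -> \sum_(k <- s) y k * a k <= Y * M.
Proof. by move=> [M0 h] us Y0 hY; apply: cauchy_schwarz_sum => //; exact: h. Qed.

Lemma L2leD a b M N : (forall k, 0 <= a k) -> (forall k, 0 <= b k) ->
  L2le a M -> L2le b N -> L2le (fun k => a k + b k) (M + N).
Proof.
move=> a0 b0 ha hb; apply: L2le_dual.
- by rewrite addr_ge0; [|case: ha|case: hb].
- by move=> k; rewrite addr_ge0.
- move=> y Y s us Y0 y0 hY; rewrite mulrDr.
  under eq_bigr do rewrite mulrDr; rewrite big_split/= lerD//; exact: L2le_pair.
Qed.

Lemma L2leZ a M (c : R) : 0 <= c -> L2le a M -> L2le (fun k => c * a k) (c * M).
Proof.
move=> c0 [M0 h]; split; first by rewrite mulr_ge0.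
rewrite exprMn; under [X in L1le X]eq_fun do rewrite exprMn.
by apply: L1leZ => //; exact: sqr_ge0.
Qed.

Lemma L2le_point a M k : L2le a M -> a k <= M.
Proof.
move=> [M0 /L1le_point h]; have := h k => h1.
rewrite leNgt; apply/negP => lt; move: h1; apply/negP; rewrite -ltNge.
by rewrite ltrXn2r// nnegrE// (le_trans M0)// ltW.
Qed.

Lemma L1le_L2le a M : (forall k, 0 <= a k) -> L1le a M -> L2le a M.
Proof.
move=> a0 h; have M0 := L1le_ge0 h; split => // s us.
rewrite expr2; apply: (@le_trans _ _ (\sum_(k <- s) M * a k)).
  apply: ler_sum => k _; rewrite expr2 ler_wpM2r// ; exact: L1le_point.
by rewrite -mulr_sumr ler_wpM2l// h.
Qed.

(** ** Unconditional sums *)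

(** Convergence along the finite subsets, which is independent of any enumeration. *)
Definition has_sum u y := forall e, 0 < e -> exists s0, forall s, uniq s ->
  {subset s0 <= s} -> `|y - \sum_(k <- s) u k| <= e.

Definition tsum u : R := xget 0 [set y | has_sum u y].

Lemma has_sum_uniq u y z : has_sum u y -> has_sum u z -> y = z.
Proof.
move=> hy hz; apply/eqP; rewrite -subr_eq0 -normr_eq0 eq_le normr_ge0 andbT.
apply/ler_addgt0Pr => e e0; rewrite add0r.
have e2 : 0 < e / 2 by rewrite divr_gt0.
have [s1 h1] := hy _ e2; have [s2 h2] := hz _ e2.
pose s := undup (s1 ++ s2).
have us : uniq s := undup_uniq _.
have H1 : `|y - \sum_(k <- s) u k| <= e / 2.
  by apply: h1 => // k ks; rewrite mem_undup mem_cat ks.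
have H2 : `|z - \sum_(k <- s) u k| <= e / 2.
  by apply: h2 => // k ks; rewrite mem_undup mem_cat ks orbT.
rewrite (splitr e); apply: le_trans (lerD H1 H2).
rewrite [X in _ <= _ + X]distrC; apply: le_trans (ler_normD _ _).
by rewrite addrA subrK.
Qed.

Lemma has_sumE u y : has_sum u y -> tsum u = y.
Proof.
move=> h; apply: (@has_sum_uniq u) => //.
exact: (@xgetPex _ 0 [set y | has_sum u y] (ex_intro _ y h)).
Qed.

Lemma has_sumD u v y z : has_sum u y -> has_sum v z -> has_sum (fun k => u k + v k) (y + z).
Proof.
move=> hy hz e e0; have e2 : 0 < e / 2 by rewrite divr_gt0.
have [s1 h1] := hy _ e2; have [s2 h2] := hz _ e2.
exists (s1 ++ s2) => s us sub; rewrite big_split/= (splitr e) opprD addrACA.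
apply: (le_trans (ler_normD _ _)); apply: lerD.
  by apply: h1 => // k ks; apply: sub; rewrite mem_cat ks.
by apply: h2 => // k ks; apply: sub; rewrite mem_cat ks orbT.
Qed.

Lemma has_sumZ u y (c : R) : has_sum u y -> has_sum (fun k => c * u k) (c * y).
Proof.
move=> hy e e0; have c0 : 0 < `|c| + 1 by rewrite ltr_wpDl.
have [s0 h] := hy _ (divr_gt0 e0 c0); exists s0 => s us sub.
rewrite -mulr_sumr -mulrBr normrM.
have := h s us sub; rewrite ler_pdivlMr// => h1; apply: le_trans h1.
by rewrite mulrC ler_wpM2l// lerDl.
Qed.

Lemma has_sum_ge0 u M : (forall k, 0 <= u k) -> L1le u M -> exists y, has_sum u y.
Proof.
move=> u0 h; pose A := [set x | exists2 s, uniq s & x = \sum_(k <- s) u k].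
have hA : has_sup A.
  split; first by exists 0, [::] => //; rewrite big_nil.
  by exists M => _ [s us ->]; exact: h.
exists (sup A) => e e0.
have [_ [s0 us0 ->] hs0] := sup_adherent e0 hA.
exists s0 => s us sub.
have h1 : \sum_(k <- s0) u k <= \sum_(k <- s) u k.
  rewrite [leRHS](bigID (mem s0))/= -[leLHS]addr0 lerD//; last by rewrite sumr_ge0.
  rewrite -[leRHS]big_filter le_eqVlt; apply/orP; left; apply/eqP; apply: perm_big.
  apply: uniq_perm => //; first exact: filter_uniq.
  move=> k; rewrite mem_filter /=; case ks: (k \in s0) => //=.
  by rewrite sub.
have h2 : \sum_(k <- s) u k <= sup A by apply: ub_le_sup; [case: hA|exists s].
by rewrite ger0_norm ?subr_ge0// lerBlDr -lerBlDl (le_trans (ltW hs0)).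
Qed.

Lemma has_sum_tsum u M : L1le (fun k => `|u k|) M -> has_sum u (tsum u).
Proof.
move=> h.
have [y hy] := has_sum_ge0 (fun k => normr_ge0 (u k)) h.
have [z hz] : exists z, has_sum (fun k => u k + `|u k|) z.
  apply: (@has_sum_ge0 _ (M + M)); first by move=> k; have := ler_norm (- u k); rewrite normrN; lra.
  apply: L1leD => //; apply: L1le_le h => // k; exact: ler_norm.
have H : has_sum u (z + (-1) * y).
  have := has_sumD hz (has_sumZ (-1) hy).
  by under [X in has_sum X]eq_fun do rewrite mulN1r addrK.
by rewrite (has_sumE H).
Qed.

Lemma has_sum_norm u y M : L1le (fun k => `|u k|) M -> has_sum u y -> `|y| <= M.
Proof.
move=> h hy; apply/ler_addgt0Pr => e e0; have [s0 h1] := hy _ e0.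
have us : uniq (undup s0) := undup_uniq _.
have h2 : `|y - \sum_(k <- undup s0) u k| <= e by apply: h1 => // k; rewrite mem_undup.
rewrite -[y](subrK (\sum_(k <- undup s0) u k)) (le_trans (ler_normD _ _))// addrC lerD//.
exact: le_trans (ler_norm_sum _ _ _) (h _ us).
Qed.

Lemma has_sum_le u y s b e : uniq s -> has_sum u y ->
  (forall k, `|u k| <= b k) ->
  (forall s', uniq s' -> (forall k, k \in s' -> k \notin s) -> \sum_(k <- s') b k <= e) ->
  `|y - \sum_(k <- s) u k| <= e.
Proof.
move=> us hy ub tl; apply/ler_addgt0Pr => e' e'0; have [s0 h1] := hy _ e'0.
pose s1 := undup (s0 ++ s).
have us1 : uniq s1 := undup_uniq _.
have h2 : `|y - \sum_(k <- s1) u k| <= e' by apply: h1 => // k ks; rewrite mem_undup mem_cat ks.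
have -> : y - \sum_(k <- s) u k = (\sum_(k <- s1) u k - \sum_(k <- s) u k) + (y - \sum_(k <- s1) u k) by ring.
apply: (le_trans (ler_normD _ _)); apply: lerD => //.
have -> : \sum_(k <- s1) u k = \sum_(k <- s) u k + \sum_(k <- s1 | k \notin s) u k.
  rewrite (bigID (mem s))/=; congr (_ + _); rewrite -big_filter; apply: perm_big.
  apply: uniq_perm => //; first exact: filter_uniq.
  by move=> k; rewrite mem_filter mem_undup mem_cat; case: (k \in s); rewrite ?orbT.
rewrite addrAC subrr add0r -big_filter.
apply: (le_trans (ler_norm_sum _ _ _)).
apply: (@le_trans _ _ (\sum_(k <- [seq k <- s1 | k \notin s]) b k)); first exact: ler_sum.
by apply: tl; [exact: filter_uniq|move=> k; rewrite mem_filter => /andP[]].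
Qed.

Lemma L1le_esum a M : (forall k, 0 <= a k) ->
  L1le a M <-> (\esum_(k in [set: I]) (a k)%:E <= M%:E)%E.
Proof.
move=> a0; split => [h|h s us].
  apply: ge_ereal_sup => _ [A [finA _] <-].
  by rewrite fsbig_finite//= sumEFin lee_fin h.
rewrite -lee_fin; apply: le_trans h.
apply: ereal_sup_ubound; exists [set` s].
  by split => //; exact: finite_seq.
by rewrite -fsbig_seq//= sumEFin.
Qed.

End finite_sums.

(** * Frequencies *)

Section frequencies.
Context {R : realType} {d : nat}.
Local Notation Z := 'rV[int]_d.
Implicit Types (k l : Z).
Local Notation kn := (@freq_norm R d).

Lemma kn_ge0 k : 0 <= kn k.
Proof. exact: sqrtr_ge0. Qed.

Lemma sqnorm_ge0 (x : 'rV[R]_d) : 0 <= sqnorm x.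
Proof. by apply: sumr_ge0 => j _; exact: sqr_ge0. Qed.

Lemma kn_sqr k : kn k ^+ 2 = \sum_j (k 0 j)%:~R ^+ 2.
Proof.
rewrite sqr_sqrtr ?sqnorm_ge0// /sqnorm.
by apply: eq_bigr => j _; rewrite mxE.
Qed.

Lemma kn0 : kn 0 = 0.
Proof.
by apply/eqP; rewrite -sqrf_eq0 kn_sqr big1// => j _; rewrite mxE expr0n.
Qed.

Lemma coord_le_kn k j : `|(k 0 j)%:~R : R| <= kn k.
Proof.
rewrite -(@ler_pXn2r _ 2)// ?nnegrE ?kn_ge0// kn_sqr real_normK ?num_real//.
by rewrite (bigD1 j)//= lerDl sumr_ge0// => i _; exact: sqr_ge0.
Qed.

Lemma kn_le_coord k (M : R) : 0 <= M -> (forall j, `|(k 0 j)%:~R : R| <= M) -> kn k <= d%:R * M.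
Proof.
move=> M0 h; rewrite -(@ler_pXn2r _ 2)// ?nnegrE ?kn_ge0 ?mulr_ge0// kn_sqr exprMn.
apply: (@le_trans _ _ (\sum_(j < d) M ^+ 2)).
  apply: ler_sum => j _; rewrite -[leLHS]real_normK ?num_real//.
  by rewrite lerXn2r// nnegrE.
rewrite sumr_const card_ord -[leLHS]mulr_natl ler_wpM2r ?sqr_ge0// -natrX ler_nat.
by rewrite expnS expn1; case: (d) => // n; rewrite leq_pmulr.
Qed.

Lemma kn_ge1 k : k != 0 -> 1 <= kn k.
Proof.
move=> k0; have [j kj] : exists j, k 0 j != 0.
  apply: contrapT => H; move/eqP: k0; apply; apply/rowP => j; rewrite mxE.
  by apply/eqP/negPn/negP => kj; apply: H; exists j.
apply: le_trans (coord_le_kn k j).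
by rewrite -intr_norm (ler_int _ 1) lez_nat lt0n absz_eq0.
Qed.

Lemma knN k : kn (- k) = kn k.
Proof.
apply/eqP; rewrite -(@eqrXn2 _ 2)// ?kn_ge0// !kn_sqr; apply/eqP.
by apply: eq_bigr => j _; rewrite mxE intrN sqrrN.
Qed.

Lemma knD k l : kn (k + l) <= kn k + kn l.
Proof.
rewrite -(@ler_pXn2r _ 2)// ?nnegrE ?addr_ge0 ?kn_ge0// sqrrD !kn_sqr.
have -> : \sum_j ((k + l) 0 j)%:~R ^+ 2 = \sum_j (k 0 j)%:~R ^+ 2 +
    (\sum_j ((k 0 j)%:~R * (l 0 j)%:~R)) *+ 2 + \sum_j (l 0 j)%:~R ^+ 2 :> R.
  rewrite -sumrMnl -!big_split/=; apply: eq_bigr => j _.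
  by rewrite mxE intrD sqrrD.
rewrite lerD2r lerD2l lerMn2r/=.
by apply: cauchy_schwarz_sum; rewrite ?kn_ge0// kn_sqr.
Qed.

End frequencies.

(** * Synthesis of functions from their coefficients *)

Section synthesis.
Context {R : realType} {d : nat}.
Local Notation pt := 'rV[R]_d.
Local Notation Z := 'rV[int]_d.
Local Notation kn := (@freq_norm R d).
Implicit Types (f g : pt -> R) (k l m : Z) (c : Z -> R[i]).

Definition kappa : R := ((2 * pi) ^+ d)^-1.

Lemma kappa_gt0 : 0 < kappa.
Proof. by rewrite invr_gt0 exprn_gt0// pi2_gt0. Qed.
Let kappa_ge0 := ltW kappa_gt0.

Lemma kappaK : kappa * (2 * pi) ^+ d = 1.
Proof. by rewrite mulVf// gt_eqF// exprn_gt0// pi2_gt0. Qed.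

(** The real wave with complex amplitude [z]. *)
Definition trig (z : R[i]) k (x : pt) : R := complex.Re (z * cexpi (phase k x)).

Lemma trigE z k x : trig z k x =
  complex.Re z * cos (phase k x) - complex.Im z * sin (phase k x).
Proof. by rewrite /trig ReMc. Qed.

Lemma cabs_cexpi (x : R) : cabs (cexpi x) = 1.
Proof. by rewrite cabsE /sqmod/= cos2Dsin2 sqrtr1. Qed.

Lemma trig_le z k x : `|trig z k x| <= cabs z.
Proof. by rewrite (le_trans (Re_le_cabs _))// cabsM cabs_cexpi mulr1. Qed.

Lemma pcont_trig z k : pcont (trig z k).
Proof.
have -> : trig z k = (fun x => complex.Re z * cos (0 + phase k x) +
    complex.Im z * cos (pi / 2 + phase k x)).
  by apply/funext => x; rewrite trigE add0r cosD cos_pihalf sin_pihalf mul0r sub0r mul1r mulrN.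
by apply: pcontD; apply: pcontM; try exact: pcont_cst; exact: pcont_cos.
Qed.

Lemma fourier_trigM z l m g : tI g ->
  fourier (fun x => trig z l x * g x) m =
  (2^-1)%:C * (z * fourier g (m - l) + (z^*)%C * fourier g (m + l)).
Proof.
move=> Ig; case: z => a b.
have F th : fcos th m (fun x => trig (a +i* b) l x * g x) =
   2^-1 * (a * (fcos th (m - l) g + fcos th (m + l) g) -
           b * (fcos (th - pi / 2) (m + l) g - fcos (th - pi / 2) (m - l) g)).
  have I1 t k : tI (fun x => g x * cos (t + phase k x)).
    by apply: tIM => //; exact: bpt_cos.
  have cI (u : R) f : tI f -> tI (fun x => u * f x).
    move=> If; under eq_fun do rewrite mulrC; apply: tIM => //; exact: bpt_cst.
  rewrite /fcos -tintD// -tintB// -!tintZ//; try by [exact: tID|exact: tIB].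
  rewrite -tintB//; try by [apply: cI; exact: tID|apply: cI; exact: tIB].
  rewrite -tintZ; last by apply: tIB; apply: cI; [exact: tID|exact: tIB].
  congr tint; apply/funext => x; rewrite trigE/=.
  have phN : phase (- l) x = - phase l x :> R.
    by rewrite /phase -sumrN; apply: eq_bigr => i _; rewrite mxE intrN mulNr.
  rewrite !phaseD phN.
  have -> : th - pi / 2 + (phase m x + phase l x) = (th + phase m x) + phase l x - pi / 2 by ring.
  have -> : th - pi / 2 + (phase m x - phase l x) = (th + phase m x) - phase l x - pi / 2 by ring.
  rewrite !addrA; move: (th + phase m x) (phase l x) => A B.
  rewrite !(cosB _ (pi / 2)) cos_pihalf sin_pihalf !cosD !sinD !cosN !sinN.
  by field.
rewrite !fourierE !F; apply: complex_ext; rewrite !(ReMc, ImMc, ReDc, ImDc)/=.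
- have E k : fcos (0 - pi / 2) k g = - fcos (pi / 2) k g.
    rewrite !fcosE// !ReMc/= !sub0r !opprK !cosN !sinN cos_pihalf sin_pihalf; ring.
  by rewrite !E; ring.
- by rewrite subrr; ring.
Qed.

Lemma fourier_cst1 k : fourier (fun=> 1 : R) k = if k == 0 then ((2 * pi) ^+ d)%:C else 0.
Proof.
have E th : fcos th k (fun=> 1) = if k == 0 then cos th * (2 * pi) ^+ d else 0.
  rewrite /fcos; under eq_fun do rewrite mul1r.
  case: eqVneq => [->|k0]; last exact: torus_int_cos.
  rewrite -tint_cst; congr tint; apply/funext => x.
  by rewrite /phase big1 ?addr0// => i _; rewrite mxE mul0r.
rewrite fourierE !E; case: eqP => // _.
by rewrite cos0 cos_pihalf mul1r mul0r.
Qed.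

Definition psyn (s : seq Z) c (x : pt) : R := \sum_(l <- s) kappa * trig (c l) l x.

Lemma pcont_psyn s c : pcont (psyn s c).
Proof. by apply: pcont_sum => l; apply: pcontM; [exact: pcont_cst|exact: pcont_trig]. Qed.

Lemma fourier_sum (J : Type) (r : seq J) (F : J -> pt -> R) k : (forall j, bpt (F j)) ->
  fourier (fun x => \sum_(j <- r) F j x) k = \sum_(j <- r) fourier (F j) k.
Proof.
move=> bF; elim: r => [|j r IH].
  rewrite big_nil; under eq_fun do rewrite big_nil.
  have -> : (fun _ : pt => 0 : R) = (fun x => 0 * 0) by apply/funext => x; rewrite mulr0.
  by rewrite fourierZ ?mul0r//; exact/bpt_tI/bpt_cst.
rewrite big_cons -IH -fourierD; [|exact: bpt_tI|by apply: bpt_tI; exact: bpt_sum].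
by congr fourier; apply/funext => x; rewrite big_cons.
Qed.

(** The real part adds the conjugate wave, hence both [m] and [- m] contribute. *)
Lemma fourier_psyn s c m : uniq s -> fourier (psyn s c) m =
  (2^-1)%:C * ((if m \in s then c m else 0) + (if - m \in s then (c (- m))^*%C else 0)).
Proof.
move=> us; rewrite fourier_sum; last first.
  by move=> l; apply: bptZ; exact/pcont_bpt/pcont_trig.
have E l : fourier (fun x => kappa * trig (c l) l x) m =
    (2^-1)%:C * ((if l == m then c l else 0) + (if l == - m then (c l)^*%C else 0)).
  rewrite fourierZ; last exact/bpt_tI/pcont_bpt/pcont_trig.
  have := @fourier_trigM (c l) l m (fun=> 1) (bpt_tI (bpt_cst 1)).
  under eq_fun do rewrite mulr1; move=> ->.
  rewrite !fourier_cst1 subr_eq0 addr_eq0 [m == l]eq_sym.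
  have -> : (m == - l) = (l == - m) by rewrite eq_sym eqr_oppLR.
  rewrite mulrCA; congr (_ * _); rewrite mulrDr.
  have H (z : R[i]) (b : bool) : kappa%:C * (z * (if b then ((2 * pi) ^+ d)%:C else 0)) = if b then z else 0.
    case: b; rewrite ?mulr0// mulrCA -rmorphM/= kappaK; exact: mulr1.
  by rewrite !H.
under eq_bigr do rewrite E.
rewrite -mulr_sumr big_split/=; congr (_ * (_ + _)).
  rewrite -big_mkcond/=; case: ifPn => ms.
    by rewrite -big_filter filter_pred1_uniq// big_seq1.
  by rewrite big1_seq// => i /andP[/eqP -> ]; rewrite (negPf ms).
rewrite -big_mkcond/=; case: ifPn => ms.
  by rewrite -big_filter filter_pred1_uniq// big_seq1.
by rewrite big1_seq// => i /andP[/eqP -> ]; rewrite (negPf ms).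
Qed.

Lemma Re_fourier0 f : complex.Re (fourier f 0) = tint f.
Proof.
rewrite fourierE /fcos/=; congr tint; apply/funext => x.
by rewrite /phase big1 ?addr0 ?cos0 ?mulr1// => i _; rewrite mxE mul0r.
Qed.

Lemma tint_trigM z l g : tI g ->
  tint (fun x => trig z l x * g x) = complex.Re ((z^*)%C * fourier g l).
Proof.
move=> Ig; have := fourier_trigM z l 0 Ig => /(congr1 (@complex.Re R)).
rewrite Re_fourier0 sub0r add0r fourierN// => ->.
by move: (fourier g l) => [u v]; case: z => a b /=; field.
Qed.

Lemma tint_psynM s c g : tI g ->
  tint (fun x => psyn s c x * g x) = kappa * \sum_(l <- s) complex.Re ((c l)^*%C * fourier g l).
Proof.
move=> Ig.
have It l : tI (fun x => trig (c l) l x * g x).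
  by under eq_fun do rewrite mulrC; apply: tIM => //; exact/pcont_bpt/pcont_trig.
elim: s => [|l s IH].
  rewrite big_nil mulr0.
  under eq_fun do rewrite /psyn big_nil mul0r.
  by rewrite tint_cst mul0r.
rewrite big_cons mulrDr -IH -tint_trigM// -tintZ// -tintD; last 2 first.
- have -> : (fun x => kappa * (trig (c l) l x * g x)) = (fun x => g x * (kappa * trig (c l) l x)).
    by apply/funext => x; ring.
  by apply: tIM => //; apply: bptZ; exact/pcont_bpt/pcont_trig.
- by under eq_fun do rewrite mulrC; apply: tIM => //; exact/pcont_bpt/pcont_psyn.
by congr tint; apply/funext => x; rewrite /psyn big_cons mulrDl mulrA.
Qed.

Lemma Re_conjM (z : R[i]) : complex.Re ((z^*)%C * z) = cabs z ^+ 2.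
Proof. by rewrite cabs_sqr; case: z => a b /=; rewrite /sqmod/=; ring. Qed.

(** The integral of [(g - f) ^+ 2] is nonnegative, where [f] is the partial synthesis of [g]. A real
   wave whose opposite frequency is not in [s] enters [f] with half of its amplitude, which lowers
   the integral of [f ^+ 2] without affecting that of [f * g]. *)
Lemma bessel g s : pcont g -> uniq s ->
  \sum_(l <- s) cabs (fourier g l) ^+ 2 <= (2 * pi) ^+ d * tint (fun x => g x ^+ 2).
Proof.
move=> pg us; pose c := fourier g; pose f := psyn s c.
have pf : pcont f := pcont_psyn s c.
have Ig := bpt_tI (pcont_bpt pg); have If := bpt_tI (pcont_bpt pf).
set X := \sum_(l <- s) _.
have fg : tint (fun x => f x * g x) = kappa * X.
  by rewrite tint_psynM//; congr (_ * _); apply: eq_bigr => l _; rewrite Re_conjM.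
have ff : tint (fun x => f x * f x) <= kappa * X.
  rewrite tint_psynM// ler_pM2l ?kappa_gt0// /X !(big_seq _ _ s); apply: ler_sum => l ls.
  rewrite fourier_psyn// ls /c fourierN// conjcK.
  set z := fourier g l.
  have -> : complex.Re ((z^*)%C * ((2^-1)%:C * (z + (if - l \in s then z else 0)))) =
     (if - l \in s then 1 else 2^-1) * cabs z ^+ 2.
    by rewrite cabs_sqr; case: ifP => _; case: z => a b /=; rewrite /sqmod/=; field.
  by rewrite -[leRHS]mul1r ler_wpM2r ?sqr_ge0//; case: ifP => // _; lra.
have := tint_ge0 (fun x => sqr_ge0 (g x - f x)).
have -> : (fun x => (g x - f x) ^+ 2) = (fun x => (g x ^+ 2 + f x * f x) - 2 * (f x * g x)).
  by apply/funext => x; ring.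
have If2 := bpt_tI (pcont_bpt (pcontM pf pf)); have Ifg := bpt_tI (pcont_bpt (pcontM pf pg)).
have Ig2 : tI (fun x => g x ^+ 2) by exact/bpt_tI/pcont_bpt/pcontX.
rewrite tintB; [|exact: tID|by apply: bpt_tI; apply: bptZ; exact/pcont_bpt/pcontM].
rewrite tintD// tintZ// fg => h.
have h2 : kappa * X <= tint (fun x => g x ^+ 2) by lra.
have p0 : 0 < (2 * pi) ^+ d :> R by rewrite exprn_gt0// pi2_gt0.
by rewrite mulrC -ler_pdivrMr// mulrC.
Qed.

(** The function with Fourier coefficients [c], for summable [c] with the symmetry [conj_sym]
   of the coefficients of real functions. *)
Definition syn c (x : pt) : R := tsum (fun l => kappa * trig (c l) l x).

Definition conj_sym c := forall k, c (- k) = (c k)^*%C.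

Section absolutely_summable.
Variables (c : Z -> R[i]) (M : R).
Hypothesis hc : L1le (fun k => cabs (c k)) M.

Lemma L1le_trig x : L1le (fun l => `|kappa * trig (c l) l x|) (kappa * M).
Proof.
apply: L1le_le (L1leZ kappa_ge0 hc) => // k.
by rewrite normrM (ger0_norm kappa_ge0) ler_wpM2l// trig_le.
Qed.

Lemma has_sum_syn x : has_sum (fun l => kappa * trig (c l) l x) (syn c x).
Proof. exact: has_sum_tsum (L1le_trig x). Qed.

Lemma syn_le x : `|syn c x| <= kappa * M.
Proof. exact: has_sum_norm (L1le_trig x) (has_sum_syn x). Qed.

Lemma syn_psyn e : 0 < e -> exists2 s0, uniq s0 &
  forall s, uniq s -> {subset s0 <= s} -> forall x, `|syn c x - psyn s c x| <= e.
Proof.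
move=> e0; have ek : 0 < e / kappa by rewrite divr_gt0// kappa_gt0.
have [s0 us0 H] := L1le_tail (fun k => cabs_ge0 (c k)) hc ek.
exists s0 => // s us sub x.
apply: (has_sum_le us (has_sum_syn x) (b := fun l => kappa * cabs (c l))).
  by move=> k; rewrite normrM (ger0_norm kappa_ge0) ler_wpM2l// trig_le.
move=> s' us' dis; rewrite -mulr_sumr mulrC -ler_pdivlMr ?kappa_gt0//.
by apply: H => // k ks'; apply: contra (dis k ks') => /sub.
Qed.

Lemma pcont_syn : pcont (syn c).
Proof.
split.
  move=> x k; congr tsum; apply/funext => l; congr (_ * _).
  by have [p _] := pcont_trig (c l) l; rewrite p.
apply/ball_normP => x e e0; have e3 : 0 < e / 4 by rewrite divr_gt0.
have [s0 us0 H] := syn_psyn e3.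
have [_ /ball_normP cp] := pcont_psyn s0 c.
have e2 : 0 < e / 2 by rewrite divr_gt0.
have [r r0 rP] := cp x _ e2; exists r => // y /rP h.
have hx := H s0 us0 (fun _ h => h) x; have hy := H s0 us0 (fun _ h => h) y.
have -> : syn c x - syn c y = (syn c x - psyn s0 c x) + (psyn s0 c x - psyn s0 c y) -
   (syn c y - psyn s0 c y) by ring.
apply: (le_lt_trans (ler_normB _ _)).
have := ler_normD (syn c x - psyn s0 c x) (psyn s0 c x - psyn s0 c y).
by move: hx hy h; lra.
Qed.

(** The synthesis is a uniform limit of its partial sums. *)
Lemma fourier_syn m : conj_sym c -> fourier (syn c) m = c m.
Proof.
move=> herm; apply/eqP; rewrite -subr_eq0; apply/eqP/cabs_eq0/eqP.
rewrite eq_le cabs_ge0 andbT; apply/ler_addgt0Pr => e e0; rewrite add0r.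
have p0 : 0 < 2 * (2 * pi) ^+ d :> R by rewrite mulr_gt0// exprn_gt0// pi2_gt0.
have [s0 us0 H] := syn_psyn (divr_gt0 e0 p0).
pose s := undup (m :: - m :: s0); have us : uniq s := undup_uniq _.
have sub : {subset s0 <= s} by move=> k ks; rewrite mem_undup !inE ks !orbT.
have {}H := H s us sub.
have Fm : fourier (psyn s c) m = c m.
  rewrite fourier_psyn// !mem_undup !inE !eqxx orbT/= herm conjcK.
  by case: (c m) => a b; apply: complex_ext => /=; field.
have p1 := pcont_bpt pcont_syn; have p2 := pcont_bpt (pcont_psyn s c).
rewrite -{1}Fm -fourierB; [|exact: bpt_tI|exact: bpt_tI].
apply: (le_trans (fourier_le m (bptB p1 p2) H)).
rewrite le_eqVlt; apply/orP; left; apply/eqP.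
by move: p0; move: (_ ^+ d) => P P0; field; rewrite gt_eqF//; lra.
Qed.

(** The partial sums converge uniformly, so their integrals against the synthesis converge too. *)
Lemma parseval_syn M2 : conj_sym c -> L2le (fun k => cabs (c k)) M2 ->
  tint (fun x => syn c x ^+ 2) <= kappa * M2 ^+ 2.
Proof.
move=> herm [M20 h2]; apply/ler_addgt0Pr => e e0.
pose B := kappa * M + 1.
have B0 : 0 < B by rewrite ltr_wpDl// mulr_ge0// (L1le_ge0 hc).
have p0 : 0 < (2 * pi) ^+ d :> R by rewrite exprn_gt0// pi2_gt0.
have [s us H] := syn_psyn (divr_gt0 e0 (mulr_gt0 B0 p0)).
have {}H := H s us (fun _ h => h).
have p1 := pcont_syn; have p2 := pcont_psyn s c.
have I1 := bpt_tI (pcont_bpt p1).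
have -> : (fun x => syn c x ^+ 2) =
   (fun x => psyn s c x * syn c x + (syn c x - psyn s c x) * syn c x).
  by apply/funext => x; ring.
rewrite tintD; [|by apply/bpt_tI/pcont_bpt/pcontM|by apply/bpt_tI/pcont_bpt/pcontM => //; exact: pcontB].
apply: lerD.
  rewrite tint_psynM// ler_wpM2l//; apply: le_trans (h2 s us).
  by apply: ler_sum => l _; rewrite fourier_syn// Re_conjM.
pose E := e / (B * (2 * pi) ^+ d) * B.
have -> : e = E * (2 * pi) ^+ d.
  rewrite /E.
  by move: p0; move: (_ ^+ d) => P P0; field; rewrite !gt_eqF.
rewrite -(tint_cst E); apply: tint_le; [by apply/bpt_tI/pcont_bpt/pcontM => //; exact: pcontB|exact/bpt_tI/bpt_cst|].
move=> x; apply: (le_trans (ler_norm _)); rewrite normrM ler_pM//.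
by rewrite (le_trans (syn_le x))// lerDl.
Qed.

End absolutely_summable.

(** Both sides are continuous and have the same coefficients. *)
Lemma syn_fourier f M : (0 < d)%N -> pcont f -> L1le (fun k => cabs (fourier f k)) M ->
  syn (fourier f) = f.
Proof.
move=> d0 pf h; have ps := pcont_syn h.
have herm : conj_sym (fourier f) by move=> k; rewrite fourierN//; exact/bpt_tI/pcont_bpt.
apply/funext => x; apply/eqP; rewrite -subr_eq0; apply/eqP.
apply: (@fourier_inj0 _ _ (fun x => syn (fourier f) x - f x)) => //; first exact: pcontB.
move=> k; rewrite fourierB; [|exact/bpt_tI/pcont_bpt|exact/bpt_tI/pcont_bpt].
by rewrite (fourier_syn h)// subrr.
Qed.

(** ** Products *)

Section products.
Variables (f g : pt -> R).
Hypotheses (d0 : (0 < d)%N) (pf : pcont f) (pg : pcont g).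

(** Replacing one factor by a partial sum of its Fourier series costs a uniform error and
   leaves a finite convolution, so that infinite convolutions are never formed. *)
Lemma fourierM_le M e : L1le (fun k => cabs (fourier f k)) M -> 0 < e ->
  exists2 s, uniq s & forall m, cabs (fourier (fun x => f x * g x) m) <=
    kappa * \sum_(l <- s) cabs (fourier f l) * cabs (fourier g (m - l)) + e.
Proof.
move=> h e0; have [B hB] := pcont_bounded pg.
have B0 : 0 <= B := le_trans (normr_ge0 _) (hB 0).
have p0 : 0 < (2 * pi) ^+ d :> R by rewrite exprn_gt0// pi2_gt0.
have q0 : 0 < 2 * (B + 1) * (2 * pi) ^+ d by rewrite mulr_gt0// mulr_gt0// ltr_wpDl.
have [s0 us0 H] := syn_psyn h (divr_gt0 e0 q0).
(* a set of frequencies symmetric about the origin, so that the two halves of each real wave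
   give the same convolution *)
pose s := undup (s0 ++ map -%R s0); have us : uniq s := undup_uniq _.
have sub : {subset s0 <= s} by move=> k ks; rewrite mem_undup mem_cat ks.
have syms : perm_eq (map -%R s) s.
  apply: uniq_perm => //; first by rewrite map_inj_uniq//; exact: oppr_inj.
  have sN k : k \in s -> - k \in s.
    rewrite !mem_undup !mem_cat => /orP[ks|/mapP[l ls ->]]; last by rewrite opprK ls.
    by rewrite (map_f -%R ks) orbT.
  move=> k; apply/idP/idP => [/mapP[l ls ->]|ks]; first exact: sN.
  by rewrite -[k]opprK map_f// sN.
exists s => // m.
have Hs := H s us sub; rewrite (syn_fourier d0 pf h) in Hs.
pose c := fourier f; have p2 := pcont_psyn s c.
have -> : (fun x => f x * g x) = (fun x => psyn s c x * g x + (f x - psyn s c x) * g x).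
  by apply/funext => x; ring.
rewrite fourierD; [|exact/bpt_tI/pcont_bpt/pcontM|by apply/bpt_tI/pcont_bpt/pcontM => //; exact: pcontB].
apply: (le_trans (cabsD _ _)); apply: lerD; last first.
  apply: (le_trans (fourier_le m (M := e / (2 * (B + 1) * (2 * pi) ^+ d) * B) _ _)).
  - by apply/pcont_bpt/pcontM => //; exact: pcontB.
  - by move=> x; rewrite normrM ler_pM//; exact: Hs.
  have -> : 2 * (e / (2 * (B + 1) * (2 * pi) ^+ d) * B) * (2 * pi) ^+ d = e * (B / (B + 1)).
    by move: p0; move: (_ ^+ d) => P P0; field; rewrite !gt_eqF//; lra.
  rewrite -[leRHS]mulr1 ler_wpM2l ?(ltW e0)// ler_pdivrMr ?ltr_wpDl//; lra.
have -> : (fun x => psyn s c x * g x) = (fun x => \sum_(l <- s) kappa * (trig (c l) l x * g x)).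
  by apply/funext => x; rewrite /psyn mulr_suml; apply: eq_bigr => l _; rewrite mulrA.
have bt l : bpt (fun x => trig (c l) l x * g x).
  by apply/pcont_bpt/pcontM => //; exact: pcont_trig.
rewrite fourier_sum; last by move=> l; exact: bptZ.
apply: (le_trans (cabs_sum _ _ _)).
pose F l := kappa * (2^-1 * (cabs (c l) * cabs (fourier g (m - l)))).
apply: (@le_trans _ _ (\sum_(l <- s) (F l + F (- l)))).
  apply: ler_sum => l _; rewrite fourierZ; last exact: bpt_tI.
  rewrite fourier_trigM; last exact/bpt_tI/pcont_bpt.
  rewrite cabsM cabs_real (ger0_norm kappa_ge0) /F -!mulrDr ler_wpM2l//.
  rewrite cabsM cabs_real ger0_norm ?invr_ge0// ler_wpM2l ?invr_ge0//.
  apply: (le_trans (cabsD _ _)); rewrite !cabsM opprK.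
  have -> : c (- l) = (c l)^*%C by rewrite /c fourierN//; exact/bpt_tI/pcont_bpt.
  exact: lexx.
rewrite big_split/=.
have E : \sum_(l <- s) F (- l) = \sum_(l <- s) F l.
  transitivity (\sum_(l <- map -%R s) F l); first by rewrite big_map.
  exact: perm_big.
rewrite [X in _ + X <= _]E -big_split/= mulr_sumr; apply: ler_sum => l _; rewrite /F /c.
by rewrite le_eqVlt; apply/orP; left; apply/eqP; field.
Qed.

(** Young's inequality [l1 * l1 -> l1] for a submultiplicative weight. *)
Lemma fourierM_L1 (W : Z -> R) A B : (forall k, 1 <= W k) ->
  (forall k l, W (k + l) <= W k * W l) ->
  L1le (fun k => W k * cabs (fourier f k)) A ->
  L1le (fun k => W k * cabs (fourier g k)) B ->
  L1le (fun k => W k * cabs (fourier (fun x => f x * g x) k)) (kappa * (A * B)).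
Proof.
move=> W1 WM hA hB s us; have W0 k : 0 <= W k := le_trans ler01 (W1 k).
have hA1 : L1le (fun k => cabs (fourier f k)) A.
  by apply: L1le_le hA => // k; rewrite ler_peMl ?cabs_ge0.
have B0 := L1le_ge0 hB.
apply/ler_addgt0Pr => e e0.
have q0 : 0 < \sum_(k <- s) W k + 1 by rewrite ltr_wpDl// sumr_ge0.
have [S uS H] := fourierM_le hA1 (divr_gt0 e0 q0).
apply: (@le_trans _ _ (\sum_(k <- s) (\sum_(l <- S) kappa * (W l * cabs (fourier f l)) *
    (W (k - l) * cabs (fourier g (k - l))) + W k * (e / (\sum_(k <- s) W k + 1))))).
  apply: ler_sum => k _; apply: (le_trans (ler_wpM2l (W0 k) (H k))).
  rewrite mulrDr lerD2r mulrCA !mulr_sumr ; apply: ler_sum => l _.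
  rewrite -mulrA ler_wpM2l// mulrACA ler_wpM2r ?mulr_ge0 ?cabs_ge0//.
  by have := WM l (k - l); rewrite addrC subrK.
rewrite big_split/= -mulr_suml; apply: lerD; last first.
  rewrite mulrCA -[leRHS]mulr1 ler_wpM2l ?(ltW e0)// ler_pdivrMr// mul1r lerDl//.
rewrite exchange_big/=.
apply: (@le_trans _ _ (\sum_(l <- S) kappa * (W l * cabs (fourier f l)) * B)).
  apply: ler_sum => l _; rewrite -mulr_sumr ler_wpM2l ?mulr_ge0 ?cabs_ge0//.
  by apply: (L1le_inj hB) => //; exact: addIr.
by rewrite -mulr_suml -mulr_sumr -mulrA ler_wpM2l// ler_wpM2r// hA.
Qed.

(** Young's inequality [l1 * l2 -> l2] for a weight obeying a Leibniz rule. *)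
Lemma fourierM_L2 (rho : Z -> R) (C A A' B B' : R) : (forall k, 0 <= rho k) -> 0 <= C ->
  (forall k l, rho (k + l) <= C * (rho k + rho l)) ->
  L1le (fun k => cabs (fourier f k)) A -> L2le (fun k => rho k * cabs (fourier f k)) A' ->
  L1le (fun k => cabs (fourier g k)) B -> L2le (fun k => rho k * cabs (fourier g k)) B' ->
  L2le (fun k => rho k * cabs (fourier (fun x => f x * g x) k)) (kappa * (C * (A' * B + A * B'))).
Proof.
move=> r0 C0 rM hA hA' hB hB'.
have A0 := L1le_ge0 hA; have B0 := L1le_ge0 hB.
have [A'0 _] := hA'; have [B'0 _] := hB'.
apply: L2le_dual.
- by rewrite !(mulr_ge0, addr_ge0).
- by move=> k; rewrite mulr_ge0 ?cabs_ge0.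
move=> y Y s us Y0 y0 hy; apply/ler_addgt0Pr => e e0.
have q0 : 0 < \sum_(k <- s) y k * rho k + 1 by rewrite ltr_wpDl// sumr_ge0// => k _; rewrite mulr_ge0.
have [S uS H] := fourierM_le hA (divr_gt0 e0 q0).
set e' := e / _ in H.
pose a l := cabs (fourier f l); pose b l := cabs (fourier g l).
apply: (@le_trans _ _ (kappa * C * (\sum_(k <- s) \sum_(l <- S) y k * (rho l * a l) * b (k - l) +
    \sum_(k <- s) \sum_(l <- S) y k * (a l * (rho (k - l) * b (k - l)))) +
    \sum_(k <- s) y k * rho k * e')).
  rewrite -big_split/= mulr_sumr -big_split/=; apply: ler_sum => k _.
  rewrite mulrA; apply: (le_trans (ler_wpM2l (mulr_ge0 (y0 k) (r0 k)) (H k))).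
  rewrite mulrDr lerD2r -big_split/= mulrCA -mulrA ler_wpM2l// !mulr_sumr.
  apply: ler_sum => l _; have h : rho k <= C * (rho l + rho (k - l)).
    by rewrite -{1}[k](subrK l) addrC; exact: rM.
  rewrite -/(a l) -/(b (k - l)).
  have ab : 0 <= y k * (a l * b (k - l)) by rewrite !mulr_ge0// cabs_ge0.
  have := ler_wpM2r ab h; set u := rho (k - l); set v := b (k - l).
  have -> : rho k * (y k * (a l * v)) = y k * rho k * (a l * v) by ring.
  move=> h'; apply: (le_trans h'); rewrite le_eqVlt; apply/orP; left; apply/eqP; ring.
rewrite -mulr_suml; apply: lerD; last first.
  rewrite /e' mulrCA -[leRHS]mulr1 ler_wpM2l ?(ltW e0)// ler_pdivrMr// mul1r lerDl//.
have -> : Y * (kappa * (C * (A' * B + A * B'))) = kappa * C * (Y * A' * B + Y * (A * B')) by ring.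
rewrite ler_wpM2l ?mulr_ge0//; apply: lerD; last first.
  rewrite exchange_big/=.
  apply: (@le_trans _ _ (\sum_(l <- S) a l * (Y * B'))).
    apply: ler_sum => l _; under eq_bigr do rewrite mulrCA.
    rewrite -mulr_sumr ler_wpM2l ?cabs_ge0//.
    apply: cauchy_schwarz_sum => //; have [_ hB2] := hB'.
    apply: (@L1le_inj _ _ (fun k => (rho k * b k) ^+ 2) _ (fun k => k - l) s) => //.
    exact: addIr.
  by rewrite -mulr_suml [leRHS]mulrCA ler_wpM2r ?mulr_ge0//; exact: hA.
(* Young's inequality by Cauchy-Schwarz on the product set, splitting [b] into two square roots *)
pose T := [seq (k, l) | k <- s, l <- S].
have -> : \sum_(k <- s) \sum_(l <- S) y k * (rho l * a l) * b (k - l) =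
   \sum_(p <- T) (y p.1 * Num.sqrt (b (p.1 - p.2))) * (rho p.2 * a p.2 * Num.sqrt (b (p.1 - p.2))).
  rewrite big_allpairs_dep/=; apply: eq_bigr => k _; apply: eq_bigr => l _.
  by rewrite mulrACA -expr2 sqr_sqrtr ?cabs_ge0.
have sB := sqr_sqrtr B0.
have -> : Y * A' * B = (Y * Num.sqrt B) * (A' * Num.sqrt B) by rewrite mulrACA -expr2 sB.
apply: cauchy_schwarz_sum; rewrite ?mulr_ge0 ?sqrtr_ge0//.
  rewrite exprMn sB big_allpairs_dep/=.
  under eq_bigr do under eq_bigr do rewrite exprMn sqr_sqrtr ?cabs_ge0//.
  apply: (@le_trans _ _ (\sum_(k <- s) y k ^+ 2 * B)).
    apply: ler_sum => k _; rewrite -mulr_sumr ler_wpM2l ?sqr_ge0//.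
    by apply: (L1le_inj hB (f := fun l => k - l)) => //; move=> l1 l2 /addrI /oppr_inj.
  by rewrite -mulr_suml ler_wpM2r.
rewrite exprMn sB big_allpairs_dep/= exchange_big/=.
under eq_bigr do under eq_bigr do rewrite exprMn sqr_sqrtr ?cabs_ge0//.
apply: (@le_trans _ _ (\sum_(l <- S) (rho l * a l) ^+ 2 * B)).
  apply: ler_sum => l _; rewrite -mulr_sumr ler_wpM2l ?sqr_ge0//.
  by apply: (L1le_inj hB (f := fun k => k - l)) => //; exact: addIr.
by rewrite -mulr_suml ler_wpM2r//; have [_] := hA'; apply.
Qed.

End products.

End synthesis.

(** * Differentiability of synthesized functions *)

Section trigonometric_estimates.
Context {R : realType}.

Lemma sin_lip (a b : R) : `|sin a - sin b| <= `|a - b|.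
Proof.
wlog ab : a b / b <= a.
  by move=> W; have [h|/ltW h] := leP b a; [|rewrite distrC [leRHS]distrC]; exact: W.
have [c _ ->] := @MVT_segment R sin cos b a ab (fun x _ => is_derive_sin x)
   (continuous_subspaceT (@continuous_sin R)).
by rewrite normrM ler_piMl// ler_norml cos_geN1 cos_le1.
Qed.

Lemma cos_mvt (A B : R) :
  exists2 x, `|x - A| <= `|B - A| & cos B - cos A = - sin x * (B - A).
Proof.
have MV (a b : R) : a <= b -> exists2 c, c \in `[a, b] & cos b - cos a = - sin c * (b - a).
  move=> ab; exact: (@MVT_segment R cos (fun x => - sin x) a b ab (fun x _ => is_derive_cos x)
   (continuous_subspaceT (@continuous_cos R))).
have [h|/ltW h] := leP A B.
  have [c] := MV _ _ h; rewrite in_itv/= => /andP[c1 c2] E; exists c => //.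
  by rewrite !ger0_norm ?subr_ge0// lerD2r.
have [c] := MV _ _ h; rewrite in_itv/= => /andP[c1 c2] E; exists c.
  by rewrite !ler0_norm ?subr_le0// lerN2 lerD2r.
rewrite -[LHS]opprB E; ring.
Qed.

Lemma cos_taylor (A h : R) : `|cos (A + h) - cos A + h * sin A| <= h ^+ 2.
Proof.
have [x hx ->] := cos_mvt A (A + h); move: hx; rewrite addrAC subrr add0r => hx.
have -> : - sin x * h + h * sin A = h * (sin A - sin x) by ring.
rewrite normrM -[leRHS]real_normK ?num_real// expr2 ler_wpM2l//.
by apply: (le_trans (sin_lip _ _)); rewrite distrC.
Qed.

End trigonometric_estimates.

(** Differentiability from the little-o expansion, with the differential given in advance. *)
Lemma differentiable_near (R : realType) (V W : normedModType R) (f : V -> W)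
  (L : {linear V -> W}) (x : V) : continuous L ->
  (forall e, 0 < e -> \forall v \near (0 : V), `|f (x + v) - f x - L v| <= e * `|v|) ->
  differentiable f x /\ 'd f x = L :> (V -> W).
Proof.
move=> cL H.
have E : f \o shift x = cst (f x) + L +o_ (0 : V) id.
  apply/eqaddoP => e /= /H; apply: filterS => v /=; rewrite !fctE /=.
  by rewrite opprD addrA [v + x]addrC.
have dE : 'd f x = L :> (V -> W) by exact: diff_unique.
by split => //; apply/diff_locallyP; rewrite dE; split.
Qed.

Section differentiability.
Context {R : realType} {d : nat}.
Local Notation kappa := (@kappa R d).
Local Notation pt := 'rV[R]_d.

Lemma differentiable_quadratic (f : pt -> R) (x : pt) (a : 'I_d -> R) (M : R) :
  (forall v, `|f (x + v) - f x - \sum_j v 0 j * a j| <= M * `|v| ^+ 2) ->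
  differentiable f x /\ forall v, 'D_v f x = \sum_j v 0 j * a j.
Proof.
move=> H; pose L (v : pt) : R := \sum_j v 0 j * a j.
have linL : linear (L : pt -> (R : normedModType R)).
  move=> c u v; rewrite /L scaler_sumr -big_split/=; apply: eq_bigr => j _.
  by rewrite !mxE mulrDl; congr (_ + _); rewrite -mulrA.
pose L' : {linear pt -> (R : normedModType R)} := HB.pack (L : pt -> (R : normedModType R)) (GRing.isLinear.Build R pt (R : normedModType R) _ (L : pt -> (R : normedModType R)) linL).
have cL : continuous L'.
  apply: (_ : continuous L) => y; rewrite /L.
  have -> : (fun v : pt => \sum_j v 0 j * a j) = \sum_j (fun v : pt => v 0 j * a j).
    by apply/funext => v; rewrite fct_sumE.
  apply: (big_ind (fun f : pt -> R => {for y, continuous f})).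
  - exact: cst_continuous.
  - by move=> g h cg ch; exact: continuousD.
  - by move=> j _; apply: continuousM; [exact: coord_continuous|exact: cst_continuous].
have M0 : 0 < `|M| + 1 by rewrite ltr_wpDl.
have [df dE] : differentiable f x /\ 'd f x = L' :> (pt -> R).
  apply: differentiable_near => // e e0.
  have F : \forall v \near (0 : pt), `|v| <= e / (`|M| + 1).
    apply/nbhs_normP; exists (e / (`|M| + 1)); first by rewrite /= divr_gt0.
    by move=> u /=; rewrite sub0r normrN => /ltW.
  apply: filterS F => v h2.
  apply: (le_trans (H v)); rewrite expr2 mulrA ler_wpM2r//.
  apply: (@le_trans _ _ ((`|M| + 1) * (e / (`|M| + 1)))); last by rewrite mulrC divfK// gt_eqF.
  rewrite (@le_trans _ _ ((`|M| + 1) * `|v|))//; last by rewrite ler_wpM2l// ltW.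
  by rewrite ler_wpM2r// (le_trans (ler_norm _))// lerDl.
by split => // v; rewrite deriveE// dE.
Qed.

Local Notation Z := 'rV[int]_d.
Local Notation kn := (@freq_norm R d).
Implicit Types (c : Z -> R[i]).

Lemma phase_linear (k : Z) (x v : pt) : phase k (x + v) = phase k x + phase k v.
Proof.
by rewrite /phase -big_split; apply: eq_bigr => j _; rewrite mxE mulrDr.
Qed.

Lemma phase_le (k : Z) (v : pt) : `|phase k v| <= d%:R * kn k * `|v|.
Proof.
rewrite /phase (le_trans (ler_norm_sum _ _ _))//.
apply: (@le_trans _ _ (\sum_(j < d) kn k * `|v|)).
  by apply: ler_sum => j _; rewrite normrM ler_pM ?coord_le_kn ?rV_coord_le.
by rewrite sumr_const card_ord -[leLHS]mulr_natl mulrA.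
Qed.

(** The coefficients of the [j]-th partial derivative. *)
Definition dcoef (j : 'I_d) c : Z -> R[i] := fun k => (0 +i* (k 0 j)%:~R) * c k.

Lemma cabs_dcoef j c k : cabs (dcoef j c k) = `|(k 0 j)%:~R| * cabs (c k).
Proof. by rewrite /dcoef cabsM cabs_imag. Qed.

Lemma cabs_dcoef_le j c k : cabs (dcoef j c k) <= kn k * cabs (c k).
Proof. by rewrite cabs_dcoef ler_wpM2r ?cabs_ge0// coord_le_kn. Qed.

Lemma conj_sym_dcoef j c : conj_sym c -> conj_sym (dcoef j c).
Proof.
move=> h k; rewrite /dcoef h mxE intrN; case: (c k) => a b.
by apply: complex_ext => /=; ring.
Qed.

Lemma trig_taylor (z : R[i]) (k : Z) (x v : pt) :
  `|trig z k (x + v) - trig z k x - \sum_j v 0 j * trig ((0 +i* (k 0 j)%:~R) * z) k x|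
   <= 2 * cabs z * (d%:R * kn k * `|v|) ^+ 2.
Proof.
have -> : \sum_j v 0 j * trig ((0 +i* (k 0 j)%:~R) * z) k x =
    phase k v * (- complex.Im z * cos (phase k x) - complex.Re z * sin (phase k x)).
  rewrite {2}/phase mulr_suml; apply: eq_bigr => j _.
  by rewrite trigE ReMc ImMc/=; ring.
rewrite !trigE phase_linear; set A := phase k x; set h := phase k v.
have -> : complex.Re z * cos (A + h) - complex.Im z * sin (A + h) -
   (complex.Re z * cos A - complex.Im z * sin A) -
   h * (- complex.Im z * cos A - complex.Re z * sin A) =
   complex.Re z * (cos (A + h) - cos A + h * sin A) +
   complex.Im z * (cos ((A + pi / 2) + h) - cos (A + pi / 2) + h * sin (A + pi / 2)).
  have e (y : R) : cos (y + pi / 2) = - sin y by rewrite cosD cos_pihalf sin_pihalf; ring.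
  by rewrite (addrAC A (pi / 2) h) !e [sin (A + pi / 2)]sinD cos_pihalf sin_pihalf; ring.
have H1 := cos_taylor A h; have H2 := cos_taylor (A + pi / 2) h.
apply: (le_trans (ler_normD _ _)); rewrite !normrM.
have hh : h ^+ 2 <= (d%:R * kn k * `|v|) ^+ 2.
  rewrite -[leLHS]real_normK ?num_real// lerXn2r ?nnegrE ?phase_le//.
  by rewrite !mulr_ge0 ?kn_ge0.
have := ler_pM (normr_ge0 _) (normr_ge0 _) (Re_le_cabs z) (le_trans H1 hh).
have := ler_pM (normr_ge0 _) (normr_ge0 _) (Im_le_cabs z) (le_trans H2 hh).
lra.
Qed.

(** Two summable moments bound the second order Taylor remainders of the waves. *)
Lemma syn_differentiable c M : L1le (fun k => (1 + kn k) ^+ 2 * cabs (c k)) M ->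
  forall x, differentiable (syn c) x /\
    forall v, 'D_v (syn c) x = \sum_j v 0 j * syn (dcoef j c) x.
Proof.
move=> h x.
have h0 : L1le (fun k => cabs (c k)) M.
  apply: L1le_le h => // k; rewrite ler_peMl ?cabs_ge0// exprn_ege1// lerDl kn_ge0//.
have h1 j : L1le (fun k => cabs (dcoef j c k)) M.
  apply: L1le_le h => // k; apply: (le_trans (cabs_dcoef_le _ _ _)).
  rewrite ler_wpM2r ?cabs_ge0// expr2; have := kn_ge0 k; nra.
apply: (@differentiable_quadratic _ _ (fun j => syn (dcoef j c) x) (kappa * (2 * d%:R ^+ 2 * M))) => v.
have HS : has_sum (fun k => kappa * trig (c k) k (x + v) + (-1) * (kappa * trig (c k) k x) +
    (-1) * \sum_j v 0 j * (kappa * trig (dcoef j c k) k x))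
    (syn c (x + v) + (-1) * syn c x + (-1) * \sum_j v 0 j * syn (dcoef j c) x).
  apply: has_sumD.
    by apply: has_sumD; [exact: (has_sum_syn h0)|apply: has_sumZ; exact: (has_sum_syn h0)].
  apply: has_sumZ.
  elim: (index_enum _) => [|j r IH].
    rewrite big_nil; under eq_fun do rewrite big_nil.
    move=> e e0; exists [::] => s _ _; rewrite big1// subrr normr0 ltW//.
  rewrite big_cons; under eq_fun do rewrite big_cons.
  by apply: has_sumD => //; apply: has_sumZ; exact: has_sum_syn (h1 j) x.
have -> : syn c (x + v) - syn c x - \sum_j v 0 j * syn (dcoef j c) x =
   syn c (x + v) + (-1) * syn c x + (-1) * \sum_j v 0 j * syn (dcoef j c) x by ring.
have K0 := ltW (@kappa_gt0 R d).
rewrite -mulrA -mulrA; apply: (has_sum_norm _ HS).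
apply: L1le_le (_ : L1le (fun k => kappa * ((2 * d%:R ^+ 2 * `|v| ^+ 2) * ((1 + kn k) ^+ 2 * cabs (c k)))) (kappa * ((2 * d%:R ^+ 2 * `|v| ^+ 2) * M))) => //; last first.
- by apply: L1leZ => //; apply: L1leZ => //; rewrite !mulr_ge0 ?sqr_ge0.
- by rewrite le_eqVlt; apply/orP; left; apply/eqP; ring.
move=> k.
have -> : kappa * trig (c k) k (x + v) + -1 * (kappa * trig (c k) k x) +
    -1 * \sum_j v 0 j * (kappa * trig (dcoef j c k) k x) =
    kappa * (trig (c k) k (x + v) - trig (c k) k x -
      \sum_j v 0 j * trig ((0 +i* (k 0 j)%:~R) * c k) k x).
  have -> : \sum_j v 0 j * (kappa * trig (dcoef j c k) k x) =
      kappa * \sum_j v 0 j * trig ((0 +i* (k 0 j)%:~R) * c k) k x.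
    by rewrite mulr_sumr; apply: eq_bigr => j _; exact: mulrCA.
  ring.
rewrite normrM (ger0_norm K0) ler_wpM2l//; apply: (le_trans (trig_taylor _ _ _ _)).
have -> : 2 * cabs (c k) * (d%:R * kn k * `|v|) ^+ 2 =
   2 * d%:R ^+ 2 * `|v| ^+ 2 * (kn k ^+ 2 * cabs (c k)) by ring.
rewrite ler_wpM2l ?mulr_ge0 ?sqr_ge0// ler_wpM2r ?cabs_ge0//.
by rewrite lerXn2r ?nnegrE ?addr_ge0 ?kn_ge0// lerDr.
Qed.

Lemma syn_partial c M : L1le (fun k => (1 + kn k) ^+ 2 * cabs (c k)) M ->
  forall j, partial j (syn c) = syn (dcoef j c).
Proof.
move=> h j; apply/funext => x; rewrite /partial.
have [_ ->] := syn_differentiable h x.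
rewrite (bigD1 j)//= mxE !eqxx/= mul1r big1 ?addr0// => i ij.
by rewrite mxE eqxx (negPf ij)/= mul0r.
Qed.

Definition rapid c := forall m : nat, exists M, L1le (fun k => (1 + kn k) ^+ m * cabs (c k)) M.

Lemma rapid_dcoef j c : rapid c -> rapid (dcoef j c).
Proof.
move=> h m; have [M hM] := h m.+1; exists M; apply: L1le_le hM => // k.
rewrite exprSr -mulrA ler_wpM2l ?exprn_ge0 ?addr_ge0 ?kn_ge0//.
by rewrite (le_trans (cabs_dcoef_le _ _ _))// ler_wpM2r ?cabs_ge0// lerDr.
Qed.

Lemma rapid_L1 c : rapid c -> exists M, L1le (fun k => cabs (c k)) M.
Proof.
by move=> /(_ 0)[M h]; exists M; apply: L1le_le h => // k; rewrite expr0 mul1r.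
Qed.

Lemma syn_Ck m c : rapid c -> Ck m (syn c).
Proof.
elim: m c => [|m IH] c rc /=.
  by have [M h] := rapid_L1 rc; have [] := pcont_syn h.
have [M h] := rc 2; split; first by move=> x; have [] := syn_differentiable h x.
by move=> j; rewrite (syn_partial h); apply: IH; exact: rapid_dcoef.
Qed.

(** ** Parseval for gradients *)

Lemma trig_shift (z : R[i]) (k : Z) (x : pt) (j : 'I_d) (e : R) :
  trig z k (x + e *: delta_mx 0 j) = trig (z * cexpi (e * (k 0 j)%:~R)) k x.
Proof.
rewrite !trigE phase_line ReMc ImMc/= cosD sinD; ring.
Qed.

Lemma cabs_cexpi_sub1 (x : R) : cabs (cexpi x - 1) <= `|x|.
Proof.
rewrite cabsE -sqrtr_sqr ler_sqrt ?sqr_ge0// /sqmod ReBc ImBc/= subr0.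
have -> : (cos x - 1) ^+ 2 + sin x ^+ 2 = 4 * sin (x / 2) ^+ 2.
  have c2 := cos2Dsin2 (x / 2).
  have -> : cos x = cos (x / 2) ^+ 2 - sin (x / 2) ^+ 2.
    by rewrite {1}(splitr x) cosD -!expr2.
  have -> : sin x = 2 * (sin (x / 2) * cos (x / 2)).
    by rewrite {1}(splitr x) sinD mulr_natl mulr2n [cos _ * _]mulrC.
  move: c2; move: (sin _) (cos _) => s c h.
  have -> : c ^+ 2 = 1 - s ^+ 2 by rewrite -h; ring.
  rewrite !exprMn; have -> : c ^+ 2 = 1 - s ^+ 2 by rewrite -h; ring.
  by ring.
have := sin_lip (x / 2) 0; rewrite sin0 !subr0 => h.
have h2 : sin (x / 2) ^+ 2 <= (x / 2) ^+ 2.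
  by rewrite -[leLHS]real_normK ?num_real// -[leRHS]real_normK ?num_real// lerXn2r ?nnegrE.
have := ler_wpM2l (ler0n R 4) h2; rewrite expr_div_n => h3.
by apply: (le_trans h3); rewrite le_eqVlt; apply/orP; left; apply/eqP; field.
Qed.

(** The coefficients of [partial j w] need not be summable. Those of the difference quotients of
   [w] are, and they are dominated by [kn k * cabs (fourier w k)]; Fatou's lemma gives the limit. *)
Lemma parseval_partial (w : pt -> R) (j : 'I_d) M M2 : (0 < d)%N -> pcont w ->
  (forall x, differentiable w x) -> continuous (partial j w) ->
  L1le (fun k => cabs (fourier w k)) M ->
  L2le (fun k => kn k * cabs (fourier w k)) M2 ->
  tint (fun x => partial j w x ^+ 2) <= kappa * M2 ^+ 2.
Proof.
move=> d0 pw dw cpw h1 h2.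
pose a := fourier w; have wE : w = syn a by rewrite (syn_fourier d0 pw h1).
have herm : conj_sym a by move=> k; rewrite /a fourierN//; exact/bpt_tI/pcont_bpt.
(* [b n] are the coefficients of the difference quotient [D n] *)
pose D (n : nat) (x : pt) := n.+1%:R * (w (x + n.+1%:R^-1 *: delta_mx 0 j) - w x).
pose b (n : nat) (k : Z) : R[i] := (n.+1%:R)%:C * (a k * (cexpi (n.+1%:R^-1 * (k 0 j)%:~R) - 1)).
have bn n k : cabs (b n k) <= kn k * cabs (a k).
  rewrite /b !cabsM cabs_real ger0_norm// mulrCA [leRHS]mulrC ler_wpM2l ?cabs_ge0//.
  apply: (@le_trans _ _ (n.+1%:R * `|n.+1%:R^-1 * (k 0 j)%:~R|)).
    by rewrite ler_wpM2l// cabs_cexpi_sub1.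
  by rewrite normrM ger0_norm ?invr_ge0// mulrA mulfV ?pnatr_eq0// mul1r coord_le_kn.
have b1 n : L1le (fun k => cabs (b n k)) (n.+1%:R * (2 * M)).
  apply: L1le_le (L1leZ (ler0n _ n.+1) (L1leZ (ler0n _ 2) h1)) => // k.
  rewrite /b !cabsM cabs_real ger0_norm// ler_wpM2l// mulrC ler_wpM2r ?cabs_ge0//.
  by apply: (le_trans (cabsB _ _)); rewrite cabs_cexpi (cabs_real 1) normr1.
have DE n : D n = syn (b n).
  apply/funext => x; rewrite /D wE.
  have HS := has_sumZ n.+1%:R (has_sumD (has_sum_syn h1 (x + n.+1%:R^-1 *: delta_mx 0 j))
     (has_sumZ (-1) (has_sum_syn h1 x))).
  rewrite mulN1r in HS; apply: (has_sum_uniq HS).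
  have -> : (fun k => n.+1%:R * (kappa * trig (a k) k (x + n.+1%:R^-1 *: delta_mx 0 j) +
      -1 * (kappa * trig (a k) k x))) = (fun k => kappa * trig (b n k) k x); last exact: has_sum_syn.
  apply/funext => k; rewrite trig_shift !trigE /b !(ReMc, ImMc, ReBc, ImBc)/=; ring.
have herb n : conj_sym (b n).
  move=> k; rewrite /b herm mxE intrN mulrN; case: (a k) => u v.
  by apply: complex_ext => /=; rewrite cosN sinN; ring.
have Db n : tint (fun x => D n x ^+ 2) <= kappa * M2 ^+ 2.
  rewrite DE; apply: (parseval_syn (b1 n)) => //.
  by apply: L2le_le h2 => // k; rewrite cabs_ge0 bn.
have pD n : pcont (D n) by rewrite DE; exact: pcont_syn.
have ppw : pcont (partial j w) by split => //; apply: partial_periodic; case: pw.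
have cvgD x : D n x @[n --> \oo] --> partial j w x.
  have dv : derivable w x (delta_mx 0 j) by apply: diff_derivable; exact: dw.
  have c0 : (n.+1%:R^-1 : R) @[n --> \oo] --> 0^'.
    move=> A hA; have [N _ HN] := @cvg_harmonic R _ hA; exists N => // n /HN /=; apply.
    by rewrite /= /harmonic invr_neq0// pnatr_eq0.
  have /= := cvg_comp _ _ c0 dv; rewrite -/(partial j w x).
  apply: cvg_trans; apply: near_eq_cvg; near=> n.
  by rewrite /D /= invrK [x + _]addrC.
have meas n : measurable_fun setT (fun t => ((D n (pt_of_tuple t)) ^+ 2)%:E : \bar R).
  by apply/measurable_EFinP; have [] := pcont_bpt (pcontX 2 (pD n)).
pose F n (t : d.-tuple (measurableTypeR R)) : \bar R := ((D n (pt_of_tuple t)) ^+ 2)%:E.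
have fat : (\int[torus_measure R d]_t limn_einf (F^~ t) <=
    limn_einf (fun n => \int[torus_measure R d]_t F n t))%E.
  by apply: fatou => // n t _; rewrite /F lee_fin sqr_ge0.
have E1 : (\int[torus_measure R d]_t limn_einf (F^~ t) = (tint (fun x => partial j w x ^+ 2))%:E)%E.
  rewrite /tint /torus_int /Rintegral fineK; last first.
    by apply: integrable_fin_num => //; exact: (bpt_tI (pcont_bpt (pcontX 2 ppw))).
  apply: eq_integral => t _; apply: (cvg_limn_einf_sup _).1.
  apply: cvg_EFin; first exact: nearW.
  have c2 : (D n (pt_of_tuple t) * D n (pt_of_tuple t)) @[n --> \oo] --> partial j w (pt_of_tuple t) ^+ 2.
    by rewrite expr2; apply: cvgM; exact: cvgD.
  by apply: cvg_trans c2; apply: near_eq_cvg; apply: nearW => n; rewrite /F /= expr2.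
rewrite -lee_fin -E1; apply: (le_trans fat); rewrite limn_einf_lim.
apply: lime_le; first exact: is_cvg_einfs.
apply: nearW => n.
apply: (@le_trans _ _ (\int[torus_measure R d]_t F n t)%E).
  by apply: ereal_inf_lbound; exists n => //=.
rewrite -[leLHS]fineK; first by rewrite lee_fin; exact: Db.
by apply: integrable_fin_num => //; exact: (bpt_tI (pcont_bpt (pcontX 2 (pD n)))).
Unshelve. all: by end_near.
Qed.

End differentiability.

(** * Lattice sums *)

Section lattice_sums.
Context {R : realType} {d : nat}.
Local Notation Z := 'rV[int]_d.
Local Notation kn := (@freq_norm R d).
Hypothesis d0 : (0 < d)%N.

(** The maximum norm: its spheres have few lattice points, and it is comparable to [freq_norm]. *)
Definition kinf (k : Z) : nat := (\max_(j < d) absz (k ord0 j))%N.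

Lemma kinf_coord (k : Z) j : (absz (k ord0 j) <= kinf k)%N.
Proof. exact: (leq_bigmax (F := fun j => absz (k ord0 j))). Qed.

Lemma kinf_gt0 (k : Z) : k != 0 -> (0 < kinf k)%N.
Proof.
rewrite lt0n; apply: contra => /eqP k0; apply/eqP/rowP => j; rewrite mxE.
by have := kinf_coord k j; rewrite k0 leqn0 absz_eq0 => /eqP.
Qed.

Lemma kinf_attained (k : Z) : exists j, kinf k = absz (k ord0 j).
Proof.
have c0 : (0 < #|'I_d|)%N by rewrite card_ord.
by have [i Ei] := @bigop.eq_bigmax _ (fun j => absz (k ord0 j)) c0; exists i.
Qed.

Lemma kinf_le_kn (k : Z) : (kinf k)%:R <= kn k.
Proof.
have [j ->] := kinf_attained k; apply: le_trans (coord_le_kn k j).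
by rewrite -intr_norm -abszE -pmulrn.
Qed.

Lemma kn_le_kinf (k : Z) : kn k <= d%:R * (kinf k)%:R.
Proof.
apply: kn_le_coord => // j; rewrite -intr_norm -abszE -pmulrn ler_nat.
exact: kinf_coord.
Qed.

Lemma absz_itv (z : int) (m : nat) : (absz z <= m)%N -> - m%:Z <= z <= m%:Z.
Proof. lia. Qed.
Lemma absz_shift_lt (z : int) (m : nat) : - m%:Z <= z <= m%:Z -> (absz (z + m%:Z)%R < (2 * m).+1)%N.
Proof. lia. Qed.
Lemma absz_shift_inj (z w : int) (m : nat) : - m%:Z <= z <= m%:Z -> - m%:Z <= w <= m%:Z ->
  absz (z + m%:Z) = absz (w + m%:Z) -> z = w.
Proof. lia. Qed.
Lemma absz_extreme (z : int) (m : nat) : m = absz z ->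
  absz (z + m%:Z) = 0%N \/ absz (z + m%:Z) = (2 * m)%N.
Proof. lia. Qed.

(** Shifted by [m], a point of the sphere is a function into [0 .. 2 m] with an extreme value at
   some coordinate. *)
Lemma shell_count (s : seq Z) (m : nat) : uniq s -> (0 < m)%N ->
  (count (fun k => kinf k == m) s <= d * (2 * (2 * m).+1 ^ d.-1))%N.
Proof.
move=> us m0; rewrite -size_filter; set s' := seq.filter _ s.
pose N := (2 * m).+1.
pose g (k : Z) : {ffun 'I_d -> 'I_N} := [ffun j => inord (absz (k ord0 j + m%:Z))].
(* the points whose [j]-th coordinate is extreme *)
pose A (j : 'I_d) := family (fun i : 'I_d => if i == j then pred2 ord0 (ord_max : 'I_N) else predT).
have us' : uniq s' by exact: filter_uniq.
have bnd k j : k \in s' -> (- m%:Z <= k ord0 j <= m%:Z).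
  rewrite mem_filter => /andP[/eqP km _]; by apply: absz_itv; rewrite -km; exact: kinf_coord.
have gE k j : k \in s' -> (g k j : nat) = absz (k ord0 j + m%:Z).
  by move=> ks; rewrite ffunE inordK//; apply: absz_shift_lt; exact: bnd.
have ginj : {in s' &, injective g}.
  move=> k l ks ls /ffunP E; apply/rowP => j.
  have := congr1 (@nat_of_ord _) (E j); rewrite !gE//.
  by apply: absz_shift_inj; exact: bnd.
have gA k : k \in s' -> [exists j, g k \in A j].
  move=> ks; have [j kj] := kinf_attained k; apply/existsP; exists j.
  apply/familyP => i; case: eqP => // ->; rewrite inE.
  move: (ks); rewrite mem_filter => /andP[/eqP km _].
  have := absz_extreme (etrans (esym km) kj); rewrite -(gE k j ks) => -[E|E].
    by apply/orP; left; apply/eqP/val_inj.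
  by apply/orP; right; apply/eqP/val_inj.
have cA j : (#|A j| <= 2 * N ^ d.-1)%N.
  rewrite card_family.
  have -> (t : seq nat) : foldr muln 1%N t = (\prod_(x <- t) x)%N by rewrite foldrE.
  rewrite big_map big_enum/= (bigD1 j)//= eqxx; apply: leq_mul.
    by rewrite card2; case: (_ != _).
  rewrite (eq_bigr (fun=> N)); last by move=> i /negPf ->; rewrite card_ord.
  by rewrite prod_nat_const cardC1 card_ord.
rewrite -(size_map g) -(card_uniqP _); last by rewrite map_inj_in_uniq.
pose U := finset (fun f : {ffun 'I_d -> 'I_N} => [exists j, f \in A j]).
pose V (j : 'I_d) := finset (fun f : {ffun 'I_d -> 'I_N} => f \in A j).
apply: (@leq_trans #|U|).
  by apply/subset_leq_card/fintype.subsetP => f /mapP[k ks ->]; rewrite finset.in_set; exact: gA.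
have -> : U = (\big[@finset.setU _/finset.set0]_(j < d) V j).
  apply/finset.setP => f; rewrite finset.in_set; apply/existsP/bigcupP => [[j fj]|[j _]].
    by exists j => //; rewrite finset.in_set.
  by rewrite finset.in_set => fj; exists j.
apply: (@leq_trans (\sum_(j < d) 2 * N ^ d.-1)%N); last by rewrite sum_nat_const card_ord.
apply: (big_ind2 (fun (X : {set {ffun 'I_d -> 'I_N}}) n => is_true (#|X| <= n)%N)).
- by rewrite cards0.
- by move=> X1 n1 X2 n2 h1 h2; apply: leq_trans (leq_add h1 h2); rewrite (leq_card_setU X1 X2).
- by move=> j _; rewrite cardsE; exact: cA.
Qed.

(** Sum over spheres of the maximum norm. *)
Lemma shell_sum (phi : nat -> R) (B : R) (s : seq Z) : (forall m, 0 <= phi m) ->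
  uniq s -> (forall k, k \in s -> k != 0) ->
  (forall N, \sum_(1 <= m < N) m%:R ^+ d.-1 * phi m <= B) ->
  \sum_(k <- s) phi (kinf k) <= (d * 2 * 3 ^ d.-1)%:R * B.
Proof.
move=> phi0 us s0 hB.
pose N := (\max_(k <- s) kinf k).+1.
have E k : k \in s -> phi (kinf k) = \sum_(1 <= m < N) (if kinf k == m then phi m else 0).
  move=> ks; rewrite -big_mkcond/= -big_filter (eq_filter (a2 := pred1 (kinf k))); last first.
    by move=> m; rewrite /= eq_sym.
  rewrite filter_pred1_uniq ?iota_uniq// ?big_seq1//.
  rewrite mem_index_iota kinf_gt0 ?s0//= ltnS.
  exact: (@leq_bigmax_seq _ s xpredT kinf k ks isT).
rewrite big_seq (eq_bigr _ E) -big_seq exchange_big/=.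
apply: (@le_trans _ _ (\sum_(1 <= m < N) (d * 2 * 3 ^ d.-1)%:R * (m%:R ^+ d.-1 * phi m))); last first.
  by rewrite -mulr_sumr ler_wpM2l.
rewrite !big_nat; apply: ler_sum => m /andP[m1 _].
rewrite -big_mkcond/= big_const_seq iter_addr_0 -[leLHS]mulr_natl mulrA ler_wpM2r//.
rewrite -natrX -natrM ler_nat; apply: (leq_trans (shell_count us m1)).
rewrite -!mulnA leq_mul2l; apply/orP; right.
rewrite leq_mul2l; apply/orP; right; rewrite -expnMn.
case: (d.-1) => // n; rewrite leq_exp2r//; lia.
Qed.

Lemma sum_inv_sqr (N : nat) : \sum_(1 <= m < N) (m%:R ^+ 2)^-1 <= 2 :> R.
Proof.
suff H n : \sum_(1 <= m < n.+2) (m%:R ^+ 2)^-1 <= 2 - n.+1%:R^-1 :> R.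
  case: N => [|[|n]]; [by rewrite big_geq|by rewrite big_geq|].
  by rewrite (le_trans (H n))// gerBl.
elim: n => [|n IH]; first by rewrite big_nat1 expr1n invr1; lra.
rewrite big_nat_recr//= -lerBrDr; apply: (le_trans IH).
rewrite -subr_ge0.
have n0 : n.+1%:R != 0 :> R by rewrite pnatr_eq0.
have n1 : n.+2%:R != 0 :> R by rewrite pnatr_eq0.
have -> : 2 - n.+2%:R^-1 - (n.+2%:R ^+ 2)^-1 - (2 - n.+1%:R^-1) = (n.+1%:R * n.+2%:R ^+ 2)^-1 :> R.
  move: n0 n1; rewrite -[n.+2%:R]natr1 -[n.+1%:R]natr1 => n0 n1; field.
  by rewrite n0 n1.
by rewrite invr_ge0 mulr_ge0// sqr_ge0.
Qed.

(** The summand is at most [2 / a] times the decrease of [(1 + a m^2)^-1], and these telescope. *)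
Lemma sum_heat (a : R) (N : nat) : 0 < a ->
  \sum_(1 <= m < N) m%:R * (1 + a ^+ 2 * m%:R ^+ 4)^-1 <= 2 / a.
Proof.
move=> a0; pose T (m : nat) : R := (1 + a * m%:R ^+ 2)^-1.
have P m : 0 < 1 + a * m%:R ^+ 2 by rewrite ltr_pwDl// mulr_ge0 ?(ltW a0)// exprn_ge0.
have step m : m.+1%:R * (1 + a ^+ 2 * m.+1%:R ^+ 4)^-1 <= 2 / a * (T m - T m.+1).
  have u0 := P m.+1; have v0 := P m; rewrite /T.
  set y : R := m.+1%:R in u0 *; set x : R := m%:R in v0 *.
  have yx : y = x + 1 by rewrite /y natr1.
  have x0 : 0 <= x by exact: ler0n.
  have w0 : 0 < 1 + a ^+ 2 * y ^+ 4.
    by rewrite ltr_pwDl// mulr_ge0 ?sqr_ge0// exprn_ge0// yx addr_ge0.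
  apply: (@le_trans _ _ (y * (2 / (1 + a * y ^+ 2) ^+ 2))).
    rewrite ler_wpM2l ?yx ?addr_ge0// -yx ler_pdivlMr ?exprn_gt0// mulrC ler_pdivrMr//.
    have := sqr_ge0 (1 - a * y ^+ 2); nra.
  have -> : 2 / a * ((1 + a * x ^+ 2)^-1 - (1 + a * y ^+ 2)^-1) =
     2 * (y + x) / ((1 + a * x ^+ 2) * (1 + a * y ^+ 2)).
    by rewrite yx in u0 *; field; rewrite !gt_eqF.
  rewrite mulrCA -mulrA ler_wpM2l// ler_pM ?invr_ge0 ?exprn_ge0 ?(ltW u0)//.
  - by rewrite lerDl.
  rewrite lef_pV2 ?posrE ?mulr_gt0 ?exprn_gt0// [leRHS]expr2 ler_wpM2r ?(ltW u0)// lerD2l.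
  by rewrite ler_wpM2l ?(ltW a0)// lerXn2r ?nnegrE// yx ?addr_ge0// lerDl.
have tele n : \sum_(1 <= m < n.+1) m%:R * (1 + a ^+ 2 * m%:R ^+ 4)^-1 <= 2 / a * (1 - T n).
  elim: n => [|n IH]; first by rewrite big_geq// /T expr0n/= mulr0 addr0 invr1 subrr mulr0.
  rewrite big_nat_recr//=; apply: (le_trans (lerD IH (step n))).
  by rewrite -mulrDr addrA subrK.
have a2 : 0 <= 2 / a by rewrite divr_ge0// ltW.
case: N => [|n]; first by rewrite big_geq.
apply: (le_trans (tele n)); rewrite -[leRHS]mulr1 ler_wpM2l// gerBl /T invr_ge0; exact: ltW.
Qed.

Definition shell_cst : R := (d * 2 * 3 ^ d.-1)%:R.

Lemma L1le_nonzero (a : Z -> R) (M : R) : 0 <= a 0 ->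
  (forall s : seq Z, uniq s -> (forall k, k \in s -> k != 0) -> \sum_(k <- s) a k <= M) ->
  L1le a (a 0 + M).
Proof.
move=> a0 H s us; rewrite (bigID (pred1 0))/=; apply: lerD.
  rewrite -big_filter; have [s0|s0] := boolP (0 \in s).
    by rewrite filter_pred1_uniq// big_seq1.
  rewrite big_seq big1 // => k; rewrite mem_filter => /andP[/= /eqP -> ].
  by rewrite (negPf s0).
rewrite -big_filter; apply: H; first exact: filter_uniq.
by move=> k; rewrite mem_filter => /andP[].
Qed.

Lemma lattice_poly : L1le (fun k : Z => ((1 + kn k) ^+ (d + 2))^-1) (1 + shell_cst * 2).
Proof.
have -> : 1 + shell_cst * 2 = ((1 + kn 0) ^+ (d + 2))^-1 + shell_cst * 2.
  by rewrite kn0 addr0 expr1n invr1.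
apply: L1le_nonzero; first by rewrite kn0 addr0 expr1n invr1.
move=> s us s0.
pose phi (m : nat) : R := (m%:R ^+ (d + 2))^-1.
apply: (@le_trans _ _ (\sum_(k <- s) phi (kinf k))).
  rewrite !big_seq; apply: ler_sum => k ks; have k1 := kinf_gt0 (s0 k ks).
  rewrite /phi lef_pV2 ?posrE ?exprn_gt0 ?ltr0n ?ltr_wpDr ?kn_ge0//.
  rewrite lerXn2r ?nnegrE ?addr_ge0 ?kn_ge0//.
  by rewrite (le_trans (kinf_le_kn k))// lerDr.
apply: shell_sum => //; first by move=> m; rewrite invr_ge0 exprn_ge0.
move=> N; apply: le_trans (sum_inv_sqr N); rewrite !big_nat; apply: ler_sum => m /andP[m1 _].
have mp : 0 < m%:R :> R by rewrite ltr0n.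
rewrite /phi ler_pdivrMr ?exprn_gt0// mulrC ler_pdivlMr ?exprn_gt0//.
rewrite -exprD; apply: ler_weXn2l; first by rewrite ler1n.
by rewrite leq_add2r leq_pred.
Qed.

(** The rational function dominates the heat kernel [exp (- a^2 |k|^4)] and telescopes.  In every
   dimension the sum over the sphere of radius [m] is of the order of the summand of [sum_heat],
   as the factor [kn k ^+ d] offsets the number of points. *)
Lemma lattice_heat (a : R) (s : seq Z) : 0 < a -> uniq s -> (forall k, k \in s -> k != 0) ->
  \sum_(k <- s) kn k ^+ 2 / kn k ^+ d * (1 + a ^+ 2 * kn k ^+ 4)^-1 <=
  shell_cst * (d%:R ^+ 2 * (2 / a)).
Proof.
move=> a0 us s0.
pose phi (m : nat) : R := d%:R ^+ 2 * m%:R ^+ 2 / m%:R ^+ d * (1 + a ^+ 2 * m%:R ^+ 4)^-1.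
have P (x : R) : 0 <= x -> 0 < 1 + a ^+ 2 * x ^+ 4.
  by move=> x0; rewrite ltr_pwDl// mulr_ge0 ?sqr_ge0// exprn_ge0.
apply: (@le_trans _ _ (\sum_(k <- s) phi (kinf k))).
  rewrite !big_seq; apply: ler_sum => k ks; have k1 := kinf_gt0 (s0 k ks).
  have h1 := kinf_le_kn k; have h2 := kn_le_kinf k.
  have i0 : 0 < (kinf k)%:R :> R by rewrite ltr0n.
  have n0 : 0 < kn k by exact: lt_le_trans h1.
  rewrite /phi; apply: ler_pM.
  - by rewrite divr_ge0 ?exprn_ge0 ?kn_ge0.
  - by rewrite invr_ge0; apply/ltW/P/kn_ge0.
  - apply: ler_pM; rewrite ?sqr_ge0 ?invr_ge0 ?exprn_ge0 ?kn_ge0//.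
      by rewrite -exprMn lerXn2r ?nnegrE ?kn_ge0 ?mulr_ge0.
    by rewrite lef_pV2 ?posrE ?exprn_gt0// lerXn2r ?nnegrE ?kn_ge0.
  - rewrite lef_pV2 ?posrE ?P ?kn_ge0// lerD2l ler_wpM2l ?sqr_ge0//.
    by rewrite lerXn2r ?nnegrE ?kn_ge0.
apply: shell_sum => //.
  move=> m; rewrite mulr_ge0 ?invr_ge0//; last exact/ltW/P.
move=> N; apply: (@le_trans _ _ (d%:R ^+ 2 * \sum_(1 <= m < N) m%:R * (1 + a ^+ 2 * m%:R ^+ 4)^-1)); last first.
  by rewrite ler_wpM2l ?sqr_ge0// sum_heat.
rewrite mulr_sumr !big_nat; apply: ler_sum => m /andP[m1 _].
have mp : m%:R != 0 :> R by rewrite pnatr_eq0 -lt0n.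
rewrite /phi le_eqVlt; apply/orP; left; apply/eqP.
have -> : (m%:R ^+ d : R) = m%:R ^+ d.-1 * m%:R by rewrite -exprSr prednK.
set H := (1 + _)^-1; field.
by rewrite mp expf_neq0.
Qed.

End lattice_sums.

(** * Singular time integrals *)

Section time_integrals.
Context {R : realType}.
Local Notation mu := (@lebesgue_measure R).

Lemma ge0_integral_oo_le (f F : R -> R) (a b B : R) : a < b ->
  (forall x, a < x < b -> 0 <= f x) -> {in `]a, b[, continuous f} ->
  (forall x, a < x < b -> is_derive x 1 F (f x)) ->
  (forall x y, a < x -> x < y -> y < b -> F y - F x <= B) ->
  (\int[mu]_(x in `]a, b[) (f x)%:E <= B%:E)%E.
Proof.
move=> ab f0 cf dF FB; have ba : 0 < b - a by rewrite subr_gt0.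
pose e (n : nat) : R := (b - a) / n.+3%:R.
have e0 n : 0 < e n by rewrite divr_gt0.
have e3 n : e n <= (b - a) / 3.
  by rewrite /e ler_wpM2l ?(ltW ba)// lef_pV2 ?posrE// ler_nat.
pose S (n : nat) : set (measurableTypeR R) := `[a + e n, b - e n]%classic.
have SE : \bigcup_n S n = `]a, b[%classic.
  apply/seteqP; split => x /=.
    move=> [n _]; rewrite /S /= !in_itv/= => /andP[h1 h2]; have h := e0 n.
    by apply/andP; split; lra.
  rewrite in_itv/= => /andP[ax xb].
  have m0 : 0 < Num.min (x - a) (b - x) by rewrite lt_min !subr_gt0 ax xb.
  exists (Num.truncn ((b - a) / Num.min (x - a) (b - x))) => //=.
  set n := Num.truncn _.
  have h : e n <= Num.min (x - a) (b - x).
    rewrite /e ler_pdivrMr// mulrC -ler_pdivrMr//.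
    by apply: ltW; apply: (lt_le_trans (truncnS_gt _)); rewrite ler_nat; do 2! apply: leqW.
  by move: h; rewrite le_min => /andP[h1 h2]; rewrite /S /= in_itv/=; apply/andP; split; lra.
have mS n : measurable (S n) by exact: measurable_itv.
have ndS : nondecreasing_seq S.
  move=> n m nm; apply/subsetPset => x; rewrite /S /= !in_itv/= => /andP[h1 h2].
  have h : e m <= e n by rewrite /e ler_wpM2l ?(ltW ba)// lef_pV2 ?posrE// ler_nat.
  by apply/andP; split; lra.
have mf : measurable_fun `]a, b[%classic f.
  by apply: open_continuous_measurable_fun => // x; rewrite inE; exact: cf.
have H1 n : measurable_fun (S n) (fun x => (f x)%:E).
  apply/measurable_EFinP; apply: measurable_funS mf => // x Sx.
  by rewrite -SE; exists n.
have H2 n x : S n x -> (0 <= (f x)%:E)%E.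
  move=> Sx; rewrite lee_fin f0//; have : (\bigcup_n S n) x by exists n.
  by rewrite SE /= in_itv.
have cv := @ge0_nondecreasing_set_cvg_integral _ _ _ S (fun x => (f x)%:E) mu ndS mS H1 H2.
rewrite -SE -(cvg_lim _ cv)//; apply: lime_le; first by apply/cvg_ex; eexists; exact: cv.
apply: nearW => n; have en := e0 n; have e3n := e3 n.
have abn : a + e n < b - e n by lra.
have inn x : x \in `[a + e n, b - e n] -> a < x < b.
  by rewrite in_itv/= => /andP[h1 h2]; apply/andP; split; lra.
have cF x : a < x < b -> {for x, continuous F}.
  move=> /dF h; apply: differentiable_continuous; apply/derivable1_diffP; by case: h.
rewrite (@continuous_FTC2 _ f F)//.
- by rewrite -EFinB lee_fin FB//; lra.
- apply: continuous_in_subspaceT => x; rewrite inE /= => /inn h; apply: cf.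
  by rewrite in_itv.
- split.
  + move=> x hx; have h : a < x < b.
      by move: hx; rewrite in_itv/= => /andP[h1 h2]; apply/andP; split; lra.
    by case: (dF x h).
  + by apply: cvg_at_right_filter; apply: cF; apply/andP; split; lra.
  + by apply: cvg_at_left_filter; apply: cF; apply/andP; split; lra.
- move=> x; rewrite in_itv/= => /andP[h1 h2]; rewrite derive1E.
  by case: (dF x _) => //; apply/andP; split; lra.
Qed.

Lemma integral_powR_le (q t : R) : 0 < t -> 0 <= q -> q < 1 ->
  (\int[mu]_(s in `]0%R, t[) (s `^ (- q))%:E <= (t `^ (1 - q) / (1 - q))%:E)%E.
Proof.
move=> t0 q0 q1; have q1' : 0 < 1 - q by rewrite subr_gt0.
apply: (@ge0_integral_oo_le _ (fun s => s `^ (1 - q) / (1 - q))) => //.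
- by move=> x _; exact: powR_ge0.
- move=> x; rewrite in_itv/= => /andP[x0 _].
  apply: differentiable_continuous; apply/derivable1_diffP.
  by apply: derivable_powR; rewrite in_itv/= x0.
- move=> x /andP[x0 _].
  have h := @is_derive1_powR R (1 - q) x x0.
  have := @is_deriveZ R R R (fun s => s `^ (1 - q)) (1 - q)^-1 x 1 _ h.
  have -> : (1 - q)^-1 *: ((1 - q) * x `^ (1 - q - 1)) = x `^ (- q).
    have -> : 1 - q - 1 = - q by ring.
    by rewrite /GRing.scale/= mulrA mulVf ?mul1r// gt_eqF.
  by congr (is_derive x 1 _ _); apply/funext => s; rewrite mulrC.
- move=> x y x0 xy yt; rewrite -mulrBl ler_pM2r ?invr_gt0//.
  have h : y `^ (1 - q) <= t `^ (1 - q).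
    apply: ge0_ler_powR; rewrite ?nnegrE ?(ltW q1') ?(ltW t0) ?(ltW yt)//.
    by rewrite ltW// (lt_trans x0).
  by have := powR_ge0 x (1 - q); lra.
Qed.

Lemma integral_powR_rev_le (p t : R) : 0 < t -> 0 <= p -> p < 1 ->
  (\int[mu]_(s in `]0%R, t[) ((t - s) `^ (- p))%:E <= (t `^ (1 - p) / (1 - p))%:E)%E.
Proof.
move=> t0 q0 q1; have q1' : 0 < 1 - p by rewrite subr_gt0.
apply: (@ge0_integral_oo_le _ (fun s => - ((t - s) `^ (1 - p) / (1 - p)))) => //.
- by move=> x _; exact: powR_ge0.
- move=> x; rewrite in_itv/= => /andP[_ xt].
  apply: (@continuous_comp _ _ _ (fun s => t - s) (fun s => s `^ (- p))).
    by apply: continuousB; [exact: cst_continuous|exact: id_cont].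
  apply: differentiable_continuous; apply/derivable1_diffP.
  by apply: derivable_powR; rewrite in_itv/= subr_gt0 xt.
- move=> x /andP[_ xt].
  have tx : 0 < t - x by rewrite subr_gt0.
  have h := @is_derive1_powR R (1 - p) (t - x) tx.
  have h2 : is_derive x 1 (fun s => (t - s) `^ (1 - p)) (- ((1 - p) * (t - x) `^ (- p))).
    have h3 : is_derive x (1 : R) (fun s => t - s) (-1).
      by have := is_deriveB (is_derive_cst t x (1 : R)) (is_derive_id x (1 : R)); rewrite sub0r.
    have := @is_derive1_comp _ (fun y => y `^ (1 - p)) (fun s => t - s) x _ _ h h3.
    by rewrite mulrN1 (_ : 1 - p - 1 = - p)//; ring.
  have := @is_deriveZ R R R _ (- (1 - p)^-1) x 1 _ h2.
  have -> : (- (1 - p)^-1) *: (- ((1 - p) * (t - x) `^ (- p))) = (t - x) `^ (- p).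
    by rewrite /GRing.scale/= mulrNN mulrA mulVf ?mul1r// gt_eqF.
  by congr (is_derive x 1 _ _); apply/funext => s; rewrite /= /GRing.scale/= mulNr mulrC.
- move=> x y x0 xy yt; rewrite opprK addrC -mulrBl ler_pM2r ?invr_gt0//.
  have h : (t - x) `^ (1 - p) <= t `^ (1 - p).
    apply: ge0_ler_powR; rewrite ?nnegrE ?(ltW q1') ?(ltW t0)//; lra.
  by have := powR_ge0 (t - y) (1 - p); lra.
Qed.

(** The kernel of all time integrals: the first factor is the cost of derivatives, the second
   the weight of the nonlinearity at the initial time. *)
Definition sker (p q t s : R) : R := (t - s) `^ (- p) * s `^ (- q).

Lemma sker_ge0 p q t s : 0 <= sker p q t s.
Proof. by rewrite mulr_ge0 ?powR_ge0. Qed.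

Lemma sker_measurable p q t : measurable_fun setT (sker p q t).
Proof.
apply: measurable_funM; last exact: measurable_powR.
apply: (@measurableT_comp _ _ _ _ _ _ (fun s => s `^ (- p))); first exact: measurable_powR.
exact: measurable_funB.
Qed.

Lemma powR_antitone (p x y : R) : 0 <= p -> 0 < x -> x <= y -> y `^ (- p) <= x `^ (- p).
Proof.
move=> p0 x0 xy; rewrite !powRN lef_pV2 ?posrE ?powR_gt0 ?(lt_le_trans x0)//.
by apply: ge0_ler_powR => //; rewrite nnegrE ltW// (lt_le_trans x0).
Qed.

(** A Beta integral: on each half of the interval one factor is nearly constant.  The uniform
   constant is what restricts the exponents to [3 / 4]. *)
Lemma integral_sker_le (p q t : R) : 0 < t -> 0 <= p <= 3 / 4 -> 0 <= q <= 3 / 4 ->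
  (\int[mu]_(s in `]0%R, t[) (sker p q t s)%:E <= (16 * t `^ (1 - p - q))%:E)%E.
Proof.
move=> t0 /andP[p0 p1] /andP[q0 q1]; have th : 0 < t / 2 by rewrite divr_gt0.
pose A := (t / 2) `^ (- p); pose B := (t / 2) `^ (- q).
have A0 : 0 <= A by exact: powR_ge0.
have B0 : 0 <= B by exact: powR_ge0.
have mR r : measurable_fun `]0, t[%classic (fun s : R => ((t - s) `^ (- r))%:E : \bar R).
  apply/measurable_EFinP; apply: measurable_funS (_ : measurable_fun setT _) => //.
  by apply: (@measurableT_comp _ _ _ _ _ _ (fun s => s `^ (- r))) => //; exact: measurable_funB.
have mL r : measurable_fun `]0, t[%classic (fun s : R => (s `^ (- r))%:E : \bar R).
  by apply/measurable_EFinP; apply: measurable_funS (_ : measurable_fun setT _).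
apply: (@le_trans _ _ (\int[mu]_(s in `]0%R, t[) (A%:E * (s `^ (- q))%:E + B%:E * ((t - s) `^ (- p))%:E))%E).
  apply: ge0_le_integral => //.
  - by move=> x _; rewrite lee_fin sker_ge0.
  - by apply/measurable_EFinP; apply: measurable_funS (sker_measurable p q t).
  - by apply: emeasurable_funD; apply: measurable_funeM; [exact: mL|exact: mR].
  move=> s /=; rewrite in_itv/= => /andP[s0 st]; rewrite -!EFinM -EFinD lee_fin /sker.
  have [h|h] := leP s (t / 2).
    apply: (@le_trans _ _ (A * s `^ (- q))); last by rewrite lerDl mulr_ge0// powR_ge0.
    rewrite ler_wpM2r ?powR_ge0// powR_antitone//; lra.
  apply: (@le_trans _ _ (B * (t - s) `^ (- p))); last by rewrite lerDr mulr_ge0// powR_ge0.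
  by rewrite mulrC ler_wpM2r ?powR_ge0// powR_antitone// ltW.
rewrite ge0_integralD//; last 4 first.
- by move=> x _; rewrite mule_ge0// lee_fin// powR_ge0.
- by apply: measurable_funeM; exact: mL.
- by move=> x _; rewrite mule_ge0// lee_fin// powR_ge0.
- by apply: measurable_funeM; exact: mR.
rewrite !ge0_integralZl//; try by move=> x _; rewrite lee_fin powR_ge0.
have h1 := @integral_powR_le q t t0 q0 _; have h2 := @integral_powR_rev_le p t t0 p0 _.
have {}h1 := h1 (le_lt_trans q1 _); have {}h2 := h2 (le_lt_trans p1 _).
have lt1 : 3 / 4 < 1 :> R by lra.
apply: (@le_trans _ _ ((A * (t `^ (1 - q) / (1 - q)))%:E + (B * (t `^ (1 - p) / (1 - p)))%:E)%E).
  by rewrite !EFinM; apply: leeD; apply: lee_wpmul2l; rewrite ?lee_fin// -?EFinM; [exact: h1|exact: h2].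
rewrite -EFinD lee_fin.
have half r : 0 <= r -> r <= 3/4 -> (t / 2) `^ (- r) <= 2 * t `^ (- r).
  move=> r0 r1; rewrite powRM ?invr_ge0 ?(ltW t0)// mulrC ler_wpM2r ?powR_ge0//.
  rewrite -powR_inv1// -powRrM mulrNN mul1r.
  by rewrite -[leRHS]powRr1// ler_powR//; lra.
have inv (r : R) : 0 <= r -> r <= 3/4 -> (1 - r)^-1 <= 4.
  by move=> r0 r1; rewrite -[leRHS]invrK lef_pV2 ?posrE ?invr_gt0//; lra.
have tD x y : t `^ x * t `^ y = t `^ (x + y) by rewrite powRD// (gt_eqF t0) implybT.
have X a b : 0 <= a -> a <= 3/4 -> 0 <= b -> b <= 3/4 ->
   (t / 2) `^ (- a) * (t `^ (1 - b) / (1 - b)) <= 8 * t `^ (1 - a - b).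
  move=> a0 a1 b0 b1.
  have -> : 8 * t `^ (1 - a - b) = (2 * t `^ (- a)) * (t `^ (1 - b) * 4).
    have -> : 1 - a - b = - a + (1 - b) by ring.
    by rewrite -tD; ring.
  apply: ler_pM; rewrite ?powR_ge0 ?half//.
    by rewrite divr_ge0 ?powR_ge0// subr_ge0; lra.
  by rewrite ler_wpM2l ?powR_ge0// inv.
have := X p q p0 p1 q0 q1; have := X q p q0 q1 p0 p1.
have -> : 1 - q - p = 1 - p - q by ring.
rewrite -/A -/B; lra.
all: try exact: mR; exact: mL.
Qed.

Lemma integrable_sker (p q t : R) : 0 < t -> 0 <= p <= 3 / 4 -> 0 <= q <= 3 / 4 ->
  mu.-integrable `]0, t[ (EFin \o sker p q t).
Proof.
move=> t0 hp hq; apply/integrableP; split.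
  by apply/measurable_EFinP; apply: measurable_funS (sker_measurable p q t).
apply: le_lt_trans (ltry (16 * t `^ (1 - p - q))).
apply: le_trans (integral_sker_le t0 hp hq).
by apply: ge0_le_integral => //; [by apply: measurableT_comp => //; apply/measurable_EFinP; apply: measurable_funS (sker_measurable p q t)|
 by apply/measurable_EFinP; apply: measurable_funS (sker_measurable p q t)|by move=> s _; rewrite /= ger0_norm ?sker_ge0].
Qed.

Lemma Rintegral_sker_le (p q t : R) : 0 < t -> 0 <= p <= 3 / 4 -> 0 <= q <= 3 / 4 ->
  \int[mu]_(s in `]0, t[) sker p q t s <= 16 * t `^ (1 - p - q).
Proof.
move=> t0 hp hq; rewrite -lee_fin /Rintegral fineK; first exact: integral_sker_le.
by apply: integrable_fin_num => //; exact: integrable_sker.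
Qed.

End time_integrals.

(** * The Duhamel integral of one frequency *)

Section scalar_duhamel.
Context {R : realType}.
Local Notation mu := (@lebesgue_measure R).
Implicit Types (T lam : R) (f g phi : R -> R).

(** Continuity on the half-open interval [0 < t <= T], as an explicit epsilon-delta property. *)
Definition econt T f := forall t0, 0 < t0 <= T -> forall e, 0 < e ->
  exists2 r, 0 < r & forall t, 0 < t <= T -> `|t0 - t| < r -> `|f t0 - f t| < e.

Lemma econtP T f : econt T f <-> {within `]0, T], continuous f}.
Proof.
split=> [H|/subspace_continuousP H].
  apply/subspace_continuousP => t0; rewrite /= in_itv/= => ht0.
  apply/cvgrPdist_lt => e e0; have [r r0 rP] := H t0 ht0 e e0.
  rewrite near_withinE; apply/nbhs_normP; exists r => // t /= ht; rewrite in_itv/= => htT.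
  exact: rP.
move=> t0 ht0 e e0; have ht0' : `]0, T]%classic t0 by rewrite /= in_itv.
have /cvgrPdist_lt/(_ _ e0) := H t0 ht0'.
rewrite near_withinE => /nbhs_normP[r r0 rP].
by exists r => // t htT ht; apply: (rP t) => //; rewrite /= in_itv.
Qed.

Lemma econt_in T f t0 : econt T f -> 0 < t0 < T -> {for t0, continuous f}.
Proof.
move=> H /andP[p0 pT]; apply/cvgrPdist_lt => e e0.
have [|r r0 rP] := H t0 _ e e0; first by rewrite p0 ltW.
apply/nbhs_normP; exists (Num.min r (Num.min t0 (T - t0))).
  by rewrite /= !lt_min r0 p0 subr_gt0.
move=> t /=; rewrite !lt_min => /and3P[h1 h2 h3]; apply: rP => //.
move: h2 h3; rewrite !ltr_norml => /andP[_ h2] /andP[h3 _].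
by apply/andP; split; lra.
Qed.

Lemma econt_within T f a : econt T f -> 0 < a -> {within `[a, T], continuous f}.
Proof.
move=> /econtP H a0; apply: continuous_subspaceW H => x /=; rewrite !in_itv/= => /andP[ax ->].
by rewrite (lt_le_trans a0 ax).
Qed.

Lemma within_econt T f : {within `[0, T], continuous f} -> econt T f.
Proof.
move=> H; apply/econtP; apply: continuous_subspaceW H => x /=; rewrite !in_itv/= => /andP[x0 ->].
by rewrite (ltW x0).
Qed.

Lemma econt_cont T f : continuous f -> econt T f.
Proof. by move=> cf; apply/econtP/continuous_subspaceT. Qed.

Lemma econtD T f g : econt T f -> econt T g -> econt T (fun t => f t + g t).
Proof.
move=> /econtP cf /econtP cg; apply/econtP => x.
exact: (@continuousD _ _ _ (f : subspace _ -> R) g x (cf x) (cg x)).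
Qed.

Lemma econtB T f g : econt T f -> econt T g -> econt T (fun t => f t - g t).
Proof.
move=> /econtP cf /econtP cg; apply/econtP => x.
exact: (@continuousB _ _ _ (f : subspace _ -> R) g x (cf x) (cg x)).
Qed.

Lemma econtM T f g : econt T f -> econt T g -> econt T (fun t => f t * g t).
Proof.
move=> /econtP cf /econtP cg; apply/econtP => x.
exact: (@continuousM _ _ (f : subspace _ -> R) g x (cf x) (cg x)).
Qed.

Lemma econtS T T' f : T' <= T -> econt T f -> econt T' f.
Proof.
move=> TT /econtP H; apply/econtP; apply: continuous_subspaceW H => x /=.
by rewrite !in_itv/= => /andP[-> xT]; exact: le_trans TT.
Qed.

Lemma continuous_expR_lin lam (c : R) : continuous (fun s => expR (lam * (s + c))).
Proof.
move=> s; apply: (@continuous_comp _ _ _ (fun s => lam * (s + c)) expR); last exact: continuous_expR.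
by apply: (@continuousM _ _ (fun=> lam) (fun s => s + c)); [exact: cst_continuous|];
  apply: (@continuousD _ _ _ (fun s => s) (fun=> c)); [exact: id_cont|exact: cst_continuous].
Qed.

(** The source of a scalar Duhamel integral: continuous for positive times, and as singular at
   the initial time as the cube of a gradient of size [t^(-1/4)]. *)
Definition radm T phi := econt T phi /\
  exists M, forall s, 0 < s <= T -> `|phi s| <= M * s `^ (- (3 / 4)).

Lemma integrable_oo_cc a b f : mu.-integrable `]a, b[ (EFin \o f) -> mu.-integrable `[a, b] (EFin \o f).
Proof.
move=> /integrableP[/measurable_EFinP mf fi].
have mf' : measurable_fun `[a, b] f.
  by apply/measurable_fun_itv_bndo_bndcP/measurable_fun_itv_obnd_cbndP.
apply/integrableP; split; first exact/measurable_EFinP.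
rewrite integral_itv_bndoo//.
by apply: measurableT_comp => //; exact/measurable_EFinP.
Qed.

Lemma Rintegral_oo_cc a b f : mu.-integrable `]a, b[ (EFin \o f) ->
  \int[mu]_(s in `]a, b[) f s = \int[mu]_(s in `[a, b]) f s.
Proof.
move=> /integrableP[mf _]; by rewrite /Rintegral [in RHS]integral_itv_bndoo.
Qed.

Lemma integrable_adm t f M : 0 < t -> {in `]0, t[, continuous f} ->
  (forall s, 0 < s < t -> `|f s| <= M * s `^ (- (3 / 4))) ->
  mu.-integrable `]0, t[ (EFin \o f).
Proof.
move=> t0 cf fM.
have iM : mu.-integrable `]0, t[ (fun s => M%:E * (sker 0 (3 / 4) t s)%:E)%E.
  by apply: integrableZl => //; apply: integrable_sker => //; lra.
apply: le_integrable iM => //.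
  apply/measurable_EFinP; apply: open_continuous_measurable_fun => // x; rewrite inE; exact: cf.
move=> s /=; rewrite in_itv/= => hs; rewrite lee_fin /sker oppr0 powRr0 mul1r.
exact: le_trans (fM s hs) (ler_norm _).
Qed.

(** The solution of [y' = - lam y + phi] with zero initial value. *)
Definition duh1 lam phi t : R := \int[mu]_(s in `]0, t[) (expR (- (lam * (t - s))) * phi s).

Lemma cont_ker lam t : continuous (fun s => expR (- (lam * (t - s)))).
Proof.
have -> : (fun s => expR (- (lam * (t - s)))) = (fun s => expR (lam * (s + - t))).
  by apply/funext => s; congr expR; ring.
exact: continuous_expR_lin.
Qed.

Lemma ker_le1 lam t s : 0 <= lam -> s <= t -> 0 < expR (- (lam * (t - s))) <= 1.
Proof. by move=> l0 st; rewrite expR_gt0 -expR0 ler_expR oppr_le0 mulr_ge0// subr_ge0. Qed.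

Lemma integrable_duh lam T phi t : 0 <= lam -> radm T phi -> 0 < t <= T ->
  mu.-integrable `]0, t[ (EFin \o (fun s => expR (- (lam * (t - s))) * phi s)).
Proof.
move=> l0 [cphi [M phiM]] /andP[t0 tT]; apply: (@integrable_adm _ _ M) => //.
  move=> s; rewrite in_itv/= => /andP[s0 st].
  apply: (@continuousM _ _ (fun s => expR (- (lam * (t - s)))) phi s); first exact: cont_ker.
  by apply: (econt_in cphi); rewrite s0 (lt_le_trans st).
move=> s /andP[s0 st]; rewrite normrM.
have /andP[k0 k1] := ker_le1 l0 (ltW st).
rewrite (gtr0_norm k0); apply: (@le_trans _ _ (1 * `|phi s|)); first by rewrite ler_wpM2r.
by rewrite mul1r phiM// s0 (le_trans (ltW st)).
Qed.

Lemma duh1B lam T f g t : 0 <= lam -> radm T f -> radm T g -> 0 < t <= T ->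
  duh1 lam (fun s => f s - g s) t = duh1 lam f t - duh1 lam g t.
Proof.
move=> l0 af ag ht; rewrite /duh1 -RintegralB//; try exact: (integrable_duh _ _ ht).
by apply: eq_Rintegral => s _; rewrite mulrBr.
Qed.

Lemma duh1_norm lam T f t : 0 <= lam -> radm T f -> 0 < t <= T ->
  `|duh1 lam f t| <= \int[mu]_(s in `]0, t[) (expR (- (lam * (t - s))) * `|f s|).
Proof.
move=> l0 af ht; apply: le_trans (le_normr_Rintegral _ _) _ => //.
  exact: (integrable_duh l0 af ht).
rewrite le_eqVlt; apply/orP; left; apply/eqP; apply: eq_Rintegral => s; rewrite inE/= in_itv/= => /andP[_ st].
by rewrite normrM gtr0_norm// expR_gt0.
Qed.

(** Up to the factor [exp (- lam t)], the integral is a primitive of an integrable function. *)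
Lemma duh1_econt lam T phi : 0 <= lam -> radm T phi -> econt T (duh1 lam phi).
Proof.
move=> l0 aphi; have [T0|T0] := leP T 0.
  by move=> t0 /andP[h1 h2]; have := lt_le_trans h1 (le_trans h2 T0); rewrite ltxx.
(* the kernel factors as [exp (- lam t)] times a function of [s] alone *)
pose psi s := expR (lam * (s + 0)) * phi s.
have ipsi t : 0 < t <= T -> mu.-integrable `]0, t[ (EFin \o psi).
  move: aphi => [cphi [M phiM]] /andP[t0 tT].
  apply: (@integrable_adm _ _ (expR (lam * T) * M)) => //.
    move=> s; rewrite in_itv/= => /andP[s0 st].
    apply: (@continuousM _ _ (fun s => expR (lam * (s + 0))) phi s); first exact: continuous_expR_lin.
    by apply: (econt_in cphi); rewrite s0 (lt_le_trans st).
  move=> s /andP[s0 st]; rewrite normrM gtr0_norm ?expR_gt0// -mulrA ler_pM ?expR_ge0//.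
    by rewrite ler_expR ler_wpM2l// addr0 (le_trans (ltW st)).
  by rewrite phiM// s0 (le_trans (ltW st)).
have TT : 0 < T <= T by rewrite T0 lexx.
have ipsi' := integrable_oo_cc (ipsi T TT).
have cP := parameterized_integral_continuous (ltW T0) ipsi'.
have E t : 0 < t <= T -> duh1 lam phi t = expR (- lam * (t + 0)) * parameterized_integral mu 0 t psi.
  move=> ht; rewrite /parameterized_integral /duh1 -Rintegral_oo_cc; last exact: ipsi.
  rewrite -RintegralZl//; last exact: ipsi.
  by apply: eq_Rintegral => s _; rewrite /psi mulrA -expRD; congr (expR _ * _); ring.
have H : econt T (fun t => expR (- lam * (t + 0)) * parameterized_integral mu 0 t psi).
  by apply: econtM; [apply/econt_cont; exact: continuous_expR_lin|exact: within_econt].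
move=> t0 ht0 e e0; have [r r0 rP] := H t0 ht0 e e0; exists r => // t ht htr.
by rewrite !E//; exact: rP.
Qed.

Lemma Rintegral_shift (G : R -> R) (a t : R) : 0 < t -> {within `[a, a + t], continuous G} ->
  \int[mu]_(s in `]a, a + t[) G s = \int[mu]_(s in `]0, t[) G (a + s).
Proof.
move=> t0 cG; pose F := fun s : R => a + s.
have dF (x : R) : is_derive x (1 : R) F (1 : R).
  by have := is_deriveD (is_derive_cst a x (1 : R)) (is_derive_id x (1 : R)); rewrite add0r.
have F1 : derive1 F = (fun=> 1) by apply/funext => x; rewrite derive1E; exact: derive_val.
have cF : continuous F by move=> x; apply: (@continuousD _ _ _ (fun=> a) id); [exact: cst_continuous|exact: id_cont].
have H := @integration_by_substitution_increasing R F G 0 t (ltW t0).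
have {H} : (\int[mu]_(x in `[F 0%R, F t]) (G x)%:E = \int[mu]_(x in `[0%R, t]) (((G \o F) * derive1 F) x)%:E)%E.
  apply: H; rewrite ?F1.
  - by move=> x y _ _ xy; rewrite ltrD2l.
  - by move=> x _; exact: cst_continuous.
  - by apply/cvg_ex; exists 1; exact: cvg_cst.
  - by apply/cvg_ex; exists 1; exact: cvg_cst.
  - split.
    + by move=> x _; case: (dF x).
    + by apply: cvg_at_right_filter; exact: cF.
    + by apply: cvg_at_left_filter; exact: cF.
  - by rewrite /F addr0.
rewrite F1 /F addr0 => H.
have mG : measurable_fun `]a, a + t[ G.
  apply: open_continuous_measurable_fun => // x; rewrite inE => hx.
  by apply: within_continuous_continuous cG hx; rewrite ltrDl.
have mG' : measurable_fun `]0, t[ (fun s => G (a + s)).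
  apply: open_continuous_measurable_fun => // x; rewrite inE/= in_itv/= => /andP[x0 xt].
  apply: (@continuous_comp _ _ _ F G); first exact: cF.
  apply: within_continuous_continuous cG _; first by rewrite ltrDl.
  by rewrite in_itv/= ltrDl x0 ltrD2l.
have E1 := @integral_itv_bndoo R a (a + t) (EFin \o G) true false (iffRL (measurable_EFinP _ _) mG).
have E2 := @integral_itv_bndoo R 0 t (EFin \o (fun s => G (a + s))) true false (iffRL (measurable_EFinP _ _) mG').
rewrite /Rintegral; move: E1 E2; rewrite /= => <- <-; rewrite H.
by congr fine; apply: eq_integral => s _; rewrite /= mulr1.
Qed.

Lemma duh1_restart lam T phi t1 t : 0 <= lam -> radm T phi -> 0 < t1 -> 0 < t -> t1 + t <= T ->
  duh1 lam phi (t1 + t) = expR (- (lam * t)) * duh1 lam phi t1 + duh1 lam (fun s => phi (t1 + s)) t.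
Proof.
move=> l0 aphi t10 t0 tT; rewrite {1}/duh1.
have ht : 0 < t1 + t <= T by rewrite addr_gt0.
have ht1 : 0 < t1 <= T by rewrite t10 (le_trans _ tT)// lerDl ltW.
have ii := integrable_duh l0 aphi ht.
have := Rintegral_itvB (a := BRight 0) (b := BLeft (t1 + t)) (x := t1) ii.
rewrite !bnd_simp => /(_ (ltW t10)); rewrite ltrDl => /(_ t0) /eqP.
rewrite subr_eq => /eqP ->; rewrite addrC; congr (_ + _).
  rewrite -Rintegral_itv_bndo_bndc; last first.
    apply: integrableS ii => // s /=; rewrite !in_itv/= => /andP[-> st]/=.
    by rewrite (lt_trans st)// ltrDl.
  rewrite -RintegralZl//; last exact: (integrable_duh l0 aphi ht1).
  by apply: eq_Rintegral => s _; rewrite mulrA -expRD; congr (expR _ * _); ring.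
rewrite Rintegral_shift//.
  by apply: eq_Rintegral => s _; rewrite opprD addrACA subrr add0r.
move: aphi => [c _]; move=> x; apply: (@continuousM _ _ ((fun s => expR (- (lam * (t1 + t - s)))) : subspace _ -> R) phi x).
  have h : {within `[t1, t1 + t], continuous (fun s => expR (- (lam * (t1 + t - s))))}.
    by apply: continuous_subspaceT; exact: cont_ker.
  exact: h.
have h2 : {within `[t1, t1 + t], continuous phi} := econt_within (econtS tT c) t10.
exact: h2.
Qed.

End scalar_duhamel.

(** * The Duhamel operator on Fourier coefficients *)

Section duhamel.
Context {R : realType} {d : nat}.
Variable nu : R.
Hypothesis nu0 : 0 < nu.
Local Notation mu := (@lebesgue_measure R).
Local Notation Z := 'rV[int]_d.
Local Notation kn := (@freq_norm R d).
Implicit Types (q : R -> Z -> R[i]) (T : R).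

Definition bs (t : R) (k : Z) : R := bih_symbol nu t k.
Definition rate (k : Z) : R := nu * kn k ^+ 4.

Lemma rate_ge0 k : 0 <= rate k.
Proof. by rewrite mulr_ge0 ?(ltW nu0)// exprn_ge0// kn_ge0. Qed.

Lemma bsE t k : bs t k = expR (- (rate k * t)).
Proof. by rewrite /bs /bih_symbol /rate; congr (expR (- _)); ring. Qed.

Lemma bs_gt0 t k : 0 < bs t k. Proof. exact: expR_gt0. Qed.

Lemma bs_le1 t k : 0 <= t -> bs t k <= 1.
Proof. by move=> t0; rewrite bsE -expR0 ler_expR oppr_le0 mulr_ge0// rate_ge0. Qed.

Lemma bsD s t k : bs (s + t) k = bs s k * bs t k.
Proof. by rewrite !bsE -expRD; congr expR; ring. Qed.

Lemma bs_k0 t : bs t 0 = 1.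
Proof. by rewrite bsE /rate kn0 expr0n mulr0 mul0r oppr0 expR0. Qed.

Definition cecont T (f : R -> R[i]) := forall t0, 0 < t0 <= T -> forall e, 0 < e ->
  exists2 r, 0 < r & forall t, 0 < t <= T -> `|t0 - t| < r -> cabs (f t0 - f t) < e.

Lemma cecont_ReIm T f : cecont T f <->
  econt T (fun t => complex.Re (f t)) /\ econt T (fun t => complex.Im (f t)).
Proof.
split=> [H|[H1 H2] t0 ht0 e e0].
  split=> t0 ht0 e e0; have [r r0 rP] := H t0 ht0 e e0; exists r => // t ht htr.
    by rewrite -ReBc; apply: le_lt_trans (Re_le_cabs _) _; exact: rP.
  by rewrite -ImBc; apply: le_lt_trans (Im_le_cabs _) _; exact: rP.
have e2 : 0 < e / 2 by rewrite divr_gt0.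
have [r r0 rP] := H1 t0 ht0 _ e2; have [r' r0' rP'] := H2 t0 ht0 _ e2.
exists (Num.min r r'); first by rewrite lt_min r0.
move=> t ht; rewrite lt_min => /andP[h1 h2].
apply: (le_lt_trans (cabs_le_ReIm _)); rewrite ReBc ImBc [ltRHS]splitr.
by apply: ltrD; [exact: rP|exact: rP'].
Qed.

(** The vector-valued version of [radm], frequency by frequency. *)
Definition adm T q := forall k, cecont T (fun s => q s k) /\
  exists M, forall s, 0 < s <= T -> cabs (q s k) <= M * s `^ (- (3 / 4)).

Lemma adm_Re T q k : adm T q -> radm T (fun s => complex.Re (q s k)).
Proof.
move=> /(_ k)[/cecont_ReIm[c _] [M H]]; split => //; exists M => s hs.
exact: le_trans (Re_le_cabs _) (H s hs).
Qed.

Lemma adm_Im T q k : adm T q -> radm T (fun s => complex.Im (q s k)).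
Proof.
move=> /(_ k)[/cecont_ReIm[_ c] [M H]]; split => //; exists M => s hs.
exact: le_trans (Im_le_cabs _) (H s hs).
Qed.

Lemma adm_abs T q k : adm T q -> radm T (fun s => cabs (q s k)).
Proof.
move=> /(_ k)[c [M H]]; split; last by exists M => s hs; rewrite ger0_norm ?cabs_ge0// H.
move=> t0 ht0 e e0; have [r r0 rP] := c t0 ht0 e e0; exists r => // t ht htr.
apply: le_lt_trans (rP t ht htr).
have h1 := cabsD (q t0 k - q t k) (q t k); have h2 := cabsD (q t k - q t0 k) (q t0 k).
rewrite subrK in h1; rewrite subrK cabs_distC in h2; rewrite ler_norml; apply/andP; split; lra.
Qed.

Lemma cecontB T f g : cecont T f -> cecont T g -> cecont T (fun t => f t - g t).
Proof.
move=> /cecont_ReIm[f1 f2] /cecont_ReIm[g1 g2]; apply/cecont_ReIm; split.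
  by have := econtB f1 g1; congr (econt T _); apply/funext => t; rewrite ReBc.
by have := econtB f2 g2; congr (econt T _); apply/funext => t; rewrite ImBc.
Qed.

Lemma cecontD T f g : cecont T f -> cecont T g -> cecont T (fun t => f t + g t).
Proof.
move=> /cecont_ReIm[f1 f2] /cecont_ReIm[g1 g2]; apply/cecont_ReIm; split.
  by have := econtD f1 g1; congr (econt T _); apply/funext => t; rewrite ReDc.
by have := econtD f2 g2; congr (econt T _); apply/funext => t; rewrite ImDc.
Qed.

Lemma cecont_bs T (z : R[i]) k : cecont T (fun t => (bs t k)%:C * z).
Proof.
have cb : econt T (fun t => bs t k).
  apply: econt_cont => t; have := @continuous_expR_lin _ (- rate k) 0 t.
  by congr (continuous_at _ _); apply/funext => s; rewrite bsE addr0 mulNr.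
apply/cecont_ReIm; split.
  have := econtM cb (econt_cont (T := T) (@cst_continuous _ _ (complex.Re z))).
  by congr (econt T _); apply/funext => s; rewrite ReMc/= mul0r subr0.
have := econtM cb (econt_cont (T := T) (@cst_continuous _ _ (complex.Im z))).
by congr (econt T _); apply/funext => s; rewrite ImMc/= mul0r addr0.
Qed.

Lemma admB T q1 q2 : adm T q1 -> adm T q2 -> adm T (fun s k => q1 s k - q2 s k).
Proof.
move=> H1 H2 k; have [c1 [M1 h1]] := H1 k; have [c2 [M2 h2]] := H2 k.
split; first exact: cecontB.
exists (M1 + M2) => s hs; rewrite mulrDl; apply: (le_trans (cabsB _ _)).
by apply: lerD; [exact: h1|exact: h2].
Qed.

(** The Duhamel term of the mild formulation for the source [q]. *)
Definition duh q t k : R[i] :=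
  duh1 (rate k) (fun s => complex.Re (q s k)) t +i* duh1 (rate k) (fun s => complex.Im (q s k)) t.

Lemma duh_econt T q k : adm T q -> cecont T (fun t => duh q t k).
Proof.
move=> aq; apply/cecont_ReIm; split; apply: duh1_econt (rate_ge0 k) _.
  exact: adm_Re.
exact: adm_Im.
Qed.

Lemma duhB T q1 q2 t k : adm T q1 -> adm T q2 -> 0 < t <= T ->
  duh (fun s k => q1 s k - q2 s k) t k = duh q1 t k - duh q2 t k.
Proof.
move=> a1 a2 ht; apply: complex_ext; rewrite ?ReBc ?ImBc /=.
  rewrite -(duh1B (rate_ge0 k) (adm_Re k a1) (adm_Re k a2) ht); congr (duh1 _ _ _).
  by apply/funext => s; rewrite ReBc.
rewrite -(duh1B (rate_ge0 k) (adm_Im k a1) (adm_Im k a2) ht); congr (duh1 _ _ _).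
by apply/funext => s; rewrite ImBc.
Qed.

Lemma duh_restart T q t1 t k : adm T q -> 0 < t1 -> 0 < t -> t1 + t <= T ->
  duh q (t1 + t) k = (bs t k)%:C * duh q t1 k + duh (fun s => q (t1 + s)) t k.
Proof.
move=> aq t10 t0 tT; apply: complex_ext; rewrite ?ReDc ?ImDc ?ReMc ?ImMc /= mul0r ?subr0 ?addr0 bsE.
  exact: (duh1_restart (rate_ge0 k) (adm_Re k aq)).
exact: (duh1_restart (rate_ge0 k) (adm_Im k aq)).
Qed.

(** Minkowski's integral inequality in dual form: against finitely many weights [y], the Duhamel
   integral is bounded by the time integral of the weighted source.  The factor [2] comes from
   treating real and imaginary parts separately. *)
Lemma duh_le T q t (s : seq Z) (y : Z -> R) (g : R -> R) (I : R) : adm T q -> 0 < t <= T ->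
  (forall k, 0 <= y k) -> mu.-integrable `]0, t[ (EFin \o g) ->
  (forall u, 0 < u < t -> \sum_(k <- s) y k * (bs (t - u) k * cabs (q u k)) <= g u) ->
  \int[mu]_(u in `]0, t[) g u <= I ->
  \sum_(k <- s) y k * cabs (duh q t k) <= 2 * I.
Proof.
move=> aq ht y0 ig hg hI.
pose f k u := expR (- (rate k * (t - u))) * cabs (q u k).
have fi k : mu.-integrable `]0, t[ (EFin \o f k).
  exact: (integrable_duh (rate_ge0 k) (adm_abs k aq) ht).
have le1 k : cabs (duh q t k) <= 2 * \int[mu]_(u in `]0, t[) f k u.
  apply: (le_trans (cabs_le_ReIm _)); rewrite [_ * (\int[mu]_(u in _) _)]mulrDl !mul1r /=.
  apply: lerD.
    apply: (le_trans (duh1_norm (rate_ge0 k) (adm_Re k aq) ht)); apply: le_Rintegral => //.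
      have := integrable_duh (rate_ge0 k) _ ht; apply.
      have [c [M HM]] := adm_Re k aq; split; last by exists M => u hu; rewrite normr_id; exact: HM.
      move=> t0 ht0 e e0; have [r r0 rP] := c t0 ht0 e e0; exists r => // u hu hur.
      by apply: le_lt_trans (rP u hu hur); exact: ler_dist_dist.
    by move=> u _; rewrite ler_wpM2l ?expR_ge0// Re_le_cabs.
  apply: (le_trans (duh1_norm (rate_ge0 k) (adm_Im k aq) ht)); apply: le_Rintegral => //.
    have := integrable_duh (rate_ge0 k) _ ht; apply.
    have [c [M HM]] := adm_Im k aq; split; last by exists M => u hu; rewrite normr_id; exact: HM.
    move=> t0 ht0 e e0; have [r r0 rP] := c t0 ht0 e e0; exists r => // u hu hur.
    by apply: le_lt_trans (rP u hu hur); exact: ler_dist_dist.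
  by move=> u _; rewrite ler_wpM2l ?expR_ge0// Im_le_cabs.
have sumI (r : seq Z) : mu.-integrable `]0, t[ (EFin \o (fun u => \sum_(k <- r) y k * f k u)) /\
   \int[mu]_(u in `]0, t[) (\sum_(k <- r) y k * f k u) = \sum_(k <- r) y k * \int[mu]_(u in `]0, t[) f k u.
  elim: r => [|k r [IH1 IH2]].
    have -> : (fun u => \sum_(k <- [::]) y k * f k u) = (fun=> 0) by apply/funext => u; rewrite big_nil.
    split; last by rewrite big_nil Rintegral_cst// mul0r.
    exact: integrable0.
  have ik : mu.-integrable `]0, t[ (EFin \o (fun u => y k * f k u)).
    have : mu.-integrable `]0, t[ (fun u => (y k)%:E * (f k u)%:E)%E.
      by apply: integrableZl => //; exact: fi.
    by apply: eq_integrable => // u _; rewrite /= EFinM.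
  have -> : (fun u => \sum_(j <- k :: r) y j * f j u) =
    (fun u => y k * f k u + \sum_(j <- r) y j * f j u) by apply/funext => u; rewrite big_cons.
  split; last by rewrite RintegralD// IH2 big_cons RintegralZl.
  pose fa u := y k * f k u; pose fb u := \sum_(j <- r) y j * f j u.
  have : mu.-integrable `]0, t[ ((EFin \o fa) \+ (EFin \o fb))%E by apply: integrableD.
  by apply: eq_integrable => // u _; rewrite /= EFinD.
have [i1 i2] := sumI s.
apply: (@le_trans _ _ (2 * \int[mu]_(u in `]0, t[) (\sum_(k <- s) y k * f k u))).
  rewrite i2 mulr_sumr; apply: ler_sum => k _; rewrite mulrCA ler_wpM2l//.
rewrite ler_wpM2l//; apply: le_trans hI; apply: le_Rintegral => // u; rewrite /= in_itv/= => hu.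
by apply: le_trans (hg u hu); rewrite le_eqVlt; apply/orP; left; apply/eqP; apply: eq_bigr => k _; rewrite /f bsE.
Qed.

(** The form in which the mild formulation writes the Duhamel term. *)
Lemma duh_Cintegral T q t k : adm T q -> 0 < t <= T ->
  Cintegral mu `[0, t] (fun s => (bs (t - s) k)%:C * q s k) = duh q t k.
Proof.
move=> aq ht; rewrite /Cintegral /duh /duh1; congr (_ +i* _).
  rewrite Rintegral_oo_cc; last exact: (integrable_duh (rate_ge0 k) (adm_Re k aq) ht).
  by apply: eq_Rintegral => s _; rewrite ReMc/= mul0r subr0 bsE.
rewrite Rintegral_oo_cc; last exact: (integrable_duh (rate_ge0 k) (adm_Im k aq) ht).
by apply: eq_Rintegral => s _; rewrite ImMc/= mul0r addr0 bsE.
Qed.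

End duhamel.

Section duh_algebra.
Context {R : realType} {d : nat}.
Variable nu : R.
Hypothesis nu0 : 0 < nu.
Local Notation Z := 'rV[int]_d.
Implicit Types (q : R -> Z -> R[i]).

Lemma duh_zero q t k : (forall s, 0 < s < t -> q s k = 0) -> duh nu q t k = 0.
Proof.
move=> h; have z : \int[@lebesgue_measure R]_(s in `]0, t[) (0 : R) = 0.
  by rewrite Rintegral_cst// mul0r.
apply: complex_ext; rewrite /= -[RHS]z; apply: eq_Rintegral => s; rewrite inE/= in_itv/= => hs;
  by rewrite h//= mulr0.
Qed.

Lemma duh_ext_on q q' t k : (forall s, 0 < s < t -> q s k = q' s k) -> duh nu q t k = duh nu q' t k.
Proof.
move=> h; apply: complex_ext; rewrite /= /duh1; apply: eq_Rintegral => s; rewrite inE/= in_itv/= => hs;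
  by rewrite h.
Qed.

Lemma duh_conj T q t k : adm T q -> 0 < t <= T -> (forall s, 0 < s < t -> q s (- k) = (q s k)^*%C) ->
  duh nu q t (- k) = (duh nu q t k)^*%C.
Proof.
move=> aq ht h; have rN : rate nu (- k) = rate nu k by rewrite /rate knN.
apply: complex_ext; rewrite /= /duh1 rN.
  by apply: eq_Rintegral => s; rewrite inE/= in_itv/= => hs; rewrite h//; case: (q s k).
rewrite -[RHS]mulN1r -RintegralZl//; last exact: (integrable_duh (rate_ge0 nu0 k) (adm_Im k aq) ht).
apply: eq_Rintegral => s; rewrite inE/= in_itv/= => hs; rewrite h//; case: (q s k) => a b /=.
by rewrite mulrN mulN1r.
Qed.

End duh_algebra.

(** * The cubic nonlinearity *)

Section cubic.
Context {R : realType} {d : nat}.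
Local Notation pt := 'rV[R]_d.
Local Notation Z := 'rV[int]_d.
Local Notation kn := (@freq_norm R d).
Local Notation kappa := (@kappa R d).
Implicit Types (u v : 'I_d -> pt -> R).

(** The flux as a function of an arbitrary field in place of the gradient. *)
Definition cub u (j : 'I_d) (x : pt) : R := (\sum_i u i x ^+ 2 - 1) * u j x.

Lemma flux_cub (f : pt -> R) j : flux f j = cub (fun i => partial i f) j.
Proof.
apply/funext => x; rewrite /flux /cub /sqnorm mxE; congr ((_ - _) * _).
by apply: eq_bigr => i _; rewrite mxE.
Qed.

Lemma pcont_cub u j : (forall i, pcont (u i)) -> pcont (cub u j).
Proof.
move=> pu; apply: pcontM => //; apply: pcontB; last exact: pcont_cst.
by apply: pcont_sum => i; exact: pcontX.
Qed.

Lemma cub_sub u v j x : cub u j x - cub v j x =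
  \sum_i ((u i x - v i x) * u i x * u j x + v i x * (u i x - v i x) * u j x +
    v i x * v i x * (u j x - v j x)) - (u j x - v j x).
Proof.
have -> : \sum_i ((u i x - v i x) * u i x * u j x + v i x * (u i x - v i x) * u j x +
    v i x * v i x * (u j x - v j x)) = \sum_i u i x ^+ 2 * u j x - \sum_i v i x ^+ 2 * v j x.
  by rewrite -sumrB; apply: eq_bigr => i _; ring.
by rewrite /cub !mulrBl -!mulr_suml; ring.
Qed.

Lemma cub_lip u v j x (A : R) : (forall i, `|u i x| <= A) -> (forall i, `|v i x| <= A) ->
  `|cub u j x - cub v j x| <= ((d%:R + 2) * A ^+ 2 + 1) * \sum_i `|u i x - v i x|.
Proof.
move=> uA vA; have A0 : 0 <= A := le_trans (normr_ge0 _) (uA j).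
set S := \sum_i _; have S0 : 0 <= S by exact: sumr_ge0.
have jS : `|u j x - v j x| <= S by rewrite /S (bigD1 j)//= lerDl sumr_ge0.
rewrite cub_sub; apply: (le_trans (ler_normB _ _)); rewrite [leRHS]mulrDl mul1r lerD//.
apply: (le_trans (ler_norm_sum _ _ _)).
apply: (@le_trans _ _ (\sum_i (2 * A ^+ 2 * `|u i x - v i x| + A ^+ 2 * S))).
  apply: ler_sum => i _.
  have -> : 2 * A ^+ 2 * `|u i x - v i x| + A ^+ 2 * S =
    `|u i x - v i x| * A * A + A * `|u i x - v i x| * A + A * A * S by ring.
  apply: (le_trans (ler_normD _ _)); apply: lerD; last by rewrite !normrM !ler_pM ?mulr_ge0.
  by apply: (le_trans (ler_normD _ _)); apply: lerD; rewrite !normrM !ler_pM ?mulr_ge0.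
rewrite big_split/= -mulr_sumr -/S sumr_const card_ord -[X in _ + X]mulr_natl le_eqVlt; apply/orP; left; apply/eqP.
ring.
Qed.

Lemma cub0 j x : cub (fun _ _ => 0) j x = 0.
Proof. by rewrite /cub mulr0. Qed.

(** The Fourier coefficients of the divergence of the flux. *)
Definition nlu u (k : Z) : R[i] := \sum_j (0 +i* (k 0 j)%:~R) * fourier (cub u j) k.

Lemma nlu0 u : nlu u 0 = 0.
Proof. by rewrite /nlu big1// => j _; rewrite mxE mul0r. Qed.

Lemma nlu_sub u v k : cabs (nlu u k - nlu v k) <=
  kn k * \sum_j cabs (fourier (cub u j) k - fourier (cub v j) k).
Proof.
rewrite /nlu -sumrB; apply: (le_trans (cabs_sum _ _ _)); rewrite mulr_sumr.
apply: ler_sum => j _; rewrite -mulrBr cabsM cabs_imag ler_wpM2r ?cabs_ge0//.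
exact: coord_le_kn.
Qed.

Lemma nlu_le u k : cabs (nlu u k) <= kn k * \sum_j cabs (fourier (cub u j) k).
Proof.
apply: (le_trans (cabs_sum _ _ _)); rewrite mulr_sumr.
apply: ler_sum => j _; rewrite cabsM cabs_imag ler_wpM2r ?cabs_ge0//.
exact: coord_le_kn.
Qed.

Definition fcst : R := 2 * (2 * pi) ^+ d.

Lemma fcst_ge0 : 0 <= fcst.
Proof. by rewrite mulr_ge0// exprn_ge0// ltW// pi2_gt0. Qed.

Lemma fourier_cub_lip u v j k (A D : R) : (forall i, pcont (u i)) -> (forall i, pcont (v i)) ->
  (forall i x, `|u i x| <= A) -> (forall i x, `|v i x| <= A) -> (forall i x, `|u i x - v i x| <= D) ->
  cabs (fourier (cub u j) k - fourier (cub v j) k) <= fcst * (((d%:R + 2) * A ^+ 2 + 1) * (d%:R * D)).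
Proof.
move=> pu pv uA vA uv; have A0 : 0 <= A := le_trans (normr_ge0 _) (uA j 0).
have Iu := pcont_bpt (pcont_cub j pu); have Iv := pcont_bpt (pcont_cub j pv).
rewrite -fourierB; [|exact: bpt_tI..].
have := @fourier_le R d (fun x => cub u j x - cub v j x) k (((d%:R + 2) * A ^+ 2 + 1) * (d%:R * D)) (bptB Iu Iv).
rewrite mulrAC; apply => x; apply: (le_trans (cub_lip _ (uA ^~ x) (vA ^~ x))).
rewrite ler_wpM2l//; first by rewrite addr_ge0// mulr_ge0// exprn_ge0.
apply: (@le_trans _ _ (\sum_(i < d) D)); last by rewrite sumr_const card_ord mulr_natl.
by apply: ler_sum.
Qed.

Lemma nlu_lip u v k (A D : R) : (forall i, pcont (u i)) -> (forall i, pcont (v i)) ->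
  (forall i x, `|u i x| <= A) -> (forall i x, `|v i x| <= A) -> (forall i x, `|u i x - v i x| <= D) ->
  cabs (nlu u k - nlu v k) <= kn k * (d%:R * (fcst * (((d%:R + 2) * A ^+ 2 + 1) * (d%:R * D)))).
Proof.
move=> pu pv uA vA uv; apply: (le_trans (nlu_sub _ _ _)); rewrite ler_wpM2l ?kn_ge0//.
rewrite [leRHS]mulr_natl -[X in _ *+ X]card_ord -sumr_const; apply: ler_sum => j _.
exact: fourier_cub_lip.
Qed.

Lemma nlu_zero k : nlu (fun _ _ => 0) k = 0.
Proof.
rewrite /nlu big1// => j _.
have -> : cub (fun _ _ => 0) j = (fun x : pt => 0 * 0) by apply/funext => x; rewrite cub0 mulr0.
by rewrite fourierZ ?mul0r ?mulr0//; apply: bpt_tI; exact: bpt_cst.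
Qed.

Lemma nlu_bound u k (A : R) : (forall i, pcont (u i)) -> (forall i x, `|u i x| <= A) -> 0 <= A ->
  cabs (nlu u k) <= kn k * (d%:R * (fcst * (((d%:R + 2) * A ^+ 2 + 1) * (d%:R * A)))).
Proof.
move=> pu uA A0; have := @nlu_lip u (fun _ _ => 0) k A A pu (fun=> pcont_cst 0) uA.
rewrite nlu_zero subr0; apply => i x; first by rewrite normr0.
by rewrite subr0.
Qed.

(** A field of size [s^(-1/4)], continuous in time for the supremum norm, has a flux of size
   [s^(-3/4)], the strongest singularity that the Duhamel integral admits. *)
Lemma adm_nlu (u : R -> 'I_d -> pt -> R) (T A : R) : 0 <= A ->
  (forall s, 0 < s <= T -> forall i, pcont (u s i)) ->
  (forall s, 0 < s <= T -> forall i x, `|u s i x| <= A * s `^ (- 4^-1)) ->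
  (forall s0, 0 < s0 <= T -> forall e, 0 < e -> exists2 r, 0 < r &
     forall s, 0 < s <= T -> `|s0 - s| < r -> forall i x, `|u s0 i x - u s i x| <= e) ->
  adm T (fun s => nlu (u s)).
Proof.
move=> A0 pu uA uc k; split.
  move=> s0 hs0 e e0; have /andP[s00 s0T] := hs0.
  pose B := A * (s0 / 2) `^ (- 4^-1).
  have B0 : 0 <= B by rewrite mulr_ge0// powR_ge0.
  pose K := kn k * (d%:R * (fcst * (((d%:R + 2) * B ^+ 2 + 1) * d%:R))).
  have K0 : 0 <= K.
    have K1 : 0 <= (d%:R + 2) * B ^+ 2 + 1 by rewrite addr_ge0// mulr_ge0 ?addr_ge0// exprn_ge0.
    have h := fcst_ge0; have h2 := kn_ge0 (R := R) k; by rewrite /K; do 4! (apply: mulr_ge0 => //).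
  have [r r0 rP] := uc s0 hs0 (e / (K + 1)) (divr_gt0 e0 (ltr_wpDl K0 ltr01)).
  exists (Num.min r (s0 / 2)); first by rewrite lt_min r0 divr_gt0.
  move=> s hs; rewrite lt_min => /andP[h1 h2].
  have s2 : s0 / 2 <= s by move: h2; rewrite ltr_norml => /andP[_ h2]; lra.
  have hB t : 0 < t <= T -> s0 / 2 <= t -> forall i x, `|u t i x| <= B.
    move=> ht tt i x; apply: (le_trans (uA t ht i x)); rewrite ler_wpM2l//.
    by apply: powR_antitone => //; rewrite ?divr_gt0// invr_ge0.
  have hB0 : s0 / 2 <= s0 by lra.
  apply: (le_lt_trans (nlu_lip k (pu _ hs0) (pu _ hs) (hB _ hs0 hB0) (hB _ hs s2) (rP s hs h1))).
  have -> : kn k * (d%:R * (fcst * (((d%:R + 2) * B ^+ 2 + 1) * (d%:R * (e / (K + 1)))))) = K * (e / (K + 1)).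
    by rewrite /K; ring.
  by rewrite mulrCA -[ltRHS]mulr1 ltr_pM2l// ltr_pdivrMr ?ltr_wpDl// mul1r ltrDl.
have [T0|T0] := leP T 0.
  by exists 0 => s /andP[h1 h2]; have := lt_le_trans h1 (le_trans h2 T0); rewrite ltxx.
exists (kn k * (d%:R * (fcst * (((d%:R + 2) * A ^+ 2 + T `^ 2^-1) * (d%:R * A))))).
move=> s hs; have /andP[s0 sT] := hs.
have As0 : 0 <= A * s `^ (- 4^-1) by rewrite mulr_ge0// powR_ge0.
apply: (le_trans (nlu_bound k (pu s hs) (uA s hs) As0)).
move: fcst fcst_ge0 => F F0.
rewrite -!mulrA; apply: ler_wpM2l; first exact: kn_ge0.
apply: ler_wpM2l => //; apply: ler_wpM2l => //.
have E : s `^ (- (3 / 4)) = (s `^ (- 4^-1)) ^+ 2 * s `^ (- 4^-1).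
  rewrite -powR_mulrn ?powR_ge0// -powRrM -powRD; last by rewrite (gt_eqF s0) implybT.
  by congr (_ `^ _); field.
have E2 : s `^ (- 4^-1) = s `^ (2^-1) * s `^ (- (3 / 4)).
  by rewrite -powRD ?(gt_eqF s0) ?implybT//; congr (_ `^ _); field.
have h1 : s `^ 2^-1 <= T `^ 2^-1 by apply: ge0_ler_powR; rewrite ?nnegrE ?invr_ge0// ltW.
set P := s `^ (- 4^-1) in E E2 *; set Q := s `^ (- (3 / 4)) in E E2 *.
have Q0 : 0 <= Q by exact: powR_ge0.
have -> : ((d%:R + 2) * (A * P) ^+ 2 + 1) * (d%:R * (A * P)) =
   d%:R * A * ((d%:R + 2) * A ^+ 2 * Q + P) by rewrite E; ring.
have -> : ((d%:R + 2) * A ^+ 2 + T `^ 2^-1) * (d%:R * (A * Q)) =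
   d%:R * A * ((d%:R + 2) * A ^+ 2 * Q + T `^ 2^-1 * Q) by ring.
rewrite ler_wpM2l ?mulr_ge0// lerD2l {1}E2; exact: ler_wpM2r.
Qed.

(** ** Estimates in weighted Wiener norms *)

Lemma fourierM_l1 (f g : pt -> R) A B : (0 < d)%N -> pcont f -> pcont g ->
  L1le (fun k => cabs (fourier f k)) A -> L1le (fun k => cabs (fourier g k)) B ->
  L1le (fun k => cabs (fourier (fun x => f x * g x) k)) (kappa * (A * B)).
Proof.
move=> d0 pf pg hA hB.
have e (h : pt -> R) : (fun k => cabs (fourier h k)) = (fun k => 1 * cabs (fourier h k)).
  by apply/funext => k; rewrite mul1r.
rewrite e in hA; rewrite e in hB; rewrite e.
by apply: (@fourierM_L1 R d f g d0 pf pg (fun=> 1)) => // k l; rewrite mul1r.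
Qed.

Section wiener.
Variable W : Z -> R.
Hypothesis W1 : forall k, 1 <= W k.
Hypothesis WM : forall k l, W (k + l) <= W k * W l.
Hypothesis d0 : (0 < d)%N.

Let wl (f : pt -> R) (A : R) := L1le (fun k => W k * cabs (fourier f k)) A.

Lemma wl_M (f g : pt -> R) A B : pcont f -> pcont g -> wl f A -> wl g B ->
  wl (fun x => f x * g x) (kappa * (A * B)).
Proof. by move=> pf pg; apply: fourierM_L1. Qed.

Lemma wl_M3 (f g h : pt -> R) A B C : pcont f -> pcont g -> pcont h -> wl f A -> wl g B -> wl h C ->
  wl (fun x => f x * g x * h x) (kappa ^+ 2 * (A * B * C)).
Proof.
move=> pf pg ph fA gB hC; have := wl_M (pcontM pf pg) ph (wl_M pf pg fA gB) hC.
by congr (wl _ _); ring.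
Qed.

Lemma wl_D (f g : pt -> R) A B : pcont f -> pcont g -> wl f A -> wl g B ->
  wl (fun x => f x + g x) (A + B).
Proof.
move=> pf pg fA gB; apply: L1le_le (L1leD fA gB) => // k.
rewrite fourierD; [|exact/bpt_tI/pcont_bpt..].
by rewrite -mulrDr ler_wpM2l ?cabsD// (le_trans ler01).
Qed.

Lemma wl_B (f g : pt -> R) A B : pcont f -> pcont g -> wl f A -> wl g B ->
  wl (fun x => f x - g x) (A + B).
Proof.
move=> pf pg fA gB; apply: L1le_le (L1leD fA gB) => // k.
rewrite fourierB; [|exact/bpt_tI/pcont_bpt..].
by rewrite -mulrDr ler_wpM2l ?cabsB// (le_trans ler01).
Qed.

Lemma wl_sum (F : 'I_d -> pt -> R) A : (forall i, pcont (F i)) -> (forall i, wl (F i) A) ->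
  wl (fun x => \sum_i F i x) (d%:R * A).
Proof.
move=> pF hF; have -> : d%:R * A = \sum_(i < d) A by rewrite sumr_const card_ord mulr_natl.
apply: L1le_le (L1le_sum (index_enum 'I_d) (M := fun=> A) hF) => // k.
have -> : fourier (fun x => \sum_i F i x) k = \sum_i fourier (F i) k.
  by apply: fourier_sum => i; exact: pcont_bpt.
by rewrite -mulr_sumr ler_wpM2l ?cabs_sum// (le_trans ler01).
Qed.

(** The difference of two cubic terms is a sum of products with one factor [u - v]. *)
Lemma wl_cub_sub u v j (A D : R) : (forall i, pcont (u i)) -> (forall i, pcont (v i)) ->
  (forall i, wl (u i) A) -> (forall i, wl (v i) A) -> (forall i, wl (fun x => u i x - v i x) D) ->
  L1le (fun k => W k * cabs (fourier (cub u j) k - fourier (cub v j) k))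
    ((3 * d%:R * kappa ^+ 2 * A ^+ 2 + 1) * D).
Proof.
move=> pu pv uA vA uvD.
have pw i : pcont (fun x => u i x - v i x) by exact: pcontB.
have := wl_B (f := fun x => \sum_i ((u i x - v i x) * u i x * u j x + v i x * (u i x - v i x) * u j x +
    v i x * v i x * (u j x - v j x))) (A := d%:R * (3 * (kappa ^+ 2 * (A ^+ 2 * D)))) _ (pw j) _ (uvD j).
have pF i : pcont (fun x => (u i x - v i x) * u i x * u j x + v i x * (u i x - v i x) * u j x +
    v i x * v i x * (u j x - v j x)).
  by apply: pcontD; [apply: pcontD|]; apply: pcontM => //; apply: pcontM.
have hF i : wl (fun x => (u i x - v i x) * u i x * u j x + v i x * (u i x - v i x) * u j x +
    v i x * v i x * (u j x - v j x)) (3 * (kappa ^+ 2 * (A ^+ 2 * D))).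
  have h1 := wl_M3 (pw i) (pu i) (pu j) (uvD i) (uA i) (uA j).
  have h2 := wl_M3 (pv i) (pw i) (pu j) (vA i) (uvD i) (uA j).
  have h3 := wl_M3 (pv i) (pv i) (pw j) (vA i) (vA i) (uvD j).
  have pA := pcontM (pcontM (pw i) (pu i)) (pu j).
  have pB := pcontM (pcontM (pv i) (pw i)) (pu j).
  have pC := pcontM (pcontM (pv i) (pv i)) (pw j).
  have := wl_D (pcontD pA pB) pC (wl_D pA pB h1 h2) h3.
  by congr (wl _ _); ring.
move=> /(_ (pcont_sum _ pF) (wl_sum pF hF)); rewrite /wl => H.
have -> : (3 * d%:R * kappa ^+ 2 * A ^+ 2 + 1) * D = d%:R * (3 * (kappa ^+ 2 * (A ^+ 2 * D))) + D by ring.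
apply: L1le_le H => // k; rewrite ler_wpM2l ?(le_trans ler01)//.
rewrite -fourierB; [|exact/bpt_tI/pcont_bpt/pcont_cub..].
by under eq_fun do rewrite cub_sub.
Qed.

Variable rho : Z -> R.
Variable C : R.
Hypothesis rho0 : forall k, 0 <= rho k.
Hypothesis C0 : 0 <= C.
Hypothesis rhoD : forall k l, rho (k + l) <= C * (rho k + rho l).

(** By the Leibniz rule of the weight, one factor takes the weighted [l2] norm and
   the others the [l1] norm. *)
Lemma l2_cub u j (A K : R) : (forall i, pcont (u i)) ->
  (forall i, L1le (fun k => cabs (fourier (u i) k)) A) ->
  (forall i, L2le (fun k => rho k * cabs (fourier (u i) k)) K) ->
  L2le (fun k => rho k * cabs (fourier (cub u j) k))
    ((d%:R * (kappa ^+ 2 * C * (2 * C + 1)) * A ^+ 2 + 1) * K).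
Proof.
move=> pu uA uK.
have K0 : 0 <= K by case: (uK j).
have A0 := L1le_ge0 (uA j).
pose G i x := u i x * u i x * u j x.
have pG i : pcont (G i) by apply: pcontM => //; apply: pcontM.
have hG i : L2le (fun k => rho k * cabs (fourier (G i) k)) (kappa ^+ 2 * C * (2 * C + 1) * A ^+ 2 * K).
  have p2 := pcontM (pu i) (pu i).
  have h2 := fourierM_L2 d0 (pu i) (pu i) rho0 C0 rhoD (uA i) (uK i) (uA i) (uK i).
  have h1 : L1le (fun k => cabs (fourier (fun x => u i x * u i x) k)) (kappa * (A * A)).
    exact: fourierM_l1 d0 (pu i) (pu i) (uA i) (uA i).
  have := fourierM_L2 d0 p2 (pu j) rho0 C0 rhoD h1 h2 (uA j) (uK j).
  by congr (L2le _ _); ring.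
have hS : L2le (fun k => \sum_(i <- index_enum 'I_d) rho k * cabs (fourier (G i) k))
   (\sum_(i <- index_enum 'I_d) kappa ^+ 2 * C * (2 * C + 1) * A ^+ 2 * K).
  elim: (index_enum 'I_d) => [|i r IH].
    under eq_fun do rewrite big_nil; rewrite big_nil; split => // s us.
    by under eq_bigr do rewrite expr0n; rewrite big1// expr0n.
  under eq_fun do rewrite big_cons; rewrite big_cons; apply: L2leD => // k.
    by rewrite mulr_ge0 ?cabs_ge0.
  by rewrite sumr_ge0// => l _; rewrite mulr_ge0 ?cabs_ge0.
have := L2leD (a := fun k => \sum_i rho k * cabs (fourier (G i) k)) _ _ hS (uK j).
rewrite sumr_const card_ord -[X in X + _]mulr_natl.
have -> : d%:R * (kappa ^+ 2 * C * (2 * C + 1) * A ^+ 2 * K) + K =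
  (d%:R * (kappa ^+ 2 * C * (2 * C + 1)) * A ^+ 2 + 1) * K by ring.
move=> H; apply: L2le_le (H _ _) => // k; last 2 first.
- by rewrite sumr_ge0// => l _; rewrite mulr_ge0 ?cabs_ge0.
- by rewrite mulr_ge0 ?cabs_ge0.
rewrite mulr_ge0 ?cabs_ge0//= -mulr_sumr -mulrDr ler_wpM2l//.
have -> : cub u j = (fun x => \sum_i G i x - u j x).
  by apply/funext => x; rewrite /cub mulrBl mul1r mulr_suml; congr (_ - _); apply: eq_bigr => i _; rewrite expr2.
rewrite fourierB; [|exact/bpt_tI/pcont_bpt/pcont_sum|exact/bpt_tI/pcont_bpt].
apply: (le_trans (cabsB _ _)); rewrite lerD2r.
have -> : fourier (fun x => \sum_i G i x) k = \sum_i fourier (G i) k.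
  by apply: fourier_sum => i; exact: pcont_bpt.
exact: cabs_sum.
Qed.

End wiener.

End cubic.

(** * Uniqueness *)

Section multipliers.
Context {R : realType}.

Lemma expRN_powR (x p : R) : 0 < x -> 0 <= p <= 1 -> expR (- x) <= x `^ (- p).
Proof.
move=> x0 /andP[p0 p1]; rewrite expRN powRN lef_pV2 ?posrE ?expR_gt0 ?powR_gt0//.
apply: (@le_trans _ _ (1 + x)); last exact: expR_ge1Dx.
have [x1|x1] := leP x 1.
  apply: (@le_trans _ _ 1); last by rewrite lerDl ltW.
  have -> : 1 = (1 : R) `^ p by rewrite powR1.
  by apply: ge0_ler_powR; rewrite ?nnegrE// ltW.
apply: (@le_trans _ _ x); last by rewrite lerDr.
by rewrite -[leRHS]powRr1 ?(ltW x0)//; apply: ler_powR => //; exact: ltW.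
Qed.

(** Parabolic smoothing: the power of the frequency is traded for a power of time. *)
Lemma smoothing (a y p : R) (n : nat) : 0 < a -> 0 <= y -> 0 <= p <= 1 -> n%:R = 4 * p ->
  y ^+ n * expR (- (a * y ^+ 4)) <= a `^ (- p).
Proof.
move=> a0; rewrite le_eqVlt => /predU1P[<-|y0] hp np.
  case: n np => [|n] np; last by rewrite expr0n mul0r powR_ge0.
  have -> : p = 0 by move: np; rewrite mulr0n => h; lra.
  by rewrite oppr0 powRr0 expr0 mul1r -expR0 ler_expR expr0n/= mulr0 oppr0.
have ay : 0 < a * y ^+ 4 by rewrite mulr_gt0// exprn_gt0.
apply: (@le_trans _ _ (y ^+ n * (a * y ^+ 4) `^ (- p))).
  by rewrite ler_wpM2l ?exprn_ge0 ?(ltW y0)// expRN_powR.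
rewrite powRM ?(ltW a0) ?exprn_ge0 ?(ltW y0)// mulrCA -[leRHS]mulr1 ler_wpM2l ?powR_ge0//.
rewrite -!powR_mulrn ?(ltW y0)// -powRrM -powRD ?(gt_eqF y0) ?implybT//.
by rewrite (_ : n%:R + 4 * - p = 0) ?powRr0// np; ring.
Qed.

Local Notation mu := (@lebesgue_measure R).

Lemma integrable_lin (c t : R) f : mu.-integrable `]0, t[ (EFin \o f) ->
  mu.-integrable `]0, t[ (EFin \o (fun u => c * f u)).
Proof.
move=> hf; have : mu.-integrable `]0, t[ (fun u => c%:E * (f u)%:E)%E by apply: integrableZl.
by apply: eq_integrable => // u _; rewrite /= EFinM.
Qed.

Lemma integrable_add (t : R) f g : mu.-integrable `]0, t[ (EFin \o f) ->
  mu.-integrable `]0, t[ (EFin \o g) -> mu.-integrable `]0, t[ (EFin \o (fun u => f u + g u)).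
Proof.
move=> hf hg; have : mu.-integrable `]0, t[ ((EFin \o f) \+ (EFin \o g))%E by apply: integrableD.
by apply: eq_integrable => // u _; rewrite /= EFinD.
Qed.

End multipliers.

Section uniqueness.
Context {R : realType} {d : nat}.
Variable nu : R.
Hypothesis nu0 : 0 < nu.
Hypothesis d0 : (0 < d)%N.
Local Notation mu := (@lebesgue_measure R).
Local Notation pt := 'rV[R]_d.
Local Notation Z := 'rV[int]_d.
Local Notation kn := (@freq_norm R d).
Local Notation kappa := (@kappa R d).
Local Notation bs := (bs nu).
Local Notation duh := (duh nu).
Implicit Types (h g : R -> pt -> R) (c : Z -> R[i]).

Lemma kn_bs_le t k n p : 0 < t -> 0 <= p <= 1 -> n%:R = 4 * p ->
  kn k ^+ n * bs t k <= (nu * t) `^ (- p).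
Proof.
move=> t0 hp np; rewrite bsE.
have -> : rate nu k * t = (nu * t) * kn k ^+ 4 by rewrite /rate; ring.
by apply: smoothing; rewrite ?mulr_gt0 ?kn_ge0.
Qed.

Definition gr h (s : R) (i : 'I_d) : pt -> R := partial i (h s).

(** What uniqueness uses of a solution with initial coefficients [c0]. The smallness [flow_small]
   at the initial time is the substitute for subcriticality. *)
Record flow c0 (T : R) h : Prop := Flow {
  flow_reg : forall t, 0 < t <= T ->
    [/\ torus_periodic (h t), Ck 1 (h t) & exists M, L1le (fun k => cabs (fourier (h t) k)) M];
  flow_bnd : exists2 A, 0 <= A & forall t, 0 < t <= T -> forall i x, `|gr h t i x| <= A * t `^ (- 4^-1);
  flow_small : forall e, 0 < e -> exists2 r, 0 < r & forall t, 0 < t <= T -> t < r ->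
     forall i x, `|gr h t i x| <= e * t `^ (- 4^-1);
  flow_cont : forall s0, 0 < s0 <= T -> forall e, 0 < e -> exists2 r, 0 < r &
     forall s, 0 < s <= T -> `|s0 - s| < r -> forall i x, `|gr h s0 i x - gr h s i x| <= e;
  flow_mild : forall t, 0 < t <= T -> forall k,
     fourier (h t) k = (bs t k)%:C * c0 k + duh (fun s => nlu (gr h s)) t k }.

Lemma flow_pcont c0 T h t i : flow c0 T h -> 0 < t <= T -> pcont (gr h t i).
Proof.
move=> F ht; have [per [_ C] _] := flow_reg F ht; split; last exact: C.
exact: partial_periodic.
Qed.

Lemma flow_pcont0 c0 T h t : flow c0 T h -> 0 < t <= T -> pcont (h t).
Proof.
move=> F ht; have [per [df C] _] := flow_reg F ht; split => // x.
exact: differentiable_continuous.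
Qed.

Lemma flow_adm c0 T h : flow c0 T h -> adm T (fun s => nlu (gr h s)).
Proof.
move=> F; have [A A0 hA] := flow_bnd F; apply: (adm_nlu A0) => //.
- by move=> s hs i; exact: flow_pcont F hs.
- exact: flow_cont F.
Qed.

Lemma flowS c0 T T' h : T' <= T -> flow c0 T h -> flow c0 T' h.
Proof.
move=> TT F; have sub t : 0 < t <= T' -> 0 < t <= T by move=> /andP[-> h1]; exact: le_trans TT.
split.
- by move=> t /sub; exact: (flow_reg F).
- by have [A A0 hA] := flow_bnd F; exists A => // t /sub; exact: hA.
- move=> e e0; have [r r0 rP] := flow_small F e0; exists r => // t /sub; exact: rP.
- move=> s0 /sub hs0 e e0; have [r r0 rP] := flow_cont F hs0 e0; exists r => // t /sub; exact: rP.
- by move=> t /sub; exact: (flow_mild F).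
Qed.

(** After a positive time the gradient is bounded, hence below every multiple of [t^(-1/4)] for
   short times; the Duhamel integral splits at the restart time. *)
Lemma flow_restart c0 T h t1 : flow c0 T h -> 0 < t1 -> t1 < T ->
  flow (fourier (h t1)) (T - t1) (fun t => h (t1 + t)).
Proof.
move=> F t10 t1T; have [A A0 hA] := flow_bnd F.
have sub t : 0 < t <= T - t1 -> 0 < t1 + t <= T.
  by move=> /andP[h1 h2]; apply/andP; split; lra.
have q0 : 0 <= 4^-1 :> R by rewrite invr_ge0.
have mono t : 0 < t -> (t1 + t) `^ (- 4^-1) <= t1 `^ (- 4^-1) /\ (t1 + t) `^ (- 4^-1) <= t `^ (- 4^-1).
  by move=> ht0; split; apply: powR_antitone => //; lra.
split.
- by move=> t /sub; exact: (flow_reg F).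
- exists A => // t ht i x; apply: (le_trans (hA _ (sub _ ht) i x)).
  by move/andP: ht => [/mono[_ h1] _]; rewrite ler_wpM2l.
- move=> e e0; pose K := A * t1 `^ (- 4^-1) + 1.
  have K0 : 0 < K by rewrite ltr_wpDl// mulr_ge0// powR_ge0.
  exists ((e / K) `^ 4); first by rewrite powR_gt0// divr_gt0.
  move=> t ht tr i x; apply: (le_trans (hA _ (sub _ ht) i x)).
  have /andP[t0 _] := ht; have [h1 _] := mono _ t0.
  apply: (@le_trans _ _ K); first by rewrite (le_trans (ler_wpM2l A0 h1))// lerDl.
  rewrite powRN ler_pdivlMr ?powR_gt0//.
  have : t `^ 4^-1 <= ((e / K) `^ 4) `^ 4^-1.
    by apply: ge0_ler_powR => //; rewrite ?nnegrE ?powR_ge0// ltW.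
  rewrite -powRrM mulfV// powRr1 ?divr_ge0 ?(ltW e0) ?(ltW K0)//.
  by rewrite ler_pdivlMr// mulrC.
- move=> s0 hs0 e e0; have [r r0 rP] := flow_cont F (sub _ hs0) e0; exists r => // s hs hr.
  by apply: (rP (t1 + s) (sub _ hs)); rewrite opprD addrACA subrr add0r.
- move=> t ht k; have /andP[t0 tT] := ht.
  have ht1 : 0 < t1 <= T by rewrite t10 ltW.
  rewrite (flow_mild F (sub _ ht)) (flow_mild F ht1).
  have tT' : t1 + t <= T by lra.
  have key X Y : (bs (t1 + t) k)%:C * c0 k + ((bs t k)%:C * X + Y) =
     (bs t k)%:C * ((bs t1 k)%:C * c0 k + X) + Y.
    by rewrite bsD rmorphM/=; ring.
  have E := duh_restart nu0 k (flow_adm F) t10 t0 tT'.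
  apply: (etrans (congr1 (+%R ((bs (t1 + t) k)%:C * c0 k)) E)).
  exact: key.
Qed.

Lemma sum_sqr_le (x : 'I_d -> R) : (\sum_i `|x i|) ^+ 2 <= d%:R * \sum_i x i ^+ 2.
Proof.
have S0 : 0 <= \sum_i x i ^+ 2 by apply: sumr_ge0 => i _; exact: sqr_ge0.
have := @cauchy_schwarz_sum R _ (index_enum 'I_d) (fun=> 1) (fun i => `|x i|)
  (Num.sqrt d%:R) (Num.sqrt (\sum_i x i ^+ 2)) (sqrtr_ge0 _) (sqrtr_ge0 _).
rewrite !sqr_sqrtr//.
have -> : \sum_(i < d) (1 : R) ^+ 2 = d%:R.
  by under eq_bigr do rewrite expr1n; rewrite sumr_const card_ord.
have -> : \sum_i `|x i| ^+ 2 = \sum_i x i ^+ 2 by apply: eq_bigr => i _; rewrite real_normK ?num_real.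
move=> /(_ (lexx _) (lexx _)); under eq_bigr do rewrite mul1r.
move=> h; rewrite -[d%:R]sqr_sqrtr// -[X in _ * X]sqr_sqrtr// -exprMn.
by rewrite lerXn2r// nnegrE ?sumr_ge0// mulr_ge0 ?sqrtr_ge0.
Qed.

Lemma grad_l2 (f : pt -> R) (A : R) : 0 <= A -> torus_periodic f -> Ck 1 f ->
  (forall i x, `|partial i f x| <= A) ->
  L2le (fun k => kn k * cabs (fourier f k)) (d%:R * ((2 * pi) ^+ d * A)).
Proof.
move=> A0 per [df C] fA; have p0 : 0 <= (2 * pi) ^+ d :> R by rewrite exprn_ge0// ltW// pi2_gt0.
split; first by rewrite !mulr_ge0.
move=> s us.
have pp i : pcont (partial i f) by split; [exact: partial_periodic|exact: C].
apply: (@le_trans _ _ (\sum_(i < d) ((2 * pi) ^+ d * A) ^+ 2)).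
  have -> : \sum_(k <- s) (kn k * cabs (fourier f k)) ^+ 2 =
      \sum_i \sum_(k <- s) cabs (fourier (partial i f) k) ^+ 2.
    rewrite exchange_big/=; apply: eq_bigr => k _; rewrite exprMn kn_sqr mulr_suml.
    apply: eq_bigr => i _; rewrite fourier_partial// ?cabsM ?cabs_imag ?exprMn ?real_normK ?num_real//.
  apply: ler_sum => i _; apply: (le_trans (bessel (pp i) us)).
  have -> : ((2 * pi) ^+ d * A) ^+ 2 = (2 * pi) ^+ d * (A ^+ 2 * (2 * pi) ^+ d) by ring.
  rewrite ler_wpM2l// -(tint_cst (A ^+ 2)).
  apply: tint_le; [exact/bpt_tI/pcont_bpt/pcontX|exact/bpt_tI/bpt_cst|].
  by move=> x; rewrite -[leLHS]real_normK ?num_real// lerXn2r ?nnegrE.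
rewrite sumr_const card_ord -[leLHS]mulr_natl [leRHS]exprMn ler_wpM2r ?sqr_ge0//.
by rewrite expr2 ler_peMl// ler1n.
Qed.

(** The difference of two fluxes is controlled in [L2] by the difference of the
   gradients; Bessel and Parseval translate this to coefficients. *)
Lemma flux_diff_l2 (f g : pt -> R) j (A Y M N : R) : pcont f -> pcont g -> Ck 1 f -> Ck 1 g ->
  (forall i x, `|partial i f x| <= A) -> (forall i x, `|partial i g x| <= A) ->
  L1le (fun k => cabs (fourier f k)) M -> L1le (fun k => cabs (fourier g k)) N ->
  L2le (fun k => kn k * cabs (fourier f k - fourier g k)) Y ->
  L2le (fun k => cabs (fourier (cub (fun i => partial i f) j) k - fourier (cub (fun i => partial i g) j) k))
    (((d%:R + 2) * A ^+ 2 + 1) * (d%:R * Y)).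
Proof.
move=> pf pg [df Cf] [dg Cg] fA gA hM hN [Y0 hY].
have A0 : 0 <= A := le_trans (normr_ge0 _) (fA j 0).
set La := (_ * A ^+ 2 + 1); have La0 : 0 <= La by rewrite addr_ge0// mulr_ge0 ?addr_ge0// exprn_ge0.
split; first by rewrite !mulr_ge0.
move=> s us; pose w x := f x - g x.
have pw : pcont w by exact: pcontB.
have dw x : differentiable w x by apply: differentiableB.
have wE i x : partial i w x = partial i f x - partial i g x.
  by rewrite /partial deriveB//; exact: diff_derivable.
have pfi i : pcont (partial i f) by split; [apply: partial_periodic; case: pf|exact: Cf].
have pgi i : pcont (partial i g) by split; [apply: partial_periodic; case: pg|exact: Cg].
have pwi i : pcont (partial i w).
  by have -> : partial i w = (fun x => partial i f x - partial i g x); [exact/funext|exact: pcontB].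
have fw k : fourier w k = fourier f k - fourier g k by rewrite fourierB//; exact/bpt_tI/pcont_bpt.
have PW i : tint (fun x => partial i w x ^+ 2) <= kappa * Y ^+ 2.
  apply: (@parseval_partial _ _ w i (M + N)) => //; first by case: (pwi i).
    by apply: L1le_le (L1leD hM hN) => // k; rewrite fw cabsB.
  by split => //; under eq_fun do rewrite fw.
set u := fun i => partial i f; set v := fun i => partial i g.
have pG : pcont (fun x => cub u j x - cub v j x) by apply: pcontB; apply: pcont_cub.
have p0 : 0 <= (2 * pi) ^+ d :> R by rewrite exprn_ge0// ltW// pi2_gt0.
have -> : \sum_(k <- s) cabs (fourier (cub u j) k - fourier (cub v j) k) ^+ 2 =
   \sum_(k <- s) cabs (fourier (fun x => cub u j x - cub v j x) k) ^+ 2.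
  by apply: eq_bigr => k _; rewrite fourierB//; apply/bpt_tI/pcont_bpt/pcont_cub.
apply: (le_trans (bessel pG us)).
have IS : tI (fun x => La ^+ 2 * (d%:R * \sum_i partial i w x ^+ 2)).
  by apply/bpt_tI/bptZ/bptZ/bpt_sum => i; exact/pcont_bpt/pcontX.
apply: (@le_trans _ _ ((2 * pi) ^+ d * tint (fun x => La ^+ 2 * (d%:R * \sum_i partial i w x ^+ 2)))).
  rewrite ler_wpM2l//; apply: tint_le => //; first exact/bpt_tI/pcont_bpt/pcontX.
  move=> x; have := cub_lip j (u := u) (v := v) (x := x) (fun i => fA i x) (fun i => gA i x).
  rewrite -/La => h; have h2 := sum_sqr_le (fun i => partial i w x).
  apply: (@le_trans _ _ ((La * \sum_i `|u i x - v i x|) ^+ 2)).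
    rewrite -[leLHS]real_normK ?num_real// lerXn2r ?nnegrE// mulr_ge0//.
    by apply: sumr_ge0.
  rewrite exprMn ler_wpM2l ?sqr_ge0//; apply: le_trans h2.
  by under [in leRHS]eq_bigr do rewrite wE.
rewrite tintZ; last by apply/bpt_tI/bptZ/bpt_sum => i; exact/pcont_bpt/pcontX.
rewrite tintZ; last by apply/bpt_tI/bpt_sum => i; exact/pcont_bpt/pcontX.
rewrite tint_sum; last by move=> i; exact/pcont_bpt/pcontX.
apply: (@le_trans _ _ ((2 * pi) ^+ d * (La ^+ 2 * (d%:R * (d%:R * (kappa * Y ^+ 2)))))).
  rewrite ler_wpM2l// ler_wpM2l ?sqr_ge0// ler_wpM2l//.
  apply: (@le_trans _ _ (\sum_(i < d) kappa * Y ^+ 2)); first by apply: ler_sum.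
  by rewrite sumr_const card_ord mulr_natl.
have -> : (2 * pi) ^+ d * (La ^+ 2 * (d%:R * (d%:R * (kappa * Y ^+ 2)))) =
   (kappa * (2 * pi) ^+ d) * (La * (d%:R * Y)) ^+ 2 by ring.
by rewrite kappaK mul1r.
Qed.

(** The Lipschitz constant of the flux along two solutions: a small multiple of the critical rate
   [t^(-1/2)] plus a constant, by splitting at a time before which the gradients are small. *)
Lemma flow_pair_small c0 T h g eta : flow c0 T h -> flow c0 T g -> 0 < eta ->
  exists2 C, 0 <= C & forall t, 0 < t <= T -> exists A,
    [/\ forall i x, `|gr h t i x| <= A, forall i x, `|gr g t i x| <= A &
     (d%:R + 2) * A ^+ 2 + 1 <= eta * t `^ (- 2^-1) + C].
Proof.
move=> Fh Fg eta0; have D0 : 0 < d%:R + 2 :> R by rewrite ltr_wpDl.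
pose e := Num.sqrt (eta / (d%:R + 2)).
have e0 : 0 < e by rewrite sqrtr_gt0 divr_gt0.
have [r r0 rP] := flow_small Fh e0; have [r' r0' rP'] := flow_small Fg e0.
have [A A0 hA] := flow_bnd Fh; have [A' A0' hA'] := flow_bnd Fg.
pose de := Num.min r r'; have de0 : 0 < de by rewrite lt_min r0.
pose B := (A + A') * de `^ (- 4^-1); have B0 : 0 <= B by rewrite mulr_ge0 ?powR_ge0// addr_ge0.
have q0 : 0 <= 4^-1 :> R by rewrite invr_ge0.
exists ((d%:R + 2) * B ^+ 2 + 1); first by rewrite addr_ge0// mulr_ge0 ?(ltW D0)// exprn_ge0.
move=> t ht; have /andP[t0 _] := ht; have [tde|tde] := ltP t de.
  exists (e * t `^ (- 4^-1)); move: tde; rewrite lt_min => /andP[t1 t2]; split.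
  - exact: rP.
  - exact: rP'.
  rewrite [leRHS]addrA lerD2r; apply: (@le_trans _ _ (eta * t `^ (- 2^-1))).
    rewrite exprMn sqr_sqrtr ?divr_ge0 ?(ltW eta0) ?(ltW D0)//.
    have -> : (d%:R + 2) * (eta / (d%:R + 2) * t `^ (- 4^-1) ^+ 2) = eta * t `^ (- 4^-1) ^+ 2.
      by field; exact: lt0r_neq0.
    rewrite -powR_mulrn ?powR_ge0// -powRrM.
    by have -> : - 4^-1 * 2%:R = - 2^-1 :> R by field.
  by rewrite lerDl mulr_ge0 ?(ltW D0)// exprn_ge0.
exists B; split.
- move=> i x; apply: (le_trans (hA t ht i x)); apply: ler_pM; rewrite ?powR_ge0 ?lerDl//.
  exact: powR_antitone.
- move=> i x; apply: (le_trans (hA' t ht i x)); apply: ler_pM; rewrite ?powR_ge0 ?lerDr//.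
  exact: powR_antitone.
by rewrite lerDr mulr_ge0 ?powR_ge0// ltW.
Qed.

Lemma nlu_diff_le (u v : 'I_d -> pt -> R) k p t : 0 < t -> p = 2^-1 ->
  kn k * (bs t k * cabs (nlu u k - nlu v k)) <=
  (nu * t) `^ (- p) * \sum_j cabs (fourier (cub u j) k - fourier (cub v j) k).
Proof.
move=> t0 pE.
apply: (@le_trans _ _ (kn k ^+ 2 * bs t k * \sum_j cabs (fourier (cub u j) k - fourier (cub v j) k))).
  have -> : kn k ^+ 2 * bs t k * \sum_j cabs (fourier (cub u j) k - fourier (cub v j) k) =
    kn k * (bs t k * (kn k * \sum_j cabs (fourier (cub u j) k - fourier (cub v j) k))) by ring.
  by rewrite ler_wpM2l ?kn_ge0// ler_wpM2l ?(ltW (bs_gt0 _ _ _))// nlu_sub.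
rewrite ler_wpM2r//; first by apply: sumr_ge0 => j _; exact: cabs_ge0.
by apply: kn_bs_le => //; rewrite pE; lra.
Qed.

(** The Duhamel formula halves the weighted norm of the difference of two solutions:
   the critical part of the Lipschitz constant is small, and the constant part is absorbed by
   the weight [e^(lam t)]. *)
Lemma flow_contract c0 T h g : 0 < T -> flow c0 T h -> flow c0 T g ->
  exists2 lam, 0 <= lam & forall B, 0 <= B ->
   (forall t, 0 < t <= T -> L2le (fun k => kn k * cabs (fourier (h t) k - fourier (g t) k))
       (B * (t `^ (- 4^-1) * expR (lam * t)))) ->
   (forall t, 0 < t <= T -> L2le (fun k => kn k * cabs (fourier (h t) k - fourier (g t) k))
       (B / 2 * (t `^ (- 4^-1) * expR (lam * t)))).
Proof.
move=> T0 Fh Fg; pose D : R := d%:R ^+ 2 * nu `^ (- 2^-1).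
have dp : 0 < d%:R :> R by rewrite ltr0n.
have D0 : 0 < D by rewrite mulr_gt0 ?exprn_gt0 ?powR_gt0.
(* [2 * (2 * eta * 16) * D = 1 / 2], where [16] is the constant of the singular integrals and
   [2] that of [duh_le] *)
pose eta := (128 * D)^-1.
have eta0 : 0 < eta by rewrite invr_gt0 mulr_gt0.
have [C C0 hC] := flow_pair_small Fh Fg eta0.
(* the constant [C] is compensated by [lam ^ (- 1 / 4) = X^-1], as [exp (- x) <= x ^ (- 1 / 4)] *)
pose X := (C * T `^ 4^-1 + 1) / eta.
have X0 : 0 < X by rewrite divr_gt0// ltr_wpDl// mulr_ge0 ?powR_ge0.
pose lam := X `^ 4; have lam0 : 0 < lam by rewrite powR_gt0.
have lamE : lam `^ (- 4^-1) = X^-1.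
  by rewrite powRN -powRrM mulfV// powRr1// ltW.
exists lam; first exact: ltW.
move=> B B0 H t ht; have /andP[t0 tT] := ht.
have e0 : 0 <= expR (lam * t) by exact: expR_ge0.
apply: L2le_dual.
- by rewrite !mulr_ge0 ?powR_ge0// invr_ge0.
- by move=> k; rewrite mulr_ge0 ?kn_ge0 ?cabs_ge0.
move=> y Y s us Y0 y0 hy.
have wE k : fourier (h t) k - fourier (g t) k =
    duh (fun s k => nlu (gr h s) k - nlu (gr g s) k) t k.
  rewrite (duhB nu0 k (flow_adm Fh) (flow_adm Fg) ht) (flow_mild Fh ht) (flow_mild Fg ht).
  by rewrite opprD addrACA subrr add0r.
pose E := Y * B * D * expR (lam * t).
have E0 : 0 <= E.
  by rewrite /E mulr_ge0// mulr_ge0 ?(ltW D0)//; exact: mulr_ge0.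
pose G u := E * (eta * sker 2^-1 (3 / 4) t u) + E * (C * X^-1 * sker (3 / 4) 4^-1 t u).
have i1 : mu.-integrable `]0, t[ (EFin \o sker 2^-1 (3 / 4) t) by apply: integrable_sker => //; lra.
have i2 : mu.-integrable `]0, t[ (EFin \o sker (3 / 4) 4^-1 t) by apply: integrable_sker => //; lra.
have j1 := integrable_lin E (integrable_lin eta i1).
have j2 := integrable_lin E (integrable_lin (C * X^-1) i2).
have iG : mu.-integrable `]0, t[ (EFin \o G) by exact: integrable_add.
have IG : \int[mu]_(u in `]0, t[) G u <= Y * (B / 4 * (t `^ (- 4^-1) * expR (lam * t))).
  rewrite /G RintegralD//.
  have k1 : \int[mu]_(u in `]0, t[) (E * (eta * sker 2^-1 (3 / 4) t u)) <= E * (eta * (16 * t `^ (- 4^-1))).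
    rewrite RintegralZl//; last exact: integrable_lin.
    rewrite ler_wpM2l// RintegralZl// ler_wpM2l ?(ltW eta0)//.
    have -> : - 4^-1 = 1 - 2^-1 - 3 / 4 :> R by field.
    by apply: Rintegral_sker_le => //; lra.
  have k2 : \int[mu]_(u in `]0, t[) (E * (C * X^-1 * sker (3 / 4) 4^-1 t u)) <= E * (eta * (16 * t `^ (- 4^-1))).
    rewrite RintegralZl//; last exact: integrable_lin.
    rewrite ler_wpM2l// RintegralZl//.
    apply: (@le_trans _ _ (C * X^-1 * 16)).
      rewrite ler_wpM2l ?mulr_ge0 ?invr_ge0 ?(ltW X0)//.
      have := @Rintegral_sker_le R (3 / 4) 4^-1 t t0.
      have -> : 1 - 3 / 4 - 4^-1 = 0 :> R by field.
      by rewrite powRr0 mulr1; apply; lra.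
    have E1 : eta * X = C * T `^ 4^-1 + 1 by rewrite /X mulrC divfK// gt_eqF.
    have h1 : C / X <= eta * t `^ (- 4^-1).
      rewrite ler_pdivrMr// mulrAC E1 powRN ler_pdivlMr ?powR_gt0//.
      apply: (@le_trans _ _ (C * T `^ 4^-1)); last by rewrite lerDl.
      by rewrite ler_wpM2l//; apply: ge0_ler_powR; rewrite ?nnegrE ?invr_ge0 ?(ltW t0) ?(ltW T0).
    have -> : eta * (16 * t `^ (- 4^-1)) = (eta * t `^ (- 4^-1)) * 16 by ring.
    by rewrite ler_wpM2r.
  apply: (le_trans (lerD k1 k2)); rewrite /E /eta.
  rewrite le_eqVlt; apply/orP; left; apply/eqP; field; exact: lt0r_neq0.
have -> : Y * (B / 2 * (t `^ (- 4^-1) * expR (lam * t))) = 2 * (Y * (B / 4 * (t `^ (- 4^-1) * expR (lam * t)))).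
  by field.
under eq_bigr do rewrite wE mulrA.
apply: (duh_le nu0 (admB (flow_adm Fh) (flow_adm Fg)) ht _ iG _ IG); first by move=> k; rewrite mulr_ge0 ?kn_ge0.
move=> u /andP[u0 ut]; have tu : 0 < t - u by rewrite subr_gt0.
have hu : 0 < u <= T by rewrite u0 (le_trans (ltW ut)).
have [A [hA1 hA2 hA3]] := hC u hu.
have [ph [dh Ch] [M hM]] := flow_reg Fh hu; have [pg [dg Cg] [N hN]] := flow_reg Fg hu.
pose q := (nu * (t - u)) `^ (- 2^-1).
pose Yu := B * (u `^ (- 4^-1) * expR (lam * u)).
have FD j := @flux_diff_l2 (h u) (g u) j A Yu M N (flow_pcont0 Fh hu) (flow_pcont0 Fg hu)
  (conj dh Ch) (conj dg Cg) hA1 hA2 hM hN (H u hu).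
apply: (@le_trans _ _ (\sum_(k <- s) q * (\sum_j y k * cabs (fourier (cub (gr h u) j) k - fourier (cub (gr g u) j) k)))).
  apply: ler_sum => k _; rewrite -mulrA -mulr_sumr [leRHS]mulrCA ler_wpM2l//.
  exact: nlu_diff_le.
rewrite -mulr_sumr exchange_big/=.
have La0 : 0 <= (d%:R + 2) * A ^+ 2 + 1 by rewrite addr_ge0// mulr_ge0 ?addr_ge0// exprn_ge0// (le_trans _ (hA1 (Ordinal d0) 0)).
apply: (@le_trans _ _ (q * (d%:R * (Y * ((eta * u `^ (- 2^-1) + C) * (d%:R * Yu)))))).
  rewrite ler_wpM2l ?powR_ge0//.
  apply: (@le_trans _ _ (\sum_(j < d) Y * (((d%:R + 2) * A ^+ 2 + 1) * (d%:R * Yu)))).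
    by apply: ler_sum => j _; apply: (L2le_pair (FD j)).
  rewrite sumr_const card_ord -[leLHS]mulr_natl ler_wpM2l// ler_wpM2l// ler_wpM2r// !mulr_ge0 ?powR_ge0 ?expR_ge0//.
rewrite /Yu; have -> : expR (lam * u) = expR (lam * t) * expR (- (lam * (t - u))) by rewrite -expRD; congr expR; ring.
set z := expR (- _).
have z1 : z <= 1 by rewrite -expR0 ler_expR oppr_le0 mulr_ge0 ?ltW.
have z2 : z <= X^-1 * (t - u) `^ (- 4^-1).
  rewrite -lamE -powRM ?(ltW lam0) ?(ltW tu)//; apply: expRN_powR; first exact: mulr_gt0.
  lra.
have z0 : 0 <= z by exact: expR_ge0.
have qE : q = nu `^ (- 2^-1) * (t - u) `^ (- 2^-1) by rewrite /q powRM// ltW.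
have p1 : u `^ (- 2^-1) * u `^ (- 4^-1) = u `^ (- (3 / 4)).
  by rewrite -powRD ?(gt_eqF u0) ?implybT//; congr (_ `^ _); field.
have p2 : (t - u) `^ (- 2^-1) * (t - u) `^ (- 4^-1) = (t - u) `^ (- (3 / 4)).
  by rewrite -powRD ?(gt_eqF tu) ?implybT//; congr (_ `^ _); field.
rewrite /G /sker -p1 -p2 qE /E /D.
set a := (t - u) `^ (- 2^-1) in z2 *; set b := (t - u) `^ (- 4^-1) in z2 *.
set a' := u `^ (- 2^-1); set b' := u `^ (- 4^-1); set e := expR (lam * t).
have a0 : 0 <= a by exact: powR_ge0.
have b0 : 0 <= b by exact: powR_ge0.
have a0' : 0 <= a' by exact: powR_ge0.
have b0' : 0 <= b' by exact: powR_ge0.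
set n' := nu `^ (- 2^-1); have n0 : 0 <= n' by exact: powR_ge0.
have -> : n' * a * (d%:R * (Y * ((eta * a' + C) * (d%:R * (B * (b' * (e * z))))))) =
  (Y * B * (d%:R ^+ 2 * n') * e) * (eta * (a * (a' * b'))) * z +
  (Y * B * (d%:R ^+ 2 * n') * e) * (C * a * b') * z by ring.
have P0 : 0 <= Y * B * (d%:R ^+ 2 * n') * e by rewrite !mulr_ge0 ?exprn_ge0 ?(ltW dp)//; exact: expR_ge0.
apply: lerD.
  by rewrite ler_piMr// mulr_ge0// !mulr_ge0// ltW.
have -> : Y * B * (d%:R ^+ 2 * n') * e * (C / X * (a * b * b')) =
  (Y * B * (d%:R ^+ 2 * n') * e) * (C * a * b') * (X^-1 * b) by ring.
by rewrite ler_wpM2l// mulr_ge0// !mulr_ge0.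
Qed.

(** By [flow_contract] the weighted norm of the difference is at most [B / 2 ^+ n] for all [n].
   It controls all coefficients but that of frequency [0], on which the nonlinearity vanishes. *)
Lemma flow_uniq c0 T h g : flow c0 T h -> flow c0 T g -> forall t, 0 < t <= T -> h t = g t.
Proof.
move=> Fh Fg t ht; have /andP[t0 tT] := ht; have T0 : 0 < T := lt_le_trans t0 tT.
have [lam lam0 contr] := flow_contract T0 Fh Fg.
have [A A0 hA] := flow_bnd Fh; have [A' A0' hA'] := flow_bnd Fg.
pose B := d%:R * ((2 * pi) ^+ d * (A + A')).
have p0 : 0 <= (2 * pi) ^+ d :> R by rewrite exprn_ge0// ltW// pi2_gt0.
have B0 : 0 <= B by rewrite !mulr_ge0// addr_ge0.
have start s : 0 < s <= T -> L2le (fun k => kn k * cabs (fourier (h s) k - fourier (g s) k))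
       (B * (s `^ (- 4^-1) * expR (lam * s))).
  move=> hs; have [ph Ch _] := flow_reg Fh hs; have [pg Cg _] := flow_reg Fg hs.
  have s4 : 0 <= s `^ (- 4^-1) by exact: powR_ge0.
  have k1 := grad_l2 (mulr_ge0 A0 s4) ph Ch (hA s hs).
  have k2 := grad_l2 (mulr_ge0 A0' s4) pg Cg (hA' s hs).
  apply: L2le_le (L2leD _ _ k1 k2) => [k||k|k]; rewrite ?mulr_ge0 ?kn_ge0 ?cabs_ge0//=.
    by rewrite -mulrDr ler_wpM2l ?kn_ge0// cabsB.
  have -> : d%:R * ((2 * pi) ^+ d * (A * s `^ (- 4^-1))) + d%:R * ((2 * pi) ^+ d * (A' * s `^ (- 4^-1))) =
    B * (s `^ (- 4^-1) * 1) by rewrite /B; ring.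
  rewrite ler_wpM2l// ler_wpM2l// -expR0 ler_expR mulr_ge0//; first by case/andP: hs => /ltW.
have all n s : 0 < s <= T -> L2le (fun k => kn k * cabs (fourier (h s) k - fourier (g s) k))
       (B / 2 ^+ n * (s `^ (- 4^-1) * expR (lam * s))).
  elim: n s => [|n IH] s hs; first by rewrite expr0 divr1; exact: start.
  have -> : B / 2 ^+ n.+1 = B / 2 ^+ n / 2 by rewrite exprSr invfM mulrA.
  by apply: (contr (B / 2 ^+ n)) => //; rewrite divr_ge0// exprn_ge0.
have z0 k : k != 0 -> fourier (h t) k - fourier (g t) k = 0.
  move=> k0; apply: cabs_eq0; apply/eqP; rewrite eq_le cabs_ge0 andbT.
  apply/ler_addgt0Pr => e e0; rewrite add0r.
  set Q := B * (t `^ (- 4^-1) * expR (lam * t)).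
  have Q0 : 0 <= Q by rewrite /Q mulr_ge0// mulr_ge0 ?powR_ge0 ?expR_ge0.
  pose n := Num.truncn (Q / e).
  have nQ : Q / e <= 2 ^+ n.
    apply: ltW; apply: (lt_le_trans (truncnS_gt _)); rewrite -natrX ler_nat.
    exact: ltn_expl.
  have := L2le_point k (all n t ht); rewrite mulrAC -/Q => h1.
  apply: (@le_trans _ _ (kn k * cabs (fourier (h t) k - fourier (g t) k))).
    by rewrite ler_peMl ?cabs_ge0// kn_ge1.
  apply: (le_trans h1); rewrite ler_pdivrMr ?exprn_gt0//.
  by rewrite mulrC -ler_pdivrMr.
have z1 : fourier (h t) 0 = fourier (g t) 0.
  have E0 : duh (fun s => nlu (gr h s)) t 0 = duh (fun s => nlu (gr g s)) t 0.
    by apply: duh_ext_on => s _; rewrite !nlu0.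
  exact: etrans (flow_mild Fh ht 0) (etrans (congr1 (+%R _) E0) (esym (flow_mild Fg ht 0))).
apply/funext => x; apply/eqP; rewrite -subr_eq0; apply/eqP.
have ph := flow_pcont0 Fh ht; have pg := flow_pcont0 Fg ht.
apply: (@fourier_inj0 R d (fun x => h t x - g t x)) => //; first exact: pcontB.
move=> k; rewrite fourierB; [|exact/bpt_tI/pcont_bpt..].
by have [->|/z0//] := eqVneq k 0; rewrite z1 subrr.
Qed.

End uniqueness.

Opaque duh.

(** * Linear estimates *)

Section sequences.
Context {R : realType} {I : choiceType}.
Implicit Types a b : I -> R.

Lemma L2le_split a G : (forall k, 0 <= a k) -> L2le a G -> forall e, 0 < e ->
  exists2 s0, uniq s0 & L2le (fun k => if k \in s0 then 0 else a k) e.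
Proof.
move=> a0 [G0 h] e e0; have e20 : 0 < e ^+ 2 by rewrite exprn_gt0.
have [s0 us0 H] := L1le_tail (fun k => sqr_ge0 (a k)) h e20.
exists s0 => //; split; first exact: ltW.
move=> s us; rewrite (bigID (mem s0))/= big1 ?add0r; last by move=> k ->; rewrite expr0n.
apply: (@le_trans _ _ (\sum_(k <- s | k \notin s0) a k ^+ 2)).
  by apply: ler_sum => k /negPf ->.
rewrite -big_filter; apply: H; first exact: filter_uniq.
by move=> k; rewrite mem_filter => /andP[].
Qed.

Lemma L1le_fin a M (s0 : seq I) : uniq s0 -> (forall k, 0 <= a k) -> \sum_(k <- s0) a k <= M ->
  L1le (fun k => if k \in s0 then a k else 0) M.
Proof.
move=> us0 a0 hM s us; apply: le_trans hM.
rewrite (bigID (mem s0))/= [X in _ + X]big1 ?addr0; last by move=> k /negPf ->.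
rewrite (eq_bigr a); last by move=> k ->.
rewrite -big_filter (bigID (mem s) (r := s0))/= -[X in _ <= X + _]big_filter.
have -> : \sum_(k <- [seq k <- s | k \in s0]) a k = \sum_(k <- [seq k <- s0 | k \in s]) a k.
  apply: perm_big; apply: uniq_perm; rewrite ?filter_uniq//.
  by move=> k; rewrite !mem_filter andbC.
by rewrite lerDl; apply: sumr_ge0.
Qed.

(** Dominated convergence in [l1]. *)
Lemma L1le_dominated (phi : I -> R) M (f : R -> I -> R) (s0 : R) (P : R -> Prop) :
  (forall k, 0 <= phi k) -> L1le phi M -> (forall s k, P s -> f s k <= phi k) ->
  (forall k e, 0 < e -> exists2 r, 0 < r & forall s, P s -> `|s0 - s| < r -> f s k <= e) ->
  forall e, 0 < e -> exists2 r, 0 < r & forall s, P s -> `|s0 - s| < r -> L1le (f s) e.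
Proof.
move=> p0 hphi fphi fk e e0; have e20 : 0 < e / 2 by rewrite divr_gt0.
have [S uS HS] := L1le_tail p0 hphi e20.
pose e' := e / 2 / (size S).+1%:R; have e'0 : 0 < e' by rewrite divr_gt0.
have [r r0 rP] : exists2 r, 0 < r & forall s, P s -> `|s0 - s| < r -> forall k, k \in S -> f s k <= e'.
  elim: (S) => [|k S' [r r0 IH]]; first by exists 1.
  have [r' r0' rP'] := fk k e' e'0; exists (Num.min r r'); first by rewrite lt_min r0.
  move=> s Ps; rewrite lt_min => /andP[h1 h2] l; rewrite inE => /orP[/eqP ->|lS]; first exact: rP'.
  exact: IH.
exists r => // s Ps hs l ul; rewrite (bigID (mem S))/= [leRHS]splitr; apply: lerD.
  apply: (@le_trans _ _ (\sum_(k <- l | k \in S) e')); first by apply: ler_sum => k kS; exact: rP.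
  rewrite -big_filter big_const_seq count_predT iter_addr_0 -[leLHS]mulr_natl /e' mulrCA -[leRHS]mulr1.
  rewrite ler_wpM2l ?(ltW e20)// ler_pdivrMr// mul1r ler_nat.
  apply: leqW; apply: uniq_leq_size; first exact: filter_uniq.
  by move=> k; rewrite mem_filter => /andP[].
apply: (@le_trans _ _ (\sum_(k <- l | k \notin S) phi k)); first by apply: ler_sum => k _; exact: fphi.
rewrite -big_filter; apply: HS; first exact: filter_uniq.
by move=> k; rewrite mem_filter => /andP[].
Qed.

End sequences.

Section linear.
Context {R : realType} {d : nat}.
Variable nu : R.
Hypothesis nu0 : 0 < nu.
Hypothesis d0 : (0 < d)%N.
Local Notation Z := 'rV[int]_d.
Local Notation kn := (@freq_norm R d).
Local Notation bs := (bs nu).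
Implicit Types (g c : Z -> R[i]).

(** An analytic weight with growing radius; it is submultiplicative in the frequency, so that
   it preserves the Wiener algebra. *)
Definition wt (t : R) (k : Z) : R := expR (nu * t / 2 * kn k).

(** The weight of the critical space [H^(d/2)], without the zero mode. *)
Definition rho (k : Z) : R := Num.sqrt (kn k ^+ d).

Definition rhoC : R := Num.sqrt (2 ^+ d).

Lemma rho_ge0 k : 0 <= rho k. Proof. exact: sqrtr_ge0. Qed.

Lemma rho_sqr k : rho k ^+ 2 = kn k ^+ d.
Proof. by rewrite sqr_sqrtr// exprn_ge0// kn_ge0. Qed.

Lemma rho_gt0 k : k != 0 -> 0 < rho k.
Proof. by move=> k0; rewrite sqrtr_gt0 exprn_gt0// (lt_le_trans ltr01)// kn_ge1. Qed.

Lemma rho_add k l : rho (k + l) <= rhoC * (rho k + rho l).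
Proof.
wlog kl : k l / kn l <= kn k.
  move=> H; have [h|/ltW h] := leP (kn l) (kn k); first exact: H.
  by rewrite addrC [rho k + _]addrC; exact: H.
apply: (@le_trans _ _ (rhoC * rho k)); last by rewrite ler_wpM2l ?sqrtr_ge0// lerDl rho_ge0.
rewrite /rho /rhoC -sqrtrM ?exprn_ge0// ler_wsqrtr// -exprMn lerXn2r ?nnegrE ?mulr_ge0 ?kn_ge0//.
by apply: (le_trans (knD _ _)); rewrite mulrDl !mul1r lerD2l.
Qed.

Lemma wt_ge1 t k : 0 <= t -> 1 <= wt t k.
Proof.
move=> t0; rewrite -expR0 ler_expR mulr_ge0 ?kn_ge0// mulr_ge0 ?invr_ge0//.
by rewrite mulr_ge0// ltW.
Qed.

Lemma wt_ge0 t k : 0 <= wt t k. Proof. exact: expR_ge0. Qed.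

Lemma wt_sub t k l : 0 <= t -> wt t (k + l) <= wt t k * wt t l.
Proof.
move=> t0; rewrite -expRD ler_expR -mulrDr ler_wpM2l ?knD// mulr_ge0 ?invr_ge0//.
by rewrite mulr_ge0// ltW.
Qed.

Lemma wt_mono s t k : 0 <= s -> s <= t -> wt s k <= wt t k.
Proof.
move=> s0 st; rewrite ler_expR ler_wpM2r ?kn_ge0// ler_wpM2r ?invr_ge0//.
by rewrite ler_wpM2l// ltW.
Qed.

Lemma kn_le_kn4 k : kn k <= kn k ^+ 4.
Proof.
have [->|k0] := eqVneq k 0; first by rewrite kn0 expr0n.
by rewrite -[leLHS]expr1 ler_weXn2l// kn_ge1.
Qed.

(** Half of the biharmonic decay pays for the growth of the weight, as [kn k <= kn k ^+ 4] on
   the lattice. *)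
Lemma wt_bs s t k : 0 <= s <= t -> wt t k * bs (t - s) k <= wt s k * expR (- ((nu * (t - s) / 2) * kn k ^+ 4)).
Proof.
move=> /andP[s0 st]; rewrite bsE -!expRD ler_expR /rate.
have h := kn_le_kn4 k; have n2 : 0 <= nu * (t - s) / 2.
  by rewrite mulr_ge0 ?invr_ge0// mulr_ge0 ?subr_ge0// ltW.
have := ler_wpM2l n2 h.
have -> : nu * t / 2 * kn k = nu * s / 2 * kn k + nu * (t - s) / 2 * kn k by ring.
have -> : nu * kn k ^+ 4 * (t - s) = nu * (t - s) / 2 * kn k ^+ 4 + nu * (t - s) / 2 * kn k ^+ 4 by field.
lra.
Qed.

Lemma wt_bs0 t k : 0 <= t -> wt t k * bs t k <= expR (- ((nu * t / 2) * kn k ^+ 4)).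
Proof.
move=> t0; have := @wt_bs 0 t k; rewrite lexx t0 subr0 => /(_ isT).
by rewrite /wt mulr0 !mul0r expR0 mul1r.
Qed.

(** Polynomial growth is dominated by the weight. *)
Lemma poly_le_expR (a y : R) (n : nat) : 0 < a -> 0 <= y ->
  (1 + y) ^+ n <= (1 + n%:R / a) ^+ n * expR (a * y).
Proof.
move=> a0 y0; case: n => [|n]; first by rewrite !expr0 mul1r -expR0 ler_expR mulr_ge0// ltW.
have n0 : 0 < n.+1%:R :> R by rewrite ltr0n.
have -> : a * y = n.+1%:R * (a * y / n.+1%:R) by rewrite [RHS]mulrC divfK// gt_eqF.
rewrite expRM_natl -exprMn lerXn2r ?nnegrE ?addr_ge0//.
  by rewrite mulr_ge0 ?expR_ge0// addr_ge0// divr_ge0// ltW.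
apply: (@le_trans _ _ ((1 + n.+1%:R / a) * (1 + a * y / n.+1%:R))); last first.
  by rewrite ler_wpM2l ?expR_ge1Dx// addr_ge0// divr_ge0// ltW.
rewrite mulrDl mul1r mulrDr mulr1 addrA.
have -> : n.+1%:R / a * (a * y / n.+1%:R) = y.
  by field; rewrite gt_eqF//= lt0r_neq0.
by rewrite lerD2r -addrA lerDl addr_ge0 ?divr_ge0 ?mulr_ge0 ?(ltW a0).
Qed.

Definition linC : R := Num.sqrt (@shell_cst R d * (d%:R ^+ 2 * 2)) * nu `^ (- 4^-1).

Lemma linC_ge0 : 0 <= linC.
Proof. by rewrite mulr_ge0 ?sqrtr_ge0 ?powR_ge0. Qed.

(** The linear flow on coefficients. *)
Definition lin g (t : R) (k : Z) : R[i] := (bs t k)%:C * g k.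

Lemma lin0 g t : lin g t 0 = g 0.
Proof. by rewrite /lin bs_k0 mul1r. Qed.

Lemma cabs_lin g t k : cabs (lin g t k) = bs t k * cabs (g k).
Proof. by rewrite cabsM cabs_real gtr0_norm// bs_gt0. Qed.

(** The norm of the fixed point argument: the Wiener norm of the gradient with the analytic weight. *)
Definition nw (t : R) c (A : R) := L1le (fun k => kn k * (wt t k * cabs (c k))) A.

(** Cauchy-Schwarz against the lattice sum [lattice_heat]; this is where the space [H^(d/2)]
   enters, and where the rate [t^(-1/4)] comes from. *)
Lemma lin_nw g G t : 0 < t -> L2le (fun k => rho k * cabs (g k)) G ->
  nw t (lin g t) (linC * G * t `^ (- 4^-1)).
Proof.
move=> t0 hG; have G0 : 0 <= G by case: hG.
pose a := Num.sqrt (nu * t); have nt : 0 < nu * t by exact: mulr_gt0.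
have a0 : 0 < a by rewrite sqrtr_gt0.
have aE : a = (nu * t) `^ 2^-1 by rewrite /a powR12_sqrt// ltW.
pose X := @shell_cst R d * (d%:R ^+ 2 * (2 / a)).
have X0 : 0 <= X.
  by rewrite !mulr_ge0 ?exprn_ge0 ?invr_ge0 ?(ltW a0)//; exact: ler0n.
have XE : Num.sqrt X = linC * t `^ (- 4^-1).
  have -> : X = (@shell_cst R d * (d%:R ^+ 2 * 2)) * ((nu * t) `^ (- 4^-1)) ^+ 2.
    rewrite -(powR_mulrn 2 (powR_ge0 (nu * t) (- 4^-1))) -powRrM.
    have -> : - 4^-1 * 2%:R = - 2^-1 :> R by field.
    by rewrite powRN -aE /X; ring.
  rewrite sqrtrM ?sqrtr_sqr ?ger0_norm ?powR_ge0//; last first.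
    by rewrite !mulr_ge0 ?exprn_ge0//; exact: ler0n.
  have -> : (nu * t) `^ (- 4^-1) = nu `^ (- 4^-1) * t `^ (- 4^-1) by rewrite powRM// ltW.
  exact: mulrA.
have -> : linC * G * t `^ (- 4^-1) = kn 0 * (wt t 0 * cabs (lin g t 0)) + Num.sqrt X * G.
  by rewrite kn0 mul0r add0r XE; ring.
apply: L1le_nonzero; first by rewrite kn0 mul0r.
move=> s us s0.
apply: (@le_trans _ _ (\sum_(k <- s) (kn k / rho k * expR (- ((nu * t / 2) * kn k ^+ 4))) * (rho k * cabs (g k)))).
  rewrite !big_seq; apply: ler_sum => k ks; have r0 := rho_gt0 (s0 k ks).
  have -> : kn k / rho k * expR (- (nu * t / 2 * kn k ^+ 4)) * (rho k * cabs (g k)) =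
     kn k * (expR (- (nu * t / 2 * kn k ^+ 4)) * cabs (g k)).
    by field; exact: lt0r_neq0.
  rewrite ler_wpM2l ?kn_ge0// cabs_lin mulrA ler_wpM2r ?cabs_ge0//.
  by apply: wt_bs0; exact: ltW.
apply: cauchy_schwarz_sum; rewrite ?sqrtr_ge0//; last by case: hG => _; apply.
rewrite sqr_sqrtr//.
apply: le_trans (lattice_heat d0 a0 us s0); rewrite !big_seq; apply: ler_sum => k ks.
rewrite exprMn -expRM_natl expr_div_n rho_sqr ler_wpM2l//.
  by rewrite divr_ge0 ?exprn_ge0 ?kn_ge0.
have -> : 2%:R * - (nu * t / 2 * kn k ^+ 4) = - (a ^+ 2 * kn k ^+ 4).
  by rewrite sqr_sqrtr ?(ltW nt)//; field.
have p0 : 0 < 1 + a ^+ 2 * kn k ^+ 4 by rewrite ltr_pwDl// mulr_ge0 ?sqr_ge0// exprn_ge0// kn_ge0.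
by rewrite expRN lef_pV2 ?posrE ?expR_gt0// expR_ge1Dx.
Qed.

Lemma lin_L2 g G t : 0 < t -> L2le (fun k => rho k * cabs (g k)) G ->
  L2le (fun k => kn k * (rho k * cabs (lin g t k))) (nu `^ (- 4^-1) * G * t `^ (- 4^-1)).
Proof.
move=> t0 hG; have q0 : 0 <= (nu * t) `^ (- 4^-1) by exact: powR_ge0.
have := L2leZ q0 hG.
have -> : (nu * t) `^ (- 4^-1) * G = nu `^ (- 4^-1) * G * t `^ (- 4^-1).
  by rewrite powRM ?(ltW nu0) ?(ltW t0)//; ring.
apply: L2le_le => // k; rewrite !mulr_ge0 ?kn_ge0 ?rho_ge0 ?cabs_ge0//= cabs_lin.
have -> : kn k * (rho k * (bs t k * cabs (g k))) = kn k ^+ 1 * bs t k * (rho k * cabs (g k)) by ring.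
rewrite ler_wpM2r ?mulr_ge0 ?rho_ge0 ?cabs_ge0//.
by apply: kn_bs_le => //; lra.
Qed.

Lemma powR_quarter_large (e M : R) : 0 < e -> 0 <= M ->
  exists2 T, 0 < T & forall t, 0 < t <= T -> M <= e * t `^ (- 4^-1).
Proof.
move=> e0 M0; exists ((e / (M + 1)) `^ 4); first by rewrite powR_gt0 // divr_gt0// ltr_wpDl.
move=> t /andP[t0 tT]; rewrite powRN ler_pdivlMr ?powR_gt0//.
have h : t `^ 4^-1 <= e / (M + 1).
  have : t `^ 4^-1 <= ((e / (M + 1)) `^ 4) `^ 4^-1.
    by apply: ge0_ler_powR => //; rewrite ?nnegrE ?powR_ge0 ?invr_ge0// ltW.
  by rewrite -powRrM mulfV// powRr1// divr_ge0 ?(ltW e0)// addr_ge0.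
apply: (le_trans (ler_wpM2l M0 h)); rewrite mulrCA -[leRHS]mulr1 ler_wpM2l ?(ltW e0)//.
by rewrite ler_pdivrMr ?ltr_wpDl// mul1r lerDl.
Qed.

(** The split behind all statements on short times: for finitely many modes everything is explicit
   in [t], and the remainder is small uniformly in [t]. *)
Lemma data_split g G : L2le (fun k => rho k * cabs (g k)) G -> forall e, 0 < e ->
  exists s0 g1 g2, [/\ uniq s0, (forall k, g k = g1 k + g2 k),
    (forall k, k \notin s0 -> g1 k = 0), (forall k, cabs (g1 k) <= cabs (g k)) &
    L2le (fun k => rho k * cabs (g2 k)) e].
Proof.
move=> hG e e0.
have [s0 us0 H] := L2le_split (fun k => mulr_ge0 (rho_ge0 k) (cabs_ge0 (g k))) hG e0.
exists s0, (fun k => if k \in s0 then g k else 0), (fun k => if k \in s0 then 0 else g k).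
split => //.
- by move=> k; case: ifP; rewrite ?addr0 ?add0r.
- by move=> k /negPf ->.
- by move=> k; case: ifP; rewrite ?cabs0 ?cabs_ge0.
- by apply: L2le_le H => // k; case: ifP; rewrite ?cabs0 ?mulr0 ?lexx// mulr_ge0 ?rho_ge0 ?cabs_ge0//= lexx.
Qed.

(** The finitely many modes of a datum contribute a bounded amount, which is less than any multiple
   of [t^(-1/4)] for short times; the remainder and the perturbation are small in norm. *)
Lemma lin_nw_small g0 G e : L2le (fun k => rho k * cabs (g0 k)) G -> 0 < e ->
  exists T eta, [/\ 0 < T, 0 < eta & forall g, L2le (fun k => rho k * cabs (g k - g0 k)) eta ->
    forall t, 0 < t <= T -> nw t (lin g t) (e * t `^ (- 4^-1))].
Proof.
move=> hG e0; pose eta := e / 3 / (linC + 1).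
have L0 := linC_ge0; have L1 : 0 < linC + 1 by rewrite ltr_wpDl.
have eta0 : 0 < eta by rewrite !divr_gt0.
have Le : linC * eta <= e / 3.
  rewrite /eta mulrCA -[leRHS]mulr1 ler_wpM2l ?divr_ge0 ?(ltW e0)// ler_pdivrMr// mul1r lerDl//.
have [s0 [g1 [g2 [us0 gE g10 g1g hg2]]]] := data_split hG eta0.
pose M := \sum_(k <- s0) kn k * cabs (g0 k).
have M0 : 0 <= M by apply: sumr_ge0 => k _; rewrite mulr_ge0 ?kn_ge0 ?cabs_ge0.
have [T T0 HT] := powR_quarter_large (divr_gt0 e0 (ltr0n R 3)) M0.
exists T, eta; split => // g hg t ht; have /andP[t0 tT] := ht.
have h2 := lin_nw t0 hg2; have h3 := lin_nw t0 hg.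
have h1 : nw t (lin g1 t) M.
  have : L1le (fun k => if k \in s0 then kn k * cabs (g0 k) else 0) M.
    by apply: L1le_fin => // k; rewrite mulr_ge0 ?kn_ge0 ?cabs_ge0.
  apply: L1le_le => // k; case: ifPn => [ks|ks]; last by rewrite cabs_lin g10// cabs0 !mulr0.
  rewrite ler_wpM2l ?kn_ge0// cabs_lin mulrA; apply: (@le_trans _ _ (1 * cabs (g1 k))).
    rewrite ler_wpM2r ?cabs_ge0//; apply: (le_trans (wt_bs0 k (ltW t0))).
    rewrite -expR0 ler_expR oppr_le0 mulr_ge0 ?exprn_ge0 ?kn_ge0// mulr_ge0 ?invr_ge0//.
    by rewrite mulr_ge0 ?(ltW nu0) ?(ltW t0).
  by rewrite mul1r.
have := L1leD (L1leD h1 h2) h3; apply: L1le_le => [k|].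
  rewrite -!mulrDr ler_wpM2l ?kn_ge0// ler_wpM2l ?wt_ge0//.
  have -> : lin g t k = lin g1 t k + lin g2 t k + lin (fun k => g k - g0 k) t k.
    by rewrite /lin -!mulrDr gE; congr (_ * _); ring.
  by apply: (le_trans (cabsD _ _)); rewrite lerD2r cabsD.
have T4 : 0 <= t `^ (- 4^-1) by exact: powR_ge0.
have h5 := HT t ht; have h6 := ler_wpM2r T4 Le; lra.
Qed.

Lemma lin_L2_small g0 G e : L2le (fun k => rho k * cabs (g0 k)) G -> 0 < e ->
  exists2 T, 0 < T & forall t, 0 < t <= T ->
    L2le (fun k => kn k * (rho k * cabs (lin g0 t k))) (e * t `^ (- 4^-1)).
Proof.
move=> hG e0; pose eta := e / 2 / (nu `^ (- 4^-1) + 1).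
have L0 : 0 <= nu `^ (- 4^-1) by exact: powR_ge0.
have L1 : 0 < nu `^ (- 4^-1) + 1 by rewrite ltr_wpDl.
have eta0 : 0 < eta by rewrite !divr_gt0.
have Le : nu `^ (- 4^-1) * eta <= e / 2.
  rewrite /eta mulrCA -[leRHS]mulr1 ler_wpM2l ?divr_ge0 ?(ltW e0)// ler_pdivrMr// mul1r lerDl//.
have [s0 [g1 [g2 [us0 gE g10 g1g hg2]]]] := data_split hG eta0.
pose M := \sum_(k <- s0) kn k * (rho k * cabs (g0 k)).
have M0 : 0 <= M by apply: sumr_ge0 => k _; rewrite !mulr_ge0 ?kn_ge0 ?rho_ge0 ?cabs_ge0.
have [T T0 HT] := powR_quarter_large (divr_gt0 e0 (ltr0n R 2)) M0.
exists T => // t ht; have /andP[t0 tT] := ht.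
have h2 := lin_L2 t0 hg2.
have p0 c k : 0 <= kn k * (rho k * cabs (c k)) by rewrite !mulr_ge0 ?kn_ge0 ?rho_ge0 ?cabs_ge0.
have h1 : L2le (fun k => kn k * (rho k * cabs (lin g1 t k))) M.
  apply: L1le_L2le => //.
  have : L1le (fun k => if k \in s0 then kn k * (rho k * cabs (g0 k)) else 0) M by exact: L1le_fin.
  apply: L1le_le => // k; case: ifPn => [ks|ks]; last by rewrite cabs_lin g10// cabs0 !mulr0.
  rewrite ler_wpM2l ?kn_ge0// ler_wpM2l ?rho_ge0// cabs_lin.
  apply: (@le_trans _ _ (1 * cabs (g1 k))); last by rewrite mul1r.
  by rewrite ler_wpM2r ?cabs_ge0// bs_le1// ltW.
have := L2leD (p0 _) (p0 _) h1 h2; apply: L2le_le => [k|].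
  rewrite p0/= -!mulrDr ler_wpM2l ?kn_ge0// ler_wpM2l ?rho_ge0//.
  by rewrite {1}/lin gE mulrDr cabsD.
have T4 : 0 <= t `^ (- 4^-1) by exact: powR_ge0.
have h5 := HT t ht; have h6 := ler_wpM2r T4 Le; lra.
Qed.

(** Strong continuity of the biharmonic semigroup at the initial time. *)
Lemma lin_cont0 g0 G e : L2le (fun k => rho k * cabs (g0 k)) G -> 0 < e ->
  exists2 T, 0 < T & forall t, 0 < t <= T ->
    L2le (fun k => rho k * cabs (lin g0 t k - g0 k)) e.
Proof.
move=> hG e0; have e20 : 0 < e / 4 by rewrite divr_gt0.
have [s0 [g1 [g2 [us0 gE g10 g1g hg2]]]] := data_split hG e20.
pose M := \sum_(k <- s0) rate nu k * (rho k * cabs (g0 k)).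
have r0 (k : Z) : 0 <= rate nu k := rate_ge0 nu0 k.
have M0 : 0 <= M by apply: sumr_ge0 => k _; rewrite mulr_ge0 ?r0// mulr_ge0 ?rho_ge0 ?cabs_ge0.
have M1 : 0 < M + 1 by rewrite ltr_wpDl.
exists (e / 2 / (M + 1)); first by rewrite !divr_gt0.
move=> t /andP[t0 tT].
have p0 (z : R[i]) k : 0 <= rho k * cabs z by rewrite mulr_ge0 ?rho_ge0 ?cabs_ge0.
have linB c k : cabs (lin c t k - c k) = (1 - bs t k) * cabs (c k).
  have -> : lin c t k - c k = (bs t k - 1)%:C * c k by rewrite /lin rmorphB/= mulrBl mul1r.
  by rewrite cabsM cabs_real distrC ger0_norm// subr_ge0 bs_le1// ltW.
have h2 : L2le (fun k => rho k * cabs (lin g2 t k - g2 k)) (e / 4).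
  apply: L2le_le hg2 => // k; rewrite p0/= ler_wpM2l ?rho_ge0// linB.
  by rewrite ler_piMl ?cabs_ge0// gerBl ltW// bs_gt0.
have h1 : L2le (fun k => rho k * cabs (lin g1 t k - g1 k)) (t * M).
  apply: L1le_L2le => //.
  have : L1le (fun k => if k \in s0 then t * (rate nu k * (rho k * cabs (g0 k))) else 0) (t * M).
    apply: L1le_fin => //; first by move=> k; rewrite mulr_ge0 ?(ltW t0)// mulr_ge0 ?r0// mulr_ge0 ?rho_ge0 ?cabs_ge0.
    by rewrite -mulr_sumr.
  apply: L1le_le => // k; rewrite linB; case: ifPn => [ks|ks]; last by rewrite g10// cabs0 !mulr0.
  have -> : t * (rate nu k * (rho k * cabs (g0 k))) = rho k * ((rate nu k * t) * cabs (g0 k)) by ring.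
  rewrite ler_wpM2l ?rho_ge0// ler_pM ?cabs_ge0 ?subr_ge0 ?bs_le1 ?(ltW t0)//.
  by rewrite bsE lerBlDr -lerBlDl; have := expR_ge1Dx (- (rate nu k * t)); lra.
have := L2leD (fun k => p0 _ k) (fun k => p0 _ k) h1 h2; apply: L2le_le => [k|].
  rewrite p0/= -!mulrDr ler_wpM2l ?rho_ge0//.
  have -> : lin g0 t k - g0 k = (lin g1 t k - g1 k) + (lin g2 t k - g2 k).
    by rewrite /lin gE mulrDr; ring.
  exact: cabsD.
have : t * M <= e / 2.
  apply: (@le_trans _ _ (e / 2 / (M + 1) * M)); first by rewrite ler_wpM2r.
  rewrite mulrAC ler_pdivrMr// ler_wpM2l ?divr_ge0 ?(ltW e0)// lerDl//.
lra.
Qed.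

End linear.

(** * Local existence *)

(** ** Smoothing by the Duhamel integral *)

Section duhamel_estimates.
Context {R : realType} {d : nat}.
Variable nu : R.
Hypothesis nu0 : 0 < nu.
Hypothesis d0 : (0 < d)%N.
Local Notation mu := (@lebesgue_measure R).
Local Notation pt := 'rV[R]_d.
Local Notation Z := 'rV[int]_d.
Local Notation kn := (@freq_norm R d).
Local Notation kappa := (@kappa R d).
Local Notation rho := (@rho R d).
Local Notation bs := (bs nu).
Local Notation wt := (wt nu).
Local Notation nw := (nw nu).
Local Notation duh := (duh nu).
Implicit Types (g c e : Z -> R[i]) (q : R -> Z -> R[i]) (F : R -> 'I_d -> Z -> R).

(** Two powers of the frequency, one of the divergence and one of the gradient in the norm, cost
   [(t - u)^(-1/2)], which is integrated against [u^(-3/4)]. *)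
Lemma duh_nw T q t F (B : R) : adm T q -> 0 < t <= T -> 0 <= B ->
  (forall s j k, 0 <= F s j k) ->
  (forall s k, 0 < s < t -> cabs (q s k) <= kn k * \sum_j F s j k) ->
  (forall s j, 0 < s < t -> L1le (fun k => wt s k * F s j k) (B * s `^ (- (3 / 4)))) ->
  nw t (duh q t) (32 * d%:R * (nu / 2) `^ (- 2^-1) * B * t `^ (- 4^-1)).
Proof.
move=> aq ht B0 F0 hq hF s us; have /andP[t0 tT] := ht.
pose C := (nu / 2) `^ (- 2^-1) * d%:R * B.
have C0 : 0 <= C by rewrite mulr_ge0// mulr_ge0 ?powR_ge0.
have i1 : mu.-integrable `]0, t[ (EFin \o sker 2^-1 (3 / 4) t) by apply: integrable_sker => //; lra.
have -> : 32 * d%:R * (nu / 2) `^ (- 2^-1) * B * t `^ (- 4^-1) = 2 * (C * (16 * t `^ (- 4^-1))).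
  by rewrite /C; ring.
under eq_bigr do rewrite mulrA.
apply: (duh_le nu0 aq ht _ (integrable_lin C i1)).
- by move=> k; rewrite mulr_ge0 ?kn_ge0 ?wt_ge0.
- move=> u hu; have /andP[u0 ut] := hu; have tu : 0 < t - u by rewrite subr_gt0.
  have nt : 0 < nu * (t - u) / 2 by rewrite divr_gt0// mulr_gt0.
  have qE : (nu / 2) `^ (- 2^-1) * (t - u) `^ (- 2^-1) = (nu * (t - u) / 2) `^ (- 2^-1).
    by rewrite -powRM ?(ltW tu) ?divr_ge0 ?(ltW nu0)//; congr (_ `^ _); ring.
  have hu2 : 0 <= u <= t by rewrite (ltW u0) (ltW ut).
  have ku k : kn k * wt t k * (bs (t - u) k * cabs (q u k)) <=
     ((nu / 2) `^ (- 2^-1) * (t - u) `^ (- 2^-1)) * (\sum_j wt u k * F u j k).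
    have S0 : 0 <= \sum_j F u j k by apply: sumr_ge0.
    have h1 := @wt_bs R d nu nu0 u t k hu2.
    have h2 : kn k ^+ 2 * expR (- (nu * (t - u) / 2 * kn k ^+ 4)) <= (nu * (t - u) / 2) `^ (- 2^-1).
      by apply: (@smoothing R (nu * (t - u) / 2) (kn k) 2^-1 2 nt (kn_ge0 k)); lra.
    apply: (@le_trans _ _ (kn k * (wt t k * bs (t - u) k) * (kn k * \sum_j F u j k))).
      have -> : kn k * wt t k * (bs (t - u) k * cabs (q u k)) = kn k * (wt t k * bs (t - u) k) * cabs (q u k) by ring.
      by rewrite ler_wpM2l ?hq// mulr_ge0 ?kn_ge0// mulr_ge0 ?wt_ge0// ltW// bs_gt0.
    apply: (@le_trans _ _ (kn k * (wt u k * expR (- ((nu * (t - u) / 2) * kn k ^+ 4))) * (kn k * \sum_j F u j k))).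
      by rewrite ler_wpM2r ?mulr_ge0 ?kn_ge0// ler_wpM2l ?kn_ge0.
    rewrite qE -mulr_sumr.
    have -> : kn k * (wt u k * expR (- (nu * (t - u) / 2 * kn k ^+ 4))) * (kn k * \sum_j F u j k) =
      (kn k ^+ 2 * expR (- (nu * (t - u) / 2 * kn k ^+ 4))) * (wt u k * \sum_j F u j k) by ring.
    by apply: ler_wpM2r => //; rewrite mulr_ge0 ?wt_ge0.
  apply: (@le_trans _ _ (\sum_(k <- s) ((nu / 2) `^ (- 2^-1) * (t - u) `^ (- 2^-1)) * (\sum_j wt u k * F u j k))).
    by apply: ler_sum => k _; exact: ku.
  rewrite -mulr_sumr exchange_big/=.
  apply: (@le_trans _ _ ((nu / 2) `^ (- 2^-1) * (t - u) `^ (- 2^-1) * (d%:R * (B * u `^ (- (3 / 4)))))).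
    rewrite ler_wpM2l ?mulr_ge0 ?powR_ge0//.
    apply: (@le_trans _ _ (\sum_(j < d) (B * u `^ (- (3 / 4))))); last by rewrite sumr_const card_ord -[leLHS]mulr_natl.
    by apply: ler_sum => j _; apply: (hF u j hu).
  by rewrite /sker /C le_eqVlt; apply/orP; left; apply/eqP; ring.
- rewrite RintegralZl// ler_wpM2l//.
  have -> : - 4^-1 = 1 - 2^-1 - 3 / 4 :> R by field.
  by apply: Rintegral_sker_le => //; lra.
Qed.

(** The same in weighted [l2]: the cost of [n + 1] derivatives is [(t - u)^(- p)] with
   [4 p = n + 1]. *)
Lemma duh_l2 T q t F (B p : R) (n : nat) : adm T q -> 0 < t <= T -> 0 <= B ->
  n.+1%:R = 4 * p -> 0 <= p <= 3 / 4 ->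
  (forall s j k, 0 <= F s j k) ->
  (forall s k, 0 < s < t -> cabs (q s k) <= kn k * \sum_j F s j k) ->
  (forall s j, 0 < s < t -> L2le (fun k => rho k * F s j k) (B * s `^ (- (3 / 4)))) ->
  L2le (fun k => kn k ^+ n * (rho k * cabs (duh q t k)))
    (32 * d%:R * nu `^ (- p) * B * t `^ (1 - p - 3 / 4)).
Proof.
move=> aq ht B0 np hp F0 hq hF; have /andP[t0 tT] := ht.
have w0 k : 0 <= kn k ^+ n * rho k by rewrite mulr_ge0 ?exprn_ge0 ?kn_ge0 ?rho_ge0.
apply: L2le_dual.
- by rewrite !mulr_ge0 ?powR_ge0.
- by move=> k; rewrite mulrA mulr_ge0 ?w0 ?cabs_ge0.
move=> y Y s us Y0 y0 hy.
pose C := nu `^ (- p) * d%:R * B * Y.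
have C0 : 0 <= C by rewrite mulr_ge0// mulr_ge0// mulr_ge0 ?powR_ge0.
have p34 : is_true (((0 : R) <= (3 / 4 : R)) && ((3 / 4 : R) <= (3 / 4 : R))).
  by apply/andP; split; [exact: divr_ge0|exact: lexx].
have i1 : mu.-integrable `]0, t[ (EFin \o sker p (3 / 4) t) by apply: integrable_sker.
have -> : Y * (32 * d%:R * nu `^ (- p) * B * t `^ (1 - p - 3 / 4)) = 2 * (C * (16 * t `^ (1 - p - 3 / 4))).
  by rewrite /C; ring.
have -> : \sum_(k <- s) y k * (kn k ^+ n * (rho k * cabs (duh q t k))) =
   \sum_(k <- s) y k * (kn k ^+ n * rho k) * cabs (duh q t k).
  by apply: eq_bigr => k _; ring.
apply: (duh_le nu0 aq ht _ (integrable_lin C i1)).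
- by move=> k; rewrite mulr_ge0.
- move=> u hu; have /andP[u0 ut] := hu; have tu : 0 < t - u by rewrite subr_gt0.
  have ku k : y k * (kn k ^+ n * rho k) * (bs (t - u) k * cabs (q u k)) <=
     (nu `^ (- p) * (t - u) `^ (- p)) * (\sum_j y k * (rho k * F u j k)).
    have S0 : 0 <= \sum_j F u j k by apply: sumr_ge0.
    have h2 : kn k ^+ n.+1 * bs (t - u) k <= (nu * (t - u)) `^ (- p).
      by apply: kn_bs_le => //; move: hp => /andP[h3 h4]; rewrite h3/=; lra.
    have -> : nu `^ (- p) * (t - u) `^ (- p) = (nu * (t - u)) `^ (- p) by rewrite powRM ?(ltW tu) ?(ltW nu0).
    have -> : \sum_j y k * (rho k * F u j k) = y k * (rho k * \sum_j F u j k).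
      by rewrite !mulr_sumr.
    apply: (@le_trans _ _ (y k * (kn k ^+ n * rho k) * (bs (t - u) k * (kn k * \sum_j F u j k)))).
      apply: ler_wpM2l; first by apply: mulr_ge0; [exact: y0|exact: w0].
      by apply: ler_wpM2l; [exact: ltW (bs_gt0 _ _ _)|exact: hq].
    have -> : y k * (kn k ^+ n * rho k) * (bs (t - u) k * (kn k * \sum_j F u j k)) =
      (kn k ^+ n.+1 * bs (t - u) k) * (y k * (rho k * \sum_j F u j k)) by rewrite exprSr; ring.
    by apply: ler_wpM2r => //; rewrite mulr_ge0// mulr_ge0 ?rho_ge0.
  apply: (@le_trans _ _ (\sum_(k <- s) (nu `^ (- p) * (t - u) `^ (- p)) * (\sum_j y k * (rho k * F u j k)))).
    by apply: ler_sum => k _; exact: ku.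
  rewrite -mulr_sumr exchange_big/=.
  apply: (@le_trans _ _ (nu `^ (- p) * (t - u) `^ (- p) * (d%:R * (Y * (B * u `^ (- (3 / 4))))))).
    rewrite ler_wpM2l ?mulr_ge0 ?powR_ge0//.
    apply: (@le_trans _ _ (\sum_(j < d) (Y * (B * u `^ (- (3 / 4)))))); last by rewrite sumr_const card_ord -[leLHS]mulr_natl.
    by apply: ler_sum => j _; apply: (L2le_pair (hF u j hu)).
  by rewrite /sker /C le_eqVlt; apply/orP; left; apply/eqP; ring.
- rewrite RintegralZl// ler_wpM2l//.
  exact: Rintegral_sker_le.
Qed.

(** ** The source term of a sequence *)

(** The components of the gradient of the function with coefficients [c]. *)
Definition sg c (i : 'I_d) : pt -> R := syn (dcoef i c).
Definition src c : Z -> R[i] := nlu (sg c).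

Lemma src0 c : src c 0 = 0. Proof. exact: nlu0. Qed.

Lemma nw_ge0 t c A : nw t c A -> 0 <= A. Proof. exact: L1le_ge0. Qed.

Lemma nw_kn t c A : 0 <= t -> nw t c A -> L1le (fun k => kn k * cabs (c k)) A.
Proof.
move=> t0; apply: L1le_le => // k; rewrite ler_wpM2l ?kn_ge0//.
by rewrite ler_peMl ?cabs_ge0// wt_ge1.
Qed.

Lemma nw_mono s t c A : 0 <= s -> s <= t -> nw t c A -> nw s c A.
Proof.
move=> s0 st; apply: L1le_le => // k; rewrite ler_wpM2l ?kn_ge0//.
by rewrite ler_wpM2r ?cabs_ge0// wt_mono.
Qed.

Definition polyC (t : R) (m : nat) : R := (1 + m%:R / (nu * t / 2)) ^+ m.

Lemma polyC_ge0 t m : 0 < t -> 0 <= polyC t m.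
Proof.
by move=> t0; rewrite exprn_ge0// addr_ge0// divr_ge0// divr_ge0// mulr_ge0// ltW.
Qed.

Lemma nw_poly t c A m k : 0 < t -> nw t c A -> k != 0 ->
  (1 + kn k) ^+ m * cabs (c k) <= polyC t m * A.
Proof.
move=> t0 h k0; have a0 : 0 < nu * t / 2 by rewrite divr_gt0// mulr_gt0.
apply: (@le_trans _ _ (polyC t m * (kn k * (wt t k * cabs (c k))))); last first.
  by rewrite ler_wpM2l ?polyC_ge0//; exact: L1le_point h.
apply: (@le_trans _ _ (polyC t m * (wt t k * cabs (c k)))); last first.
  rewrite ler_wpM2l ?polyC_ge0// ler_peMl ?kn_ge1// mulr_ge0 ?wt_ge0 ?cabs_ge0//.
by rewrite mulrA ler_wpM2r ?cabs_ge0// poly_le_expR ?kn_ge0.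
Qed.

(** The exponential weight dominates all powers. *)
Lemma nw_rapid t c A : 0 < t -> nw t c A -> rapid c.
Proof.
move=> t0 h m; pose D := polyC t (m + (d + 2)) * A + cabs (c 0).
have D0 : 0 <= D by rewrite addr_ge0 ?cabs_ge0// mulr_ge0 ?polyC_ge0//; exact: nw_ge0 h.
exists (D * (1 + @shell_cst R d * 2)).
apply: L1le_le (L1leZ D0 (lattice_poly d0)) => // k.
have kp : 0 < 1 + kn k by rewrite ltr_pwDl ?kn_ge0.
have [->|k0] := eqVneq k 0.
  rewrite kn0 addr0 !expr1n invr1 mul1r mulr1 /D lerDr mulr_ge0 ?polyC_ge0//; exact: nw_ge0 h.
rewrite ler_pdivlMr ?exprn_gt0// mulrAC -exprD.
by apply: (le_trans (nw_poly _ t0 h k0)); rewrite lerDl cabs_ge0.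
Qed.

Section one_time.
Variable t : R.
Hypothesis t0 : 0 < t.

Lemma sg_L1 c A i : nw t c A -> L1le (fun k => cabs (dcoef i c k)) A.
Proof.
by move=> h; apply: L1le_le (nw_kn (ltW t0) h) => // k; exact: cabs_dcoef_le.
Qed.

Lemma sg_pcont c A i : nw t c A -> pcont (sg c i).
Proof. by move=> h; exact: pcont_syn (sg_L1 i h). Qed.

Lemma sg_fourier c A i k : conj_sym c -> nw t c A -> fourier (sg c i) k = dcoef i c k.
Proof. by move=> hc h; apply: (fourier_syn (sg_L1 i h)); exact: conj_sym_dcoef. Qed.

Lemma sg_wl c A i : conj_sym c -> nw t c A -> L1le (fun k => wt t k * cabs (fourier (sg c i) k)) A.
Proof.
move=> hc h; apply: L1le_le (h) => // k; rewrite (sg_fourier i k hc h).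
by rewrite [leRHS]mulrCA ler_wpM2l ?wt_ge0// cabs_dcoef_le.
Qed.

Lemma sg_partial c A i : nw t c A -> partial i (syn c) = sg c i.
Proof. by move=> h; have [M hM] := nw_rapid t0 h 2; rewrite (syn_partial hM). Qed.

Lemma sg_le c A i x : nw t c A -> `|sg c i x| <= kappa * A.
Proof. by move=> h; exact: syn_le (sg_L1 i h) x. Qed.

Lemma sg_sub c e A B i x : nw t c A -> nw t e B -> sg c i x - sg e i x = sg (fun k => c k - e k) i x.
Proof.
move=> hc he; have H1 := has_sum_syn (sg_L1 i hc) x; have H2 := has_sum_syn (sg_L1 i he) x.
have H3 := has_sumD H1 (has_sumZ (-1) H2).
rewrite mulN1r in H3; rewrite -(has_sumE H3); congr tsum; apply/funext => k.
have -> : dcoef i (fun k => c k - e k) k = dcoef i c k - dcoef i e k by rewrite /dcoef mulrBr.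
by rewrite !trigE ReBc ImBc; ring.
Qed.

Lemma sg_sub_le c e A B D i x : nw t c A -> nw t e B ->
  L1le (fun k => kn k * cabs (c k - e k)) D -> `|sg c i x - sg e i x| <= kappa * D.
Proof.
move=> hc he hD; rewrite (sg_sub i x hc he); apply: syn_le.
by apply: L1le_le hD => // k; exact: cabs_dcoef_le.
Qed.

Lemma src_wl c e A D j : conj_sym c -> conj_sym e -> nw t c A -> nw t e A ->
  nw t (fun k => c k - e k) D ->
  L1le (fun k => wt t k * cabs (fourier (cub (sg c) j) k - fourier (cub (sg e) j) k))
    ((3 * d%:R * kappa ^+ 2 * A ^+ 2 + 1) * D).
Proof.
move=> sc se hc he hD.
apply: (wl_cub_sub (W := wt t)) => //.
- by move=> k; rewrite wt_ge1// ltW.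
- by move=> k l; rewrite wt_sub// ltW.
- by move=> i; exact: sg_pcont hc.
- by move=> i; exact: sg_pcont he.
- by move=> i; exact: sg_wl.
- by move=> i; exact: sg_wl.
move=> i; apply: L1le_le hD => // k; rewrite fourierB; [|exact/bpt_tI/pcont_bpt/(sg_pcont i hc)|exact/bpt_tI/pcont_bpt/(sg_pcont i he)].
rewrite (sg_fourier i k sc hc) (sg_fourier i k se he) /dcoef -mulrBr.
by rewrite [leRHS]mulrCA ler_wpM2l ?wt_ge0// (cabs_dcoef_le i (fun k => c k - e k)).
Qed.

Lemma conj_sym0 : conj_sym (fun _ : Z => 0 : R[i]).
Proof. by move=> k; rewrite rmorph0. Qed.

Lemma nw0 : nw t (fun _ : Z => 0) 0.
Proof. by move=> s _; rewrite big1// => k _; rewrite cabs0 !mulr0. Qed.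

Lemma sg0 i x : sg (fun=> 0) i x = 0.
Proof.
have := sg_le i x nw0; rewrite mulr0 normr_le0 => /eqP h; exact: h.
Qed.

Lemma src_wl0 c A j : conj_sym c -> nw t c A ->
  L1le (fun k => wt t k * cabs (fourier (cub (sg c) j) k)) ((3 * d%:R * kappa ^+ 2 * A ^+ 2 + 1) * A).
Proof.
move=> sc hc; have A0 := nw_ge0 hc.
have hz : nw t (fun _ : Z => 0) A by apply: (L1le_le (fun k => lexx _) A0 nw0).
have hcz : nw t (fun k => c k - 0) A by apply: L1le_le hc => // k; rewrite subr0.
apply: L1le_le (src_wl j sc conj_sym0 hc hz hcz) => // k.
have -> : fourier (cub (sg (fun=> 0)) j) k = 0; last by rewrite subr0.
have -> : cub (sg (fun=> 0)) j = (fun x : pt => 0 * 0).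
  by apply/funext => x; rewrite /cub sg0 mulr0 mulr0.
by rewrite fourierZ ?mul0r//; apply: bpt_tI; exact: bpt_cst.
Qed.

Definition lC : R := d%:R * (kappa ^+ 2 * @rhoC R d * (2 * @rhoC R d + 1)).

Lemma lC_ge0 : 0 <= lC.
Proof.
have r0 : 0 <= @rhoC R d by exact: sqrtr_ge0.
by rewrite /lC !mulr_ge0 ?exprn_ge0 ?(ltW (@kappa_gt0 R d))// addr_ge0// mulr_ge0.
Qed.

Lemma src_l2 c A K j : conj_sym c -> nw t c A -> L2le (fun k => kn k * (rho k * cabs (c k))) K ->
  L2le (fun k => rho k * cabs (fourier (cub (sg c) j) k)) ((lC * A ^+ 2 + 1) * K).
Proof.
move=> sc hc hK; apply: (l2_cub d0) => //.
- exact: rho_ge0.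
- exact: sqrtr_ge0.
- exact: rho_add.
- by move=> i; exact: sg_pcont hc.
- by move=> i; apply: L1le_le (sg_L1 i hc) => // k; rewrite (sg_fourier i k sc hc).
move=> i; apply: L2le_le hK => // k; rewrite (sg_fourier i k sc hc).
rewrite mulr_ge0 ?rho_ge0 ?cabs_ge0//= mulrCA ler_wpM2l ?rho_ge0//; exact: cabs_dcoef_le.
Qed.

End one_time.

End duhamel_estimates.

(** ** Limits of sequences of coefficients *)

Section limits.
Context {R : realType} {I : choiceType}.
Implicit Types (u : nat -> I -> R[i]).

Definition ptlim u (l : I -> R[i]) := forall k e, 0 < e -> exists N, forall n, (N <= n)%N -> cabs (u n k - l k) <= e.

Lemma ptlim_sum u l (v : I -> R) M N0 (s : seq I) : ptlim u l -> (forall k, 0 <= v k) ->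
  (forall n, (N0 <= n)%N -> \sum_(k <- s) v k * cabs (u n k) <= M) ->
  \sum_(k <- s) v k * cabs (l k) <= M.
Proof.
move=> H v0 hM; apply/ler_addgt0Pr => e e0.
have [N hN] : exists N, forall n, (N <= n)%N -> \sum_(k <- s) v k * cabs (u n k - l k) <= e.
  elim: (s) e e0 => [|k s' IH] e e0; first by exists 0%N => n _; rewrite big_nil ltW.
  have e2 : 0 < e / 2 by rewrite divr_gt0.
  have [N hN] := IH _ e2; have [N' hN'] := H k (e / 2 / (v k + 1)) (divr_gt0 e2 (ltr_wpDl (v0 k) ltr01)).
  exists (maxn N N') => n; rewrite geq_max => /andP[h1 h2]; rewrite big_cons [leRHS]splitr.
  apply: lerD; last exact: hN.
  apply: (le_trans (ler_wpM2l (v0 k) (hN' n h2))).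
  by rewrite mulrCA -[leRHS]mulr1 ler_wpM2l ?(ltW e2)// ler_pdivrMr ?ltr_wpDl// mul1r lerDl.
pose n := maxn N N0.
have h1 := hN n (leq_maxl _ _); have h2 := hM n (leq_maxr _ _).
apply: (le_trans _ (lerD h2 h1)); rewrite -big_split/=; apply: ler_sum => k _.
rewrite -mulrDr ler_wpM2l//; have := cabsB (u n k) (u n k - l k).
by rewrite opprB addrC subrK.
Qed.

Lemma L1le_ptlim u l (v : I -> R) M N0 : ptlim u l -> (forall k, 0 <= v k) ->
  (forall n, (N0 <= n)%N -> L1le (fun k => v k * cabs (u n k)) M) ->
  L1le (fun k => v k * cabs (l k)) M.
Proof. by move=> H v0 hM s us; apply: (ptlim_sum (N0 := N0) H v0) => n /hM; apply. Qed.

Lemma L2le_ptlim u l (v : I -> R) M N0 : ptlim u l -> (forall k, 0 <= v k) ->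
  (forall n, (N0 <= n)%N -> L2le (fun k => v k * cabs (u n k)) M) ->
  L2le (fun k => v k * cabs (l k)) M.
Proof.
move=> H v0 hM; apply: L2le_dual.
- by have [] := hM N0 (leqnn _).
- by move=> k; rewrite mulr_ge0 ?cabs_ge0.
move=> y Y s us Y0 y0 hy; under eq_bigr do rewrite mulrA.
apply: (ptlim_sum (N0 := N0) H); first by move=> k; rewrite mulr_ge0.
move=> n hn; under eq_bigr do rewrite -mulrA.
exact: (L2le_pair (hM n hn)).
Qed.

Lemma geom_cvg (u : nat -> R) C : (forall n, `|u n.+1 - u n| <= C / 2 ^+ n) ->
  exists l, forall n, `|u n - l| <= 2 * C / 2 ^+ n.
Proof.
move=> h; have C0 : 0 <= C by have := le_trans (normr_ge0 _) (h 0%N); rewrite expr0 divr1.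
have p2 n : 0 < 2 ^+ n :> R by rewrite exprn_gt0.
have step n : 2 * C / 2 ^+ n.+1 = C / 2 ^+ n by rewrite exprS; field; rewrite gt_eqF.
pose A := [set x | exists n, x = u n - 2 * C / 2 ^+ n].
have lo n m : u n - 2 * C / 2 ^+ n <= u (n + m)%N - 2 * C / 2 ^+ (n + m).
  elim: m => [|m IH]; first by rewrite addn0.
  apply: (le_trans IH); rewrite addnS; have := h (n + m)%N; rewrite ler_norml => /andP[h1 _].
  have := step (n + m)%N; have -> : 2 * C / 2 ^+ (n + m) = C / 2 ^+ (n + m) + C / 2 ^+ (n + m) by ring.
  lra.
have hi n m : u (n + m)%N + 2 * C / 2 ^+ (n + m) <= u n + 2 * C / 2 ^+ n.
  elim: m => [|m IH]; first by rewrite addn0.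
  apply: le_trans IH; rewrite addnS; have := h (n + m)%N; rewrite ler_norml => /andP[_ h1].
  have := step (n + m)%N; have -> : 2 * C / 2 ^+ (n + m) = C / 2 ^+ (n + m) + C / 2 ^+ (n + m) by ring.
  lra.
have q0 n : 0 <= 2 * C / 2 ^+ n by rewrite divr_ge0 ?mulr_ge0// ltW.
have ub n m : u m - 2 * C / 2 ^+ m <= u n + 2 * C / 2 ^+ n.
  have := lo m n; have := hi n m; rewrite [(m + n)%N]addnC; have := q0 (n + m)%N; lra.
have hA : has_sup A.
  split; first by exists (u 0%N - 2 * C / 2 ^+ 0), 0%N.
  by exists (u 0%N + 2 * C / 2 ^+ 0) => x [m ->]; exact: ub.
exists (sup A) => n; rewrite ler_norml; apply/andP; split.
  have : sup A <= u n + 2 * C / 2 ^+ n by apply: ge_sup; [case: hA|move=> x [m ->]; exact: ub].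
  lra.
have : u n - 2 * C / 2 ^+ n <= sup A by apply: ub_le_sup; [case: hA|exists n].
lra.
Qed.

Lemma geom_ccvg (u : nat -> R[i]) C : (forall n, cabs (u n.+1 - u n) <= C / 2 ^+ n) ->
  exists l, forall n, cabs (u n - l) <= 4 * C / 2 ^+ n.
Proof.
move=> h; have [a ha] : exists l, forall n, `|complex.Re (u n) - l| <= 2 * C / 2 ^+ n.
  by apply: geom_cvg => n; rewrite -ReBc; exact: le_trans (Re_le_cabs _) _.
have [b hb] : exists l, forall n, `|complex.Im (u n) - l| <= 2 * C / 2 ^+ n.
  by apply: geom_cvg => n; rewrite -ImBc; exact: le_trans (Im_le_cabs _) _.
exists (a +i* b) => n; apply: (le_trans (cabs_le_ReIm _)); rewrite ReBc ImBc/=.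
have -> : 4 * C / 2 ^+ n = 2 * C / 2 ^+ n + 2 * C / 2 ^+ n by ring.
exact: lerD.
Qed.

End limits.

(** ** Picard iteration *)

Section picard.
Context {R : realType} {d : nat}.
Variable nu : R.
Hypothesis nu0 : 0 < nu.
Hypothesis d0 : (0 < d)%N.
Local Notation pt := 'rV[R]_d.
Local Notation Z := 'rV[int]_d.
Local Notation kn := (@freq_norm R d).
Local Notation kappa := (@kappa R d).
Local Notation rho := (@rho R d).
Local Notation bs := (bs nu).
Local Notation wt := (wt nu).
Local Notation nw := (nw nu).
Local Notation duh := (duh nu).
Local Notation lin := (lin nu).
Local Notation lC := (@lC R d).
Implicit Types (g : Z -> R[i]) (c : R -> Z -> R[i]).

(** The class in which the fixed point argument runs. The zero mode is prescribed, because the norm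
   [nw] does not see it. *)
Record tame (z0 : R[i]) (T E : R) c : Prop := Tame {
  tame_conj : forall t, 0 < t <= T -> conj_sym (c t);
  tame_zero : forall t, 0 < t <= T -> c t 0 = z0;
  tame_cont : forall k, cecont T (fun t => c t k);
  tame_nw : forall t, 0 < t <= T -> nw t (c t) (E * t `^ (- 4^-1)) }.

Lemma powR_quarters (s : R) : 0 < s ->
  (s `^ (- (3 / 4)) = (s `^ (- 4^-1)) ^+ 2 * s `^ (- 4^-1)) *
  (s `^ (- 4^-1) = s `^ (2^-1) * s `^ (- (3 / 4))).
Proof.
move=> s0; split.
  rewrite -powR_mulrn ?powR_ge0// -powRrM -powRD; last by rewrite (gt_eqF s0) implybT.
  by congr (_ `^ _); field.
by rewrite -powRD ?(gt_eqF s0) ?implybT//; congr (_ `^ _); field.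
Qed.

Lemma quarter_bound (s T X E D : R) : 0 < s <= T -> 0 <= X -> 0 <= D ->
  (X * (E * s `^ (- 4^-1)) ^+ 2 + 1) * (D * s `^ (- 4^-1)) <=
  (X * E ^+ 2 + T `^ 2^-1) * D * s `^ (- (3 / 4)).
Proof.
move=> /andP[s0 sT] X0 D0; have [h1 h2] := powR_quarters s0.
have hT : s `^ 2^-1 <= T `^ 2^-1.
  by apply: ge0_ler_powR; rewrite ?nnegrE ?invr_ge0 ?(ltW s0)// (le_trans _ sT)// ltW.
set P := s `^ (- 4^-1) in h1 h2 *; set Q := s `^ (- (3 / 4)) in h1 h2 *.
have Q0 : 0 <= Q by exact: powR_ge0.
have -> : (X * (E * P) ^+ 2 + 1) * (D * P) = D * (X * E ^+ 2 * Q + P) by rewrite h1; ring.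
have -> : (X * E ^+ 2 + T `^ 2^-1) * D * Q = D * (X * E ^+ 2 * Q + T `^ 2^-1 * Q) by ring.
by rewrite ler_wpM2l// lerD2l [leLHS]h2 ler_wpM2r.
Qed.

(** Away from the initial time the coefficients decay rapidly, uniformly in time; continuity of
   each coefficient then upgrades to continuity in every weighted [l1]. *)
Lemma tame_l1cont z0 T E c m : tame z0 T E c -> forall s0, 0 < s0 <= T -> forall e, 0 < e ->
  exists2 r, 0 < r & forall s, 0 < s <= T -> `|s0 - s| < r ->
    L1le (fun k => (1 + kn k) ^+ m * cabs (c s0 k - c s k)) e.
Proof.
move=> tc s0 hs0 e e0; have /andP[s00 s0T] := hs0.
have s20 : 0 < s0 / 2 by rewrite divr_gt0.
have s2s : s0 / 2 <= s0 by lra.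
pose A := E * (s0 / 2) `^ (- 4^-1).
pose M := 2 * (polyC nu (s0 / 2) (m + (d + 2)) * A).
pose P s := 0 < s <= T /\ s0 / 2 <= s.
have q0 : 0 <= 4^-1 :> R by rewrite invr_ge0.
have E0 : 0 <= E.
  have := nw_ge0 (tame_nw tc hs0); rewrite pmulr_lge0// powR_gt0//.
have A0 : 0 <= A by rewrite mulr_ge0 ?powR_ge0.
have nwA s : P s -> nw (s0 / 2) (c s) A.
  move=> [hs ss]; have h := nw_mono nu0 (ltW s20) ss (tame_nw tc hs).
  apply: L1le_le h => //; rewrite ler_wpM2l//; exact: powR_antitone.
have M0 : 0 <= M by rewrite mulr_ge0// mulr_ge0// polyC_ge0.
have Ps0 : P s0 by [].
pose phi k : R := M * ((1 + kn k) ^+ (d + 2))^-1.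
have kp (k : Z) : 0 < 1 + kn k by rewrite ltr_pwDl ?kn_ge0.
have one s k : P s -> k != 0 -> (1 + kn k) ^+ m * cabs (c s k) <= polyC nu (s0 / 2) (m + (d + 2)) * A * ((1 + kn k) ^+ (d + 2))^-1.
  move=> /nwA h k0; rewrite ler_pdivlMr ?exprn_gt0// mulrAC -exprD.
  exact: nw_poly h k0.
pose f s k : R := (1 + kn k) ^+ m * cabs (c s0 k - c s k).
have H1 k : 0 <= phi k by rewrite mulr_ge0 ?invr_ge0 ?exprn_ge0 ?(ltW (kp k)).
have H2 : L1le phi (M * (1 + @shell_cst R d * 2)) by apply: L1leZ => //; exact: lattice_poly.
have H3 s k : P s -> f s k <= phi k.
  move=> Ps; have [->|k0] := eqVneq k 0.
    by have [hs _] := Ps; rewrite /f (tame_zero tc hs) (tame_zero tc hs0) subrr cabs0 mulr0.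
  apply: (@le_trans _ _ ((1 + kn k) ^+ m * (cabs (c s0 k) + cabs (c s k)))).
    by rewrite ler_wpM2l ?cabsB// exprn_ge0 ?(ltW (kp k)).
  have h1 := one s0 k Ps0 k0; have h2 := one s k Ps k0.
  rewrite mulrDr; apply: (le_trans (lerD h1 h2)).
  by rewrite /phi /M le_eqVlt; apply/orP; left; apply/eqP; ring.
have H4 k e' : 0 < e' -> exists2 r, 0 < r & forall s, P s -> `|s0 - s| < r -> f s k <= e'.
  move=> e'0; have p0 : 0 < (1 + kn k) ^+ m by rewrite exprn_gt0.
  have [r r0 rP] := tame_cont tc k hs0 (divr_gt0 e'0 p0).
  exists r => // s [hs _] hr; have := ltW (rP s hs hr).
  by rewrite ler_pdivlMr// mulrC.
have [r r0 rP] := @L1le_dominated R _ phi _ f s0 P H1 H2 H3 H4 e e0.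
exists (Num.min r (s0 / 2)); first by rewrite lt_min r0.
move=> s hs; rewrite lt_min => /andP[h1 h2]; apply: rP => //; split => //.
by move: h2; rewrite ltr_norml => /andP[_ h2]; lra.
Qed.

Lemma tame_E0 z0 T E c : 0 < T -> tame z0 T E c -> 0 <= E.
Proof.
move=> T0 tc; have hT : 0 < T <= T by rewrite T0 lexx.
by have := nw_ge0 (tame_nw tc hT); rewrite pmulr_lge0// powR_gt0.
Qed.

Lemma tame_sup z0 T E c : tame z0 T E c -> forall s0, 0 < s0 <= T -> forall e, 0 < e ->
  exists2 r, 0 < r & forall s, 0 < s <= T -> `|s0 - s| < r ->
    forall i x, `|sg (c s0) i x - sg (c s) i x| <= e.
Proof.
move=> tc s0 hs0 e e0; have k0 := @kappa_gt0 R d.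
have [r r0 rP] := tame_l1cont 1 tc hs0 (divr_gt0 e0 k0).
exists r => // s hs hr i x; have h := rP s hs hr.
have /andP[s00 _] := hs0; have /andP[sp _] := hs.
have hc := tame_nw tc hs0.
have hc' : nw (Num.min s0 s) (c s0) (E * s0 `^ (- 4^-1)).
  by apply: nw_mono hc => //; rewrite ?ge_min ?lexx// le_min !ltW.
have he' : nw (Num.min s0 s) (c s) (E * s `^ (- 4^-1)).
  by apply: nw_mono (tame_nw tc hs) => //; rewrite ?ge_min ?lexx ?orbT// le_min !ltW.
have m0 : 0 < Num.min s0 s by rewrite lt_min s00.
have := @sg_sub_le R d nu nu0 _ m0 (c s0) (c s) _ _ (e / kappa) i x hc' he'.
rewrite mulrCA mulfV ?gt_eqF// mulr1; apply.
apply: L1le_le h => // k; rewrite ler_wpM2r ?cabs_ge0// expr1 lerDr//.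
Qed.

Lemma tame_adm z0 T E c : tame z0 T E c -> adm T (fun s => src (c s)).
Proof.
move=> tc; have [T0|T0] := leP T 0.
  move=> k; split; first by move=> t0 /andP[h1 h2]; have := lt_le_trans h1 (le_trans h2 T0); rewrite ltxx.
  by exists 0 => s /andP[h1 h2]; have := lt_le_trans h1 (le_trans h2 T0); rewrite ltxx.
have E0 := tame_E0 T0 tc; have k0 := @kappa_gt0 R d.
apply: (@adm_nlu _ _ (fun s => sg (c s)) T (kappa * E)).
- by rewrite mulr_ge0// ltW.
- by move=> s hs i; have /andP[sp _] := hs; exact: sg_pcont sp _ _ _ (tame_nw tc hs).
- move=> s hs i x; have /andP[sp _] := hs; rewrite -mulrA; exact: sg_le sp _ _ _ x (tame_nw tc hs).
- exact: tame_sup tc.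
Qed.

(** An upper bound for all constants of the iteration, so that one smallness condition serves
   all its estimates. *)
Definition picC : R := (32 * d%:R * (nu / 2) `^ (- 2^-1) + 32 * d%:R * nu `^ (- 2^-1) + 32 * d%:R * nu `^ (- 4^-1)) *
  (4 * (3 * d%:R * kappa ^+ 2 + lC) + 1).

(** A linear part of size [E] makes the cubic term a small perturbation; a short time [T] does
   the same for the linear term of the flux. *)
Definition small (E T : R) := [/\ 0 < T, 0 <= E & picC * (E ^+ 2 + T `^ 2^-1) <= 2^-1].

Lemma picC_ge0 : 0 <= picC.
Proof.
have p (a b : R) : 0 <= 32 * d%:R * a `^ b by rewrite mulr_ge0 ?powR_ge0// mulr_ge0.
have k2 : 0 <= 3 * d%:R * kappa ^+ 2 by rewrite mulr_ge0 ?sqr_ge0// mulr_ge0.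
rewrite /picC; apply: mulr_ge0; first by apply: addr_ge0; [apply: addr_ge0; exact: p|exact: p].
by apply: addr_ge0 => //; apply: mulr_ge0 => //; apply: addr_ge0 => //; exact: lC_ge0.
Qed.

Lemma small_le (a X E T : R) : small E T ->
  a \in [:: 32 * d%:R * (nu / 2) `^ (- 2^-1); 32 * d%:R * nu `^ (- 2^-1); 32 * d%:R * nu `^ (- 4^-1)] ->
  X = 3 * d%:R * kappa ^+ 2 \/ X = lC ->
  a * (X * (2 * E) ^+ 2 + T `^ 2^-1) <= 2^-1.
Proof.
move=> [T0 E0 h] ha hX; apply: le_trans h; have l0 : 0 <= lC by exact: lC_ge0.
have X1 : 0 <= 3 * d%:R * kappa ^+ 2 by rewrite !mulr_ge0 ?exprn_ge0 ?(ltW (@kappa_gt0 R d)).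
have T2 : 0 <= T `^ 2^-1 by exact: powR_ge0.
have E2 : 0 <= E ^+ 2 by exact: sqr_ge0.
have XX : 0 <= X <= 3 * d%:R * kappa ^+ 2 + lC.
  by case: hX => ->; rewrite ?X1 ?l0/= ?lerDl ?lerDr.
have b1 : 0 <= 32 * d%:R * (nu / 2) `^ (- 2^-1) by rewrite !mulr_ge0 ?powR_ge0.
have b2 : 0 <= 32 * d%:R * nu `^ (- 2^-1) by rewrite !mulr_ge0 ?powR_ge0.
have b3 : 0 <= 32 * d%:R * nu `^ (- 4^-1) by rewrite !mulr_ge0 ?powR_ge0.
rewrite /picC -mulrA; move: X1 l0 XX b1 b2 b3 ha.
set x1 := 3 * _ * _; set B1 := 32 * _ * _; set B2 := 32 * _ * nu `^ (- 2^-1); set B3 := 32 * _ * nu `^ (- 4^-1).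
move=> X1 l0 /andP[x0 xx] b1 b2 b3 ha.
have aB : 0 <= a <= B1 + B2 + B3.
  by move: ha; rewrite !inE => /or3P[] /eqP ->; apply/andP; split; lra.
have /andP[a0 aB'] := aB.
apply: ler_pM => //; first by rewrite addr_ge0// mulr_ge0 ?sqr_ge0.
have -> : X * (2 * E) ^+ 2 = 4 * (X * E ^+ 2) by ring.
have -> : (4 * (x1 + lC) + 1) * (E ^+ 2 + T `^ 2^-1) =
  4 * ((x1 + lC) * E ^+ 2) + 4 * (x1 + lC) * T `^ 2^-1 + E ^+ 2 + T `^ 2^-1 by ring.
have h1 := ler_wpM2r E2 xx.
have h2 : 0 <= 4 * (x1 + lC) * T `^ 2^-1 by rewrite !mulr_ge0// addr_ge0.
lra.
Qed.

Section iteration.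
Variables (g : Z -> R[i]) (G : R).
Hypothesis gconj : conj_sym g.

Definition Phi c (t : R) (k : Z) : R[i] := lin g t k + duh (fun s => src (c s)) t k.

Lemma src_conj t (c : Z -> R[i]) A : 0 < t -> nw t c A -> conj_sym (src c).
Proof.
move=> t0 hc k; rewrite /src /nlu rmorph_sum; apply: eq_bigr => j _.
rewrite fourierN; last by apply/bpt_tI/pcont_bpt/pcont_cub => i; exact: sg_pcont t0 _ _ _ hc.
by rewrite mxE intrN; move: (fourier (cub (sg c) j) k) => [a b]; apply: complex_ext => /=; ring.
Qed.

Lemma lin_conj t : conj_sym (lin g t).
Proof.
move=> k; rewrite /lin gconj /bs /bih_symbol knN; case: (g k) => a b.
by apply: complex_ext => /=; ring.
Qed.

Lemma Phi_diff T E c (e : R -> Z -> R[i]) z0 D t : tame z0 T E c -> tame z0 T E e -> 0 < t <= T -> 0 <= D ->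
  (forall s, 0 < s <= T -> nw s (fun k => c s k - e s k) (D * s `^ (- 4^-1))) ->
  nw t (fun k => Phi c t k - Phi e t k)
    (32 * d%:R * (nu / 2) `^ (- 2^-1) * ((3 * d%:R * kappa ^+ 2 * E ^+ 2 + T `^ 2^-1) * D) * t `^ (- 4^-1)).
Proof.
move=> tc te ht D0 hD; have /andP[t0 tT] := ht.
have X1 : 0 <= 3 * d%:R * kappa ^+ 2 by rewrite !mulr_ge0 ?exprn_ge0 ?(ltW (@kappa_gt0 R d)).
have E0 : (fun k => Phi c t k - Phi e t k) = duh (fun s k => src (c s) k - src (e s) k) t.
  apply/funext => k; rewrite (duhB nu0 k (tame_adm tc) (tame_adm te) ht) /Phi.
  by rewrite opprD addrACA subrr add0r.
rewrite E0; apply: (duh_nw nu0 (T := T) (F := fun s j k => cabs (fourier (cub (sg (c s)) j) k - fourier (cub (sg (e s)) j) k))) => //.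
- by apply: admB; [exact: tame_adm tc|exact: tame_adm te].
- by rewrite mulr_ge0// addr_ge0 ?powR_ge0// mulr_ge0 ?sqr_ge0.
- by move=> s j k; exact: cabs_ge0.
- by move=> s k hs; exact: nlu_sub.
- move=> s j /andP[s0 st]; have hs : 0 < s <= T by rewrite s0 (le_trans (ltW st)).
  apply: L1le_le (src_wl nu0 d0 s0 j (tame_conj tc hs) (tame_conj te hs) (tame_nw tc hs) (tame_nw te hs) (hD s hs)) => //.
  exact: quarter_bound.
Qed.

Lemma Phi_nw T E c z0 t : 0 < T -> tame z0 T E c -> 0 < t <= T ->
  nw t (duh (fun s => src (c s)) t)
    (32 * d%:R * (nu / 2) `^ (- 2^-1) * ((3 * d%:R * kappa ^+ 2 * E ^+ 2 + T `^ 2^-1) * E) * t `^ (- 4^-1)).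
Proof.
move=> T0 tc ht; have /andP[t0 tT] := ht; have E0 := tame_E0 T0 tc.
have X1 : 0 <= 3 * d%:R * kappa ^+ 2 by rewrite !mulr_ge0 ?exprn_ge0 ?(ltW (@kappa_gt0 R d)).
apply: (duh_nw nu0 (T := T) (F := fun s j k => cabs (fourier (cub (sg (c s)) j) k))) => //.
- exact: tame_adm tc.
- by rewrite mulr_ge0// addr_ge0 ?powR_ge0// mulr_ge0 ?sqr_ge0.
- by move=> s j k; exact: cabs_ge0.
- by move=> s k hs; exact: nlu_le.
- move=> s j /andP[s0 st]; have hs : 0 < s <= T by rewrite s0 (le_trans (ltW st)).
  apply: L1le_le (src_wl0 nu0 d0 s0 j (tame_conj tc hs) (tame_nw tc hs)) => //.
  exact: quarter_bound.
Qed.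

Lemma Phi_l2 T E c z0 t K p n : n.+1%:R = 4 * p -> 0 <= p <= 3 / 4 -> tame z0 T E c -> 0 < t <= T -> 0 <= K ->
  (forall s, 0 < s < t -> L2le (fun k => kn k * (rho k * cabs (c s k))) (K * s `^ (- 4^-1))) ->
  L2le (fun k => kn k ^+ n * (rho k * cabs (duh (fun s => src (c s)) t k)))
    (32 * d%:R * nu `^ (- p) * ((lC * E ^+ 2 + T `^ 2^-1) * K) * t `^ (1 - p - 3 / 4)).
Proof.
move=> np hp tc ht K0 hK; have /andP[t0 tT] := ht.
apply: (duh_l2 nu0 (T := T) (F := fun s j k => cabs (fourier (cub (sg (c s)) j) k))) => //.
- exact: tame_adm tc.
- by rewrite mulr_ge0// addr_ge0 ?powR_ge0// mulr_ge0 ?sqr_ge0 ?lC_ge0.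
- by move=> s j k; exact: cabs_ge0.
- by move=> s k hs; exact: nlu_le.
- move=> s j hst; have /andP[s0 st] := hst; have hs : 0 < s <= T by rewrite s0 (le_trans (ltW st)).
  apply: L2le_le (src_l2 nu0 d0 s0 j (tame_conj tc hs) (tame_nw tc hs) (hK s hst)) => //.
    by move=> k; rewrite lexx mulr_ge0 ?rho_ge0 ?cabs_ge0.
  by apply: quarter_bound => //; exact: lC_ge0.
Qed.

Fixpoint pic (n : nat) : R -> Z -> R[i] := if n is m.+1 then Phi (pic m) else lin g.

Lemma Phi0 c t : Phi c t 0 = g 0.
Proof.
by rewrite /Phi lin0 duh_zero ?addr0// => s _; exact: src0.
Qed.

Lemma pic0 n t : pic n t 0 = g 0.
Proof. by case: n => [|n]; [rewrite /= lin0|exact: Phi0]. Qed.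

Section bounds.
Variables (E T : R).
Hypothesis hs : small E T.
Hypothesis hl : forall t, 0 < t <= T -> nw t (lin g t) (E * t `^ (- 4^-1)).

Lemma lin_tame : tame (g 0) T (2 * E) (lin g).
Proof.
have [T0 E0 _] := hs; split.
- by move=> t _; exact: lin_conj.
- by move=> t _; exact: (pic0 0).
- by move=> k; exact: cecont_bs.
- move=> t ht; apply: L1le_le (hl ht) => // ; rewrite ler_wpM2r ?powR_ge0//; lra.
Qed.

Lemma half_bound a X D q : a \in [:: 32 * d%:R * (nu / 2) `^ (- 2^-1); 32 * d%:R * nu `^ (- 2^-1); 32 * d%:R * nu `^ (- 4^-1)] ->
  X = 3 * d%:R * kappa ^+ 2 \/ X = lC -> 0 <= D -> 0 <= q ->
  a * ((X * (2 * E) ^+ 2 + T `^ 2^-1) * D) * q <= D / 2 * q.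
Proof.
move=> ha hX D0 q0; rewrite ler_wpM2r//; have := ler_wpM2r D0 (small_le hs ha hX).
by rewrite mulrA [2^-1 * D]mulrC.
Qed.

Lemma Phi_tame c : tame (g 0) T (2 * E) c -> tame (g 0) T (2 * E) (Phi c).
Proof.
move=> tc; have [T0 E0 _] := hs; have ac := tame_adm tc; split.
- move=> t ht k; rewrite /Phi (lin_conj t k) rmorphD/=; congr (_ + _).
  apply: (duh_conj nu0 ac ht) => s /andP[s0 st]; have /andP[_ tT] := ht.
  have hst : 0 < s <= T by rewrite s0 (le_trans (ltW st)).
  exact: (src_conj s0 (tame_nw tc hst)).
- by move=> t _; exact: Phi0.
- by move=> k; apply: cecontD; [exact: cecont_bs|exact: duh_econt].
- move=> t ht; have h1 := hl ht; have h2 := Phi_nw T0 tc ht.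
  have q0 : 0 <= t `^ (- 4^-1) by exact: powR_ge0.
  apply: L1le_le (L1leD h1 h2) => [k|].
    by rewrite -!mulrDr ler_wpM2l ?kn_ge0// ler_wpM2l ?wt_ge0// cabsD.
  have := @half_bound (32 * d%:R * (nu / 2) `^ (- 2^-1)) (3 * d%:R * kappa ^+ 2) (2 * E) _ _ _ _ q0.
  rewrite !inE eqxx/= => /(_ isT (or_introl erefl)) h3.
  apply: (le_trans (lerD (lexx _) (h3 _))); first by rewrite mulr_ge0.
  by rewrite le_eqVlt; apply/orP; left; apply/eqP; field.
Qed.

Lemma pic_tame n : tame (g 0) T (2 * E) (pic n).
Proof. by elim: n => [|n IH]; [exact: lin_tame|exact: Phi_tame]. Qed.

Lemma Phi_half c (e : R -> Z -> R[i]) D t : tame (g 0) T (2 * E) c -> tame (g 0) T (2 * E) e -> 0 < t <= T -> 0 <= D ->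
  (forall s, 0 < s <= T -> nw s (fun k => c s k - e s k) (D * s `^ (- 4^-1))) ->
  nw t (fun k => Phi c t k - Phi e t k) (D / 2 * t `^ (- 4^-1)).
Proof.
move=> tc te ht D0 hD; apply: L1le_le (Phi_diff tc te ht D0 hD) => //.
apply: half_bound; rewrite ?powR_ge0//; last by left.
by rewrite !inE eqxx.
Qed.

Lemma pic_step n t : 0 < t <= T ->
  nw t (fun k => pic n.+1 t k - pic n t k) (4 * E / 2 ^+ n * t `^ (- 4^-1)).
Proof.
have [T0 E0 _] := hs.
elim: n t => [|n IH] t ht.
  have h1 := tame_nw (pic_tame 1) ht; have h2 := tame_nw (pic_tame 0) ht.
  apply: L1le_le (L1leD h1 h2) => [k|].
    by rewrite -!mulrDr ler_wpM2l ?kn_ge0// ler_wpM2l ?wt_ge0// cabsB.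
  by rewrite expr0 le_eqVlt; apply/orP; left; apply/eqP; field.
have -> : 4 * E / 2 ^+ n.+1 = 4 * E / 2 ^+ n / 2 by rewrite exprSr invfM mulrA.
apply: Phi_half => //; [exact: (pic_tame n.+1)|exact: pic_tame|].
by rewrite divr_ge0 ?mulr_ge0// exprn_ge0.
Qed.

Lemma pic_tail n m t : 0 < t <= T ->
  nw t (fun k => pic n t k - pic (n + m) t k) (8 * E / 2 ^+ n * t `^ (- 4^-1)).
Proof.
move=> ht; have [T0 E0 _] := hs; have q0 : 0 <= t `^ (- 4^-1) by exact: powR_ge0.
have p2 i : 0 < 2 ^+ i :> R by rewrite exprn_gt0.
suff : nw t (fun k => pic n t k - pic (n + m) t k) ((8 * E / 2 ^+ n - 8 * E / 2 ^+ (n + m)) * t `^ (- 4^-1)).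
  apply: L1le_le => //; rewrite ler_wpM2r// gerBl divr_ge0 ?mulr_ge0// ltW//.
elim: m => [|m IH].
  by rewrite addn0 subrr mul0r => s _; rewrite big1// => k _; rewrite subrr cabs0 !mulr0.
rewrite addnS; have h := L1leD IH (pic_step (n + m) ht); apply: L1le_le h => [k|].
  rewrite -!mulrDr ler_wpM2l ?kn_ge0// ler_wpM2l ?wt_ge0//.
  rewrite [X in _ <= _ + X]cabs_distC; apply: le_trans (cabsD _ _).
  by rewrite addrA subrK.
rewrite -mulrDl ler_wpM2r//.
have -> : 8 * E / 2 ^+ (n + m).+1 = 4 * E / 2 ^+ (n + m) by rewrite exprS; field; exact: lt0r_neq0.
have -> : 8 * E / 2 ^+ (n + m) = 4 * E / 2 ^+ (n + m) + 4 * E / 2 ^+ (n + m) by ring.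
lra.
Qed.

Lemma nw_point t (c : Z -> R[i]) A k : 0 <= t -> nw t c A -> k != 0 -> cabs (c k) <= A.
Proof.
move=> t0 /L1le_point h k0; apply: le_trans (h k).
rewrite mulrA ler_peMl ?cabs_ge0//; apply: (le_trans (wt_ge1 nu0 k t0)).
by rewrite ler_peMl ?wt_ge0// kn_ge1.
Qed.

(** Consecutive iterates differ by a geometric sequence, in each coefficient. *)
Lemma pic_limit : exists c : R -> Z -> R[i], forall t, 0 < t <= T -> forall k n,
  cabs (pic n t k - c t k) <= 16 * E * t `^ (- 4^-1) / 2 ^+ n.
Proof.
have [T0 E0 _] := hs.
have H (p : R * Z) : exists l, 0 < p.1 <= T -> forall n,
    cabs (pic n p.1 p.2 - l) <= 16 * E * p.1 `^ (- 4^-1) / 2 ^+ n.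
  case: p => t k /=; have [ht|nt] := pselect (0 < t <= T); last by exists 0 => /nt.
  have q0 : 0 <= t `^ (- 4^-1) by exact: powR_ge0.
  have /geom_ccvg[l hl'] : forall n, cabs (pic n.+1 t k - pic n t k) <= 4 * E * t `^ (- 4^-1) / 2 ^+ n.
    move=> n; have [->|k0] := eqVneq k 0.
      by rewrite !pic0 subrr cabs0 divr_ge0 ?mulr_ge0// exprn_ge0.
    have /andP[tp _] := ht.
    have := nw_point (ltW tp) (pic_step n ht) k0.
    by rewrite -(mulrA (4 * E)) [_^-1 * _]mulrC mulrA.
  exists l => _ n; have := hl' n.
  by have -> : 4 * (4 * E * t `^ (- 4^-1)) / 2 ^+ n = 16 * E * t `^ (- 4^-1) / 2 ^+ n by ring.
have [f hf] := choice H; exists (fun t k => f (t, k)) => t ht k n; exact: (hf (t, k) ht n).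
Qed.

End bounds.

Lemma half_small (C e : R) : 0 <= C -> 0 < e -> exists N, forall n, (N <= n)%N -> C / 2 ^+ n <= e.
Proof.
move=> C0 e0; exists (Num.truncn (C / e)) => n hn.
have h : C / e <= 2 ^+ n.
  apply: ltW; apply: (lt_le_trans (truncnS_gt _)); rewrite -natrX ler_nat.
  exact: leq_ltn_trans hn (ltn_expl _ _).
by rewrite ler_pdivrMr ?exprn_gt0// mulrC -ler_pdivrMr.
Qed.

Lemma half_eq0 (z : R[i]) (C : R) : 0 <= C -> (forall n, cabs z <= C / 2 ^+ n) -> z = 0.
Proof.
move=> C0 h; apply: cabs_eq0; apply/eqP; rewrite eq_le cabs_ge0 andbT.
apply/ler_addgt0Pr => e e0; rewrite add0r; have [N hN] := half_small C0 e0.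
exact: le_trans (h N) (hN N (leqnn _)).
Qed.

(** The fixed point of the Duhamel map, with bounds that inherit the smallness of the
   linear part on every shorter time span: this is how the solution becomes small at the initial
   time. *)
Theorem local_existence E T : small E T ->
  (forall t, 0 < t <= T -> nw t (lin g t) (E * t `^ (- 4^-1))) ->
  exists c, [/\ tame (g 0) T (2 * E) c,
    (forall t, 0 < t <= T -> forall k, c t k = Phi c t k),
    (forall E' T', 0 <= E' <= E -> 0 < T' <= T ->
      (forall t, 0 < t <= T' -> nw t (lin g t) (E' * t `^ (- 4^-1))) ->
      forall t, 0 < t <= T' -> nw t (c t) (2 * E' * t `^ (- 4^-1))) &
    (forall K T', 0 <= K -> 0 < T' <= T ->
      (forall t, 0 < t <= T' -> L2le (fun k => kn k * (rho k * cabs (lin g t k))) (K * t `^ (- 4^-1))) ->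
      forall t, 0 < t <= T' -> L2le (fun k => kn k * (rho k * cabs (c t k))) (2 * K * t `^ (- 4^-1)))].
Proof.
move=> hs hl; have [T0 E0 hp] := hs; have [c hc] := pic_limit hs hl.
have q0 t : 0 <= t `^ (- 4^-1) :> R by exact: powR_ge0.
have C0 t : 0 <= 16 * E * t `^ (- 4^-1) by rewrite !mulr_ge0.
have cv t : 0 < t <= T -> ptlim (fun n => pic n t) (c t).
  move=> ht k e e0; have [N hN] := half_small (C0 t) e0; exists N => n hn.
  exact: le_trans (hc t ht k n) (hN n hn).
have v0 t k : 0 <= kn k * wt t k by rewrite mulr_ge0 ?kn_ge0 ?wt_ge0.
have sc E' T' : 0 <= E' <= E -> 0 < T' <= T ->
      (forall t, 0 < t <= T' -> nw t (lin g t) (E' * t `^ (- 4^-1))) ->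
      forall t, 0 < t <= T' -> nw t (c t) (2 * E' * t `^ (- 4^-1)).
  move=> /andP[E'0 E'E] /andP[T'0 T'T] hl' t ht'.
  have hs' : small E' T'.
    split => //; apply: le_trans hp; rewrite ler_wpM2l//.
      exact: picC_ge0.
    apply: lerD; first by rewrite lerXn2r ?nnegrE.
    by apply: ge0_ler_powR; rewrite ?nnegrE ?invr_ge0 ?(ltW T'0) ?(ltW T0).
  have ht : 0 < t <= T by case/andP: ht' => -> h /=; exact: le_trans T'T.
  have : L1le (fun k => (kn k * wt t k) * cabs (c t k)) (2 * E' * t `^ (- 4^-1)).
    apply: (L1le_ptlim (N0 := 0) (cv t ht) (v0 t)) => n _.
    by apply: L1le_le (tame_nw (pic_tame hs' hl' n) ht') => // k; rewrite mulrA.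
  by apply: L1le_le => // k; rewrite mulrA.
have TT : 0 < T <= T by rewrite T0 lexx.
have EE : 0 <= E <= E by rewrite E0 lexx.
have tc : tame (g 0) T (2 * E) c.
  split.
  - move=> t ht k; apply/eqP; rewrite -subr_eq0; apply/eqP.
    apply: (@half_eq0 _ (2 * (16 * E * t `^ (- 4^-1)))); first by rewrite mulr_ge0.
    move=> n; have h1 := hc t ht (- k) n; have h2 := hc t ht k n.
    have sy := tame_conj (pic_tame hs hl n) ht k.
    have -> : c t (- k) - (c t k)^*%C = (pic n t k - c t k)^*%C - (pic n t (- k) - c t (- k)).
      by rewrite sy rmorphB/=; ring.
    apply: (le_trans (cabsB _ _)).
    have -> : cabs ((pic n t k - c t k)^*)%C = cabs (pic n t k - c t k).
      by rewrite !cabsE /sqmod; case: (_ - _) => a b /=; rewrite sqrrN.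
    have -> : 2 * (16 * E * t `^ (- 4^-1)) / 2 ^+ n = 16 * E * t `^ (- 4^-1) / 2 ^+ n + 16 * E * t `^ (- 4^-1) / 2 ^+ n by ring.
    exact: lerD.
  - move=> t ht; apply/eqP; rewrite -subr_eq0; apply/eqP.
    apply: (half_eq0 (C0 t)) => n; rewrite cabs_distC -(pic0 n t); exact: hc.
  (* the iterates converge uniformly in time away from the initial time *)
  - move=> k t0 ht0 e e0; have /andP[t00 t0T] := ht0.
    have e30 : 0 < e / 4 by rewrite divr_gt0.
    have [N hN] := half_small (C0 (t0 / 2)) e30.
    have hb t : 0 < t <= T -> t0 / 2 <= t -> cabs (pic N t k - c t k) <= e / 4.
      move=> ht tt; apply: (le_trans (hc t ht k N)); apply: le_trans (hN N (leqnn _)).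
      rewrite ler_wpM2r ?invr_ge0 ?exprn_ge0// ler_wpM2l ?mulr_ge0//.
      by apply: powR_antitone; rewrite ?invr_ge0 ?divr_gt0.
    have [r r0 rP] := tame_cont (pic_tame hs hl N) k ht0 e30.
    exists (Num.min r (t0 / 2)); first by rewrite lt_min r0 divr_gt0.
    move=> t ht; rewrite lt_min => /andP[h1 h2].
    have tt : t0 / 2 <= t by move: h2; rewrite ltr_norml => /andP[_ h2]; lra.
    have tt0 : t0 / 2 <= t0 by lra.
    have b1 := hb t0 ht0 tt0; have b2 := hb t ht tt; have b3 := rP t ht h1.
    have -> : c t0 k - c t k = (pic N t0 k - pic N t k) - (pic N t0 k - c t0 k) + (pic N t k - c t k) by ring.
    apply: (le_lt_trans (cabsD _ _)); have := cabsB (pic N t0 k - pic N t k) (pic N t0 k - c t0 k); lra.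
  - exact: (sc E T EE TT hl).
exists c; split => //.
- move=> t ht k; have [->|k0] := eqVneq k 0; first by rewrite Phi0 (tame_zero tc ht).
  apply/eqP; rewrite -subr_eq0; apply/eqP.
  apply: (@half_eq0 _ (20 * E * t `^ (- 4^-1))); first by rewrite !mulr_ge0.
  move=> n; have /andP[tp _] := ht.
  have D0 : 0 <= 8 * E / 2 ^+ n by rewrite divr_ge0 ?mulr_ge0// exprn_ge0.
  have hD s : 0 < s <= T -> nw s (fun k => pic n s k - c s k) (8 * E / 2 ^+ n * s `^ (- 4^-1)).
    move=> hst; have : L1le (fun k => (kn k * wt s k) * cabs (pic n s k - c s k)) (8 * E / 2 ^+ n * s `^ (- 4^-1)).
      apply: (L1le_ptlim (u := fun m k => pic n s k - pic (n + m) s k) (N0 := 0)); last 2 first.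
      - exact: v0.
      - by move=> m _; apply: L1le_le (pic_tail hs hl n m hst) => // l; rewrite mulrA.
      move=> l e e0; have [N hN] := cv s hst l e e0; exists N => m hm.
      have -> : pic n s l - pic (n + m) s l - (pic n s l - c s l) = - (pic (n + m) s l - c s l) by ring.
      by rewrite cabsN; apply: hN; exact: leq_trans hm (leq_addl _ _).
    by apply: L1le_le => // l; rewrite mulrA.
  have h1 : cabs (pic n.+1 t k - Phi c t k) <= 8 * E / 2 ^+ n / 2 * t `^ (- 4^-1).
    exact: nw_point (ltW tp) (Phi_half hs (pic_tame hs hl n) tc ht D0 hD) k0.
  have h2 := hc t ht k n.+1.
  have id3 (x y z : R[i]) : x - y = (z - y) - (z - x) by ring.
  rewrite (id3 (c t k) (Phi c t k) (pic n.+1 t k)).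
  apply: (le_trans (cabsB _ _)); apply: (le_trans (lerD h1 h2)).
  have -> : 16 * E * t `^ (- 4^-1) / 2 ^+ n.+1 = 8 * E * t `^ (- 4^-1) / 2 ^+ n.
    by rewrite exprS; field; rewrite expf_neq0.
  have : 0 <= E * t `^ (- 4^-1) / 2 ^+ n by rewrite divr_ge0 ?mulr_ge0// exprn_ge0.
  have -> : 8 * E / 2 ^+ n / 2 * t `^ (- 4^-1) = 4 * (E * t `^ (- 4^-1) / 2 ^+ n) by field; rewrite expf_neq0.
  have -> : 8 * E * t `^ (- 4^-1) / 2 ^+ n = 8 * (E * t `^ (- 4^-1) / 2 ^+ n) by ring.
  have -> : 20 * E * t `^ (- 4^-1) / 2 ^+ n = 20 * (E * t `^ (- 4^-1) / 2 ^+ n) by ring.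
  lra.
- move=> K T' K0 /andP[T'0 T'T] hK t ht'.
  have up t' : 0 < t' <= T' -> 0 < t' <= T by case/andP => -> h /=; exact: le_trans T'T.
  have w0 k : 0 <= kn k * rho k by rewrite mulr_ge0 ?kn_ge0 ?rho_ge0.
  have pb n : forall t', 0 < t' <= T' -> L2le (fun k => kn k * (rho k * cabs (pic n t' k))) (2 * K * t' `^ (- 4^-1)).
    elim: n => [|n IH] t' ht1.
      apply: L2le_le (hK t' ht1) => [k|]; first by rewrite lexx mulrA mulr_ge0 ?cabs_ge0.
      by rewrite ler_wpM2r//; lra.
    have np : 1.+1%:R = 4 * 2^-1 :> R by field.
    have hp2 : is_true (((0 : R) <= (2^-1 : R)) && ((2^-1 : R) <= (3 / 4 : R))) by apply/andP; split; lra.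
    have K20 : 0 <= 2 * K by rewrite mulr_ge0.
    have hst s : 0 < s < t' -> L2le (fun k => kn k * (rho k * cabs (pic n s k))) (2 * K * s `^ (- 4^-1)).
      move=> /andP[s0 st]; apply: IH; rewrite s0/= (le_trans (ltW st))//; by case/andP: ht1.
    have := Phi_l2 np hp2 (pic_tame hs hl n) (up t' ht1) K20 hst.
    have -> : 1 - 2^-1 - 3 / 4 = - 4^-1 :> R by field.
    move=> h2; have h1 := hK t' ht1.
    have p0 (z : R[i]) k : 0 <= kn k * (rho k * cabs z) by rewrite !mulr_ge0 ?kn_ge0 ?rho_ge0 ?cabs_ge0.
    have {}h2 := L2le_le (fun k => introT andP (conj (p0 (duh (fun s => src (pic n s)) t' k) k) (lexx _))) (lexx _) h2.
    apply: L2le_le (L2leD (fun k => p0 _ k) (fun k => p0 _ k) h1 h2) => [k|].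
      rewrite p0/= -!mulrDr ler_wpM2l ?kn_ge0// ler_wpM2l ?rho_ge0//; exact: cabsD.
    have hm : 32 * d%:R * nu `^ (- 2^-1) \in [:: 32 * d%:R * (nu / 2) `^ (- 2^-1); 32 * d%:R * nu `^ (- 2^-1); 32 * d%:R * nu `^ (- 4^-1)].
      by rewrite !inE eqxx orbT.
    have h3 := half_bound hs hm (or_intror erefl) K20 (q0 t').
    apply: (le_trans (lerD (lexx _) h3)).
    by rewrite le_eqVlt; apply/orP; left; apply/eqP; field.
  have : L2le (fun k => (kn k * rho k) * cabs (c t k)) (2 * K * t `^ (- 4^-1)).
    apply: (L2le_ptlim (N0 := 0) (cv t (up t ht')) w0) => n _.
    by apply: L2le_le (pb n t ht') => // k; rewrite mulrA lexx mulr_ge0 ?cabs_ge0.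
  by apply: L2le_le => // k; rewrite mulrA lexx andbT mulr_ge0 ?cabs_ge0.
Qed.

End iteration.

End picard.

(** * The function spaces of the statement in terms of coefficients *)

Section spaces.
Context {R : realType} {d : nat}.
Local Notation pt := 'rV[R]_d.
Local Notation Z := 'rV[int]_d.
Local Notation mu := (torus_measure R d).
Local Notation kn := (@freq_norm R d).
Local Notation rho := (@rho R d).
Implicit Types (f g : pt -> R).

Lemma pcont_L2 f : pcont f -> L2 f.
Proof.
move=> pf; have [per _] := pf; split => //; have [mf [M fM]] := pcont_bpt pf.
rewrite inE; apply/andP; split; rewrite inE//=.
rewrite /finite_norm Lnorm.unlock poweR_lty//.
apply: (@le_lt_trans _ _ (\int[mu]_x (`|M| `^ 2)%:E)%E).
  apply: ge0_le_integral => //=.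
  - by apply/measurable_EFinP; apply: (measurableT_comp (measurable_powR _)); exact: measurableT_comp.
  - move=> t _; rewrite lee_fin; apply: ge0_ler_powR; rewrite ?nnegrE//.
    exact: le_trans (fM t) (ler_norm _).
by apply/integrable_lty => //; exact: finite_measure_integrable_cst.
Qed.

Lemma L2_tI f : L2 f -> tI f.
Proof.
move=> [_ h]; rewrite /tI; apply/Lfun1_integrable; apply: Lfun_subset12 h.
exact: fin_num_measure.
Qed.

Lemma aeq_fourier f g : L2 f -> L2 g -> aeq f g -> forall k, fourier f k = fourier g k.
Proof.
move=> /L2_tI lf /L2_tI lg fg k; rewrite !fourierE /fcos.
have E th : tint (fun x => f x * cos (th + phase k x)) = tint (fun x => g x * cos (th + phase k x)).
  have i1 := tIM lf (bpt_cos k th); have i2 := tIM lg (bpt_cos k th).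
  rewrite /tint /torus_int /Rintegral; congr fine; apply: ae_eq_integral => //.
  - exact: measurable_int i1.
  - exact: measurable_int i2.
  - move: fg => [N [mN N0 sN]]; exists N; split => // t /= ht; apply: sN => /= h; apply: ht => T.
    by rewrite /= (h T).
by rewrite !E.
Qed.

Lemma aeq_refl f : aeq f f.
Proof. exact: ae_eq_refl. Qed.

Lemma aeq_sym f g : aeq f g -> aeq g f.
Proof. exact: ae_eq_sym. Qed.

Lemma aeq_trans f g h : aeq f g -> aeq g h -> aeq f h.
Proof. exact: ae_eq_trans. Qed.

(** ** Sobolev norms with natural exponents *)

Lemma kn_powR (s : R) (n : nat) k : 2 * s = n%:R -> kn k `^ (2 * s) = kn k ^+ n.
Proof. by move=> ->; rewrite powR_mulrn// kn_ge0. Qed.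

(** The terms of the squared Sobolev norm of order [n / 2]. *)
Definition hterm (n : nat) f (k : Z) : R := (1 + kn k ^+ n) * cabs (fourier f k) ^+ 2.

Lemma hterm_ge0 n f k : 0 <= hterm n f k.
Proof. by rewrite mulr_ge0 ?sqr_ge0// addr_ge0// exprn_ge0// kn_ge0. Qed.

Lemma HnormE s n f : 2 * s = n%:R ->
  Hnorm s f = ((\esum_(k in [set: Z]) (hterm n f k)%:E) `^ 2^-1)%E.
Proof.
move=> sn; rewrite /Hnorm; congr (_ `^ _)%E; apply: eq_esum => k _.
by rewrite /hterm (kn_powR k sn) cabs_sqr.
Qed.

Lemma esum_ge0' n f : (0 <= \esum_(k in [set: Z]) (hterm n f k)%:E)%E.
Proof. by apply: esum_ge0 => k _; rewrite lee_fin hterm_ge0. Qed.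

Lemma Hnorm_le s n f (M : R) : 2 * s = n%:R -> 0 <= M -> L1le (hterm n f) (M ^+ 2) -> (Hnorm s f <= M%:E)%E.
Proof.
move=> sn M0 /L1le_esum h; rewrite (HnormE f sn).
have -> : (M%:E = ((M ^+ 2)%:E `^ 2^-1)%E).
  by rewrite poweR_EFin powR12_sqrt ?sqr_ge0// sqrtr_sqr ger0_norm.
apply: gt0_ler_poweR; rewrite ?in_itv/= ?leey ?andbT ?esum_ge0' ?lee_fin ?sqr_ge0 ?invr_ge0//.
by apply: h => k; exact: hterm_ge0.
Qed.

Lemma Hnorm_L1 s n f (M : R) : 2 * s = n%:R -> 0 <= M -> (Hnorm s f <= M%:E)%E -> L1le (hterm n f) (M ^+ 2).
Proof.
move=> sn M0 h; apply/L1le_esum; first exact: hterm_ge0.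
rewrite leNgt; apply/negP => lt; move: h; rewrite (HnormE f sn); apply/negP; rewrite -ltNge.
have S0 := esum_ge0' n f; move: lt S0; case: (esum _ _) => [r| |]//.
  rewrite lte_fin lee_fin poweR_EFin lte_fin => lt S0; rewrite powR12_sqrt//.
  by rewrite -[ltLHS](ger0_norm M0) -sqrtr_sqr ltr_sqrt// (le_lt_trans _ lt)// sqr_ge0.
by move=> _ _; rewrite poweRyr ?invr_neq0// ltry.
Qed.

Lemma Hnorm_ge0 s f : (0 <= Hnorm s f)%E.
Proof. exact: poweR_ge0. Qed.

Lemma Hnorm_fin s n f : 2 * s = n%:R -> (Hnorm s f < +oo)%E -> exists2 M, 0 <= M & L1le (hterm n f) (M ^+ 2).
Proof.
move=> sn h; exists (fine (Hnorm s f)); first by rewrite fine_ge0// Hnorm_ge0.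
apply: (Hnorm_L1 sn); first by rewrite fine_ge0// Hnorm_ge0.
by rewrite fineK// ge0_fin_numE// Hnorm_ge0.
Qed.

Lemma hterm_point n f M k : 0 <= M -> L1le (hterm n f) (M ^+ 2) -> cabs (fourier f k) <= M.
Proof.
move=> M0 /(L1le_point k) h; rewrite -ler_sqr ?nnegrE ?cabs_ge0//.
by apply: le_trans h; rewrite /hterm ler_peMl ?sqr_ge0// lerDl exprn_ge0// kn_ge0.
Qed.

Lemma crit_d : 2 * s_crit R d = d%:R.
Proof. by rewrite /s_crit; field. Qed.

Lemma crit_d2 : 2 * (s_crit R d + 1) = (d + 2)%:R.
Proof. by rewrite /s_crit natrD; field. Qed.

Lemma crit_m (m : nat) : 2 * m%:R = (2 * m)%:R :> R.
Proof. by rewrite natrM. Qed.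

Lemma hterm_rho f M : 0 <= M -> L1le (hterm d f) (M ^+ 2) -> L2le (fun k => rho k * cabs (fourier f k)) M.
Proof.
move=> M0 h; split => //; apply: L1le_le h => // k.
by rewrite exprMn rho_sqr /hterm ler_wpM2r ?sqr_ge0// lerDr.
Qed.

Lemma rho_hterm f M : L2le (fun k => rho k * cabs (fourier f k)) M ->
  L1le (hterm d f) ((2 * (cabs (fourier f 0) + M)) ^+ 2).
Proof.
move=> [M0 h]; pose z := cabs (fourier f 0); have z0 : 0 <= z by exact: cabs_ge0.
have h0 : L1le (fun k => if k \in [:: 0] then cabs (fourier f k) ^+ 2 else 0) (z ^+ 2).
  by apply: L1le_fin => //; [move=> k; exact: sqr_ge0|rewrite big_seq1].
have := L1leD h0 (L1leZ (ler0n R 2) h); apply: L1le_le => [k|]; last first.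
  rewrite exprMn -/z; have := mulr_ge0 z0 M0; have := sqr_ge0 z; have := sqr_ge0 M; nra.
rewrite inE exprMn rho_sqr /hterm; case: eqVneq => [->|k0].
  set b := _ ^+ 2; have b0 : 0 <= b by exact: sqr_ge0.
  have : 0 <= kn 0 ^+ d * b by rewrite mulr_ge0 ?exprn_ge0 ?kn_ge0.
  lra.
have h1 : 1 <= kn k ^+ d by rewrite exprn_ege1// kn_ge1.
set b := _ ^+ 2; have b0 : 0 <= b by exact: sqr_ge0.
have := ler_wpM2r b0 h1; lra.
Qed.

Lemma knrho_hterm f M : L2le (fun k => kn k * (rho k * cabs (fourier f k))) M ->
  L1le (hterm (d + 2) f) ((2 * (cabs (fourier f 0) + M)) ^+ 2).
Proof.
move=> [M0 h]; pose z := cabs (fourier f 0); have z0 : 0 <= z by exact: cabs_ge0.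
have h0 : L1le (fun k => if k \in [:: 0] then cabs (fourier f k) ^+ 2 else 0) (z ^+ 2).
  by apply: L1le_fin => //; [move=> k; exact: sqr_ge0|rewrite big_seq1].
have := L1leD h0 (L1leZ (ler0n R 2) h); apply: L1le_le => [k|]; last first.
  rewrite exprMn -/z; have := mulr_ge0 z0 M0; have := sqr_ge0 z; have := sqr_ge0 M; nra.
rewrite inE !exprMn rho_sqr mulrA -exprD addnC /hterm; case: eqVneq => [->|k0].
  set b := cabs _ ^+ 2; have b0 : 0 <= b by exact: sqr_ge0.
  have : 0 <= kn 0 ^+ (2 + d) * b by rewrite mulr_ge0 ?exprn_ge0 ?kn_ge0.
  lra.
have h1 : 1 <= kn k ^+ (2 + d) by rewrite exprn_ege1// kn_ge1.
set b := cabs _ ^+ 2; have b0 : 0 <= b by exact: sqr_ge0.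
have := ler_wpM2r b0 h1; lra.
Qed.

(** Above the critical exponent Fourier series converge absolutely: the weight leaves
   [(1 + |k|)^(- d - 2)], which is summable, and [2 a <= u + v a^2] when [u v >= 1]. *)
Lemma hterm_L1 f M : (0 < d)%N -> 0 <= M -> L1le (hterm (d + 2) f) (M ^+ 2) ->
  exists B, L1le (fun k => cabs (fourier f k)) B.
Proof.
move=> d0 M0 h.
(* [(1 + y) ^ m <= 2 ^ m * (1 + y ^ m)] *)
pose C : R := 2 ^+ (d + 2); have C0 : 0 <= C by rewrite exprn_ge0.
exists (C * (1 + @shell_cst R d * 2) + M ^+ 2).
apply: L1le_le (L1leD (L1leZ C0 (lattice_poly d0)) h) => // k.
set a := cabs _; have a0 : 0 <= a by exact: cabs_ge0.
rewrite /hterm -/a; set y := kn k; have y0 : 0 <= y by exact: kn_ge0.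
have p1 : 0 < (1 + y) ^+ (d + 2) by rewrite exprn_gt0// ltr_pwDl.
have p2 : 0 < 1 + y ^+ (d + 2) by rewrite ltr_pwDl// exprn_ge0.
have h1 : (1 + y) ^+ (d + 2) <= C * (1 + y ^+ (d + 2)).
  have [y1|/ltW y1] := leP y 1.
    apply: (@le_trans _ _ C); last by rewrite ler_peMr// lerDl exprn_ge0.
    by rewrite lerXn2r ?nnegrE ?addr_ge0//; lra.
  apply: (@le_trans _ _ ((2 * y) ^+ (d + 2))); first by rewrite lerXn2r ?nnegrE ?addr_ge0 ?mulr_ge0//; lra.
  by rewrite exprMn ler_wpM2l// lerDr.
have h2 : 1 <= C * ((1 + y) ^+ (d + 2))^-1 * (1 + y ^+ (d + 2)).
  by rewrite mulrAC ler_pdivlMr// mul1r.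
set u := C * _^-1 in h2 *; set v := 1 + y ^+ (d + 2) in p2 h2 *.
have u0 : 0 <= u by rewrite mulr_ge0// invr_ge0 ltW.
have h3 : 0 <= (u - v * a ^+ 2) ^+ 2 by exact: sqr_ge0.
have h4 : a ^+ 2 <= u * v * a ^+ 2 by rewrite ler_peMl ?sqr_ge0.
have w0 : 0 <= u + v * a ^+ 2 by rewrite addr_ge0// mulr_ge0 ?sqr_ge0// ltW.
rewrite -ler_sqr ?nnegrE//.
have -> : (u + v * a ^+ 2) ^+ 2 = (u - v * a ^+ 2) ^+ 2 + 4 * (u * v * a ^+ 2) by ring.
have := sqr_ge0 a; lra.
Qed.

End spaces.

Section convergence.
Context {R : realType}.

Lemma ecvg0P (T : Type) (F : set_system T) {FF : Filter F} (f : T -> \bar R) :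
  (forall t, (0 <= f t)%E) ->
  (f @ F --> 0%E) <-> (forall e : R, 0 < e -> \forall t \near F, (f t <= e%:E)%E).
Proof.
move=> f0; split=> [/fine_cvgP[fin /cvgrPdist_le cv] e e0|H].
  have := cv e e0; apply: filterS2 fin => t ft /=; rewrite sub0r normrN.
  by move=> h; rewrite -[leLHS]fineK// lee_fin; exact: le_trans (ler_norm _) h.
apply/fine_cvgP; split.
  by apply: filterS (H 1 ltr01) => t h; rewrite ge0_fin_numE//; exact: le_lt_trans h (ltry _).
apply/cvgrPdist_le => e e0; apply: filterS (H e e0) => t h /=.
rewrite sub0r normrN ger0_norm ?fine_ge0//.
by rewrite -lee_fin fineK// ge0_fin_numE//; exact: le_lt_trans h (ltry _).
Qed.

Lemma CtP (V : zmodType) (B : set V) (N : V -> \bar R) T (u : R -> V) : (forall v, (0 <= N v)%E) ->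
  Ct B N T u <-> forall t0, 0 <= t0 <= T -> B (u t0) /\
    forall e, 0 < e -> exists2 r, 0 < r & forall t, 0 <= t <= T -> `|t0 - t| < r -> (N (u t - u t0)%R <= e%:E)%E.
Proof.
move=> N0; split=> [H t0 ht0|H t0].
  have [|HB Hc] := H t0; first by rewrite in_itv.
  split => // e e0; have /ecvg0P/(_ _ e0) := Hc; move=> /(_ (fun t => N0 _)); rewrite near_withinE => /nbhs_normP[r r0 rP].
  by exists r => // t ht htr; apply: (rP t) => //=; rewrite in_itv.
rewrite in_itv/= => ht0; have [HB Hc] := H t0 ht0; split => //.
apply/ecvg0P => [t|e e0]; first exact: N0.
 have [r r0 rP] := Hc e e0.
rewrite near_withinE; apply/nbhs_normP; exists r => // t /= htr; rewrite in_itv/= => ht.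
exact: rP.
Qed.

End convergence.

(** * Construction of a solution *)

Section vector_valued.
Context {R : realType} {d : nat}.
Local Notation pt := 'rV[R]_d.

Lemma rV_continuous (F : pt -> 'rV[R]_d) : (forall j, continuous (fun x => F x 0 j)) -> continuous F.
Proof.
move=> cF; have -> : F = (fun x => \sum_(j < d) F x 0 j *: delta_mx 0 j).
  by apply/funext => x; rewrite {1}[F x]row_sum_delta.
elim: (index_enum 'I_d) => [|j r IH] x.
  have -> : (fun x : pt => \sum_(j <- [::] : seq (ordinal d)) F x 0 j *: (delta_mx 0 j : pt)) = (fun=> 0 : pt) by apply/funext => y; rewrite big_nil.
  exact: cst_continuous.
have -> : (fun x => \sum_(i <- j :: r) F x 0 i *: delta_mx 0 i) =
   (fun x => F x 0 j *: (delta_mx 0 j : 'rV[R]_d) + \sum_(i <- r) F x 0 i *: delta_mx 0 i).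
  by apply/funext => y; rewrite big_cons.
apply: (@continuousD _ _ _ (fun x => F x 0 j *: (delta_mx 0 j : 'rV[R]_d)) (fun x => \sum_(i <- r) F x 0 i *: delta_mx 0 i) x); last exact: IH.
apply: continuousZl; exact: cF.
Qed.

Lemma supnorm_le (F : pt -> 'rV[R]_d) (M : R) : 0 <= M -> (forall x j, `|F x 0 j| <= M) ->
  (supnorm F <= M%:E)%E.
Proof.
move=> M0 h; apply: ge_ereal_sup => _ [x _ <-]; rewrite lee_fin.
exact: rV_norm_le.
Qed.

Lemma le_supnorm (F : pt -> 'rV[R]_d) (M : R) : (supnorm F <= M%:E)%E -> forall x j, `|F x 0 j| <= M.
Proof.
move=> h x j; apply: (le_trans (rV_coord_le _ _)); rewrite -lee_fin; apply: le_trans h.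
by apply: ereal_sup_ubound; exists x.
Qed.

Lemma supnorm_ge0 (F : pt -> 'rV[R]_d) : (0 <= supnorm F)%E.
Proof.
apply: (@le_trans _ _ (`|F 0|%:E)%E); first by rewrite lee_fin.
by apply: ereal_sup_ubound; exists 0.
Qed.

End vector_valued.

Section time_weights.
Context {R : realType}.

Lemma econt_at T (f : R -> R) : (forall t, 0 < t -> {for t, continuous f}) -> econt T f.
Proof.
move=> cf t0 /andP[t00 _] e e0; have /cvgrPdist_lt/(_ _ e0) := cf t0 t00.
by move=> /nbhs_normP[r r0 rP]; exists r => // t _; exact: rP.
Qed.

Lemma econt_powR (p : R) T : econt T (fun t : R => t `^ p).
Proof.
apply: econt_at => t t0; apply: differentiable_continuous; apply/derivable1_diffP.
by apply: derivable_powR; rewrite in_itv/= t0.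
Qed.

Lemma quarterK (t : R) : 0 < t -> t `^ 4^-1 * t `^ (- 4^-1) = 1.
Proof. by move=> t0; rewrite -powRD ?(gt_eqF t0) ?implybT// subrr powRr0. Qed.

Lemma quarter_small (e M : R) : 0 < e -> 0 <= M -> exists2 r, 0 < r & forall t, 0 < t < r -> t `^ 4^-1 * M <= e.
Proof.
move=> e0 M0; have [T T0 HT] := powR_quarter_large e0 M0; exists T => // t /andP[t0 tT].
have := HT t; rewrite t0 (ltW tT) => /(_ isT) h.
have := ler_wpM2l (powR_ge0 t 4^-1) h.
by rewrite mulrCA quarterK// mulr1.
Qed.

(** Continuity of a product with a power of time; the tolerance [e'] for the other factor is
   fixed before the neighborhood. *)
Lemma powR_near (p T t0 B e : R) : 0 < t0 <= T -> 0 <= B -> 0 < e ->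
  exists r e' : R, [/\ 0 < r, r <= t0, 0 < e' & forall t, 0 < t <= T -> `|t0 - t| < r ->
    `|t `^ p - t0 `^ p| * B + t `^ p * e' <= e].
Proof.
move=> ht0 B0 e0; have /andP[t00 t0T] := ht0; have p0 := powR_ge0 t0 p.
have T1 : 0 < t0 `^ p + 1 by rewrite ltr_wpDl.
have B1 : 0 < B + 1 by rewrite ltr_wpDl.
have e20 : 0 < e / 2 by rewrite divr_gt0.
have m0 : 0 < Num.min 1 (e / 2 / (B + 1)) by rewrite lt_min ltr01 divr_gt0.
have [r r0 rP] := econt_powR p ht0 m0.
exists (Num.min r t0), (e / 2 / (t0 `^ p + 1)); split.
- by rewrite lt_min r0.
- by rewrite ge_min lexx orbT.
- exact: divr_gt0.
move=> t /andP[tp tT]; rewrite lt_min => /andP[tr _].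
have := rP t; rewrite tp tT => /(_ isT tr); rewrite distrC lt_min => /andP[/ltW n1 /ltW n2].
have h1 : `|t `^ p - t0 `^ p| * B <= e / 2.
  have q0 : 0 <= e / 2 / (B + 1) by rewrite divr_ge0// ltW.
  have qE : e / 2 / (B + 1) * (B + 1) = e / 2 by rewrite divfK// gt_eqF.
  by apply: (le_trans (ler_wpM2r B0 n2)); rewrite -[leRHS]qE mulrDr lerDl mulr1.
have h2 : t `^ p * (e / 2 / (t0 `^ p + 1)) <= e / 2.
  have q0 : 0 <= e / 2 / (t0 `^ p + 1) by rewrite divr_ge0// ltW.
  have qE : e / 2 / (t0 `^ p + 1) * (t0 `^ p + 1) = e / 2 by rewrite divfK// gt_eqF.
  rewrite -[leRHS]qE [leRHS]mulrC; apply: ler_wpM2r => //.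
  by have := ler_norm (t `^ p - t0 `^ p); lra.
by rewrite [leRHS](splitr e) lerD.
Qed.

Lemma quarter0 : 0 `^ 4^-1 = 0 :> R.
Proof. by rewrite powR0// invr_neq0. Qed.

Lemma pos_near (t0 t r : R) : r <= t0 -> `|t0 - t| < r -> 0 < t.
Proof. by move=> rt /(le_lt_trans (ler_norm _)); lra. Qed.

End time_weights.

Section from_coefficients.
Context {R : realType} {d : nat}.
Variable nu : R.
Hypothesis nu0 : 0 < nu.
Hypothesis d0 : (0 < d)%N.
Local Notation pt := 'rV[R]_d.
Local Notation Z := 'rV[int]_d.
Local Notation kn := (@freq_norm R d).
Local Notation kappa := (@kappa R d).
Local Notation rho := (@rho R d).
Local Notation bs := (bs nu).
Local Notation nw := (nw nu).
Local Notation duh := (duh nu).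
Local Notation lin := (lin nu).
Local Notation lC := (@lC R d).
Local Notation small := (@small R d nu).
Local Notation Phi := (@Phi R d nu).
Local Notation tame := (@tame R d nu).
Local Notation flow := (@flow R d nu).
Implicit Types (g : Z -> R[i]) (f : pt -> R).

Lemma exists_small : exists2 E : R, 0 < E & forall T, 0 < T <= E ^+ 2 -> small E T.
Proof.
have P0 := @picC_ge0 R d nu; have P1 : 0 < 4 * (@picC R d nu + 1) by rewrite mulr_gt0// ltr_wpDl.
pose E := (4 * (@picC R d nu + 1))^-1; have E0 : 0 < E by rewrite invr_gt0.
exists E => // T /andP[T0 TE]; split => //; first exact: ltW.
have E1 : E <= 1 by rewrite invf_le1//; lra.
have h1 : E ^+ 2 <= E by rewrite expr2 ler_piMl// ltW.
have h2 : T `^ 2^-1 <= E.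
  rewrite powR12_sqrt ?(ltW T0)// -[leRHS](ger0_norm (ltW E0)) -sqrtr_sqr.
  exact: ler_wsqrtr.
apply: (@le_trans _ _ (@picC R d nu * (2 * E))); first by rewrite ler_wpM2l//; lra.
by rewrite /E mulrA ler_pdivrMr//; lra.
Qed.

(** One time span serves all data near [g0], since smallness of the linear part is stable. *)
Lemma local_near g0 G : L2le (fun k => rho k * cabs (g0 k)) G ->
  exists E T eta, [/\ 0 < eta, small E T &
    forall g, L2le (fun k => rho k * cabs (g k - g0 k)) eta ->
      forall t, 0 < t <= T -> nw t (lin g t) (E * t `^ (- 4^-1))].
Proof.
move=> hG; have [E E0 hE] := exists_small; have [T [eta [T0 eta0 H]]] := lin_nw_small nu0 d0 hG E0.
exists E, (Num.min T (E ^+ 2)), eta; split => //.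
  by apply: hE; rewrite lt_min T0 exprn_gt0//= ge_min lexx orbT.
move=> g hg t /andP[t0]; rewrite le_min => /andP[tT _]; apply: H => //.
by rewrite t0.
Qed.

Lemma l1_hterm n f A : L1le (fun k => (1 + kn k) ^+ n * cabs (fourier f k)) A ->
  L1le (hterm n f) ((2 * A) ^+ 2).
Proof.
move=> h; have A0 := L1le_ge0 h.
apply: L1le_le (L1leZ (mulr_ge0 (ler0n R 2) A0) h) => [k|]; last first.
  by rewrite exprMn; have := sqr_ge0 A; nra.
have p1 : 1 <= (1 + kn k) ^+ n by rewrite exprn_ege1// lerDl kn_ge0.
have c0 := cabs_ge0 (fourier f k).
have cA : cabs (fourier f k) <= A.
  by apply: le_trans (L1le_point k h); rewrite ler_peMl.
have p2 : 1 + kn k ^+ n <= 2 * (1 + kn k) ^+ n.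
  have : kn k ^+ n <= (1 + kn k) ^+ n by rewrite lerXn2r ?nnegrE ?addr_ge0 ?kn_ge0// lerDr.
  lra.
rewrite /hterm expr2; set x := cabs _ in c0 cA *.
have -> : 2 * A * ((1 + kn k) ^+ n * x) = 2 * (1 + kn k) ^+ n * (A * x) by ring.
apply: ler_pM => //; first by rewrite addr_ge0 ?exprn_ge0 ?kn_ge0.
- exact: mulr_ge0.
- exact: ler_wpM2r.
Qed.

Lemma l1_Hnorm s n f A : 2 * s = n%:R -> L1le (fun k => (1 + kn k) ^+ n * cabs (fourier f k)) A ->
  (Hnorm s f <= (2 * A)%:E)%E.
Proof.
move=> sn h; apply: (Hnorm_le sn); last exact: l1_hterm.
by rewrite mulr_ge0//; exact: L1le_ge0 h.
Qed.

Lemma rapid_Hs s n f : 2 * s = n%:R -> pcont f -> rapid (fourier f) -> Hs s f.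
Proof.
move=> sn pf rf; split; first exact: pcont_L2.
have [M hM] := rf n; apply: le_lt_trans (l1_Hnorm sn hM) _; exact: ltry.
Qed.

Lemma nlu_flux (h : R -> pt -> R) s k : nlu (gr h s) k = \sum_j (0 +i* (k 0 j)%:~R) * fourier (flux (h s) j) k.
Proof. by rewrite /nlu; apply: eq_bigr => j _; rewrite flux_cub. Qed.

Lemma mild_integral (T : R) (h : R -> pt -> R) (t : R) (k : Z) : adm T (fun s => nlu (gr h s)) -> 0 < t <= T ->
  Cintegral (@lebesgue_measure R) `[0, t]
        (fun s => \sum_j (0 +i* (k 0 j)%:~R) *
                     ((bih_symbol nu (t - s) k)%:C * fourier (flux (h s) j) k)) =
  duh (fun s => nlu (gr h s)) t k.
Proof.
move=> ah ht; rewrite -(duh_Cintegral nu0 k ah ht); congr (Cintegral _ _ _).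
apply/funext => s; rewrite nlu_flux mulr_sumr; apply: eq_bigr => j _.
exact: mulrCA.
Qed.

Lemma flow_solves h0 T (h : R -> pt -> R) : flow (fourier h0) T h -> h 0 = h0 -> mild nu h0 T h.
Proof.
move=> F h00 t; rewrite in_itv/= => /andP[]; rewrite le_eqVlt => /orP[/eqP<- _|t0 tT] k.
  rewrite h00 /bih_symbol mulr0 mul0r oppr0 expR0 mul1r.
  by rewrite /Cintegral !set_itv1 !Rintegral_set1 /= addr0.
have ht : 0 < t <= T by rewrite t0.
rewrite (flow_mild F ht k); apply: (@congr1 _ _ (fun z => (bs t k)%:C * fourier h0 k + z)).
by apply/esym; exact: (mild_integral k (flow_adm F) ht).
Qed.

Section one_datum.
Variables (g : Z -> R[i]) (G E T : R) (c : R -> Z -> R[i]) (h : R -> pt -> R).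
Hypothesis hG : L2le (fun k => rho k * cabs (g k)) G.
Hypothesis hs : small E T.
Hypothesis hl : forall t, 0 < t <= T -> nw t (lin g t) (E * t `^ (- 4^-1)).
Hypothesis tc : tame (g 0) T (2 * E) c.
Hypothesis fix_c : forall t, 0 < t <= T -> forall k, c t k = Phi g c t k.
Hypothesis scale1 : forall E' T', 0 <= E' <= E -> 0 < T' <= T ->
      (forall t, 0 < t <= T' -> nw t (lin g t) (E' * t `^ (- 4^-1))) ->
      forall t, 0 < t <= T' -> nw t (c t) (2 * E' * t `^ (- 4^-1)).
Hypothesis scale2 : forall K T', 0 <= K -> 0 < T' <= T ->
      (forall t, 0 < t <= T' -> L2le (fun k => kn k * (rho k * cabs (lin g t k))) (K * t `^ (- 4^-1))) ->
      forall t, 0 < t <= T' -> L2le (fun k => kn k * (rho k * cabs (c t k))) (2 * K * t `^ (- 4^-1)).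
Hypothesis hE : forall t, 0 < t <= T -> h t = syn (c t).

Let T0 : 0 < T. Proof. by case: hs. Qed.
Let E0 : 0 <= E. Proof. by case: hs. Qed.

Lemma c_rapid t : 0 < t <= T -> rapid (c t).
Proof. by move=> ht; have /andP[t0 _] := ht; exact: nw_rapid nu0 d0 _ _ _ t0 (tame_nw tc ht). Qed.

Lemma h_pcont t : 0 < t <= T -> pcont (h t).
Proof. by move=> ht; rewrite hE//; have [M hM] := rapid_L1 (c_rapid ht); exact: pcont_syn hM. Qed.

Lemma h_fourier t : 0 < t <= T -> fourier (h t) = c t.
Proof.
move=> ht; apply/funext => k; rewrite hE//; have [M hM] := rapid_L1 (c_rapid ht).
exact: (fourier_syn hM k (tame_conj tc ht)).
Qed.

Lemma h_partial t i : 0 < t <= T -> partial i (h t) = sg (c t) i.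
Proof.
move=> ht; have /andP[t0 _] := ht; rewrite hE//.
exact: (sg_partial nu0 d0 t0 i (tame_nw tc ht)).
Qed.

(** The bounds of the fixed point are inherited by shorter time spans, on which the linear part is
   as small as required. *)
Lemma h_small e : 0 < e -> exists2 r, 0 < r & forall t, 0 < t <= T -> t < r ->
  nw t (c t) (2 * e * t `^ (- 4^-1)).
Proof.
move=> e0; have [T1 [eta [T10 eta0 H]]] := lin_nw_small nu0 d0 hG e0.
have hgg : L2le (fun k => rho k * cabs (g k - g k)) eta.
  split; first exact: ltW.
  by move=> s us; under eq_bigr do rewrite subrr cabs0 mulr0 expr0n; rewrite big1// exprn_ge0// ltW.
exists T1 => // t ht tT1; have /andP[t0 tT] := ht.
pose E' := Num.min E e; have E'0 : 0 <= E' <= E by rewrite le_min E0 (ltW e0)/= ge_min lexx.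
have := scale1 E'0 (T' := t); rewrite t0 tT => /(_ isT) H1.
have : nw t (c t) (2 * E' * t `^ (- 4^-1)).
  apply: H1; rewrite ?lexx ?t0// => s /andP[s0 st].
  have hs1 : 0 < s <= T by rewrite s0 (le_trans st).
  have hs2 : 0 < s <= T1 by rewrite s0 (le_trans st)// ltW.
  rewrite /E'; case: (leP E e) => _; first exact: hl.
  exact: H hgg _ hs2.
by apply: L1le_le => //; rewrite ler_wpM2r ?powR_ge0// ler_wpM2l// /E' ge_min lexx orbT.
Qed.

Lemma data_flow : flow g T h.
Proof.
have k0 := @kappa_gt0 R d; split.
- move=> t ht; have [per _] := h_pcont ht; split => //.
    by rewrite hE//; apply: syn_Ck; exact: c_rapid.
  by rewrite (h_fourier ht); exact: rapid_L1 (c_rapid ht).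
- exists (kappa * (2 * E)); first by rewrite mulr_ge0 ?mulr_ge0// ltW.
  move=> t ht i x; rewrite /gr (h_partial i ht) -mulrA; have /andP[t0 _] := ht.
  exact: (sg_le nu0 t0 i x (tame_nw tc ht)).
- move=> e e0; have e20 : 0 < e / (2 * kappa) by rewrite divr_gt0// mulr_gt0.
  have [r r0 rP] := h_small e20; exists r => // t ht tr i x.
  rewrite /gr (h_partial i ht); have /andP[t0 _] := ht.
  have := sg_le nu0 t0 i x (rP t ht tr); congr (_ <= _).
  by field; exact: lt0r_neq0.
- move=> s0 hs0 e e0; have [r r0 rP] := tame_sup nu0 d0 tc hs0 e0; exists r => // s hs1 hr i x.
  by rewrite /gr (h_partial i hs0) (h_partial i hs1); exact: rP.
- move=> t ht k; have /andP[_ tT] := ht; rewrite (h_fourier ht); apply: (etrans (fix_c ht k)).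
  apply: (@congr1 _ _ (fun z => lin g t k + z)).
  apply: duh_ext_on => s /andP[s0 st].
  have hs1 : 0 < s <= T by rewrite s0 (le_trans (ltW st)).
  have -> : gr h s = sg (c s) by apply/funext => i; exact: h_partial.
  by [].
Qed.

Section solution.
Variable h0 : pt -> R.
Hypothesis hh0 : Hs (s_crit R d) h0.
Hypothesis gE : g = fourier h0.
Hypothesis h00 : h 0 = h0.

Lemma h_tI t : 0 <= t <= T -> tI (h t).
Proof.
case/andP; rewrite le_eqVlt => /orP[/eqP<- _|t0 tT].
  by rewrite h00; apply: L2_tI; case: hh0.
by apply: L2_tI; apply: pcont_L2; apply: h_pcont; rewrite t0.
Qed.

(** At the initial time the linear part is continuous, and the Duhamel part is small because the
   norm of order [d / 2 + 1] is. *)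
Lemma crit_near0 e : 0 < e -> exists2 r, 0 < r & forall t, 0 < t <= T -> t < r ->
  L2le (fun k => rho k * cabs (c t k - g k)) e.
Proof.
move=> e0; have e20 : 0 < e / 2 by rewrite divr_gt0.
have [T1 T10 H1] := lin_cont0 nu0 hG e20.
have [T2 T20 H2] := lin_L2_small nu0 hG e20.
exists (Num.min T1 T2); first by rewrite lt_min T10.
move=> t ht; rewrite lt_min => /andP[tT1 tT2]; have /andP[t0 tT] := ht.
have e1 : 0 <= 2 * (e / 2) by rewrite mulr_ge0// ltW.
have hc : forall s, 0 < s < t -> L2le (fun k => kn k * (rho k * cabs (c s k))) (2 * (e / 2) * s `^ (- 4^-1)).
  move=> s /andP[s0 st]; apply: (scale2 (ltW e20) ht); last by rewrite s0 ltW.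
  by move=> s' /andP[s'0 s't]; apply: H2; rewrite s'0 (le_trans s't)// ltW.
have np : 1%:R = 4 * 4^-1 :> R by rewrite mulfV.
have p1 : 0 <= 4^-1 :> R by rewrite invr_ge0.
have p2 : 4^-1 <= 3 / 4 :> R by lra.
have hp : is_true (((0:R) <= 4^-1) && ((4^-1:R) <= 3 / 4)) by rewrite p1 p2.
have H3 := Phi_l2 nu0 d0 np hp tc ht e1 hc.
have h4 : 32 * d%:R * nu `^ (- 4^-1) * ((lC * (2 * E) ^+ 2 + T `^ 2^-1) * (2 * (e / 2))) *
    t `^ (1 - 4^-1 - 3 / 4) <= e / 2.
  have -> : 1 - 4^-1 - 3 / 4 = 0 :> R by field.
  rewrite powRr0 mulr1 mulrA.
  have := ler_wpM2r e1 (small_le (a := 32 * d%:R * nu `^ (- 4^-1)) (X := lC) hs _ _).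
  rewrite !inE eqxx !orbT => /(_ isT (or_intror erefl)) => hle; apply: (le_trans hle); lra.
have H4 := L2le_le (a := fun k => rho k * cabs (duh (fun s => src (c s)) t k)) _ h4 H3.
have {}H4 : L2le (fun k => rho k * cabs (duh (fun s => src (c s)) t k)) (e / 2).
  by apply: H4 => k; rewrite expr0 mul1r lexx andbT mulr_ge0 ?rho_ge0 ?cabs_ge0.
have H5 : L2le (fun k => rho k * cabs (lin g t k - g k)) (e / 2).
  by apply: H1; rewrite t0 ltW.
have r0c (f : Z -> R[i]) k : 0 <= rho k * cabs (f k) by rewrite mulr_ge0 ?rho_ge0 ?cabs_ge0.
have := L2leD (r0c _) (r0c _) H5 H4; rewrite -splitr; apply: L2le_le (lexx e) => k.
rewrite (r0c (fun k => c t k - g k))/= -mulrDr ler_wpM2l ?rho_ge0//.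
have -> : c t k - g k = (lin g t k - g k) + duh (fun s => src (c s)) t k.
  by apply: (etrans (congr1 (fun z => z - g k) (fix_c ht k))); exact: addrAC.
exact: cabsD.
Qed.

Lemma fourier_diff t s k : 0 <= t <= T -> 0 <= s <= T ->
  fourier (h t - h s) k = fourier (h t) k - fourier (h s) k.
Proof. by move=> ht hs'; exact: fourierB (h_tI ht) (h_tI hs'). Qed.

Lemma crit_small (e : R) f : 0 < e -> fourier f 0 = 0 -> L2le (fun k => rho k * cabs (fourier f k)) (e / 2) ->
  (Hnorm (s_crit R d) f <= e%:E)%E.
Proof.
move=> e0 f0 H; apply: (Hnorm_le (@crit_d R d) (ltW e0)).
have := rho_hterm H; rewrite f0 cabs0 add0r.
by have -> : 2 * (e / 2) = e by field.
Qed.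

(** For positive times the coefficients are continuous in every weighted [l1]; the initial time
   is [crit_near0]. *)
Lemma data_Ct : Ct (Hs (s_crit R d)) (Hnorm (s_crit R d)) T h.
Proof.
apply/CtP => [f|t0]; first exact: Hnorm_ge0.
case/andP; rewrite le_eqVlt => /orP[/eqP<- _|t00 t0T].
  split; first by rewrite h00.
  move=> e e0; have e20 : 0 < e / 2 by rewrite divr_gt0.
  have [r r0 rP] := crit_near0 e20; exists r => // t ht; rewrite sub0r normrN => tr.
  have h0T : is_true (((0 : R) <= 0) && (0 <= T)) by rewrite lexx ltW.
  have /andP[] := ht; rewrite le_eqVlt => /orP[/eqP tp tT|tp tT].
    apply: crit_small => //; rewrite -?tp.
      by rewrite fourier_diff// subrr.
    split; first exact: ltW.
    move=> s us; rewrite big1 ?sqr_ge0// => k _.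
    by rewrite fourier_diff// subrr cabs0 mulr0 expr0n.
  have ht' : 0 < t <= T by rewrite tp.
  have E1 k : fourier (h t - h 0) k = c t k - g k by rewrite fourier_diff// h_fourier// h00 gE.
  apply: crit_small => //; first by rewrite E1 (tame_zero tc ht') subrr.
  move: tr; rewrite (gtr0_norm tp) => tr; apply: L2le_le (rP t ht' tr) => [k|//].
  by rewrite E1 lexx andbT mulr_ge0 ?rho_ge0 ?cabs_ge0.
have ht0 : 0 < t0 <= T by rewrite t00.
split; first by apply: (rapid_Hs (@crit_d R d)); [exact: h_pcont|rewrite h_fourier//; exact: c_rapid].
move=> e e0; have e20 : 0 < e / 2 by rewrite divr_gt0.
have [r r0 rP] := tame_l1cont nu0 d0 d tc ht0 e20.
exists (Num.min r t0); first by rewrite lt_min r0.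
move=> t ht tr; have tp : 0 < t by apply: pos_near tr; rewrite ge_min lexx orbT.
have ht' : 0 < t <= T by rewrite tp; case/andP: ht.
have : (Hnorm (s_crit R d) (h t - h t0)%R <= (2 * (e / 2))%:E)%E.
  apply: (l1_Hnorm (@crit_d R d)); move: tr; rewrite lt_min => /andP[tr _].
  apply: L1le_le (rP t ht' tr) => // k.
  by rewrite fourier_diff ?(ltW t00)// !h_fourier// -[c t k - _]opprB cabsN.
by have -> : 2 * (e / 2) = e by field.
Qed.

Lemma data_grad : Ct_weighted (@C0x R d 'rV[R]_d) (@supnorm R d 'rV[R]_d) T 4^-1 (fun t => grad (h t)).
Proof.
exists (fun t => t `^ 4^-1 *: grad (h t)); split => //.
have vE t x j : (t `^ 4^-1 *: grad (h t)) x 0 j = t `^ 4^-1 * partial j (h t) x.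
  by rewrite /= !mxE.
have k0 := @kappa_gt0 R d; have T0' := ltW T0.
apply/CtP => [f|t0]; first exact: supnorm_ge0.
case/andP; rewrite le_eqVlt => /orP[/eqP<- _|t00 t0T].
  rewrite quarter0 scale0r; split.
    by split => [//|x]; exact: cst_continuous.
  move=> e e0; have e20 : 0 < e / (2 * kappa) by rewrite divr_gt0// mulr_gt0.
  have [r r0 rP] := h_small e20; exists r => // t ht; rewrite sub0r normrN subr0 => tr.
  apply: supnorm_le => [|x j]; first exact: ltW.
  rewrite vE; have /andP[] := ht; rewrite le_eqVlt => /orP[/eqP<- _|tp tT].
    by rewrite quarter0 mul0r normr0 ltW.
  have ht' : 0 < t <= T by rewrite tp.
  rewrite (h_partial j ht') normrM ger0_norm ?powR_ge0//.
  move: tr; rewrite (gtr0_norm tp) => tr.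
  have hsg := sg_le nu0 tp j x (rP t ht' tr).
  apply: (le_trans (ler_wpM2l (powR_ge0 t 4^-1) hsg)).
  have -> : t `^ 4^-1 * (kappa * (2 * (e / (2 * kappa)) * t `^ (- 4^-1))) =
    (t `^ 4^-1 * t `^ (- 4^-1)) * (kappa * (2 * (e / (2 * kappa)))) by ring.
  rewrite quarterK// mul1r; have -> // : kappa * (2 * (e / (2 * kappa))) = e.
  by field; exact: lt0r_neq0.
have ht0 : 0 < t0 <= T by rewrite t00.
have [perv [_ cv]] : torus_periodic (h t0) /\ Ck 1 (h t0).
  by have [] := flow_reg data_flow ht0.
split.
  split => [x k|].
    by apply/rowP => j; rewrite !vE (partial_periodic j perv).
  apply: rV_continuous => j.
  have -> : (fun x => (t0 `^ 4^-1 *: grad (h t0)) x 0 j) = (fun x => t0 `^ 4^-1 * partial j (h t0) x).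
    by apply/funext => x; exact: vE.
  by have [] := pcontM (pcont_cst (t0 `^ 4^-1)) (conj (partial_periodic j perv) (cv j)).
move=> e e0; have hn := tame_nw tc ht0.
have B0 : 0 <= kappa * (2 * E * t0 `^ (- 4^-1)) by rewrite !mulr_ge0 ?powR_ge0// ltW.
have [r1 [e1 [r10 r1t e10 P1]]] := powR_near 4^-1 ht0 B0 e0.
have [r r0 rP] := tame_sup nu0 d0 tc ht0 e10.
exists (Num.min r r1); first by rewrite lt_min r0.
move=> t ht; rewrite lt_min => /andP[tr tr1]; have tp := pos_near r1t tr1.
have ht' : 0 < t <= T by rewrite tp; case/andP: ht.
apply: supnorm_le => [|x j]; first exact: ltW.
have -> : ((t `^ 4^-1 *: grad (h t)) - (t0 `^ 4^-1 *: grad (h t0))) x 0 j =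
   (t `^ 4^-1 *: grad (h t)) x 0 j - (t0 `^ 4^-1 *: grad (h t0)) x 0 j by rewrite !mxE.
rewrite !vE !h_partial//; apply: le_trans (P1 t ht' tr1).
have id3 (a b u w : R) : a * u - b * w = (a - b) * w + a * (u - w) by ring.
rewrite id3; apply: (le_trans (ler_normD _ _)); rewrite !normrM; apply: lerD.
  have H := sg_le nu0 t00 j x hn.
  by apply: ler_wpM2l => //; exact: H.
rewrite [X in X * _ <= _]ger0_norm ?powR_ge0// ler_wpM2l ?powR_ge0// distrC.
exact: rP.
Qed.

Lemma data_high : Ct_weighted (Hs (s_crit R d + 1)) (Hnorm (s_crit R d + 1)) T 4^-1 h.
Proof.
exists (fun t => t `^ 4^-1 *: h t); split => //; have T0' := ltW T0.
have fZ t k : 0 <= t <= T -> fourier (t `^ 4^-1 *: h t) k = (t `^ 4^-1)%:C * fourier (h t) k.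
  by move=> ht; exact: fourierZ (h_tI ht).
have vI t : 0 <= t <= T -> tI (t `^ 4^-1 *: h t).
    move=> ht.
    have -> : t `^ 4^-1 *: h t = (fun x => h t x * t `^ 4^-1) by apply/funext => x; exact: mulrC.
    exact: tIM (h_tI ht) (bpt_cst _).
have zf : fourier (0 : pt -> R) = (fun=> 0).
  apply/funext => k; have h0T : is_true (((0 : R) <= 0) && (0 <= T)) by rewrite lexx.
  by have := fZ 0 k h0T; rewrite quarter0 scale0r mul0r.
apply/CtP => [f|t0]; first exact: Hnorm_ge0.
case/andP; rewrite le_eqVlt => /orP[/eqP<- _|t00 t0T].
  rewrite quarter0 scale0r; split.
    apply: (rapid_Hs (@crit_d2 R d)); first exact: pcont_cst.
    by rewrite zf => m; exists 0 => s us; rewrite big1// => k _; rewrite cabs0 mulr0.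
  move=> e e0; have e80 : 0 < e / 8 by rewrite divr_gt0.
  have [T2 T20 H2] := lin_L2_small nu0 hG e80.
  have e40 : 0 < e / 4 by rewrite divr_gt0.
  have [r r0 rP] := quarter_small e40 (cabs_ge0 (g 0)).
  exists (Num.min r T2); first by rewrite lt_min r0.
  move=> t ht; rewrite sub0r normrN subr0 => tr.
  have /andP[] := ht; rewrite le_eqVlt => /orP[/eqP<- _|tp tT].
    rewrite quarter0 scale0r; apply: (Hnorm_le (@crit_d2 R d) (ltW e0)).
    move=> s us; rewrite big1 ?sqr_ge0// => k _.
    by rewrite /hterm zf cabs0 expr0n/= mulr0.
  have ht' : 0 < t <= T by rewrite tp.
  move: tr; rewrite (gtr0_norm tp) lt_min => /andP[tr tT2].
  have E1 k : cabs (fourier (t `^ 4^-1 *: h t) k) = t `^ 4^-1 * cabs (c t k).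
    by rewrite fZ// cabsM cabs_real ger0_norm ?powR_ge0// h_fourier.
  have q0 := powR_ge0 t 4^-1.
  have H3 : L2le (fun k => kn k * (rho k * cabs (fourier (t `^ 4^-1 *: h t) k))) (e / 4).
    have H2' s : 0 < s <= t -> L2le (fun k => kn k * (rho k * cabs (lin g s k))) (e / 8 * s `^ (- 4^-1)).
      by move=> /andP[s0 st]; apply: H2; rewrite s0 (le_trans st)// ltW.
    have htt : 0 < t <= t by rewrite tp lexx.
    have H' := scale2 (ltW e80) ht' H2' htt.
    have := L2leZ q0 H'.
    have -> : t `^ 4^-1 * (2 * (e / 8) * t `^ (- 4^-1)) = (t `^ 4^-1 * t `^ (- 4^-1)) * (e / 4) by field.
    rewrite quarterK// mul1r; apply: L2le_le => [k|//].
    rewrite E1 !mulr_ge0 ?kn_ge0 ?rho_ge0 ?cabs_ge0//=.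
    by rewrite le_eqVlt; apply/orP; left; apply/eqP; ring.
  apply: (Hnorm_le (@crit_d2 R d) (ltW e0)); apply: L1le_le (knrho_hterm H3) => //.
  rewrite E1 (tame_zero tc ht'); have := rP t; rewrite tp tr => /(_ isT) hz.
  rewrite lerXn2r ?nnegrE ?mulr_ge0 ?addr_ge0 ?mulr_ge0 ?cabs_ge0 ?(ltW e40) ?(ltW e0)//; lra.
have ht0 : 0 < t0 <= T by rewrite t00.
have ht0' : 0 <= t0 <= T by rewrite (ltW t00).
split.
  apply: (rapid_Hs (@crit_d2 R d)).
    by apply: pcontM; [exact: pcont_cst|exact: h_pcont].
  move=> m; have [M hM] := c_rapid ht0 m; exists (t0 `^ 4^-1 * M).
  apply: L1le_le (L1leZ (powR_ge0 t0 4^-1) hM) => // k.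
  rewrite fZ// cabsM cabs_real ger0_norm ?powR_ge0// h_fourier//.
  by rewrite le_eqVlt; apply/orP; left; apply/eqP; ring.
move=> e e0; have e20 : 0 < e / 2 by rewrite divr_gt0.
have [B hB] := c_rapid ht0 (d + 2); have B0 := L1le_ge0 hB.
have [r1 [e1 [r10 r1t e10 P1]]] := powR_near 4^-1 ht0 B0 e20.
have [r r0 rP] := tame_l1cont nu0 d0 (d + 2) tc ht0 e10.
exists (Num.min r r1); first by rewrite lt_min r0.
move=> t ht; rewrite lt_min => /andP[tr tr1]; have tp := pos_near r1t tr1.
have ht' : 0 < t <= T by rewrite tp; case/andP: ht.
have : (Hnorm (s_crit R d + 1)%R (t `^ 4^-1 *: h t - t0 `^ 4^-1 *: h t0)%R <= (2 * (e / 2))%:E)%E.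
  apply: (l1_Hnorm (@crit_d2 R d)).
  have H := L1leD (L1leZ (normr_ge0 (t `^ 4^-1 - t0 `^ 4^-1)) hB) (L1leZ (powR_ge0 t 4^-1) (rP t ht' tr)).
  apply: L1le_le (P1 t ht' tr1) H => k.
  have -> : fourier (t `^ 4^-1 *: h t - t0 `^ 4^-1 *: h t0) k =
      (t `^ 4^-1 - t0 `^ 4^-1)%:C * c t0 k + (t `^ 4^-1)%:C * - (c t0 k - c t k).
    rewrite (fourierB k (vI _ ht) (vI _ ht0')) !fZ// !h_fourier// rmorphB/=.
    by move: ((_)%:C) ((_)%:C) => a b; ring.
  have p0 : 0 <= (1 + kn k) ^+ (d + 2) by rewrite exprn_ge0// addr_ge0// kn_ge0.
  have idM (p a b u w : R) : a * (p * u) + b * (p * w) = p * (a * u + b * w) by ring.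
  rewrite idM ler_wpM2l//.
  apply: (le_trans (cabsD _ _)); rewrite !cabsM !cabs_real cabsN.
  by rewrite (ger0_norm (powR_ge0 t 4^-1)).
by have -> : 2 * (e / 2) = e by field.
Qed.

Lemma data_solution : solution nu h0 T h.
Proof.
split.
- exact: data_Ct.
- by rewrite h00; exact: aeq_refl.
- split; last exact: data_grad.
  by move=> t; rewrite in_itv/= => ht; have [] := flow_reg data_flow ht.
- exact: data_high.
- have F := data_flow; rewrite gE in F; exact: (flow_solves F h00).
Qed.

End solution.

End one_datum.

Theorem exists_solution (h0 : pt -> R) : Hs (s_crit R d) h0 -> exists2 T, 0 < T & exists h : R -> pt -> R, solution nu h0 T h.
Proof.
move=> hh0; have [L2h0 fin] := hh0; have [M M0 hM] := Hnorm_fin crit_d fin.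
have hG := hterm_rho M0 hM; have [E [T [eta [eta0 hs H]]]] := local_near hG.
have gc : conj_sym (fourier h0) by move=> k; exact: fourierN (L2_tI L2h0).
have h00 : L2le (fun k => rho k * cabs (fourier h0 k - fourier h0 k)) eta.
  split; first exact: ltW.
  by move=> s us; rewrite big1 ?sqr_ge0// => k _; rewrite subrr cabs0 mulr0 expr0n.
have hl := H _ h00; have [c [tc fix_c sc1 sc2]] := local_existence nu0 d0 gc hs hl.
exists T; first by case: hs.
exists (fun t => if t <= 0 then h0 else syn (c t)).
apply: (data_solution hG hs hl tc fix_c sc1 sc2) => //; last by rewrite lexx.
by move=> t /andP[t0 _]; rewrite leNgt t0.
Qed.

End from_coefficients.

(** * From solutions to flows *)

Section solution_flow.
Context {R : realType} {d : nat}.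
Variable nu : R.
Hypothesis nu0 : 0 < nu.
Hypothesis d0 : (0 < d)%N.
Local Notation pt := 'rV[R]_d.
Local Notation Z := 'rV[int]_d.
Local Notation kn := (@freq_norm R d).
Local Notation rho := (@rho R d).
Local Notation flow := (@flow R d nu).
Variables (h0 : pt -> R) (T : R) (h : R -> pt -> R).
Hypothesis T0 : 0 < T.
Hypothesis sol : solution nu h0 T h.
Implicit Types (t s e : R).

Lemma sol_Hs t : 0 <= t <= T -> Hs (s_crit R d) (h t).
Proof. by move=> ht; have [/CtP cC _ _ _ _] := sol; have [] := cC (@Hnorm_ge0 R d _) t ht. Qed.

Lemma sol_tI t : 0 <= t <= T -> tI (h t).
Proof. by move=> /sol_Hs[/L2_tI]. Qed.

Lemma sol_per t : 0 <= t <= T -> torus_periodic (h t).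
Proof. by move=> /sol_Hs[[]]. Qed.

Lemma sol_rho_cont t0 : 0 <= t0 <= T -> forall e, 0 < e -> exists2 r, 0 < r &
  forall t, 0 <= t <= T -> `|t0 - t| < r -> L2le (fun k => rho k * cabs (fourier (h t) k - fourier (h t0) k)) e /\
    forall k, cabs (fourier (h t) k - fourier (h t0) k) <= e.
Proof.
move=> ht0 e e0; have [/CtP cC _ _ _ _] := sol; have [_ H] := cC (@Hnorm_ge0 R d _) t0 ht0.
have [r r0 rP] := H e e0; exists r => // t ht tr.
have hh := Hnorm_L1 crit_d (ltW e0) (rP t ht tr).
have E k : fourier (h t - h t0) k = fourier (h t) k - fourier (h t0) k.
  exact: fourierB (sol_tI ht) (sol_tI ht0).
split; last by move=> k; rewrite -E; exact: hterm_point (ltW e0) hh.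
by apply: L2le_le (hterm_rho (ltW e0) hh) => // k; rewrite E lexx andbT mulr_ge0 ?rho_ge0 ?cabs_ge0.
Qed.

(** Coefficients are summable because [h t] has more than [d / 2] derivatives. *)
Lemma sol_reg t : 0 < t <= T ->
  [/\ torus_periodic (h t), Ck 1 (h t) & exists M, L1le (fun k => cabs (fourier (h t) k)) M].
Proof.
move=> ht; have /andP[t0 tT] := ht; have ht' : 0 <= t <= T by rewrite ltW.
have [_ _ [reg _] [w [/CtP cw wE]] _] := sol; split.
- exact: sol_per.
- by apply: reg; rewrite in_itv.
have [[_ fin] _] := cw (@Hnorm_ge0 R d _) t ht'.
have [M M0 hM] := Hnorm_fin crit_d2 fin; have [B hB] := hterm_L1 d0 M0 hM.
exists (t `^ (- 4^-1) * B); apply: L1le_le (L1leZ (powR_ge0 t (- 4^-1)) hB) => // k.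
have -> : w t = t `^ 4^-1 *: h t by apply: wE; rewrite in_itv.
have -> : fourier (t `^ 4^-1 *: h t) k = (t `^ 4^-1)%:C * fourier (h t) k by exact: fourierZ (sol_tI ht').
by rewrite cabsM cabs_real ger0_norm ?powR_ge0// mulrA [X in X * _]mulrC quarterK// mul1r.
Qed.

Lemma sol_pcont t j : 0 < t <= T -> pcont (gr h t j).
Proof. by move=> ht; have [per [_ C] _] := sol_reg ht; split; [exact: partial_periodic|exact: C]. Qed.

(** The function that continues [t^(1/4) grad h] to the initial time. *)
Lemma sol_grad : exists v : R -> pt -> 'rV[R]_d,
  [/\ (forall t, 0 <= t <= T -> forall j, pcont (fun x => v t x 0 j)),
      (forall t, 0 < t <= T -> forall j x, v t x 0 j = t `^ 4^-1 * gr h t j x) &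
      forall t0, 0 <= t0 <= T -> forall e, 0 < e -> exists2 r, 0 < r &
        forall t, 0 <= t <= T -> `|t0 - t| < r -> forall j x, `|v t x 0 j - v t0 x 0 j| <= e].
Proof.
have [_ _ [_ [v [/CtP cv vE]]] _ _] := sol; have {}cv := cv (@supnorm_ge0 R d).
exists v; split.
- move=> t ht j; have [[per c] _] := cv t ht; split; first by move=> x k; rewrite per.
  by move=> x; have H := cvg_comp _ _ (c x) (@coord_continuous R 1 d 0 j (v t x)); exact: H.
- by move=> t ht j x; rewrite vE ?in_itv//= !mxE.
- move=> t0 ht0 e e0; have [_ H] := cv t0 ht0; have [r r0 rP] := H e e0.
  exists r => // t ht tr j x; have := le_supnorm (rP t ht tr) x j.
  by rewrite !mxE.
Qed.

(** The initial value of the weighted gradient vanishes because its Fourier coefficients do: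
   the coefficients of the solution stay bounded near the initial time. *)
Lemma sol_grad0 (v : R -> pt -> 'rV[R]_d) :
  (forall t, 0 <= t <= T -> forall j, pcont (fun x => v t x 0 j)) ->
  (forall t, 0 < t <= T -> forall j x, v t x 0 j = t `^ 4^-1 * gr h t j x) ->
  (forall t0, 0 <= t0 <= T -> forall e, 0 < e -> exists2 r, 0 < r &
        forall t, 0 <= t <= T -> `|t0 - t| < r -> forall j x, `|v t x 0 j - v t0 x 0 j| <= e) ->
  forall j x, v 0 x 0 j = 0.
Proof.
move=> pv vE cv j; have h0T : is_true (((0 : R) <= 0) && (0 <= T)) by rewrite lexx ltW.
apply: (fourier_inj0 d0 (pv 0 h0T j)) => k; apply: cabs_eq0; apply/eqP.
rewrite eq_le cabs_ge0 andbT; apply/ler_addgt0Pr => e e0; rewrite add0r.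
pose C : R := 2 * (2 * pi) ^+ d; have C0 : 0 < C by rewrite mulr_gt0// exprn_gt0// pi2_gt0.
have e20 : 0 < e / 2 by rewrite divr_gt0.
have [r1 r10 H1] := cv 0 h0T _ (divr_gt0 e20 C0).
have [r2 r20 H2] := sol_rho_cont h0T ltr01.
have M0 : 0 <= `|(k 0 j)%:~R : R| * (cabs (fourier (h 0) k) + 1).
  by rewrite mulr_ge0// addr_ge0// cabs_ge0.
have [r3 r30 H3] := quarter_small e20 M0.
pose m := Num.min (Num.min r1 r2) (Num.min r3 T).
have m0 : 0 < m by rewrite !lt_min r10 r20 r30.
pose t := m / 2; have t0 : 0 < t by rewrite divr_gt0.
have tm : t < m by rewrite /t ltr_pdivrMr// ltr_pMr// ltr1n.
move: (tm); rewrite !lt_min => /andP[/andP[t1 t2] /andP[t3 /ltW tT]].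
have ht : 0 < t <= T by rewrite t0.
have ht' : 0 <= t <= T by rewrite ltW.
have n0 : `|0 - t| = t by rewrite sub0r normrN gtr0_norm.
have f1 : cabs (fourier (fun x => v t x 0 j - v 0 x 0 j) k) <= e / 2.
  have pd := pcontB (pv t ht' j) (pv 0 h0T j).
  have := fourier_le k (pcont_bpt pd) (H1 t ht' _ j); rewrite n0 => /(_ t1).
  have -> // : 2 * (e / 2 / C) * (2 * pi) ^+ d = e / 2.
  have -> : 2 * (e / 2 / C) * (2 * pi) ^+ d = e / 2 / C * C by rewrite /C; ring.
  by rewrite divfK// gt_eqF.
have f2 : cabs (fourier (fun x => v t x 0 j) k) <= e / 2.
  have -> : (fun x => v t x 0 j) = (fun x => t `^ 4^-1 * gr h t j x) by apply/funext => x; exact: vE.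
  have [per [df cf] _] := sol_reg ht.
  have pg := sol_pcont j ht.
  rewrite (fourierZ _ _ (bpt_tI (pcont_bpt pg))) /gr (fourier_partial k per df (cf j)).
  rewrite !cabsM cabs_real cabs_imag ger0_norm ?powR_ge0//.
  apply: le_trans (H3 t _); last by rewrite t0.
  rewrite ler_wpM2l ?powR_ge0// ler_wpM2l//.
  have t2' : `|0 - t| < r2 by rewrite n0.
  have [_ /(_ k) h2] := H2 t ht' t2'.
  have -> : fourier (h t) k = fourier (h 0) k + (fourier (h t) k - fourier (h 0) k) by rewrite addrC subrK.
  by apply: (le_trans (cabsD _ _)); rewrite lerD2l h2.
have -> : fourier (fun x => v 0 x 0 j) k =
    fourier (fun x => v t x 0 j) k - fourier (fun x => v t x 0 j - v 0 x 0 j) k.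
  by rewrite (fourierB k (bpt_tI (pcont_bpt (pv t ht' j))) (bpt_tI (pcont_bpt (pv 0 h0T j)))) opprB addrC subrK.
by apply: (le_trans (cabsB _ _)); rewrite [leRHS](splitr e) lerD.
Qed.

(** The singularity [t^(-1/4)] and its smallness are read off the weighted gradient, which is
   bounded by compactness of the time interval. *)
Theorem solution_flow : flow (fourier h0) T h.
Proof.
have [v [pv vE cv]] := sol_grad; have v0 := sol_grad0 pv vE cv.
have h0T : is_true (((0 : R) <= 0) && (0 <= T)) by rewrite lexx ltW.
have grE t : 0 < t <= T -> forall j x, gr h t j x = t `^ (- 4^-1) * v t x 0 j.
  move=> ht j x; rewrite (vE t ht) mulrA [X in X * _]mulrC quarterK ?mul1r//.
  by case/andP: ht.
have bound t : 0 <= t <= T -> exists2 B, 0 <= B & forall j x, `|v t x 0 j| <= B.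
  move=> ht; have H j : exists M, 0 <= M /\ forall x, `|v t x 0 j| <= M.
    have [M hM] := pcont_bounded (pv t ht j); exists M; split => //.
    exact: le_trans (normr_ge0 _) (hM 0).
  have [F hF] := choice H; exists (\sum_j F j); first by apply: sumr_ge0 => j _; have [] := hF j.
  move=> j x; have [_ h1] := hF j; apply: (le_trans (h1 x)).
  by rewrite (bigD1 j)//= lerDl; apply: sumr_ge0 => i _; have [] := hF i.
have ubound : exists2 B, 0 <= B & forall t, 0 <= t <= T -> forall j x, `|v t x 0 j| <= B.
  have cpt := @segment_compact R 0 T.
  (* the bounds near single times, for all large constants, become one bound *)
  have := (compact_near_coveringP `[0, T]%classic).1 cpt R +oo%R
    (fun B t => 0 <= t <= T -> forall j x, `|v t x 0 j| <= B) _.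
  case=> [t0 /=|M [_ hM]].
    rewrite in_itv/= => ht0; have [B B0 hB] := bound t0 ht0.
    have [r r0 rP] := cv t0 ht0 1 ltr01.
    exists (ball t0 r, [set b | B + 1 < b]) => /=.
      by split; [exact: nbhsx_ballx|exists (B + 1); split; rewrite ?num_real].
    case=> t b /= [tr Bb] ht j x; apply: le_trans (ltW Bb).
    have -> : v t x 0 j = v t0 x 0 j + (v t x 0 j - v t0 x 0 j) by rewrite addrC subrK.
    by apply: (le_trans (ler_normD _ _)); rewrite lerD// rP.
  exists (`|M| + 1); first by rewrite addr_ge0.
  have hM1 : M < `|M| + 1 by rewrite (le_lt_trans (ler_norm M))// ltrDl.
  by move=> t ht; apply: (hM _ hM1 t _ ht); rewrite /= in_itv.
have [A A0 hA] := ubound.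
have bnd t : 0 < t <= T -> forall i x, `|gr h t i x| <= A * t `^ (- 4^-1).
  move=> ht i x; have /andP[t0 tT] := ht; rewrite grE// normrM ger0_norm ?powR_ge0// mulrC.
  by rewrite ler_wpM2r ?powR_ge0// hA// ltW.
have cont s0 : 0 < s0 <= T -> forall e, 0 < e -> exists2 r, 0 < r &
     forall s, 0 < s <= T -> `|s0 - s| < r -> forall i x, `|gr h s0 i x - gr h s i x| <= e.
  move=> hs0 e e0; have /andP[s00 s0T] := hs0; have hs0' : 0 <= s0 <= T by rewrite ltW.
  have [B B0 hB] := bound s0 hs0'.
  have [r1 [e1 [r10 r1s e10 P1]]] := powR_near (- 4^-1) hs0 B0 e0.
  have [r2 r20 P2] := cv s0 hs0' e1 e10.
  exists (Num.min r1 r2); first by rewrite lt_min r10.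
  move=> s hs; rewrite lt_min => /andP[sr1 sr2] i x; have /andP[sp sT] := hs.
  have hs' : 0 <= s <= T by rewrite ltW.
  rewrite !grE//; apply: le_trans (P1 s hs sr1).
  have id3 (a b u w : R) : b * w - a * u = - ((a - b) * w + a * (u - w)) by ring.
  rewrite id3 normrN; apply: (le_trans (ler_normD _ _)); rewrite !normrM; apply: lerD.
    by apply: ler_wpM2l.
  by rewrite (ger0_norm (powR_ge0 s (- 4^-1))); apply: ler_wpM2l; rewrite ?powR_ge0//; exact: P2.
split.
- exact: sol_reg.
- by exists A.
- move=> e e0; have [r r0 rP] := cv 0 h0T e e0; exists r => // t ht tr i x; have /andP[t0 tT] := ht.
  have ht' : 0 <= t <= T by rewrite ltW.
  rewrite grE// normrM ger0_norm ?powR_ge0// mulrC ler_wpM2r ?powR_ge0//.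
  have tr' : `|0 - t| < r by rewrite sub0r normrN gtr0_norm.
  by have := rP t ht' tr' i x; rewrite v0 subr0.
- exact: cont.
- move=> t ht k; have /andP[t0 tT] := ht; have [_ _ _ _ m] := sol.
  have ha : adm T (fun s => nlu (gr h s)) by apply: (adm_nlu A0) => // s hs i; exact: sol_pcont.
  have hi := m t _ k; rewrite in_itv/= (ltW t0) tT in hi.
  apply: (etrans (hi isT)); apply: (@congr1 _ _ (fun z => (bih_symbol nu t k)%:C * fourier h0 k + z)).
  exact: (mild_integral nu0 k ha ht).
Qed.

End solution_flow.

(** * The maximal solution *)

Section maximal.
Context {R : realType} {d : nat}.
Variable nu : R.
Hypothesis nu0 : 0 < nu.
Hypothesis d0 : (0 < d)%N.
Local Notation pt := 'rV[R]_d.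
Local Notation Z := 'rV[int]_d.
Local Notation kn := (@freq_norm R d).
Local Notation rho := (@rho R d).
Local Notation bs := (bs nu).
Local Notation flow := (@flow R d nu).
Implicit Types (h g : R -> pt -> R) (T t : R).

Lemma flow_congr c0 T h g : flow c0 T h -> (forall t, 0 < t <= T -> g t = h t) -> flow c0 T g.
Proof.
move=> F E; have Eg t i : 0 < t <= T -> gr g t i = gr h t i by move=> ht; rewrite /gr E.
split.
- by move=> t ht; rewrite E//; exact: flow_reg F t ht.
- by have [A A0 hA] := flow_bnd F; exists A => // t ht i x; rewrite Eg//; exact: hA.
- by move=> e e0; have [r r0 rP] := flow_small F e0; exists r => // t ht tr i x; rewrite Eg//; exact: rP.
- move=> s0 hs0 e e0; have [r r0 rP] := flow_cont F hs0 e0; exists r => // t ht tr i x.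
  by rewrite !Eg//; exact: rP.
- move=> t ht k; rewrite E//; apply: (etrans (flow_mild F ht k)).
  apply: (@congr1 _ _ (fun z => (bs t k)%:C * c0 k + z)); apply: duh_ext_on => s /andP[s0 st].
  have hs : 0 < s <= T by rewrite s0 (le_trans (ltW st))//; case/andP: ht.
  by have -> : gr g s = gr h s by apply/funext => i; exact: Eg.
Qed.

Lemma Hnorm_ext (s : R) (f f' : pt -> R) : (forall k, fourier f k = fourier f' k) -> Hnorm s f = Hnorm s f'.
Proof. by move=> E; rewrite /Hnorm; congr (_ `^ _)%E; apply: eq_esum => k _; rewrite E. Qed.

(** A solution may be changed at the initial time, where the equation sees only its class. *)
Lemma solution_congr (h0 : pt -> R) T h g : 0 < T -> Hs (s_crit R d) h0 -> solution nu h0 T h ->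
  (forall t, 0 < t <= T -> g t = h t) -> g 0 = h0 -> solution nu h0 T g.
Proof.
move=> T0 hh0 sol E g0; have Fg := flow_congr (solution_flow nu0 d0 T0 sol) E.
have E' t : t \in `]0, T] -> g t = h t by rewrite in_itv; exact: E.
have [cC a0 [reg [v [cv vE]]] [w [cw wE]] _] := sol; split.
- have h0T : is_true (((0 : R) <= 0) && (0 <= T)) by rewrite lexx ltW.
  have gHs t : 0 <= t <= T -> Hs (s_crit R d) (g t).
    move=> /andP[]; rewrite le_eqVlt => /orP[/eqP<- _|t0 tT]; first by rewrite g0.
    by rewrite E ?t0//; apply: (sol_Hs sol); rewrite ltW.
  have fE t k : 0 <= t <= T -> fourier (g t) k = fourier (h t) k.
    move=> /andP[]; rewrite le_eqVlt => /orP[/eqP<- _|t0 tT]; last by rewrite E ?t0.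
    by rewrite g0; apply/esym/aeq_fourier => //; [have [] := sol_Hs sol h0T|have [] := hh0].
  apply/CtP => [f|t0 ht0]; first exact: Hnorm_ge0.
  split; first exact: gHs.
  move=> e e0; have [_ H] := (CtP _ _ _ (@Hnorm_ge0 R d _)).1 cC t0 ht0.
  have [r r0 rP] := H e e0; exists r => // t ht tr.
  have tI_g s : 0 <= s <= T -> tI (g s) by move=> /gHs[/L2_tI].
  have -> // : Hnorm (s_crit R d) (g t - g t0)%R = Hnorm (s_crit R d) (h t - h t0)%R; last exact: rP.
  apply: Hnorm_ext => k.
  rewrite (fourierB k (tI_g _ ht) (tI_g _ ht0)) (fourierB k (sol_tI sol ht) (sol_tI sol ht0)).
  by rewrite !fE.
- by rewrite g0; exact: aeq_refl.
- split; first by move=> t ht; rewrite E'//; exact: reg.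
  by exists v; split => // t ht; rewrite vE// E'.
- by exists w; split => // t ht; rewrite wE// E'.
- by have H := flow_solves nu0 Fg g0; exact: H.
Qed.

Lemma solutionS (h0 : pt -> R) T T' h : T' <= T -> solution nu h0 T h -> solution nu h0 T' h.
Proof.
move=> TT [cC a0 [reg [v [cv vE]]] [w [cw wE]] m].
have sub t : t \in `[0, T'] -> t \in `[0, T].
  by rewrite !in_itv/= => /andP[-> h1]; exact: le_trans TT.
have sub' t : t \in `]0, T'] -> t \in `]0, T].
  by rewrite !in_itv/= => /andP[-> h1]; exact: le_trans TT.
have CtS (V : zmodType) (B : set V) (N : V -> \bar R) (u : R -> V) : (forall v, (0 <= N v)%E) ->
    Ct B N T u -> Ct B N T' u.
  move=> N0 /(CtP _ _ _ N0) C; apply/(CtP _ _ _ N0) => t0 /andP[t00 t0T].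
  have [|Bt H] := C t0; first by rewrite t00 (le_trans t0T).
  split=> // e e0; have [r r0 rP] := H e e0; exists r => // t /andP[p1 p2].
  by apply: rP; rewrite p1 (le_trans p2).
split.
- by apply: CtS cC => f; exact: Hnorm_ge0.
- by [].
- split; first by move=> t /sub'; exact: reg.
  by exists v; split; [apply: CtS cv => f; exact: supnorm_ge0|move=> t /sub'; exact: vE].
- by exists w; split; [apply: CtS cw => f; exact: Hnorm_ge0|move=> t /sub'; exact: wE].
- by move=> t /sub; exact: m.
Qed.

Lemma solution_eq (h0 : pt -> R) T T' h g t : solution nu h0 T h -> solution nu h0 T' g ->
  0 < t -> t <= T -> t <= T' -> h t = g t.
Proof.
move=> sh sg t0 tT tT'; have htt : 0 < t <= t by rewrite t0 lexx.
have Fh := solution_flow nu0 d0 t0 (solutionS tT sh).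
have Fg := solution_flow nu0 d0 t0 (solutionS tT' sg).
by have H := flow_uniq nu0 d0 Fh Fg htt; exact: H.
Qed.

Lemma solution_unique (h0 : pt -> R) T h : 0 < T -> solution nu h0 T h -> unique_solution nu h0 T h.
Proof.
move=> T0 sh; split => // g sg t; rewrite in_itv/= => /andP[].
rewrite le_eqVlt => /orP[/eqP<- _|t0 tT].
  by have [_ ah _ _ _] := sh; have [_ ag _ _ _] := sg; exact: aeq_trans ag (aeq_sym ah).
by rewrite (solution_eq sg sh t0 tT tT); exact: aeq_refl.
Qed.

(** Solutions with the same datum agree, hence one function extends them all. *)
Lemma glued_solution (h0 : pt -> R) : Hs (s_crit R d) h0 -> exists h, forall T g, 0 < T ->
  solution nu h0 T g -> solution nu h0 T h.
Proof.
move=> hh0.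
have H t : exists f : pt -> R, (t = 0 -> f = h0) /\
    forall T g, 0 < t <= T -> solution nu h0 T g -> f = g t.
  have [t0|t0] := leP t 0; first by exists h0; split => // T g; rewrite ltNge t0.
  have [[T [g [tT sg]]]|no] := pselect (exists T g, t <= T /\ solution nu h0 T g).
    exists (g t); split; first by move=> tz; rewrite tz ltxx in t0.
    by move=> T' g' /andP[_ tT'] sg'; exact: solution_eq sg sg' t0 tT tT'.
  exists h0; split => // T g /andP[_ tT] sg; exfalso; apply: no.
  by exists T, g.
have [h hh] := choice H; exists h => T g T0 sg.
apply: (solution_congr T0 hh0 sg); last by have [->] := hh 0.
by move=> t ht; have [_] := hh t; apply; [exact: ht|].
Qed.

(** Smoothing. Starting the construction slightly before the given time, from the solution
   itself, gives a time span that does not shrink, since by continuity in the critical space all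
   these data are near one datum. *)
Lemma solution_rapid (h0 : pt -> R) T h t : solution nu h0 T h -> 0 < t <= T ->
  rapid (fourier (h t)) /\ smooth (h t).
Proof.
move=> sh ht; have /andP[t0 tT] := ht; have T0 := lt_le_trans t0 tT.
have ht' : 0 <= t <= T by rewrite ltW.
have [_ fin] := sol_Hs sh ht'; have [M M0 hM] := Hnorm_fin crit_d fin.
have hG := hterm_rho M0 hM; have [E [T' [eta [eta0 hs H]]]] := local_near nu0 d0 hG.
have T'0 : 0 < T' by case: hs.
have [r r0 rP] := sol_rho_cont sh ht' eta0.
(* start at a time [t1 > 0] that is nearer to [t] than the time span and in the neighborhood where
   the data are near [h t] *)
pose m := Num.min (Num.min T' t) r; have m0 : 0 < m by rewrite !lt_min T'0 t0.
pose tau := m / 2; have tau0 : 0 < tau by rewrite divr_gt0.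
have : tau < m by rewrite /tau ltr_pdivrMr// ltr_pMr// ltr1n.
rewrite !lt_min => /andP[/andP[tau1 tau2] tau3].
pose t1 := t - tau; have t10 : 0 < t1 by rewrite subr_gt0.
have t1t : t1 < t by rewrite /t1 ltrBlDr ltrDl.
have t1T : t1 < T := lt_le_trans t1t tT.
have ht1 : 0 <= t1 <= T by rewrite !ltW.
have tr : `|t - t1| < r by rewrite /t1 opprB addrC subrK gtr0_norm.
have [near1 _] := rP t1 ht1 tr.
have hl := H _ near1.
have gc : conj_sym (fourier (h t1)) by move=> k; exact: fourierN (sol_tI sh ht1).
have [c [tc fix_c sc1 _]] := local_existence nu0 d0 gc hs hl.
have [_ fin1] := sol_Hs sh ht1; have [M1 M10 hM1] := Hnorm_fin crit_d fin1.
have hG1 := hterm_rho M10 hM1.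
have F1 : flow (fourier (h t1)) T' (fun s => syn (c s)).
  exact: (data_flow nu0 d0 hG1 hs hl tc fix_c sc1 (fun _ _ => erefl)).
have F2 := flow_restart nu0 (solution_flow nu0 d0 T0 sh) t10 t1T.
have F1' := flowS (ltW tau1) F1.
have tauT : tau <= T - t1 by rewrite /t1; lra.
have F2' := flowS tauT F2.
have htau : 0 < tau <= tau by rewrite tau0 lexx.
have := flow_uniq nu0 d0 F2' F1' htau; rewrite {1}/t1 subrK => ->.
have hT' : 0 < tau <= T' by rewrite tau0 ltW.
have rc : rapid (c tau) by exact: (c_rapid nu0 d0 tc hT').
split; last by move=> n; exact: syn_Ck.
have [N hN] := rapid_L1 rc.
have -> // : fourier (syn (c tau)) = c tau.
by apply/funext => k; exact: (fourier_syn hN k (tame_conj tc hT')).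
Qed.

Lemma solution_smooth (h0 : pt -> R) T h t : solution nu h0 T h -> 0 < t <= T ->
  (forall m : nat, (1 <= m)%N -> Hs m%:R (h t)) /\ smooth (h t).
Proof.
move=> sh ht; have [rc sm] := solution_rapid sh ht; split => // m _.
have /andP[t0 tT] := ht; have T0 := lt_le_trans t0 tT.
exact: rapid_Hs (crit_m m) (flow_pcont0 (solution_flow nu0 d0 T0 sh) ht) rc.
Qed.

(** The source of the zero mode vanishes, so that this mode is constant. *)
Lemma solution_mean_zero (h0 : pt -> R) T h t : solution nu h0 T h -> 0 < t <= T -> mean_zero h0 -> mean_zero (h t).
Proof.
move=> sh ht m0; have /andP[t0 tT] := ht; have T0 := lt_le_trans t0 tT.
have := flow_mild (solution_flow nu0 d0 T0 sh) ht 0.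
rewrite bs_k0 mul1r duh_zero ?addr0 => [E|s _]; last exact: nlu0.
have H := Re_fourier0 (h t); rewrite E Re_fourier0 in H; exact: etrans (esym H) m0.
Qed.

End maximal.

Theorem theorem1p1 (R : realType) (d : nat) (nu : R) (h0 : 'rV[R]_d -> R)
    (hd : (1 <= d)%N) (hnu : 0 < nu) (hh0 : Hs (s_crit R d) h0) :
  exists (T0 : R) (h : R -> 'rV[R]_d -> R),
    let Ts := lifespan nu h0 T0 h in
    [/\ 0 < T0,
        unique_solution nu h0 T0 h,
        (0 < Ts)%E /\
        (forall T : R, 0 < T -> (T%:E < Ts)%E -> unique_solution nu h0 T h),
        (forall t : R, 0 < t -> (t%:E < Ts)%E ->
           (forall m : nat, (1 <= m)%N -> Hs m%:R (h t)) /\ smooth (h t))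
      & mean_zero h0 ->
        forall t : R, 0 < t -> (t%:E < Ts)%E -> mean_zero (h t)].
Proof.
have [T0 T00 [g sg]] := exists_solution hnu hd hh0.
have [h glue] := glued_solution hnu hd hh0.
have sh := glue _ _ T00 sg; exists T0, h => Ts.
have below T : 0 < T -> (T%:E < Ts)%E -> solution nu h0 T h.
  move=> Tpos /ereal_sup_gt[_ [T1 [T01 [g1 [sg1 _]]] <-]]; rewrite lte_fin => /ltW TT1.
  exact: solutionS TT1 (glue _ _ (lt_le_trans T00 T01) sg1).
have upto (t : R) : 0 < t -> 0 < t <= t by move=> ->; rewrite lexx.
split => //.
- exact: solution_unique.
- split; last by move=> T Tpos TTs; apply: solution_unique => //; exact: below.
  apply: (@lt_le_trans _ _ T0%:E); first by rewrite lte_fin.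
  apply: ereal_sup_ubound; exists T0 => //; split => //; exists h; split => // t _.
  exact: aeq_refl.
- by move=> t t0 tTs; have H := solution_smooth hnu hd (below t t0 tTs) (upto t t0); exact: H.
- by move=> m0 t t0 tTs; have H := solution_mean_zero hnu hd (below t t0 tTs) (upto t t0) m0; exact: H.
Qed.
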